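(* Let $A,B,g_{1},g_{2}$ be Laurent polynomials in two variables $x,y$ with real coefficients, and let $$X=\Bigl(x\,\frac{A}{g_{1}},\;y\,\frac{B}{g_{2}}\Bigr).$$ Let $p\in(\mathbb{C}^{*})^{2}\cap\mathbb{R}^{2}$ satisfy $g_{1}(p)g_{2}(p)\neq0$ and $X(p)=0$, and suppose that $DX(p)$ is nilpotent and nonzero. Let $a$ be the first Bogdanov--Takens coefficient at $p$ and let $\dot u=v$, $\dot v=f(u)+v\,g(u)$ be a Takens form of $X$ at $p$. (i) If $A$ and $B$ have a common nonconstant factor vanishing at $p$, then $p$ is not an isolated equilibrium and $a=0$. (ii) Otherwise $p$ is an isolated equilibrium and $$\operatorname{ord}f=\mu_{p}(X)=\mu_{p}(A,B)\le \operatorname{MV}(\operatorname{Newt}A,\operatorname{Newt}B).$$ In particular, in case (ii), if $\operatorname{MV}(\operatorname{Newt}A,\operatorname{Newt}B)\le2$, then $a\neq0$ and the singularity of $X$ at $p$ is topologically a cusp; in particular it is not a nilpotent singularity of saddle, focus or elliptic type.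
   Context: Multiplicity: for $p=(x_0,y_0)$ and functions $F,G$ analytic at $p$, $\mu_p(F,G)=\dim_{\mathbb{C}}\mathbb{C}[[x-x_0,y-y_0]]/(F,G)$, and $\mu_p(X)=\mu_p(X_1,X_2)$. $\operatorname{Newt}A$ is the convex hull in $\mathbb{R}^2$ of the support (set of exponents) of $A$; for lattice polytopes, $\operatorname{MV}(\Delta,\Delta')=\operatorname{Area}(\Delta+\Delta')-\operatorname{Area}(\Delta)-\operatorname{Area}(\Delta')$. Coefficient $a$: with $J=DX(p)$, $q_0$ spanning $\ker J$, and $(q_1,p_0,p_1)$ chosen so that $Jq_1=q_0$, $J^{\top}p_1=0$, $J^{\top}p_0=p_1$, $\langle q_0,p_0\rangle=\langle q_1,p_1\rangle=1$, $\langle q_0,p_1\rangle=\langle q_1,p_0\rangle=0$, one sets $a=\tfrac12\langle p_1,D^2X(p)[q_0,q_0]\rangle$. It depends only on $X$ and $q_0$, and rescaling $q_0$ by $c\ne0$ multiplies it by $c$, so its vanishing is well defined. Takens form: a real analytic germ with nilpotent nonzero linear part can be brought by a formal change of coordinates sending $p$ to $0$ to $\dot u=v$, $\dot v=f(u)+v\,g(u)$ with $f,g$ formal power series; $\operatorname{ord}$ is the order of vanishing at $0$, with $\operatorname{ord}0=\infty$. ''Topologically a cusp'' means that the germ is locally topologically orbitally equivalent to the origin of $\dot u=v,\ \dot v=u^2$ (two hyperbolic sectors). Saddle, focus and elliptic types refer to the other local phase portraits of isolated nilpotent singularities: saddle type has four hyperbolic sectors; focus type has orbits winding around the point; elliptic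 type has one elliptic and one hyperbolic sector. All of these have $\operatorname{ord} f\ge3$. *)

(* Defs.v *)
(* The field of real numbers is an arbitrary [R : realType]. *)
From HB Require Import structures.
From mathcomp Require Import all_boot all_order all_algebra finmap.
From mathcomp Require Import all_classical all_reals all_analysis.
From mathcomp Require Import complex.

Set Implicit Arguments.
Unset Strict Implicit.
Unset Printing Implicit Defensive.

Import Order.TTheory GRing.Theory Num.Theory.
Import numFieldTopology.Exports numFieldNormedType.Exports.

Local Open Scope classical_set_scope.
Local Open Scope ring_scope.

(** * Laurent polynomials in two variables *)

(* [A m] is the coefficient of the monomial x^m.1 y^m.2. *)
Definition laurent (R : realType) := {fsfun int * int -> R with 0}.

Definition laurent_eval (R : realType) (A : laurent R) (z : R * R) : R :=
  \sum_(m <- finsupp A) A m * z.1 ^ m.1 * z.2 ^ m.2.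

(* [A = H * Q] for some Laurent polynomial [Q]. *)
Definition laurent_factor (R : realType) (H A : laurent R) : Prop :=
  exists Q : laurent R,
    forall m, A m = \sum_(k <- finsupp H) H k * Q (m - k).

Definition laurent_nonconstant (R : realType) (H : laurent R) : Prop :=
  exists2 m, m != 0 & H m != 0.

Definition common_factor_at (R : realType) (A B : laurent R) (p : R * R) :
    Prop :=
  exists H : laurent R, [/\ laurent_factor H A, laurent_factor H B,
    laurent_nonconstant H & laurent_eval H p = 0].

(** * Newton polygons and mixed volume *)

Definition convex_hull (R : realType) (S : set (R * R)) : set (R * R) :=
  smallest (fun C : set (R * R) => convex_set C) S.

Definition Newt (R : realType) (A : laurent R) : set (R * R) :=
  convex_hull [set ((m.1)%:~R, (m.2)%:~R) | m in [set` finsupp A]].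

Definition minkowski_sum (R : realType) (P Q : set (R * R)) : set (R * R) :=
  [set s + t | s in P & t in Q].

Definition area (R : realType) (S : set (R * R)) : \bar R :=
  (@lebesgue_measure R \x @lebesgue_measure R)%E S.

Definition MV (R : realType) (P Q : set (R * R)) : \bar R :=
  (area (minkowski_sum P Q) - area P - area Q)%E.

(** * Formal power series in two variables *)

(* [F i j] is the coefficient of s^i t^j. The pointwise ring structure of
   functions is not the one of power series: products are [fps2_mul]. *)
Definition fps2 (K : Type) := nat -> nat -> K.

Section FormalPowerSeries.
Variable K : fieldType.
Implicit Types (F G : fps2 K) (f : nat -> K).

Definition fps2_one : fps2 K := fun i j => ((i == 0%N) && (j == 0%N))%:R.

Definition fps2_add F G : fps2 K := fun i j => F i j + G i j.

Definition fps2_mul F G : fps2 K := fun i j =>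
  \sum_(a < i.+1) \sum_(b < j.+1) F a b * G (i - a)%N (j - b)%N.

Definition fps2_ds F : fps2 K := fun i j => F i.+1 j *+ i.+1.
Definition fps2_dt F : fps2 K := fun i j => F i j.+1 *+ j.+1.

(* The substitution [f (F)] of a series [F] without constant term in a series
   [f] in one variable: [F ^ k] has no term of total degree less than [k]. *)
Definition fps2_subst f F : fps2 K := fun i j =>
  \sum_(k < (i + j).+1) f k * iter k (fps2_mul F) fps2_one i j.

Definition fps2_ideal F G : set (fps2 K) :=
  [set S | exists U V, S = fps2_add (fps2_mul U F) (fps2_mul V G)].

Definition independent_mod (I : set (fps2 K)) n (b : 'I_n -> fps2 K) : Prop :=
  forall c : 'I_n -> K,
    I (fun i j => \sum_l c l * b l i j) -> forall l, c l = 0.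

End FormalPowerSeries.

(* The dimension of the quotient of the power series by the subspace [I],
   in the natural numbers extended with infinity. *)
Definition quotient_dim (R : realType) (K : fieldType) (I : set (fps2 K)) :
    \bar R :=
  ereal_sup [set (n%:R)%:E
    | n in [set n | exists b : 'I_n -> fps2 K, independent_mod I b]].

Definition fps_ord (R : realType) (f : nat -> R) : \bar R :=
  ereal_inf [set (k%:R)%:E | k in [set k | f k != 0]].

(** * Taylor series and multiplicity *)

Section Taylor.
Variable R : realType.
Implicit Types (F G : R * R -> R) (p : R * R).

Definition dir (i : 'I_2) : R * R := if i == 0 then (1, 0) else (0, 1).

Definition partial (i j : nat) F : R * R -> R :=
  iter i (fun G => 'D_(dir 0) G) (iter j (fun G => 'D_(dir 1) G) F).

(* The expansion of [F] in powers of s = x - p.1 and t = y - p.2. *)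
Definition taylor F p : fps2 R := fun i j =>
  partial i j F p / (i`!%:R * j`!%:R).

Definition taylorC F p : fps2 R[i] := fun i j => (taylor F p i j)%:C%C.

Definition multiplicity F G p : \bar R :=
  quotient_dim R (fps2_ideal (taylorC F p) (taylorC G p)).

End Taylor.

(** * Planar vector fields *)

Section VectorFields.
Variable R : realType.
Implicit Types (X Y : R * R -> R * R) (p : R * R) (S T D E : set (R * R)).

Definition vf_comp X (i : 'I_2) (z : R * R) : R :=
  if i == 0 then (X z).1 else (X z).2.

Definition DX X p : 'M[R]_2 :=
  \matrix_(i < 2, j < 2) 'D_(dir R j) (vf_comp X i) p.

Definition D2X X p (q r : 'cV[R]_2) : 'cV[R]_2 :=
  \col_(i < 2) \sum_(j < 2) \sum_(k < 2)
    q j 0 * r k 0 * 'D_(dir R j) ('D_(dir R k) (vf_comp X i)) p.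

Definition nilpotent_mx (J : 'M[R]_2) : Prop := exists n, J ^+ n = 0.

Definition dotp (q r : 'cV[R]_2) : R := \sum_(i < 2) q i 0 * r i 0.

(* The coefficient is determined by the choice of [q0] spanning the kernel. *)
Definition bt_coefficient X p (a : R) : Prop :=
  let J := DX X p in
  exists q0 q1 p0 p1 : 'cV[R]_2,
    [/\ q0 != 0, (forall q : 'cV[R]_2, J *m q = 0 <-> exists c, q = c *: q0),
        J *m q1 = q0, J^T *m p1 = 0 & J^T *m p0 = p1] /\
    [/\ dotp q0 p0 = 1, dotp q1 p1 = 1, dotp q0 p1 = 0 & dotp q1 p0 = 0] /\
    a = 2^-1 * dotp p1 (D2X X p q0 q0).

(* The formal change of coordinates (u, v) = (Phi1, Phi2) conjugates the Taylor
   expansion of [X] at [p] with the field u' = v, v' = f(u) + v g(u). *)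
Definition takens_form X p (f g : nat -> R) : Prop :=
  let X1 := taylor (vf_comp X 0) p in
  let X2 := taylor (vf_comp X 1) p in
  exists Phi1 Phi2 : fps2 R,
    [/\ Phi1 0%N 0%N = 0, Phi2 0%N 0%N = 0 &
        Phi1 1%N 0%N * Phi2 0%N 1%N - Phi1 0%N 1%N * Phi2 1%N 0%N != 0] /\
    fps2_add (fps2_mul (fps2_ds Phi1) X1) (fps2_mul (fps2_dt Phi1) X2) = Phi2 /\
    fps2_add (fps2_mul (fps2_ds Phi2) X1) (fps2_mul (fps2_dt Phi2) X2) =
      fps2_add (fps2_subst f Phi1) (fps2_mul Phi2 (fps2_subst g Phi1)).

Definition isolated_equilibrium X p : Prop :=
  X p = 0 /\ \forall z \near p, X z = 0 -> z = p.

(** * Local phase portraits *)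

(* [gam] is a solution of X on the open interval [I], with values in [D]. *)
Definition solution X D (I : set R) (gam : R -> R * R) : Prop :=
  [/\ open I, is_interval I, forall t, I t -> D (gam t) &
      forall t, I t -> is_derive t 1 gam (X (gam t))].

(* [h] sends the orbit arcs of [X] in [D] to orbit arcs of [Y] in [E],
   preserving the direction of time. *)
Definition carries_orbits X D Y E (h : R * R -> R * R) : Prop :=
  forall I gam, solution X D I gam ->
    exists (J : set R) (tau : R -> R),
      [/\ tau @` J = I, {in J &, {homo tau : s t / s < t}} &
          solution Y E J (h \o gam \o tau)].

Definition homeomorphism D E (h k : R * R -> R * R) : Prop :=
  [/\ h @` D `<=` E, k @` E `<=` D,
      (forall z, D z -> k (h z) = z) /\ (forall z, E z -> h (k z) = z),
      {within D, continuous h} & {within E, continuous k}].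

(* Local topological orbital equivalence between the restriction of [X] to [S]
   near [p] and the restriction of [Y] to [T] near [q]. *)
Definition locally_equivalent X S p Y T (q : R * R) : Prop :=
  exists (U V : set (R * R)) (h k : R * R -> R * R),
    [/\ open_nbhs p U, open_nbhs q V, h p = q & k q = p] /\
    [/\ homeomorphism (S `&` U) (T `&` V) h k,
        carries_orbits X (S `&` U) Y (T `&` V) h &
        carries_orbits Y (T `&` V) X (S `&` U) k].

Definition topologically_cusp X p : Prop :=
  locally_equivalent X setT p (fun z => (z.2, z.1 ^+ 2)) setT 0.

(* A hyperbolic sector looks like a closed quadrant of the linear saddle. *)
Definition hyperbolic_sector X p S : Prop :=
  locally_equivalent X S p
    (fun z => (z.1, - z.2)) [set z | 0 <= z.1 /\ 0 <= z.2] 0.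

(* An elliptic sector looks like the closed upper half-plane for the field
   z' = z^2 (z complex), whose orbits are circles tangent to the real axis at 0.
   Parabolic orbits next to the homoclinic loops belong to this sector. *)
Definition elliptic_sector X p S : Prop :=
  locally_equivalent X S p
    (fun z => (z.1 ^+ 2 - z.2 ^+ 2, 2 * z.1 * z.2)) [set z | 0 <= z.2] 0.

Definition sector_decomposition n p (S : 'I_n -> set (R * R)) : Prop :=
  trivIset setT (fun i => (S i)°) /\ \forall z \near p, exists i, S i z.

Definition saddle_type X p : Prop :=
  exists S : 'I_4 -> set (R * R),
    sector_decomposition p S /\ forall i, hyperbolic_sector X p (S i).

Definition elliptic_type X p : Prop :=
  exists S : 'I_2 -> set (R * R),
    [/\ sector_decomposition p S, elliptic_sector X p (S 0) &
        hyperbolic_sector X p (S 1)].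

(* Every orbit through a point close to [p] has, without going far from [p],
   an unbounded polar angle around [p]; centers are not excluded. *)
Definition focus_type X p : Prop :=
  forall W, nbhs p W -> \forall z \near p, z != p ->
    exists (I : set R) (gam : R -> R * R) (theta : R -> R),
      [/\ solution X (W `\ p) I gam, exists2 t, I t & gam t = z,
          {within I, continuous theta},
          forall t, I t -> exists2 r : R, 0 < r &
            gam t = p + (r * cos (theta t), r * sin (theta t)) &
          forall M : R, exists2 t, I t & M < `|theta t|].

End VectorFields.

Definition laurent_field (R : realType) (A B g1 g2 : laurent R) (z : R * R) :
    R * R :=
  (z.1 * (laurent_eval A z / laurent_eval g1 z),
   z.2 * (laurent_eval B z / laurent_eval g2 z)).

(* Main.v *)
Require Import Defs.
From HB Require Import structures.
From mathcomp Require Import all_boot all_order all_algebra finmap.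
From mathcomp Require Import all_classical all_reals all_analysis.
From mathcomp Require Import complex ring lra zify.

Set Implicit Arguments.
Unset Strict Implicit.
Unset Printing Implicit Defensive.

Import Order.TTheory GRing.Theory Num.Theory.
Import numFieldTopology.Exports numFieldNormedType.Exports.

Local Open Scope classical_set_scope.
Local Open Scope ring_scope.

(* The multiplicity is computed in the ring of complex power series at p. Dividing
   out units gives mu_p(X) = mu_p(A, B); in Takens coordinates the ideal is
   generated by v and f(u), whence ord f = mu_p(X). For the bound by the mixed
   volume, write A = D A' and B = D B' with D a greatest common divisor, which
   does not vanish at p, and put F = m A', G = m' B', where m and m' are monomials
   of D of lowest and of highest degree in x. The supports of F and G lie in
   P = Newt A and Q = Newt B (Ostrowski), and F, G are coprime over K(y). If
   b_1, ..., b_k are independent modulo (F, G) at p, then the polynomials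
   F^i G^j b_l (i, j < n), padded by monomials, F^n x^a (a in n Q) and
   G^n x^a (a in n P) are linearly independent, because F, G is a regular sequence
   at p and by a comparison of degrees in x. Their supports are close to n (P + Q),
   so counting lattice points for large n gives k + Area P + Area Q <= Area (P + Q).

   If a = 0, a parametrized curve tangent to the kernel of DX(p) shows mu_p(X) >= 3;
   hence a <> 0 when MV <= 2. If a <> 0, the orbits near p are, in suitable
   coordinates, the graphs of the solutions of a scalar equation y' = G(s, y) with
   |G(s, y) - G(s, y')| <= |y - y'| / (2 |s|). These solutions foliate a
   neighbourhood of p, so that X is orbitally equivalent at p to the field
   (x^2 + y^2, 0), and so is the cusp u' = v, v' = u^2. A local comparison of orbits
   excludes the sectors of the other types.

   If A and B have a common factor H vanishing at p, then DX(p) <> 0 forces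
   dH(p) <> 0, so p is a limit of zeros of H, and a = 0 by the previous case. *)

(** * One-variable calculus *)

(** The slope of X is singular at p, so in linear coordinates the orbits do not solve a regular
    scalar equation. Let u, s be coordinates dual to q0, q1 up to a quadratic shear, with u' = V and
    s' = P. If a <> 0, one can arrange P = A u^2 + M s^2 + ... > 0 off p, so s is a clock on every
    orbit. Replacing u by y with dy/du = w P cancels the denominator: dy/ds = w V + y_s is bounded,
    with y-derivative D / (w P). The shear and w = 1 + n u leave D = B u + O(2), and q1 + g q0 in
    place of q1 makes M large against B, whence the constant 1/(2|s|). A constant c/|s| with c < 1
    is what uniqueness through s = 0 asks for: differences of solutions grow at most like |s|^c, but
    are O(|s|) near 0. In the count, dividing A and B by D alone would shrink the Newton polygons;
    monomials of D restore what is lost. The one for F is free of x, so that F and G get no common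
    factor x; the one for G restores the full degree in x, which bounds the cofactors of F^n. *)

Lemma continuous_pair (T U V : topologicalType) (f : T -> U) (g : T -> V)
  (x : T) : {for x, continuous f} -> {for x, continuous g} ->
  {for x, continuous (fun y => (f y, g y))}.
Proof. by move=> cf cg; exact: (cvg_pair cf cg). Qed.

Lemma near_fst (T U : topologicalType) (P : T -> Prop) (a : T) (b : U) :
  (\forall x \near a, P x) -> \forall u \near (a, b), P u.1.
Proof.
by move=> h; exists (P, setT) => [|[x y] []//]; split=> //; exact: filterT.
Qed.

Lemma near_snd (T U : topologicalType) (P : U -> Prop) (a : T) (b : U) :
  (\forall x \near b, P x) -> \forall u \near (a, b), P u.2.
Proof.
by move=> h; exists (setT, P) => [|[x y] []//]; split=> //; exact: filterT.
Qed.

Lemma continuous_fst (T U V : topologicalType) (f : T -> V) (a : T) (b : U) :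
  {for a, continuous f} -> {for (a, b), continuous (fun u : T * U => f u.1)}.
Proof. by move=> fc A /fc h; exact: (@near_fst T U (fun x => A (f x)) a b h). Qed.

Section Calculus.
Variable R : realType.
Implicit Types (f F s Q : R -> R) (I J K : set R) (x y t a b c e : R).

Lemma is_derive_continuous (V : normedModType R) (f : R -> V) x l :
  is_derive x 1 f l -> {for x, continuous f}.
Proof.
by move=> [fx _]; apply/differentiable_continuous/derivable1_diffP.
Qed.

Lemma continuous_itv f a b :
  (forall x, a <= x <= b -> {for x, continuous f}) ->
  {within `[a, b], continuous f}.
Proof.
move=> fc; apply: continuous_in_subspaceT => x; rewrite inE /= in_itv /=.
exact: fc.
Qed.

Lemma mvt f df a b : a <= b ->
  (forall x, a <= x <= b -> is_derive x 1 f (df x)) ->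
  exists2 c, a <= c <= b & f b - f a = df c * (b - a).
Proof.
move=> ab fd; have [| |c] := @MVT_segment _ f df a b ab.
- by move=> x; rewrite in_itv /= => /andP[ax xb]; apply: fd; rewrite !ltW.
- by apply: continuous_itv => x /fd; apply: is_derive_continuous.
by rewrite in_itv /= => cab E; exists c.
Qed.

Lemma derive_nondecreasing f df a b : a <= b ->
  (forall x, a <= x <= b -> is_derive x 1 f (df x)) ->
  (forall x, a <= x <= b -> 0 <= df x) -> f a <= f b.
Proof.
move=> ab fd df0; have [c cab E] := mvt ab fd.
by rewrite -subr_ge0 E mulr_ge0 ?df0 // subr_ge0.
Qed.

Lemma derive_increasing f df a b : a < b ->
  (forall x, a <= x <= b -> is_derive x 1 f (df x)) ->
  (forall x, a <= x <= b -> 0 < df x) -> f a < f b.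
Proof.
move=> ab fd df0; have [c cab E] := mvt (ltW ab) fd.
by rewrite -subr_gt0 E mulr_gt0 ?df0 // subr_gt0.
Qed.

Lemma is_interval_mem I x y z : is_interval I -> I x -> I y ->
  x <= z <= y -> I z.
Proof. by move=> iI Ix Iy; apply: (iI x y). Qed.

Lemma open_itv_sub K x : open K -> K x ->
  exists2 e, 0 < e & forall y, `|x - y| <= e -> K y.
Proof.
move=> oK Kx; have /nbhs_ballP[e /= e0 He] : nbhs x K by exact: open_nbhs_nbhs.
exists (e / 2) => [|y xy]; first by rewrite divr_gt0.
by apply: He; rewrite /ball /= (le_lt_trans xy) // ltr_pdivrMr // ltr_pMr // ltr1n.
Qed.

Lemma antiderivative f K : open K -> is_interval K ->
  (forall x, K x -> {for x, continuous f}) ->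
  exists F, forall x, K x -> is_derive x 1 F (f x).
Proof.
move=> oK iK fc.
case: (pselect (exists c, K c)) => [[c Kc]|nK]; last first.
  by exists f => x Kx; case: nK; exists x.
pose mu := @lebesgue_measure R.
pose I a x := \int[mu]_(t in `[a, x]) f t.
have fi a b : K a -> K b -> mu.-integrable `[a, b] (EFin \o f).
  move=> Ka Kb; apply: continuous_compact_integrable; first exact: segment_compact.
  apply: continuous_itv => x xab; apply: fc.
  exact: (is_interval_mem iK Ka Kb).
have addI a b x : K a -> K x -> a <= b -> b <= x -> I a x = I a b + I b x.
  move=> Ka Kx ab bx.
  have Kb : K b by apply: (is_interval_mem iK Ka Kx); rewrite ab bx.
  have := @Rintegral_itvB R f (BLeft a) (BRight x) b (fi _ _ Ka Kx).
  rewrite !bnd_simp => /(_ ab bx).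
  rewrite Rintegral_itv_obnd_cbnd; last first.
    by apply: integrableS (fi _ _ Kb Kx) => //; apply: subset_itvr; rewrite bnd_simp.
  by move=> E; rewrite [I b x]/I -E /I addrC subrK.
pose F x := if c <= x then I c x else - I x c.
have FE a x : K a -> K x -> a <= c -> a <= x -> F x = I a x - I a c.
  move=> Ka Kx ac ax; rewrite /F; case: leP => [cx|xc].
    by rewrite (addI a c x) // addrC addKr.
  by rewrite (addI a x c) // ?(ltW xc) // opprD addNKr.
(* The fundamental theorem concerns an integral with fixed left end, so the base point is moved to
   [a], to the left of both [c] and [x]; near [x] this changes [F] by a constant only. *)
exists F => x Kx; have [e e0 He] := open_itv_sub oK Kx.
pose a := Num.min c (x - e).
have Ka : K a.
  by rewrite /a minElt; case: ifP => // _; apply: He; rewrite opprB addrC subrK gtr0_norm.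
have ac : a <= c by rewrite /a ge_min lexx.
have ax : a < x by rewrite /a gt_min ltrBlDr ltrDl e0 orbT.
have Kxe : K (x + e) by apply: He; rewrite opprD addNKr normrN gtr0_norm.
have [|Fd FE'] := @continuous_FTC1_closed R f a x (x + e) _ (fi _ _ Ka Kxe) ax (fc _ Kx).
  by rewrite ltrDl.
have D : is_derive x 1 (fun y => I a y - I a c) (f x).
  have -> : f x = f x - 0 by rewrite subr0.
  apply: is_deriveB; split; first exact: Fd.
  by rewrite -FE' derive1E.
apply: near_eq_is_derive D; near=> y; rewrite (FE a) //.
- by apply: He; near: y; apply: cvgr_dist_le.
- by apply: ltW; near: y; apply: lt_nbhsr.
Unshelve. all: by end_near. Qed.

Lemma increasing_inj_le s I : {in I &, {homo s : x y / x < y}} ->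
  {in I &, {mono s : x y / x <= y}}.
Proof. by move=> h; exact: le_mono_in. Qed.

Lemma increasing_inj s I : {in I &, {homo s : x y / x < y}} ->
  {in I &, injective s}.
Proof. by move=> /increasing_inj_le; exact: inc_inj_in. Qed.

Lemma increasing_image s I : open I -> is_interval I ->
  (forall t, I t -> {for t, continuous s}) ->
  {in I &, {homo s : x y / x < y}} -> open (s @` I) /\ is_interval (s @` I).
Proof.
move=> oI iI sc sI.
have ivt x y v : I x -> I y -> x <= y -> s x <= v <= s y -> (s @` I) v.
  move=> Ix Iy xy sv.
  have [| |z] := @IVT R s x y v xy.
  - apply: continuous_itv => z zxy; apply: sc; exact: (is_interval_mem iI Ix Iy).
  - by move: sv; rewrite ge_min le_max => /andP[-> ->]; rewrite orbT.
  rewrite in_itv /= => zxy <-; exists z => //.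
  exact: (is_interval_mem iI Ix Iy).
split; last first.
  move=> _ _ [x Ix <-] [y Iy <-] v /andP[xv vy].
  apply: (ivt x y) => //; last by rewrite xv vy.
  by rewrite -(increasing_inj_le sI) ?inE // (le_trans xv).
rewrite openE => _ [x Ix <-].
have [e e0 He] := open_itv_sub oI Ix.
have I1 : I (x - e) by apply: He; rewrite opprB addrC subrK gtr0_norm.
have I2 : I (x + e) by apply: He; rewrite opprD addNKr normrN gtr0_norm.
have s1 : s (x - e) < s x by apply: sI; rewrite ?inE // ltrBlDr ltrDl.
have s2 : s x < s (x + e) by apply: sI; rewrite ?inE // ltrDl.
rewrite /interior; near=> v.
apply: (ivt (x - e) (x + e)) => //.
  by rewrite lerBlDr -addrA lerDl addr_ge0 // ltW.
apply/andP; split; apply: ltW; near: v; [exact: lt_nbhsr|exact: lt_nbhsl].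
Unshelve. all: by end_near. Qed.

(* The primitive of [1 / Q] along [s] is the inverse of the new time. *)
Lemma reparametrize s Q I : open I -> is_interval I ->
  (forall t, I t -> {for t, continuous s}) ->
  {in I &, {homo s : x y / x < y}} ->
  (forall t, I t -> 0 < Q (s t) /\ {for s t, continuous Q}) ->
  exists J (tau : R -> R), [/\ open J, is_interval J, tau @` J = I,
    {in J &, {homo tau : x y / x < y}} &
    forall t, J t -> is_derive t 1 (s \o tau) (Q (s (tau t)))].
Proof.
move=> oI iI sc sI Q0.
have [oK iK] := increasing_image oI iI sc sI.
have [x [t It <-]|F FD] := @antiderivative (fun x => (Q x)^-1) _ oK iK.
  by have [Qt Qc] := Q0 t It; apply: continuousV => //; rewrite gt_eqF.
have Fc x : (s @` I) x -> {for x, continuous F}.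
  by move=> /FD; apply: is_derive_continuous.
have FI : {in s @` I &, {homo F : x y / x < y}}.
  move=> x y; rewrite !inE => Kx Ky xy.
  have sub z : x <= z <= y -> (s @` I) z by exact: (is_interval_mem iK Kx Ky).
  apply: (derive_increasing xy) => z /sub Kz; first exact: FD.
  by have [t It <-] := Kz; rewrite invr_gt0; have [] := Q0 t It.
have [oJ iJ] := increasing_image oK iK Fc FI.
pose G := F \o s.
have GI : {in I &, {homo G : x y / x < y}}.
  move=> x y xI yI xy; apply: FI; last exact: sI.
  - by rewrite inE; exists x => //; rewrite inE in xI.
  - by rewrite inE; exists y => //; rewrite inE in yI.
pose tau t := xget 0 [set x | I x /\ G x = t].
have tauE x : I x -> tau (G x) = x.
  move=> Ix; apply: xget_subset1 => // y z [Iy Gy] [Iz Gz].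
  by apply: (increasing_inj GI); rewrite ?inE // Gy.
pose rho t := xget 0 [set x | (s @` I) x /\ F x = t].
have rhoE x : (s @` I) x -> rho (F x) = x.
  move=> Kx; apply: xget_subset1 => // y z [Ky Fy] [Kz Fz].
  by apply: (increasing_inj FI); rewrite ?inE // Fy.
exists (F @` (s @` I)), tau; split => //.
- rewrite eqEsubset; split => [_ [_ [_ [x Ix <-] <-] <-]|x Ix].
    by rewrite -/(G x) tauE.
  by exists (G x); [exists (s x) => //; exists x|rewrite tauE].
- move=> a b; rewrite !inE => -[_ [x Ix <-] <-] [_ [y Iy <-] <-].
  rewrite -/(G x) -/(G y) !tauE // => Gxy.
  by rewrite ltNge -(increasing_inj_le GI) ?inE // leNgt Gxy.
- move=> _ [_ [x Ix <-] <-]; rewrite -/(G x) tauE //.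
  have Kx : (s @` I) (s x) by exists x.
  have D : is_derive (F (s x)) 1 rho (Q (s x)).
    rewrite -[X in is_derive _ _ _ X]invrK; apply: is_derive_inverse (FD _ Kx) _.
    + near=> y; apply: rhoE; near: y; exact: open_nbhs_nbhs.
    + near=> y; apply: Fc; near: y; exact: open_nbhs_nbhs.
    + by rewrite invr_eq0 gt_eqF //; have [] := Q0 x Ix.
  apply: near_eq_is_derive D; near=> y.
  have [_ [z Iz <-] <-] : (F @` (s @` I)) y.
    by near: y; apply: open_nbhs_nbhs; split=> //; exists (s x).
  by rewrite rhoE /= -?/(G z) ?tauE //; exists z.
Unshelve. all: by end_near. Qed.

Lemma is_derive_fst (g : R -> R * R) t v :
  is_derive t 1 g v -> is_derive t 1 (fun x => (g x).1) v.1.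
Proof.
move=> [gd <-].
have D : (h^-1 *: (((fun x => (g x).1) \o shift t) (h *: 1) - (g t).1))
   @[h --> 0^'] --> ('D_1 g t).1.
  have C := @cvg_fst _ _ (nbhs ('D_1 g t).1) (nbhs ('D_1 g t).2) (nbhs_filter ('D_1 g t).2).
  exact: (cvg_trans (cvg_app (@fst R R) gd) C).
by split; [apply/cvg_ex; exists ('D_1 g t).1|apply: cvg_lim D].
Qed.

Lemma is_derive_snd (g : R -> R * R) t v :
  is_derive t 1 g v -> is_derive t 1 (fun x => (g x).2) v.2.
Proof.
move=> [gd <-].
have D : (h^-1 *: (((fun x => (g x).2) \o shift t) (h *: 1) - (g t).2))
   @[h --> 0^'] --> ('D_1 g t).2.
  have C := @cvg_snd _ _ (nbhs ('D_1 g t).1) (nbhs ('D_1 g t).2) (nbhs_filter ('D_1 g t).1).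
  exact: (cvg_trans (cvg_app (@snd R R) gd) C).
by split; [apply/cvg_ex; exists ('D_1 g t).2|apply: cvg_lim D].
Qed.

Lemma is_derive_pair (f g : R -> R) t a b : is_derive t 1 f a ->
  is_derive t 1 g b -> is_derive t 1 (fun x => (f x, g x)) (a, b).
Proof.
move=> [fd <-] [gd <-].
have D : (h^-1 *: (((fun x => (f x, g x)) \o shift t) (h *: 1) - (f t, g t)))
   @[h --> 0^'] --> ('D_1 f t, 'D_1 g t).
  exact: (cvg_pair fd gd).
by split; [apply/cvg_ex; exists ('D_1 f t, 'D_1 g t)|apply: cvg_lim D].
Qed.

End Calculus.

(** * A scalar differential equation with a singular Lipschitz constant *)

(** An Archimedean substitute for letting [n] tend to infinity: limits at the singular point are
    taken along dyadic scales, or along iterates with errors of that size. *)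
Lemma le0_geometric (R : realType) (x c : R) :
  (forall n, x <= c / 2 ^+ n) -> x <= 0.
Proof.
move=> h; case: (leP x 0) => // x0.
have c0 : 0 < c by have := h 0%N; rewrite expr0 divr1; apply: lt_le_trans.
pose n := Num.bound (c / x).
have cn : c / x < n%:R.
  by apply: le_lt_trans (archi_boundP _); rewrite // divr_ge0 // ltW.
have := h n; rewrite ler_pdivlMr ?exprn_gt0 // => xn.
have : c < x * 2 ^+ n.
  rewrite ltr_pdivrMr // mulrC in cn; apply: lt_le_trans cn _.
  rewrite ler_pM2l // -natrX ler_nat ltnW // ltn_expl //.
by rewrite ltNge xn.
Qed.

Section SingularODE.
Variable R : realType.
Variables (d K : R) (G : R -> R -> R).
Hypothesis d0 : 0 < d.
Hypothesis d1 : d <= 1.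
Hypothesis K0 : 0 <= K.
Hypothesis Gcont : forall s y, `|s| < d ->
  {for (s, y), continuous (fun z : R * R => G z.1 z.2)}.
Hypothesis Gbound : forall s y, `|s| < d -> `|G s y| <= K.
Hypothesis Glip : forall s y y', `|s| < d ->
  `|s| * `|G s y - G s y'| <= `|y - y'| / 2.
Implicit Types (s t y e : R) (z w : R -> R).

Lemma derive_bound w dw c s : `|s| < d ->
  (forall t, `|t| < d -> is_derive t 1 w (dw t)) ->
  (forall t, `|t| < d -> `|dw t| <= c) -> w 0 = 0 -> `|w s| <= c * `|s|.
Proof.
move=> sd wd dwc w0; case: (leP 0 s) => s0.
  have sub t : 0 <= t <= s -> `|t| < d.
    move=> /andP[t0 ts]; rewrite ger0_norm //; apply: le_lt_trans ts _.
    by rewrite -(ger0_norm s0).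
  have [t /sub td] := mvt s0 (fun t ts => wd t (sub t ts)).
  by rewrite w0 !subr0 => ->; rewrite normrM ler_wpM2r // dwc.
have sub t : s <= t <= 0 -> `|t| < d.
  move=> /andP[st t0]; rewrite ler0_norm //; apply: le_lt_trans sd.
  by rewrite ltr0_norm // lerN2.
have [t /sub td] := mvt (ltW s0) (fun t ts => wd t (sub t ts)).
rewrite w0 sub0r => /(congr1 Num.norm); rewrite normrN => ->.
by rewrite normrM sub0r normrN ler_wpM2r // dwc.
Qed.

Lemma ball_itv : open [set t : R | `|t| < d] /\
  is_interval [set t : R | `|t| < d].
Proof.
split.
  have -> : [set t : R | `|t| < d] = ball (0 : R) d.
    by apply/seteqP; split => t; rewrite /ball /= sub0r normrN.
  exact: ball_open.
move=> x y /=; rewrite !ltr_norml => /andP[x1 _] /andP[_ y1] t /andP[xt ty].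
by rewrite ltr_norml (lt_le_trans x1 xt) (le_lt_trans ty y1).
Qed.

Lemma ball_mem s t x : `|s| < d -> `|t| < d -> s <= x <= t -> `|x| < d.
Proof. exact: (is_interval_mem ball_itv.2). Qed.

Lemma near_norm_lt s : `|s| < d -> \forall t \near s, `|t| < d.
Proof. by move=> sd; exact: (open_nbhs_nbhs (conj ball_itv.1 sd)). Qed.

Lemma picard_step e z : (forall s, `|s| < d -> {for s, continuous z}) ->
  exists w, w 0 = e /\ forall s, `|s| < d -> is_derive s 1 w (G s (z s)).
Proof.
move=> zc; have [oK iK] := ball_itv.
have [s sd|F FD] := @antiderivative R (fun s => G s (z s)) _ oK iK.
  apply: (@continuous_comp _ _ _ (fun s => (s, z s)) (fun u => G u.1 u.2)).
    by apply: continuous_pair; [exact: cvg_id|exact: zc].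
  exact: Gcont.
exists (fun s => F s - F 0 + e); split=> [|s sd]; first by rewrite subrr add0r.
rewrite -[G _ _]subr0 -[_ - 0]addr0.
apply: is_deriveD; apply: is_deriveB; exact: FD.
Qed.

(** Picard iteration contracts by 1/2 for the weighted distance sup |z1 - z2| / |s|: the hypothesis
    bounds the difference of slopes by half of it, and integration from 0 restores the factor |s|.
    The first two iterates are at finite distance because [G] is bounded by [K]. *)
Lemma singular_ode_exists e : exists w, w 0 = e /\
  forall s, `|s| < d -> is_derive s 1 w (G s (w s)).
Proof.
pose good z := z 0 = e /\ (forall s, `|s| < d -> {for s, continuous z}).
(* [choice] requires a total operator: [T] is arbitrary outside the continuous functions with value
   [e] at 0. *)
have ex_T z : exists w, good z ->
    w 0 = e /\ forall s, `|s| < d -> is_derive s 1 w (G s (z s)).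
  case: (pselect (good z)) => [gz|nz]; last by exists z => /nz.
  by have [w Hw] := picard_step e gz.2; exists w.
have [T HT] := choice ex_T.
pose z n := iter n T (fun=> e).
have gz n : good (z n).
  elim: n => [|n IH]; first by split=> // s _; apply: cst_continuous.
  have [h1 h2] := HT _ IH; split=> // s sd.
  exact: is_derive_continuous (h2 s sd).
have dz n s : `|s| < d -> is_derive s 1 (z n.+1) (G s (z n s)).
  exact: (HT _ (gz n)).2.
have step z1 z2 w1 w2 c : 0 <= c -> z1 0 = e -> z2 0 = e -> w1 0 = e -> w2 0 = e ->
    (forall s, `|s| < d -> is_derive s 1 w1 (G s (z1 s))) ->
    (forall s, `|s| < d -> is_derive s 1 w2 (G s (z2 s))) ->
    (forall s, `|s| < d -> `|z1 s - z2 s| <= c * `|s|) ->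
    forall s, `|s| < d -> `|w1 s - w2 s| <= c / 2 * `|s|.
  move=> c0 z10 z20 w10 w20 w1d w2d zc s sd.
  apply: (@derive_bound (fun s => w1 s - w2 s) (fun s => G s (z1 s) - G s (z2 s))) => //.
  - by move=> t td; apply: is_deriveB; [exact: w1d|exact: w2d].
  - move=> t td; have [->|t0] := eqVneq t 0.
      by rewrite z10 z20 subrr normr0 divr_ge0.
    have tp : 0 < `|t| by rewrite normr_gt0.
    rewrite -(ler_pM2l tp); apply: le_trans (Glip _ _ td) _.
    by rewrite mulrA ler_wpM2r ?invr_ge0 // mulrC; apply: zc.
  - by rewrite w10 w20 subrr.
have z1 n s : `|s| < d -> `|z n.+1 s - z n s| <= K / 2 ^+ n * `|s|.
  elim: n s => [|n IH] s sd.
    rewrite expr0 divr1.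
    apply: (@derive_bound (fun s => z 1 s - z 0 s) (fun s => G s e - 0)) => //.
    - by move=> t td; apply: is_deriveB; exact: dz.
    - by move=> t td; rewrite subr0; exact: Gbound.
    - by rewrite (gz 1).1 (gz 0).1 subrr.
  rewrite exprS invfM mulrA [K / 2 / _]mulrAC.
  apply: (@step (z n.+1) (z n)) => //; try exact: (gz _).1; try exact: dz.
  by rewrite divr_ge0 // exprn_ge0.
(* [C n s] bounds the whole tail of the geometric series of increments. Hence [z n - C n] increases
   and [z n + C n] decreases with [n], and the limit is obtained as a supremum. *)
pose C n s := 2 * K / 2 ^+ n * `|s|.
have C0 n s : 0 <= C n s by rewrite !mulr_ge0 // invr_ge0 exprn_ge0.
have Chalf n s : C n s = C n.+1 s + K / 2 ^+ n * `|s|.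
  rewrite /C exprS; set q := (2 ^+ n)^-1 : R.
  by rewrite [(2 * _)^-1]invfM -/q; field.
have mono m n s : `|s| < d -> (m <= n)%N ->
    z m s - C m s <= z n s - C n s /\ z n s + C n s <= z m s + C m s.
  move=> sd; elim: n => [|n IH]; first by rewrite leqn0 => /eqP ->.
  rewrite leq_eqVlt => /orP[/eqP -> //|]; rewrite ltnS => /IH[i1 i2].
  have := z1 n s sd; rewrite ler_norml => /andP[j1 j2].
  by have := Chalf n s; split; lra.
have bnd m n s : `|s| < d -> z m s - C m s <= z n s + C n s.
  move=> sd; have [i1 _] := mono m (maxn m n) s sd (leq_maxl _ _).
  have [_ i2] := mono n (maxn m n) s sd (leq_maxr _ _).
  by have := C0 (maxn m n) s; lra.
pose y s := sup (range (fun n => z n s - C n s)).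
have yz n s : `|s| < d -> `|z n s - y s| <= C n s.
  move=> sd; have hs : has_sup (range (fun n => z n s - C n s)).
    split; first by exists (z 0 s - C 0 s); exists 0%N.
    by exists (z 0 s + C 0 s) => _ [m _ <-]; apply: bnd.
  have h1 : z n s - C n s <= y s by apply: ub_le_sup; [exact: hs.2|exists n].
  have h2 : y s <= z n s + C n s.
    by apply: ge_sup; [exact: hs.1|move=> _ [m _ <-]; apply: bnd].
  by rewrite ler_norml; apply/andP; split; lra.
have zlip n s t : `|s| < d -> `|t| < d -> `|z n s - z n t| <= K * `|s - t|.
  case: n => [|n] sd td; first by rewrite subrr normr0 mulr_ge0.
  wlog st : s t sd td / s <= t => [hw|].
    by case: (leP s t) => [|/ltW] h; [|rewrite distrC (distrC s)]; apply: hw.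
  have sub x := @ball_mem s t x sd td.
  have [x xs E] := mvt st (fun x xs => dz n x (sub x xs)).
  by rewrite distrC E normrM (distrC s) ler_wpM2r // Gbound // sub.
have ylip s t : `|s| < d -> `|t| < d -> `|y s - y t| <= K * `|s - t|.
  move=> sd td; rewrite -subr_le0; apply: (@le0_geometric _ _ (4 * K)) => n.
  have h1 := yz n s sd; have h2 := yz n t td; have h3 := zlip n s t sd td.
  have hC r : `|r| < d -> C n r <= 2 * K / 2 ^+ n.
    move=> rd; rewrite /C ler_piMr // ?mulr_ge0 ?invr_ge0 ?exprn_ge0 //.
    by apply/ltW/(lt_le_trans rd).
  have := hC s sd; have := hC t td.
  have -> : 4 * K / 2 ^+ n = 2 * K / 2 ^+ n + 2 * K / 2 ^+ n by field.
  have : `|y s - y t| <= `|z n s - y s| + `|z n s - z n t| + `|z n t - y t|.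
    apply: le_trans (ler_distD (z n t) _ _) _; rewrite lerD2r.
    by apply: le_trans (ler_distD (z n s) _ _) _; rewrite (distrC (y s)).
  by lra.
have yc s : `|s| < d -> {for s, continuous y}.
  move=> sd; apply/cvgrPdist_le => eps eps0.
  near=> t; have td : `|t| < d by near: t; exact: near_norm_lt.
  apply: le_trans (ylip _ _ sd td) _.
  have st : `|s - t| <= eps / (K + 1).
    near: t; apply: cvgr_dist_le; first exact: cvg_id.
    by rewrite divr_gt0 // ltr_wpDl.
  apply: le_trans (ler_wpM2l K0 st) _.
  by rewrite mulrCA ler_piMr ?(ltW eps0) // ler_pdivrMr ?ltr_wpDl // mul1r lerDl.
have y0 : y 0 = e.
  apply/eqP; rewrite -subr_eq0 -normr_le0; have := yz 0 0.
  rewrite /C normr0 mulr0 (gz 0%N).1 distrC => h; apply: h; exact: d0.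
have [w0 wd] := HT y (conj y0 yc).
exists (T y); split=> // s sd; suff -> : T y s = y s by exact: wd.
apply/eqP; rewrite -subr_eq0 -normr_le0.
apply: (@le0_geometric _ _ (2 * K)) => n.
have h1 : `|T y s - z n.+1 s| <= 2 * K / 2 ^+ n / 2 * `|s|.
  apply: (@step y (z n)) => //; try exact: (gz _).1; try exact: dz.
    by rewrite !mulr_ge0 // invr_ge0 exprn_ge0.
  by move=> t td; rewrite distrC; exact: yz.
have h2 := yz n.+1 s sd.
have s1 : `|s| <= 1 by apply/ltW/(lt_le_trans sd).
apply: le_trans (_ : 2 * K / 2 ^+ n * `|s| <= _); last first.
  by rewrite ler_piMr // !mulr_ge0 // invr_ge0 exprn_ge0.
have -> : T y s - y s = (T y s - z n.+1 s) + (z n.+1 s - y s) by ring.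
apply: le_trans (ler_normD _ _) _; apply: le_trans (lerD h1 h2) _.
rewrite /C exprS [(2 * _)^-1]invfM.
by rewrite le_eqVlt; apply/orP; left; apply/eqP; field.
Unshelve. all: by end_near. Qed.

Lemma solution_drift w z a b : 0 <= a -> a <= b -> b < d ->
  (forall t, a <= t <= b -> is_derive t 1 w (G t (w t))) ->
  (forall t, a <= t <= b -> is_derive t 1 z (G t (z t))) ->
  `|(w b - z b) - (w a - z a)| <= 2 * K * (b - a).
Proof.
move=> a0 ab bd wd zd.
have [t tab ->] := mvt ab (fun t h => is_deriveB (wd t h) (zd t h)).
have ba : 0 <= b - a by rewrite subr_ge0.
rewrite normrM (ger0_norm ba) ler_wpM2r //.
have td : `|t| < d.
  by case/andP: tab => t1 t2; rewrite ger0_norm ?(le_trans a0) // (le_lt_trans t2).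
apply: le_trans (ler_normB _ _) _.
by have := Gbound (w t) td; have := Gbound (z t) td; lra.
Qed.

(** For D = (w - z)^2 the constant 1/2 in the hypothesis gives |t D'| <= D, so D / t decreases and t
    D increases: the gap between two solutions changes at most by a factor sqrt(b / a), in either
    direction of time. *)
Lemma compare_solutions w z a b : 0 < a -> a <= b -> b < d ->
  (forall t, a <= t <= b -> is_derive t 1 w (G t (w t))) ->
  (forall t, a <= t <= b -> is_derive t 1 z (G t (z t))) ->
  (w b - z b) ^+ 2 * a <= (w a - z a) ^+ 2 * b /\
  (w a - z a) ^+ 2 * a <= (w b - z b) ^+ 2 * b.
Proof.
move=> a0 ab bd wd zd; have b0 : 0 < b by apply: lt_le_trans ab.
pose D t := (w t - z t) ^+ 2.
pose D' t := 2 * (w t - z t) * (G t (w t) - G t (z t)).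
have t0 t : a <= t <= b -> 0 < t by case/andP=> + _; apply: lt_le_trans.
have Dd t : a <= t <= b -> is_derive t 1 D (D' t).
  move=> h; have h1 := is_deriveX 2 (is_deriveB (wd t h) (zd t h)).
  by apply: is_derive_eq h1 _; rewrite /D' /= expr1 /GRing.scale /=.
have key t : a <= t <= b -> `|D' t * t| <= D t.
  move=> h; have tp := t0 t h.
  have td : `|t| < d.
    by case/andP: h => _ h2; rewrite gtr0_norm // (le_lt_trans h2).
  have := Glip (w t) (z t) td; rewrite (gtr0_norm tp) => gl.
  rewrite /D /D' -[X in _ <= X](real_normK (num_real _)) expr2.
  rewrite !normrM (gtr0_norm tp) (ger0_norm (ler0n _ 2)).
  have := ler_wpM2l (normr_ge0 (w t - z t)) gl; lra.
split.
  have [t tab E] := mvt ab (fun t h => is_deriveM (Dd t h) (is_deriveV (lt0r_neq0 (t0 t h)) (is_derive_id t (1 : R)))).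
  have tp := t0 t tab.
  have : D b / b - D a / a <= 0.
    rewrite [_ - _]E mulr_le0_ge0 ?subr_ge0 //.
    rewrite /GRing.scale /= mulr1 mulrN -[X in _ + X]mulrC.
    have -> : - (D t / t ^+ 2) + D' t / t = (D' t * t - D t) / t ^+ 2.
      by set x := D t; set y := D' t; field; rewrite lt0r_neq0.
    rewrite pmulr_lle0 ?invr_gt0 ?exprn_gt0 // subr_le0.
    exact: le_trans (ler_norm _) (key t tab).
  by rewrite subr_le0 ler_pdivrMr // mulrAC ler_pdivlMr.
have [t tab E] := mvt ab (fun t h => is_deriveM (Dd t h) (is_derive_id t (1 : R))).
have : 0 <= D b * b - D a * a.
  rewrite [_ - _]E mulr_ge0 ?subr_ge0 //.
  rewrite /GRing.scale /= mulr1 mulrC.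
  by have := key t tab; rewrite ler_norml => /andP[]; lra.
by rewrite subr_ge0.
Qed.

(** Starting from 0 the Lipschitz constant 1/(2t) is not integrable. But boundedness of [G] gives
    D(s) <= (2 K s)^2, and since D / t decreases, D(b) <= 4 K^2 s b for every small s. *)
Lemma solution_unique_forward w z a b : 0 <= a -> a <= b -> b < d ->
  (forall t, a <= t <= b -> is_derive t 1 w (G t (w t))) ->
  (forall t, a <= t <= b -> is_derive t 1 z (G t (z t))) ->
  w a = z a -> w b = z b.
Proof.
move=> a0 ab bd wd zd E; apply/eqP; rewrite -subr_eq0 -sqrf_eq0.
rewrite eq_le sqr_ge0 andbT.
have sub t s : a <= t -> t <= s <= b -> a <= s <= b.
  by move=> at_ /andP[ts ->]; rewrite (le_trans at_).
move: (a0); rewrite le0r => /orP[/eqP a00|a0']; last first.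
  have [h _] := compare_solutions a0' ab bd wd zd.
  by move: h; rewrite E subrr expr0n /= mul0r pmulr_lle0.
have [<-|ab'] : a = b \/ a < b.
  by move: (ab); rewrite le_eqVlt => /orP[/eqP|]; [left|right].
  by rewrite E subrr expr0n.
apply: (@le0_geometric _ _ (4 * K ^+ 2 * b ^+ 2)) => n.
pose s := b / 2 ^+ n.
have b0 : 0 < b by rewrite -a00.
have s0 : 0 < s by rewrite divr_gt0 // exprn_gt0.
have sb : s <= b.
  by rewrite /s ler_piMr ?(ltW b0) // invf_le1 ?exprn_gt0 // exprn_ege1 // ler1n.
have as_ : a <= s by rewrite a00 ltW.
have [h _] := compare_solutions s0 sb bd
  (fun t h => wd t (sub s t as_ h)) (fun t h => zd t (sub s t as_ h)).
have sub' t : a <= t <= s -> a <= t <= b.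
  by move=> /andP[-> ts]; rewrite (le_trans ts).
have := solution_drift a0 as_ (le_lt_trans sb bd)
  (fun t h => wd t (sub' t h)) (fun t h => zd t (sub' t h)).
rewrite E subrr a00 !subr0 => h2.
have h3 : (w s - z s) ^+ 2 <= (2 * K * s) ^+ 2.
  rewrite -[X in X <= _](real_normK (num_real _)) ler_sqr ?nnegrE //.
  by rewrite !mulr_ge0 // ltW.
rewrite -(ler_pM2r s0); apply: le_trans h _.
apply: le_trans (ler_wpM2r (ltW b0) h3) _.
rewrite /s; set q := (2 ^+ n)^-1.
by rewrite le_eqVlt; apply/orP; left; apply/eqP; ring.
Qed.

(** Since t D increases, equality at [b] propagates back to every positive time; the drift bound
    then carries it to time 0. *)
Lemma solution_unique_backward w z a b : 0 <= a -> a <= b -> b < d ->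
  (forall t, a <= t <= b -> is_derive t 1 w (G t (w t))) ->
  (forall t, a <= t <= b -> is_derive t 1 z (G t (z t))) ->
  w b = z b -> w a = z a.
Proof.
move=> a0 ab bd wd zd E.
have pos s : 0 < s -> a <= s -> s <= b -> w s = z s.
  move=> s0 as_ sb; apply/eqP; rewrite -subr_eq0 -sqrf_eq0 eq_le sqr_ge0 andbT.
  have sub t : s <= t <= b -> a <= t <= b.
    by move=> /andP[at_ ->]; rewrite (le_trans as_).
  have [_] := compare_solutions s0 sb bd (fun t h => wd t (sub t h)) (fun t h => zd t (sub t h)).
  by rewrite E subrr expr0n /= mul0r pmulr_lle0.
move: (a0); rewrite le0r => /orP[/eqP a00|a0']; last exact: pos.
have [<- //|ab'] : b = a \/ a < b.
  by move: (ab); rewrite le_eqVlt => /orP[/eqP|]; [left|right].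
have b0 : 0 < b by rewrite -a00.
apply/eqP; rewrite -subr_eq0 -normr_le0.
apply: (@le0_geometric _ _ (2 * K * b)) => n.
pose s := b / 2 ^+ n.
have s0 : 0 < s by rewrite divr_gt0 // exprn_gt0.
have sb : s <= b.
  by rewrite /s ler_piMr ?(ltW b0) // invf_le1 ?exprn_gt0 // exprn_ege1 // ler1n.
have as_ : a <= s by rewrite a00 ltW.
have sub t : a <= t <= s -> a <= t <= b.
  by move=> /andP[-> ts]; rewrite (le_trans ts).
have := solution_drift a0 as_ (le_lt_trans sb bd)
  (fun t h => wd t (sub t h)) (fun t h => zd t (sub t h)).
by rewrite (pos s) // subrr sub0r normrN a00 subr0 mulrA.
Qed.

(** The time interval is cut at t = |w 0 - z 0|. Before the cut bounded slopes cost at most 2 K t;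
    after it D / t decreases. The outcome is Hoelder dependence of exponent 1/2 on the initial
    value. *)
Lemma solution_dependence w z b : 0 <= b -> b < d ->
  (forall t, 0 <= t <= b -> is_derive t 1 w (G t (w t))) ->
  (forall t, 0 <= t <= b -> is_derive t 1 z (G t (z t))) ->
  `|w 0 - z 0| <= 1 ->
  (w b - z b) ^+ 2 <= (1 + 2 * K) ^+ 2 * `|w 0 - z 0|.
Proof.
move=> b0 bd wd zd; set del := `|w 0 - z 0| => del1.
have del0 : 0 <= del by exact: normr_ge0.
have sq s : 0 <= s -> s <= b -> s <= del ->
    (w s - z s) ^+ 2 <= (1 + 2 * K) ^+ 2 * del ^+ 2.
  move=> s0 sb sdel.
  have sub t : 0 <= t <= s -> 0 <= t <= b.
    by move=> /andP[-> ts]; rewrite (le_trans ts).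
  have := solution_drift (lexx 0) s0 (le_lt_trans sb bd)
    (fun t h => wd t (sub t h)) (fun t h => zd t (sub t h)).
  rewrite subr0 => h.
  rewrite -exprMn -[X in X <= _](real_normK (num_real _)) ler_sqr ?nnegrE //; last first.
    by rewrite mulr_ge0 // addr_ge0 // mulr_ge0.
  have -> : w s - z s = (w s - z s - (w 0 - z 0)) + (w 0 - z 0) by ring.
  apply: le_trans (ler_normD _ _) _; rewrite -/del.
  have := ler_wpM2l K0 sdel; lra.
have [bdel|delb] := leP b del.
  apply: le_trans (sq b b0 (lexx _) bdel) _.
  by rewrite ler_wpM2l ?sqr_ge0 // expr2 ler_piMr.
move: del0; rewrite le_eqVlt => /orP[/eqP E|del0].
  have w0 : w 0 = z 0 by apply/eqP; rewrite -subr_eq0 -normr_eq0 -/del -E.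
  by rewrite (solution_unique_forward (lexx _) b0 bd wd zd w0) subrr expr0n -E mulr0.
have sub t : del <= t <= b -> 0 <= t <= b.
  by move=> /andP[dt ->]; rewrite (le_trans (ltW del0)).
have [h _] := compare_solutions del0 (ltW delb) bd (fun t h => wd t (sub t h)) (fun t h => zd t (sub t h)).
rewrite -(ler_pM2r del0); apply: le_trans h _.
apply: le_trans (ler_wpM2r b0 (sq del (ltW del0) (ltW delb) (lexx _))) _.
have h2 : del ^+ 2 * b <= del * del.
  rewrite -expr2 ler_piMr ?sqr_ge0 //; exact/ltW/(lt_le_trans bd).
by have := ler_wpM2l (sqr_ge0 (1 + 2 * K)) h2; rewrite !mulrA.
Qed.

End SingularODE.

(** The solutions of the singular equation form a continuous family of disjoint
    graphs: [E] labels each graph by its ordinate at [0]. *)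
Section Foliation.
Variable R : realType.
Variables (d K : R) (G : R -> R -> R).
Hypothesis d0 : 0 < d.
Hypothesis d1 : d <= 1.
Hypothesis K0 : 0 <= K.
Hypothesis Gcont : forall s y : R, `|s| < d ->
  {for (s, y), continuous (fun z : R * R => G z.1 z.2)}.
Hypothesis Gbound : forall s y : R, `|s| < d -> `|G s y| <= K.
Hypothesis Glip : forall s y y' : R, `|s| < d ->
  `|s| * `|G s y - G s y'| <= `|y - y'| / 2.
Implicit Types (s t y e : R) (z w : R -> R).

(** The reflection s -> -s produces an equation of the same kind, so the one-sided estimates for s
    >= 0 also serve for s <= 0. *)
Let G' s y := - G (- s) y.

Let Glip' s y y' : `|s| < d -> `|s| * `|G' s y - G' s y'| <= `|y - y'| / 2.
Proof. by rewrite /G' -opprD normrN -(normrN s); exact: Glip. Qed.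

Let Gbound' s y : `|s| < d -> `|G' s y| <= K.
Proof. by rewrite /G' normrN -(normrN s); exact: Gbound. Qed.

Let reflect w s : is_derive (- s) 1 w (G (- s) (w (- s))) ->
  is_derive s 1 (w \o -%R) (G' s ((w \o -%R) s)).
Proof.
move=> wd; have h := is_deriveN (is_derive_id s (1 : R)).
by have := is_derive1_comp wd h; rewrite mulrN1.
Qed.

Lemma solution_unique w z a b s0 : `|a| < d -> `|b| < d ->
  (forall t, a <= t <= b -> is_derive t 1 w (G t (w t))) ->
  (forall t, a <= t <= b -> is_derive t 1 z (G t (z t))) ->
  a <= s0 <= b -> w s0 = z s0 -> forall t, a <= t <= b -> w t = z t.
Proof.
move=> ad bd wd zd /andP[as0 s0b] E.
have lt_d x : `|x| < d -> x < d by apply: le_lt_trans; exact: ler_norm.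
have lt_d' x : `|x| < d -> - x < d by rewrite -normrN; exact: lt_d.
have fwd (x y : R) : a <= x -> 0 <= x -> x <= y -> y <= b -> w x = z x -> w y = z y.
  move=> ax x0 xy yb; have sub t : x <= t <= y -> a <= t <= b.
    by move=> /andP[xt ty]; rewrite (le_trans ax xt) (le_trans ty yb).
  apply: (solution_unique_forward K0 Gbound Glip x0 xy) => //.
  - exact: le_lt_trans yb (lt_d _ bd).
  - by move=> t /sub; exact: wd.
  - by move=> t /sub; exact: zd.
have bwd (x y : R) : a <= x -> 0 <= x -> x <= y -> y <= b -> w y = z y -> w x = z x.
  move=> ax x0 xy yb; have sub t : x <= t <= y -> a <= t <= b.
    by move=> /andP[xt ty]; rewrite (le_trans ax xt) (le_trans ty yb).
  apply: (solution_unique_backward Gbound Glip x0 xy) => //.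
  - exact: le_lt_trans yb (lt_d _ bd).
  - by move=> t /sub; exact: wd.
  - by move=> t /sub; exact: zd.
have rsub (x y t : R) : a <= y -> x <= b -> - x <= t <= - y -> a <= - t <= b.
  by move=> ay xb /andP[xt ty]; apply/andP; split; lra.
have fwd' (x y : R) : x <= b -> x <= 0 -> y <= x -> a <= y -> w x = z x -> w y = z y.
  move=> xb x0 yx ay Ex; rewrite -[y]opprK.
  apply: (@solution_unique_forward R d K G' K0 Gbound' Glip' (w \o -%R) (z \o -%R) (- x)).
  - by rewrite oppr_ge0.
  - by rewrite lerN2.
  - by apply: lt_d'; apply: (ball_mem ad bd); rewrite ay (le_trans yx).
  - by move=> t h; apply: reflect; apply: wd; exact: rsub h.
  - by move=> t h; apply: reflect; apply: zd; exact: rsub h.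
  - by rewrite /= opprK.
have bwd' (x y : R) : x <= b -> x <= 0 -> y <= x -> a <= y -> w y = z y -> w x = z x.
  move=> xb x0 yx ay Ey; rewrite -[x]opprK.
  apply: (@solution_unique_backward R d K G' Gbound' Glip' (w \o -%R) (z \o -%R) _ (- y)).
  - by rewrite oppr_ge0.
  - by rewrite lerN2.
  - by apply: lt_d'; apply: (ball_mem ad bd); rewrite ay (le_trans yx).
  - by move=> t h; apply: reflect; apply: wd; exact: rsub h.
  - by move=> t h; apply: reflect; apply: zd; exact: rsub h.
  - by rewrite /= opprK.
move=> t /andP[at_ tb].
have [s00|/ltW s00] := leP 0 s0.
  have [t0|/ltW t0] := leP 0 t.
    have [ts|/ltW st] := leP t s0; [exact: (bwd t s0)|exact: (fwd s0 t)].
  apply: (fwd' 0 t) => //; first exact: le_trans s0b.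
  by apply: (bwd 0 s0) => //; exact: le_trans t0.
have [t0|/ltW t0] := leP t 0.
  have [ts|/ltW st] := leP t s0; [exact: (fwd' s0 t)|exact: (bwd' t s0)].
apply: (fwd 0 t) => //; first exact: le_trans s00.
by apply: (bwd' 0 s0) => //; exact: le_trans tb.
Qed.

Lemma solution_family : exists Y : R -> R -> R, forall e, Y e 0 = e /\ forall s : R, `|s| < d -> is_derive s 1 (Y e) (G s (Y e s)).
Proof.
by have [Y HY] := choice (singular_ode_exists d0 d1 K0 Gcont Gbound Glip); exists Y.
Qed.

Variable Y : R -> R -> R.
Hypothesis Y0 : forall e, Y e 0 = e.
Hypothesis Yd : forall e s, `|s| < d -> is_derive s 1 (Y e) (G s (Y e s)).

Lemma family_drift e s : `|s| < d -> `|Y e s - e| <= K * `|s|.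
Proof.
move=> sd; apply: (@derive_bound R d (fun s => Y e s - e) (fun s => G s (Y e s) - 0)) => //.
- by move=> t td; apply: is_deriveB; exact: Yd.
- by move=> t td; rewrite subr0; exact: Gbound.
- by rewrite Y0 subrr.
Qed.

Lemma family_label_inj e e' s : `|s| < d -> Y e s = Y e' s -> e = e'.
Proof.
move=> sd E; rewrite -(Y0 e) -(Y0 e').
have d00 : `|0 : R| < d by rewrite normr0.
have [s0|/ltW s0] := leP 0 s.
  apply: (@solution_unique (Y e) (Y e') 0 s s) => //; rewrite ?lexx ?s0 //.
  - by move=> t h; apply: Yd; exact: (ball_mem d00 sd h).
  - by move=> t h; apply: Yd; exact: (ball_mem d00 sd h).
apply: (@solution_unique (Y e) (Y e') s 0 s) => //; rewrite ?lexx ?s0 //.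
- by move=> t h; apply: Yd; exact: (ball_mem sd d00 h).
- by move=> t h; apply: Yd; exact: (ball_mem sd d00 h).
Qed.

Lemma family_dependence e e' s : `|s| < d -> `|e - e'| <= 1 ->
  (Y e s - Y e' s) ^+ 2 <= (1 + 2 * K) ^+ 2 * `|e - e'|.
Proof.
move=> sd ee; have d00 : `|0 : R| < d by rewrite normr0.
have ee0 : `|Y e 0 - Y e' 0| <= 1 by rewrite !Y0.
have -> : `|e - e'| = `|Y e 0 - Y e' 0| by rewrite !Y0.
have [s0|/ltW s0] := leP 0 s.
  apply: (solution_dependence d1 K0 Gbound Glip s0) => //.
  - exact: le_lt_trans (ler_norm _) sd.
  - by move=> t h; apply: Yd; exact: (ball_mem d00 sd h).
  - by move=> t h; apply: Yd; exact: (ball_mem d00 sd h).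
have := @solution_dependence R d K G' d1 K0 Gbound' Glip' (Y e \o -%R) (Y e' \o -%R) (- s).
rewrite /= !opprK oppr0; apply => //.
- by rewrite oppr_ge0.
- by apply: le_lt_trans sd; rewrite -normrN; exact: ler_norm.
- move=> t /andP[h1 h2]; apply: reflect; apply: Yd; apply: (ball_mem sd d00).
  by apply/andP; split; lra.
- move=> t /andP[h1 h2]; apply: reflect; apply: Yd; apply: (ball_mem sd d00).
  by apply/andP; split; lra.
Qed.

Lemma family_continuous_label e s : `|s| < d -> {for e, continuous (Y^~ s)}.
Proof.
move=> sd; apply/cvgrPdist_le => eps eps0.
have C0 : 0 < (1 + 2 * K) ^+ 2 by rewrite exprn_gt0 // ltr_wpDr // mulr_ge0.
have q0 : 0 < eps ^+ 2 / (1 + 2 * K) ^+ 2 by rewrite divr_gt0 // exprn_gt0.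
near=> e'.
have h1 : `|e - e'| <= 1 by near: e'; apply: cvgr_dist_le; [exact: cvg_id|].
have h2 : `|e - e'| <= eps ^+ 2 / (1 + 2 * K) ^+ 2.
  by near: e'; apply: cvgr_dist_le; first exact: cvg_id.
rewrite -(ler_sqr (normr_ge0 _)) ?nnegrE ?(ltW eps0) // real_normK ?num_real //.
apply: le_trans (family_dependence sd h1) _.
by rewrite mulrC -ler_pdivlMr.
Unshelve. all: by end_near. Qed.

(** By the intermediate value theorem, exchanging the order of two graphs would create a common
    point, contrary to [family_label_inj]. *)
Lemma family_increasing e e' s : `|s| < d -> e < e' -> Y e s < Y e' s.
Proof.
move=> sd ee; rewrite ltNge; apply/negP => Yle.
have d00 : `|0 : R| < d by rewrite normr0.
pose D t := Y e' t - Y e t.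
have Dc t : `|t| < d -> {for t, continuous D}.
  move=> td; apply: (@continuousB); apply: is_derive_continuous; exact: Yd.
have D0 : 0 < D 0 by rewrite /D !Y0 subr_gt0.
have Ds : D s <= 0 by rewrite /D subr_le0.
have [t td Dt] : exists2 t, `|t| < d & D t = 0.
  have [s0|/ltW s0] := leP 0 s.
    have [| |t] := @IVT R D 0 s 0 s0.
    - by apply: continuous_itv => t h; apply: Dc; exact: (ball_mem d00 sd h).
    - by rewrite ge_min le_max Ds (ltW D0) orbT.
    - by rewrite in_itv /= => h Dt; exists t => //; exact: (ball_mem d00 sd h).
  have [| |t] := @IVT R D s 0 0 s0.
  - by apply: continuous_itv => t h; apply: Dc; exact: (ball_mem sd d00 h).
  - by rewrite ge_min le_max Ds (ltW D0) orbT.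
  - by rewrite in_itv /= => h Dt; exists t => //; exact: (ball_mem sd d00 h).
move/eqP: Dt; rewrite /D subr_eq0 => /eqP /(family_label_inj td) E.
by rewrite E ltxx in ee.
Qed.

(** The graph of label [e] drifts by at most [K], so the value [y] is reached by a label between
    [y - K] and [y + K]. *)
Lemma family_label : exists E : R -> R -> R, forall s y, `|s| < d ->
  Y (E s y) s = y.
Proof.
have ex (u : R * R) : exists e, `|u.1| < d -> Y e u.1 = u.2.
  case: u => s y /=; case: (ltP `|s| d) => [sd|]; last by exists 0.
  have b e : `|Y e s - e| <= K.
    apply: le_trans (family_drift e sd) _; rewrite ler_piMr //.
    exact/ltW/(lt_le_trans sd).
  have [| | |e _ <-] := @IVT R (Y^~ s) (y - K) (y + K) y.
  - by have := K0; lra.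
  - by apply: continuous_itv => e _; apply: family_continuous_label.
  - rewrite ge_min le_max; have := b (y - K); have := b (y + K).
    by rewrite !ler_norml => /andP[h1 h2] /andP[h3 h4]; apply/andP; split; lra.
  - by exists e.
have [E HE] := choice ex; exists (fun s y => E (s, y)) => s y sd.
exact: (HE (s, y)).
Qed.

Variable E : R -> R -> R.
Hypothesis EK : forall s y, `|s| < d -> Y (E s y) s = y.

Lemma label_family s e : `|s| < d -> E s (Y e s) = e.
Proof. by move=> sd; apply: (family_label_inj sd); rewrite EK. Qed.

(** Monotonicity in the label squeezes nearby graphs between those of labels [e - del] and
    [e + del], so joint continuity follows from continuity in each variable. *)
Lemma family_continuous s e : `|s| < d ->
  {for (s, e), continuous (fun u : R * R => Y u.2 u.1)}.
Proof.
move=> sd; apply/cvgrPdist_le => eps eps0.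
have eps2 : 0 < eps / 2 by rewrite divr_gt0.
have hc (f : R -> R) : {for s, continuous f} -> \forall u \near (s, e), `|f s - f u.1| <= eps / 2.
  by move=> /(@continuous_fst _ _ _ f s e) /cvgrPdist_le; apply.
have [del del0 Hdel] : exists2 del, 0 < del & Y (e + del) s <= Y e s + eps / 2 /\
    Y e s - eps / 2 <= Y (e - del) s.
  have /cvgrPdist_le /(_ _ eps2) := family_continuous_label (e := e) sd.
  move=> /nbhs_ballP[r /= r0 Hr]; exists (r / 2); first by rewrite divr_gt0.
  have r2 : r / 2 < r by rewrite ltr_pdivrMr // ltr_pMr // ltr1n.
  have h1 := Hr (e + r / 2); have h2 := Hr (e - r / 2).
  have {}h1 : `|Y e s - Y (e + r / 2) s| <= eps / 2.
    by apply: h1; rewrite /ball /= opprD addNKr normrN gtr0_norm // divr_gt0.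
  have {}h2 : `|Y e s - Y (e - r / 2) s| <= eps / 2.
    by apply: h2; rewrite /ball /= opprB addrC subrK gtr0_norm // divr_gt0.
  by move: h1 h2; rewrite !ler_norml => /andP[h1 h2] /andP[h3 h4]; split; lra.
near=> u.
have ud : `|u.1| < d.
  by near: u; apply: (@near_fst _ _ (fun x => `|x| < d)); exact: near_norm_lt.
have e1 : u.2 < e + del.
  near: u; apply: (@near_snd _ _ (fun x => x < e + del)).
  by apply: lt_nbhsl; rewrite ltrDl.
have e2 : e - del < u.2.
  near: u; apply: (@near_snd _ _ (fun x => e - del < x)).
  by apply: lt_nbhsr; rewrite ltrBlDr ltrDl.
have i1 := family_increasing ud e1; have i2 := family_increasing ud e2.
have j1 : `|Y (e + del) s - Y (e + del) u.1| <= eps / 2.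
  by near: u; apply: hc; apply: is_derive_continuous (Yd _ sd).
have j2 : `|Y (e - del) s - Y (e - del) u.1| <= eps / 2.
  by near: u; apply: hc; apply: is_derive_continuous (Yd _ sd).
move: Hdel j1 j2; rewrite /= !ler_norml => -[k1 k2] /andP[l1 l2] /andP[l3 l4].
by apply/andP; split; lra.
Unshelve. all: by end_near. Qed.

Lemma label_continuous s y : `|s| < d ->
  {for (s, y), continuous (fun u : R * R => E u.1 u.2)}.
Proof.
move=> sd; apply/cvgrPdist_le => eps eps0; set e := E s y.
have ye : Y e s = y by exact: EK.
have h1 : Y (e - eps) s < y by rewrite -ye; apply: family_increasing; lra.
have h2 : y < Y (e + eps) s by rewrite -ye; apply: family_increasing; lra.
have c e' : {for (s, y), continuous (fun u : R * R => Y e' u.1 - u.2)}.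
  apply: continuousB; last exact: cvg_snd.
  by apply: continuous_fst; exact: is_derive_continuous (Yd _ sd).
near=> u.
have ud : `|u.1| < d.
  by near: u; apply: (@near_fst _ _ (fun x => `|x| < d)); exact: near_norm_lt.
have k1 : Y (e - eps) u.1 - u.2 < 0.
  near: u; apply: (cvgr_lt (Y (e - eps) s - y)); first exact: c.
  by rewrite subr_lt0.
have k2 : 0 < Y (e + eps) u.1 - u.2.
  near: u; apply: (cvgr_gt (Y (e + eps) s - y)); first exact: c.
  by rewrite subr_gt0.
have ye' : Y (E u.1 u.2) u.1 = u.2 by exact: EK.
have l1 : e - eps <= E u.1 u.2.
  rewrite leNgt; apply/negP => /(family_increasing ud); rewrite ye'; lra.
have l2 : E u.1 u.2 <= e + eps.
  rewrite leNgt; apply/negP => /(family_increasing ud); rewrite ye'; lra.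
by rewrite /= ler_norml; apply/andP; split; lra.
Unshelve. all: by end_near. Qed.

End Foliation.

(** * Local orbital equivalence *)

Section Equivalence.
Variable R : realType.
Implicit Types (X Y Z : R * R -> R * R) (p q r z : R * R) (U V W : set (R * R))
  (I J : set R) (gam : R -> R * R) (s t : R).

(** N = a^2 + b^2 satisfies |N'| <= 4 |C| N, so N multiplied by a suitable exponential is monotone.
    This is how an orbit through an equilibrium is shown to be constant. *)
Lemma gronwall_zero (a b : R -> R) I (C : R) : is_interval I ->
  (forall t, I t -> exists da db, [/\ is_derive t 1 a da, is_derive t 1 b db,
     `|da| <= C * (`|a t| + `|b t|) & `|db| <= C * (`|a t| + `|b t|)]) ->
  forall t0 t, I t0 -> I t -> a t0 = 0 -> b t0 = 0 -> a t = 0 /\ b t = 0.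
Proof.
move=> iI ab t0 t It0 It a0 b0.
have /choice[da Hda] : forall t, exists da, I t -> exists db, [/\ is_derive t 1 a da,
    is_derive t 1 b db, `|da| <= C * (`|a t| + `|b t|) & `|db| <= C * (`|a t| + `|b t|)].
  move=> x; case: (pselect (I x)) => [/ab[d H]|n]; first by exists d.
  by exists 0 => /n.
have /choice[db H] : forall t, exists db, I t -> [/\ is_derive t 1 a (da t),
    is_derive t 1 b db, `|da t| <= C * (`|a t| + `|b t|) & `|db| <= C * (`|a t| + `|b t|)].
  move=> x; case: (pselect (I x)) => [/Hda[d Hx]|n]; first by exists d.
  by exists 0 => /n.
pose N t := a t ^+ 2 + b t ^+ 2.
pose dN t := 2 * (a t * da t + b t * db t).
have Nd x : I x -> is_derive x 1 N (dN x).
  move=> /H[d1 d2 _ _].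
  have D := is_deriveD (is_deriveX 2 d1) (is_deriveX 2 d2).
  by apply: (is_derive_eq D); rewrite /dN /= /GRing.scale /= !expr1; ring.
pose L := 4 * `|C|.
have Nb x : I x -> `|dN x| <= L * N x.
  move=> /H[_ _ h1 h2].
  have hC : C * (`|a x| + `|b x|) <= `|C| * (`|a x| + `|b x|).
    by rewrite ler_wpM2r ?addr_ge0 // ler_norm.
  rewrite /dN normrM (ger0_norm (ler0n _ 2)).
  have i1 : `|a x * da x + b x * db x| <= `|a x| * `|da x| + `|b x| * `|db x|.
    by rewrite -!normrM ler_normD.
  have i2 := ler_wpM2l (normr_ge0 (a x)) (le_trans h1 hC).
  have i3 := ler_wpM2l (normr_ge0 (b x)) (le_trans h2 hC).
  have i4 : 0 <= (`|a x| - `|b x|) ^+ 2 by exact: sqr_ge0.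
  have i5 := mulr_ge0 (normr_ge0 C) i4.
  rewrite /L /N -(real_normK (num_real (a x))) -(real_normK (num_real (b x))).
  move: (normr_ge0 C) i1 i2 i3 i5; set c := `|C|; set u := `|a x|; set v := `|b x|.
  by move=> *; nra.
(* The sign [e] treats both directions of time: for e = 1 the function N exp(L t) increases, for e =
   -1 the function N exp(-L t) decreases. *)
have mono (e x y : R) : e ^+ 2 = 1 -> I x -> I y -> x <= y ->
    e * N x * expR (e * L * x) <= e * N y * expR (e * L * y).
  move=> e2 Ix Iy xy.
  have sub w : x <= w <= y -> I w by exact: (is_interval_mem iI Ix Iy).
  pose F w := e * N w * expR (e * L * w).
  have FD w : x <= w <= y -> is_derive w 1 F ((e * dN w + L * N w) * expR (e * L * w)).
    move=> /sub Iw.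
    have h1 := is_deriveM (is_derive_cst e w (1 : R)) (Nd w Iw).
    have h2 := is_deriveM (is_derive_cst (e * L) w (1 : R)) (is_derive_id w (1 : R)).
    have D := is_deriveM h1 (is_derive1_comp (is_derive_expR _) h2).
    apply: (is_derive_eq D); rewrite /GRing.scale /= !mulr0 !addr0 !mulr1.
    have -> : (cst e * N) w = e * N w by [].
    have -> : (cst (e * L) * id) w = e * L * w by [].
    have E : L * N w = e ^+ 2 * (L * N w) by rewrite e2 mul1r.
    by rewrite [L * N w]E; ring.
  apply: (derive_nondecreasing xy FD) => w /sub Iw.
  rewrite mulr_ge0 ?expR_ge0 // -lerBlDl sub0r.
  apply: le_trans (Nb w Iw).
  have e1 : `|e| = 1 by apply/eqP; rewrite -sqrp_eq1 // real_normK ?num_real // e2.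
  have -> : `|dN w| = `|e * dN w| by rewrite [RHS]normrM e1 mul1r.
  by rewrite -normrN ler_norm.
have N0 : N t = 0.
  have N00 : N t0 = 0 by rewrite /N a0 b0 expr0n addr0.
  apply/eqP; rewrite eq_le addr_ge0 ?sqr_ge0 // andbT.
  have [tt|/ltW tt] := leP t0 t.
    have := mono (-1) t0 t _ It0 It tt; rewrite sqrrN expr1n => /(_ erefl).
    by rewrite N00 mulr0 mul0r mulN1r mulNr oppr_ge0 pmulr_lle0 // expR_gt0.
  have := mono 1 t t0 _ It It0 tt; rewrite expr1n => /(_ erefl).
  by rewrite N00 mulr0 mul0r !mul1r pmulr_lle0 // expR_gt0.
move/eqP: N0; rewrite /N paddr_eq0 ?sqr_ge0 // !sqrf_eq0.
by move=> /andP[/eqP -> /eqP ->].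
Qed.

(** Its orbits are horizontal lines, the axis being cut at the equilibrium. It serves as a common
    model of all cusps, because its orbits are described by one conserved and one increasing
    coordinate. *)
Definition flow_box z : R * R := (z.1 ^+ 2 + z.2 ^+ 2, 0).

(* The restriction of [locally_equivalent] to full neighbourhoods. *)
Definition equivalence X p Y q U V (h k : R * R -> R * R) :=
  [/\ open U /\ U p, open V /\ V q,
      h p = q /\ (forall z, U z -> V (h z) /\ k (h z) = z),
      k q = p /\ (forall z, V z -> U (k z) /\ h (k z) = z) &
      [/\ forall z, U z -> {for z, continuous h},
          forall z, V z -> {for z, continuous k},
          carries_orbits X U Y V h & carries_orbits Y V X U k]].

Lemma equivalence_locally_equivalent X p Y q U V h k :
  equivalence X p Y q U V h k -> locally_equivalent X setT p Y setT q.
Proof.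
move=> [[oU Up] [oV Vq] [hp hU] [kq kV] [hc kc c1 c2]].
exists U, V, h, k; rewrite !setTI; split; first by split.
split=> //; split.
- by move=> _ [z /hU[] ? _ <-].
- by move=> _ [z /kV[] ? _ <-].
- by split=> z => [/hU[]|/kV[]].
- by apply: continuous_in_subspaceT => z; rewrite inE; exact: hc.
- by apply: continuous_in_subspaceT => z; rewrite inE; exact: kc.
Qed.

Lemma carries_orbits_comp X U Y V V' Z W U' W' (h h' k' : R * R -> R * R) :
  carries_orbits X U Y V h -> carries_orbits Y V' Z W h' ->
  (forall z, V' z -> k' (h' z) = z) ->
  U' `<=` U `&` h @^-1` V' -> W `&` k' @^-1` (V `&` V') `<=` W' ->
  carries_orbits X U' Z W' (h' \o h).
Proof.
move=> c1 c2 hk sU sW I gam [oI iI gI gd].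
have [J [tau [tJ tinc [oJ iJ hJ dJ]]]] : exists (J : set R) (tau : R -> R),
    [/\ tau @` J = I, {in J &, {homo tau : s t / s < t}} &
        solution Y V J (h \o gam \o tau)].
  by apply: c1; split=> // t /gI /sU[].
have It t : J t -> I (tau t) by move=> Jt; rewrite -tJ; exists t.
have [|J' [tau' [tJ' tinc' [oJ' iJ' hJ' dJ']]]] := c2 J (h \o gam \o tau).
  by split=> // t /It /gI /sU[].
have Jt t : J' t -> J (tau' t) by move=> J't; rewrite -tJ'; exists t.
have VV t : J' t -> V' (h (gam (tau (tau' t)))).
  by move=> /Jt /It /gI /sU[].
exists J', (tau \o tau'); split.
- by rewrite -image_comp tJ'.
- move=> s t sJ tJ0 st; rewrite !inE in sJ tJ0.
  by apply: tinc; rewrite ?inE; [exact: Jt|exact: Jt|apply: tinc'; rewrite ?inE].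
- split=> // t J't; apply: sW; split; first exact: hJ'.
  by rewrite /= hk; [split; [exact: hJ (Jt _ J't)|exact: VV]|exact: VV].
Qed.

Lemma open_preimage U V (h : R * R -> R * R) : open U -> open V ->
  (forall z, U z -> {for z, continuous h}) -> open (U `&` h @^-1` V).
Proof.
move=> oU oV hc; rewrite openE => z [Uz Vz].
apply: filterI; first exact: open_nbhs_nbhs.
by apply: (hc z Uz); exact: open_nbhs_nbhs.
Qed.

Lemma equivalence_trans X p Y q Z r U V h k V' W h' k' :
  equivalence X p Y q U V h k -> equivalence Y q Z r V' W h' k' ->
  exists U' W', equivalence X p Z r U' W' (h' \o h) (k \o k').
Proof.
move=> [[oU Up] [oV Vq] [hp hU] [kq kV] [hc kc c1 c2]].
move=> [[oV' Vq'] [oW Wr] [hp' hU'] [kq' kV'] [hc' kc' c1' c2']].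
exists (U `&` h @^-1` (V `&` V')), (W `&` k' @^-1` (V `&` V')); split.
- by split; [apply: open_preimage => //; exact: openI|rewrite /= hp].
- by split; [apply: open_preimage => //; exact: openI|rewrite /= kq'].
- split=> [|z [Uz [Vz Vz']]]; first by rewrite /= hp hp'.
  have [w1 w2] := hU' _ Vz'; have [w3 w4] := hU _ Uz.
  by rewrite /= w2 w4; do !split.
- split=> [|z [Wz [Vz Vz']]]; first by rewrite /= kq' kq.
  have [w1 w2] := kV _ Vz; have [w3 w4] := kV' _ Wz.
  by rewrite /= w2 w4; do !split.
split.
- move=> z [Uz [_ Vz']]; apply: continuous_comp; [exact: hc|exact: hc'].
- move=> z [Wz [Vz _]]; apply: continuous_comp; [exact: kc'|exact: kc].
- apply: (carries_orbits_comp (k' := k') c1 c1').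
  + by move=> z /hU'[].
  + by move=> z [Uz [_ Vz']].
  + by [].
- apply: (carries_orbits_comp (k' := h) c2' c2).
  + by move=> z /kV[].
  + by move=> z [Wz [Vz _]].
  + by move=> z [Uz /= [Vz' Vz]].
Qed.

Lemma equivalence_sym X p Y q U V h k :
  equivalence X p Y q U V h k -> equivalence Y q X p V U k h.
Proof. by move=> [? ? ? ? []]; split. Qed.

Lemma solution_constant p X U I gam : open I -> is_interval I -> U p -> X p = 0 ->
  (forall t, I t -> gam t = p) -> solution X U I gam.
Proof.
move=> oI iI Up Xp gp; split=> // [t It|t It]; first by rewrite gp.
rewrite gp // Xp; apply: near_eq_is_derive (is_derive_cst p t (1 : R)).
by near=> u; rewrite gp //; near: u; exact: open_nbhs_nbhs.
Unshelve. all: by end_near. Qed.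

Lemma flow_box_constant U I gam : solution flow_box U I gam ->
  forall t0 t, I t0 -> I t -> gam t0 = 0 -> U `<=` [set z | `|z.1| <= 1 /\ `|z.2| <= 1] ->
  gam t = 0.
Proof.
move=> [oI iI gU gd] t0 t It0 It g0 Ub.
have [|||e1 e2] := @gronwall_zero (fun t => (gam t).1) (fun t => (gam t).2) I 1 iI _ t0 t It0 It.
- move=> u Iu; exists ((gam u).1 ^+ 2 + (gam u).2 ^+ 2), 0.
  have [b1 b2] := Ub _ (gU _ Iu).
  split; [exact: is_derive_fst (gd u Iu)|exact: is_derive_snd (gd u Iu)| |].
    rewrite mul1r ger0_norm ?addr_ge0 ?sqr_ge0 //.
    rewrite -(real_normK (num_real (gam u).1)) -(real_normK (num_real (gam u).2)).
    by rewrite !expr2 lerD // ler_piMr.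
  by rewrite normr0 mul1r addr_ge0.
- by rewrite g0.
- by rewrite g0.
by rewrite [LHS]surjective_pairing e1 e2.
Qed.

(** Only the traces of the orbits have to be matched: [h] must turn nonconstant orbits into curves
    of constant height and increasing abscissa, and horizontal curves must be carried by [k] to
    orbits up to the positive speed [m]. The change of time is then supplied by [reparametrize]. *)
Lemma flow_box_chart X p U V (h k : R * R -> R * R) (m : R * R -> R) :
  open U -> U p -> open V -> V 0 ->
  V `<=` [set z | `|z.1| <= 1 /\ `|z.2| <= 1] ->
  h p = 0 -> (forall z, U z -> V (h z) /\ k (h z) = z) ->
  k 0 = p -> (forall z, V z -> U (k z) /\ h (k z) = z) ->
  (forall z, U z -> {for z, continuous h}) ->
  (forall z, V z -> {for z, continuous k}) ->
  X p = 0 ->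
  (forall I gam, solution X U I gam -> (exists2 t, I t & gam t = p) \/
     (forall t, I t -> exists2 l, 0 < l & is_derive t 1 (fun t => (h (gam t)).1) l) /\
     (forall s t, I s -> I t -> (h (gam s)).2 = (h (gam t)).2)) ->
  (forall I gam, solution X U I gam -> forall s t, I s -> I t ->
     gam s = p -> gam t = p) ->
  (forall z, V z -> z != 0 -> [/\ 0 < m z,
     {for z.1, continuous (fun s => m (s, z.2))} &
     is_derive z.1 1 (fun s => k (s, z.2)) ((m z)^-1 *: X (k z))]) ->
  equivalence X p flow_box 0 U V h k.
Proof.
move=> oU Up oV V0 Vb hp hU k0 kV hc kc Xp solX constX mV.
have fb0 : flow_box 0 = 0 by rewrite /flow_box /= expr0n addr0.
split=> //; split=> // I gam sol; have [oI iI gI gd] := sol.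
(* The interval of a [solution] may be empty, in which case no [t1] is available to fix the height
   [e]. *)
- case: (pselect (exists t, I t)) => [[t1 It1]|nI]; last first.
    exists I, id; rewrite image_id; split=> //; split=> // t It; case: nI; exists t => //.
  case: (solX I gam sol) => [[t0 It0 g0]|[hd h2]].
    exists I, id; rewrite image_id; split=> //.
    apply: (@solution_constant 0) => // t It /=.
    by rewrite (constX I gam sol t0 t).
  pose s t := (h (gam t)).1; pose e := (h (gam t1)).2.
  (* The flow box speed could vanish only where the orbit meets p; the orbit would then be constant,
     against the positive derivative [l]. *)
  have nz t : I t -> 0 < s t ^+ 2 + e ^+ 2.
    move=> It; rewrite lt_def paddr_eq0 ?addr_ge0 ?sqr_ge0 // !sqrf_eq0 andbT.
    apply/negP => /andP[/eqP s0 /eqP e0].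
    have [l l0 dl] := hd t It.
    have gp : gam t = p.
      have [_ <-] := hU _ (gI t It); rewrite -k0; congr k.
      by rewrite [LHS]surjective_pairing -/(s t) s0 (h2 _ _ It It1) -/e e0.
    have gp' u : I u -> gam u = p by move=> Iu; apply: (constX I gam sol t u).
    have d0 : is_derive t 1 s 0.
      apply: near_eq_is_derive (is_derive_cst (0 : R) t (1 : R)).
      near=> u; rewrite /s gp' ?hp //; near: u; exact: open_nbhs_nbhs.
    by move: l0; rewrite -(@derive_val _ _ _ _ _ _ _ dl) (@derive_val _ _ _ _ _ _ _ d0) ltxx.
  have sI : {in I &, {homo s : x y / x < y}}.
    move=> x y; rewrite !inE => Ix Iy xy.
    have sub w : x <= w <= y -> I w by exact: (is_interval_mem iI Ix Iy).
    have D w : x <= w <= y -> is_derive w 1 s ('D_1 s w) /\ 0 < 'D_1 s w.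
      move=> /sub /hd[l l0 dl]; rewrite (@derive_val _ _ _ _ _ _ _ dl); split=> //.
    by apply: (derive_increasing xy) => w /D[].
  have [|t It|J [tau [oJ iJ tJ tinc td]]] := @reparametrize R s (fun x => x ^+ 2 + e ^+ 2) I oI iI _ sI.
  + by move=> t /hd[l _ /is_derive_continuous].
  + split; first exact: nz.
    apply: continuousD; last exact: cst_continuous.
    exact: exprn_continuous.
  have It t : J t -> I (tau t) by move=> Jt; rewrite -tJ; exists t.
  exists J, tau; split=> //; split=> // t Jt; first by have [] := hU _ (gI _ (It _ Jt)).
  have D := is_derive_pair (td t Jt) (is_derive_cst e t (1 : R)).
  have -> : flow_box ((h \o gam \o tau) t) = (s (tau t) ^+ 2 + e ^+ 2, 0).
    by rewrite /flow_box /= (h2 _ _ (It _ Jt) It1).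
  apply: near_eq_is_derive D; near=> u.
  have Ju : J u by near: u; exact: open_nbhs_nbhs.
  by rewrite [RHS]surjective_pairing /= (h2 _ _ (It _ Ju) It1).
- have c0 t0 t : I t0 -> I t -> gam t0 = 0 -> gam t = 0.
    by move=> It0 It g0; apply: (flow_box_constant sol It0 It g0 Vb).
  case: (pselect (exists2 t0, I t0 & gam t0 = 0)) => [[t0 It0 g0]|n0].
    exists I, id; rewrite image_id; split=> //.
    by apply: (@solution_constant p) => // t It /=; rewrite (c0 t0 t) // k0.
  case: (pselect (exists t, I t)) => [[t1 It1]|nI]; last first.
    exists I, id; rewrite image_id; split=> //; split=> // t It; case: nI; exists t => //.
  have gn0 t : I t -> gam t != 0 by move=> It; apply/eqP => g0; apply: n0; exists t.
  pose s t := (gam t).1; pose e := (gam t1).2.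
  have e2 t : I t -> (gam t).2 = e.
    have cst x y : I x -> I y -> x <= y -> (gam x).2 = (gam y).2.
      move=> Ix Iy xy.
      have [|w _ /eqP] := @mvt R (fun t => (gam t).2) (fun=> 0) x y xy.
        move=> w wxy; exact: is_derive_snd (gd w (is_interval_mem iI Ix Iy wxy)).
      by rewrite mul0r subr_eq0 => /eqP.
    by move=> It; have [tt|/ltW tt] := leP t t1; [exact: cst|symmetry; exact: cst].
  have gE t : I t -> gam t = (s t, e) by move=> It; rewrite [LHS]surjective_pairing e2.
  have sd t : I t -> is_derive t 1 s (s t ^+ 2 + e ^+ 2).
    by move=> It; have := is_derive_fst (gd t It); rewrite /= e2.
  have sp t : I t -> 0 < s t ^+ 2 + e ^+ 2.
    move=> It; rewrite lt_def paddr_eq0 ?addr_ge0 ?sqr_ge0 // !sqrf_eq0 andbT.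
    by have := gn0 t It; rewrite gE // xpair_eqE.
  have sI : {in I &, {homo s : x y / x < y}}.
    move=> x y; rewrite !inE => Ix Iy xy.
    have sub w : x <= w <= y -> I w by exact: (is_interval_mem iI Ix Iy).
    by apply: (derive_increasing xy) => w /sub; [exact: sd|exact: sp].
  have mI t : I t -> [/\ 0 < m (s t, e), {for s t, continuous (fun s => m (s, e))} &
     is_derive (s t) 1 (fun s => k (s, e)) ((m (s t, e))^-1 *: X (k (s t, e)))].
    by move=> It; apply: (mV (s t, e)); rewrite -gE //; [exact: gI|exact: gn0].
  have [|t It|J [tau [oJ iJ tJ tinc td]]] := @reparametrize R s (fun x => m (x, e)) I oI iI _ sI.
  + by move=> t /sd /is_derive_continuous.
  + by have [] := mI t It.
  have It t : J t -> I (tau t) by move=> Jt; rewrite -tJ; exists t.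
  exists J, tau; split=> //; split=> // t Jt; first by have [] := kV _ (gI _ (It _ Jt)).
  have [m0 _ kd] := mI _ (It _ Jt).
  have D1 := @is_derive1_comp _ (fun s => (k (s, e)).1) (s \o tau) t _ _ (is_derive_fst kd) (td t Jt).
  have D2 := @is_derive1_comp _ (fun s => (k (s, e)).2) (s \o tau) t _ _ (is_derive_snd kd) (td t Jt).
  have := is_derive_pair D1 D2.
  have -> : (((m (s (tau t), e))^-1 *: X (k (s (tau t), e))).1 * m (s (tau t), e),
     ((m (s (tau t), e))^-1 *: X (k (s (tau t), e))).2 * m (s (tau t), e)) =
     X ((k \o gam \o tau) t).
    have Eg : gam (tau t) = (s (tau t), e) := gE _ (It _ Jt).
    rewrite /comp Eg; case: (X _) => x y /=; rewrite /GRing.scale /=.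
    by congr (_, _); rewrite mulrAC mulVf ?mul1r // gt_eqF.
  apply: near_eq_is_derive; near=> u.
  have Ju : J u by near: u; exact: open_nbhs_nbhs.
  by rewrite [RHS]/= (gE _ (It _ Ju)) [RHS]surjective_pairing.
Unshelve. all: by end_near. Qed.

End Equivalence.

(** * Sectors at a point equivalent to the flow box *)

Lemma clamp_dist (R : realType) (a x y : R) : 0 <= a ->
  `|Num.max 0 (Num.min x a) - Num.max 0 (Num.min y a)| <= `|x - y|.
Proof.
move=> a0; wlog xy : x y / x <= y => [hw|].
  by have [|/ltW] := leP x y => h; [|rewrite distrC (distrC x)]; exact: hw.
have mm : Num.max 0 (Num.min x a) <= Num.max 0 (Num.min y a).
  rewrite ge_max le_max lexx /= le_max; apply/orP; right.
  by rewrite le_min !ge_min xy lexx orbT.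
rewrite !ler0_norm ?subr_le0 // lerN2 /Num.max /Num.min.
by case: (ltP x a) => h1; case: (ltP y a) => h2; case: ltP => h3; case: ltP => h4; lra.
Qed.

Section Sectors.
Variable R : realType.
Implicit Types (X Y : R * R -> R * R) (p q z w : R * R) (U V S T : set (R * R))
  (I J : set R) (gam : R -> R * R) (s t : R).
Variables (X : R * R -> R * R) (p : R * R) (U V : set (R * R))
  (h k : R * R -> R * R).
Hypothesis XE : equivalence X p (@flow_box R) 0 U V h k.

Definition square (rho : R) := [set w : R * R | `|w.1| < rho /\ `|w.2| < rho].

Lemma near0_square (P : set (R * R)) : (\forall w \near (0 : R * R), P w) ->
  exists2 rho, 0 < rho & square rho `<=` P.
Proof.
move=> /nbhs_ballP[e /= e0 He]; exists e => // -[x y] [/= x1 y1]; apply: He.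
by split; rewrite /ball /= sub0r normrN.
Qed.

(** The homeomorphism of a sector followed by the flow box chart, on a square where both make sense.
    Continuity is relative to the closed sector, which is not a neighbourhood of 0. *)
Definition sector_map S Y T (rho : R) (phi : R * R -> R * R) :=
  let A := T `&` square rho in
  [/\ 0 < rho, phi 0 = 0,
      (forall w, A w -> V (phi w) /\ S (k (phi w))),
      (forall w w', A w -> A w' -> phi w = phi w' -> w = w') &
      (forall w, A w -> phi @ within A (nbhs w) --> phi w) /\
      carries_orbits Y A (@flow_box R) V phi].

Lemma sector_map_exists S Y T : T 0 -> locally_equivalent X S p Y T 0 ->
  exists rho phi, sector_map S Y T rho phi.
Proof.
move=> T0 [U' [V' [h' [k' [[[oU' U'p] [oV' V'0] hp' k0'] [[hS kS [kh hk] hc kc] c1 c2]]]]]].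
have [[oU Up] [oV V0] [hp hU] [k0 kV] [hcont kcont e1 e2]] := XE.
have A0 : (T `&` V') 0 by split.
have kc0 w : (T `&` V') w -> k' @ within (T `&` V') (nbhs w) --> k' w.
  by move=> Aw; move/subspace_continuousP: kc; apply.
have n1 : \forall w \near (0 : R * R), V' w /\ ((T `&` V') w -> U (k' w)).
  near=> w; split; first by near: w; exact: open_nbhs_nbhs.
  near: w; have := kc0 _ A0; rewrite k0' => /(_ U); apply.
  exact: open_nbhs_nbhs.
have [rho r0 Hr] := near0_square n1.
have AV w : (T `&` square rho) w -> (T `&` V') w /\ U (k' w).
  by move=> [Tw /Hr[Vw Uk]]; split; [split|apply: Uk; split].
exists rho, (h \o k'); split=> //=.
- by rewrite k0' hp.
- move=> w /AV[Aw Uw]; have [? ->] := hU _ Uw; split=> //.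
  by have [] : (S `&` U') (k' w) by apply: kS; exists w.
- move=> w w' /AV[Aw Uw] /AV[Aw' Uw'] /(congr1 k).
  have [_ ->] := hU _ Uw; have [_ ->] := hU _ Uw' => E.
  by rewrite -(hk w) // -(hk w') // E.
- split=> [w Aw|].
    have [Aw' Uw] := AV w Aw.
    have sub : within (T `&` square rho) (nbhs w) `=>` within (T `&` V') (nbhs w).
      move=> P HP; rewrite /within /= in HP *; apply: filterS HP => x HP Ax.
      by apply: HP; have [] := AV x Ax.
    have C1 : k' @ within (T `&` square rho) (nbhs w) --> k' w.
      by apply: cvg_trans (kc0 _ Aw'); apply: cvg_app; exact: sub.
    exact: (cvg_comp _ _ C1 (hcont _ Uw)).
  apply: (carries_orbits_comp (k' := k) c2 e1).
  + by move=> z /hU[].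
  + by move=> w /AV[].
  + by move=> z [].
Unshelve. all: by end_near. Qed.

Lemma flow_box_solution I gam : solution (@flow_box R) V I gam ->
  (forall t, I t -> gam t != 0) ->
  (forall s t, I s -> I t -> (gam s).2 = (gam t).2) /\
  (forall s t, I s -> I t -> s < t -> (gam s).1 < (gam t).1).
Proof.
move=> [oI iI gV gd] gn0.
have c2 x y : I x -> I y -> x <= y -> (gam x).2 = (gam y).2.
  move=> Ix Iy xy.
  have [|w _ /eqP] := @mvt R (fun t => (gam t).2) (fun=> 0) x y xy.
    by move=> w wxy; exact: is_derive_snd (gd w (is_interval_mem iI Ix Iy wxy)).
  by rewrite mul0r subr_eq0 => /eqP.
split=> s t Is It.
  by have [st|/ltW st] := leP s t; [exact: c2|symmetry; exact: c2].
move=> st; have sub (x : R) : s <= x <= t -> I x by exact: (is_interval_mem iI Is It).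
apply: (@derive_increasing R (fun t => (gam t).1) (fun t => (flow_box (gam t)).1) s t st) => x /sub Ix.
  exact: is_derive_fst (gd x Ix).
rewrite /= lt_def addr_ge0 ?sqr_ge0 // andbT paddr_eq0 ?sqr_ge0 // !sqrf_eq0.
by have := gn0 x Ix; rewrite {1}[gam x]surjective_pairing xpair_eqE.
Qed.

(** Injectivity keeps the image orbit away from 0. The change of time in [carries_orbits] is
    increasing and onto [I], so monotonicity passes back to the original time. *)
Lemma sector_orbit S Y T rho phi I gam : sector_map S Y T rho phi ->
  (T `&` square rho) 0 ->
  solution Y (T `&` square rho) I gam -> (forall t, I t -> gam t != 0) ->
  (forall s t, I s -> I t -> (phi (gam s)).2 = (phi (gam t)).2) /\
  (forall s t, I s -> I t -> s < t -> (phi (gam s)).1 < (phi (gam t)).1).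
Proof.
move=> [r0 p0 pV pinj [_ car]] A0 sol gn0.
have [J [tau [tJ tinc sol']]] := car I gam sol.
have It t : J t -> I (tau t) by move=> Jt; rewrite -tJ; exists t.
have [_ _ gA _] := sol.
have [t Jt|c2 c1] := flow_box_solution sol'.
  apply/eqP => /= E; have := gn0 _ (It _ Jt); case/eqP.
  by apply: pinj => //; [exact: gA (It _ Jt)|rewrite p0].
have tle : {in J &, {mono tau : x y / x <= y}} := increasing_inj_le tinc.
split=> s t; rewrite -{1 2}tJ => -[s' Js' <-] [t' Jt' <-]; first exact: c2.
move=> st; apply: c1 => //; rewrite ltNge -tle ?inE //.
by rewrite -ltNge.
Qed.

(** A homoclinic loop tends to 0 in both directions of time, whereas the abscissa of its image in
    the flow box strictly increases and would have to tend to 0 at both ends. *)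
Lemma not_elliptic_sector S : ~ elliptic_sector X p S.
Proof.
move=> ell; have T0 : [set z : R * R | 0 <= z.2] 0 by rewrite /= lexx.
have [rho [phi sm]] := sector_map_exists T0 ell.
have [r0 p0 pV pinj [pc car]] := sm.
pose T := [set z : R * R | 0 <= z.2].
have [c c0 cr] : exists2 c, 0 < c & c^-1 < rho.
  exists (2 / rho); first by rewrite divr_gt0.
  by rewrite invf_div ltr_pdivrMr // ltr_pMr // ltr1n.
(* This is -1 / (t + i c), the solution of z' = z^2 running along a circle of diameter 1/c through
   0; [c] is large enough for the circle to fit into the square. *)
pose z t : R * R := (- t / (t ^+ 2 + c ^+ 2), c / (t ^+ 2 + c ^+ 2)).
have q0 t : 0 < t ^+ 2 + c ^+ 2 by rewrite ltr_wpDl ?sqr_ge0 // exprn_gt0.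
have zb t : `|(z t).1| <= c^-1 /\ `|(z t).2| <= c^-1.
  rewrite /z /= !normrM !normfV (gtr0_norm (q0 t)) normrN (gtr0_norm c0).
  rewrite !ler_pdivrMr // -(real_normK (num_real t)).
  have -> : c^-1 * (`|t| ^+ 2 + c ^+ 2) = `|t| ^+ 2 / c + c by field; rewrite gt_eqF.
  have : 0 <= `|t| ^+ 2 / c by rewrite divr_ge0 ?sqr_ge0 ?ltW.
  split; last by lra.
  have : 0 <= (`|t| - c) ^+ 2 / c by rewrite divr_ge0 ?sqr_ge0 ?ltW.
  have -> : (`|t| - c) ^+ 2 / c = `|t| ^+ 2 / c - 2 * `|t| + c by field; rewrite gt_eqF.
  by have := normr_ge0 t; lra.
have zA t : (T `&` square rho) (z t).
  have [b1 b2] := zb t; split; first by rewrite /T /= divr_ge0 // ltW.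
  by split; [exact: le_lt_trans b1 cr|exact: le_lt_trans b2 cr].
have zn0 t : z t != 0.
  by rewrite xpair_eqE negb_and [X in _ || X]mulf_neq0 ?orbT ?invr_eq0 ?gt_eqF.
have qd t : is_derive t 1 (fun t => t ^+ 2 + c ^+ 2) (2 * t).
  have D := is_deriveD (is_deriveX 2 (is_derive_id t (1 : R))) (is_derive_cst (c ^+ 2) t (1 : R)).
  by apply: (is_derive_eq D); rewrite /GRing.scale /= expr1 mulr1 addr0.
have zd t : is_derive t 1 z ((z t).1 ^+ 2 - (z t).2 ^+ 2, 2 * (z t).1 * (z t).2).
  apply: is_derive_pair.
    have Dn : is_derive t 1 (fun t : R => - t) (- 1) := is_deriveN (is_derive_id t (1 : R)).
    have D := is_deriveM Dn (@is_deriveV R (fun t => t ^+ 2 + c ^+ 2) t _ 1 (lt0r_neq0 (q0 t)) (qd t)).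
    apply: (is_derive_eq D); rewrite /GRing.scale /z /=; field.
    by rewrite gt_eqF.
  have D := is_deriveM (is_derive_cst c t (1 : R)) (@is_deriveV R (fun t => t ^+ 2 + c ^+ 2) t _ 1 (lt0r_neq0 (q0 t)) (qd t)).
  apply: (is_derive_eq D); rewrite /GRing.scale /z /= ; field.
  by rewrite gt_eqF.
have sol : solution (fun z => (z.1 ^+ 2 - z.2 ^+ 2, 2 * z.1 * z.2)) (T `&` square rho) setT z.
  by split; [exact: openT|move=> ? ? ? ? ? ?|move=> t _; exact: zA|move=> t _; exact: zd].
have A0 : (T `&` square rho) 0 by split; [rewrite /T /= lexx|split; rewrite /= normr0].
have [_ inc] := sector_orbit sm A0 sol (fun t _ => zn0 t).
pose f t := (phi (z t)).1.
have finc s t : s < t -> f s < f t by exact: inc.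
(* If |f| < e near both ends of time, monotonicity gives -e < f 0 and f 1 < e, which contradicts f 1
   - f 0 = 2 e. *)
pose e := (f 1 - f 0) / 2.
have e0 : 0 < e by rewrite divr_gt0 // subr_gt0 finc.
have [eta eta0 Heta] : exists2 eta, 0 < eta & forall w, T w -> square eta w -> `|(phi w).1| < e.
  have n1 : \forall w \near (0 : R * R), (T `&` square rho) w -> `|(phi w).1| < e.
    have := pc _ A0; rewrite p0 => /(_ [set w | `|w.1| < e]); apply.
    have nb : \forall x \near (0 : R), `|x| < e.
      by apply/nbhs_ballP; exists e => // x; rewrite /ball /= sub0r normrN.
    exact: (near_fst 0 nb).
  have [eta et0 He] := near0_square n1.
  exists (Num.min eta rho); first by rewrite lt_min et0 r0.
  move=> w Tw [w1 w2]; rewrite !lt_min in w1 w2.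
  move: w1 w2 => /andP[w1 w1'] /andP[w2 w2'].
  by apply: He; split.
pose M := c / eta + 1 / eta + 1.
have M0 : 0 < M by rewrite ltr_wpDl // addr_ge0 // divr_ge0 // ltW.
have far t : M <= `|t| -> `|f t| < e.
  move=> Mt; apply: Heta; first by have [] := zA t.
  have t0 : 0 < `|t| by apply: lt_le_trans Mt.
  have h1 : 1 < `|t| * eta.
    apply: lt_le_trans (_ : M * eta <= _); last by rewrite ler_wpM2r // ltW.
    rewrite /M !mulrDl !divfK ?gt_eqF // mul1r; have := c0; lra.
  have h2 : c < `|t| * eta.
    apply: lt_le_trans (_ : M * eta <= _); last by rewrite ler_wpM2r // ltW.
    rewrite /M !mulrDl !divfK ?gt_eqF // mul1r; lra.
  have h3 : 1 <= `|t|.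
    apply: le_trans Mt; rewrite /M lerDr addr_ge0 // divr_ge0 // ltW //.
  rewrite /square /z /= !normrM !normfV (gtr0_norm (q0 t)) normrN (gtr0_norm c0).
  rewrite !ltr_pdivrMr // -(real_normK (num_real t)).
  have h4 : 0 <= eta * c ^+ 2 by rewrite mulr_ge0 ?sqr_ge0 // ltW.
  move: h1 h2 h3 h4 t0; set u := `|t| => h1 h2 h3 h4 t0.
  split.
    have : u * 1 < u * (u * eta) by rewrite ltr_pM2l.
    rewrite mulr1 expr2; lra.
  have : u * eta * 1 <= u * eta * u by rewrite ler_wpM2l // mulr_ge0 ?(ltW t0) ?(ltW eta0).
  rewrite mulr1 expr2; lra.
have f1 : f 1 < e.
  have h1 : M <= `|M + 1| by rewrite gtr0_norm; lra.
  apply: lt_trans (le_lt_trans (ler_norm _) (far _ h1)); apply: finc; lra.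
have f0 : - e < f 0.
  have h1 : M <= `|- M| by rewrite normrN gtr0_norm.
  have := far (- M) h1.
  rewrite ltr_norml => /andP[+ _]; move/lt_trans; apply; apply: finc.
  by rewrite oppr_lt0.
by move: f1 f0; rewrite /e; lra.
Qed.

Lemma elliptic_type_flow_box : ~ elliptic_type X p.
Proof. by move=> [S [_ /not_elliptic_sector]]. Qed.

(** Orbits on the positive half-axis of the flow box stay on it, hence in the half-plane where the
    linear form [l] based at p is positive. Their polar angle cannot turn by pi. *)
Lemma focus_type_flow_box (l : R * R) :
  (forall s, 0 < s -> V (s, 0) ->
     0 < l.1 * ((k (s, 0)).1 - p.1) + l.2 * ((k (s, 0)).2 - p.2)) ->
  ~ focus_type X p.
Proof.
have [[oU Up] [oV V0] [hp hU] [k0 kV] [hcont kcont e1 e2]] := XE.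
move=> lpos /(_ U (open_nbhs_nbhs (conj oU Up))) nearp.
have [s s0 [Vs Hs]] : exists2 s, 0 < s & V (s, 0) /\ (k (s, 0) != p ->
    exists (I : set R) (gam : R -> R * R) (theta : R -> R),
      [/\ solution X (U `\ p) I gam, exists2 t, I t & gam t = k (s, 0),
          {within I, continuous theta},
          forall t, I t -> exists2 r : R, 0 < r &
            gam t = p + (r * cos (theta t), r * sin (theta t)) &
          forall M : R, exists2 t, I t & M < `|theta t|]).
  have n1 : \forall w \near (0 : R * R), V w /\ (k w != p ->
    exists (I : set R) (gam : R -> R * R) (theta : R -> R),
      [/\ solution X (U `\ p) I gam, exists2 t, I t & gam t = k w,
          {within I, continuous theta},
          forall t, I t -> exists2 r : R, 0 < r &
            gam t = p + (r * cos (theta t), r * sin (theta t)) &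
          forall M : R, exists2 t, I t & M < `|theta t|]).
    near=> w; split; first by near: w; exact: open_nbhs_nbhs.
    near: w; have kc : k @ nbhs (0 : R * R) --> p by rewrite -k0; exact: kcont.
    exact: (kc _ nearp).
  have [rho r0 Hr] := near0_square n1.
  exists (rho / 2); first by rewrite divr_gt0.
  apply: Hr; split; rewrite /= ?normr0 // gtr0_norm ?divr_gt0 //.
  by rewrite ltr_pdivrMr // ltr_pMr // ltr1n.
have kp : k (s, 0) != p.
  apply/eqP => E; have [_] := kV _ Vs; rewrite E hp => -[] /esym /eqP.
  by rewrite gt_eqF.
have [I [gam [theta [sol [t0 It0 gt0] tc pol unb]]]] := Hs kp.
have [oI iI gU gd] := sol.
have solU : solution X U I gam by split=> // t /gU[].
have [J [tau [tJ tinc sol']]] := e1 I gam solU.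
have It t : J t -> I (tau t) by move=> Jt; rewrite -tJ; exists t.
have gn0 t : J t -> (h \o gam \o tau) t != 0.
  move=> Jt; have [Ut np] := gU _ (It _ Jt); apply/eqP => /= E; apply: np.
  by have [_ <-] := hU _ Ut; rewrite E k0.
have [g2 g1] := flow_box_solution sol' gn0.
have [_ iJ gV' gd'] := sol'.
have [s1 Js1 ts1] : exists2 s1, J s1 & tau s1 = t0.
  by have : (tau @` J) t0 by [rewrite tJ]; move=> [s1 Js1 E]; exists s1.
have hs1 : (h \o gam \o tau) s1 = (s, 0) by rewrite /= ts1 gt0; have [] := kV _ Vs.
have g20 t : J t -> ((h \o gam \o tau) t).2 = 0 by move=> Jt; rewrite (g2 t s1) // hs1.
have g10 t : J t -> 0 < ((h \o gam \o tau) t).1.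
  move=> Jt; rewrite ltNge; apply/negP => tneg.
  pose g t := ((h \o gam \o tau) t).1.
  have ts : t <= s1.
    rewrite leNgt; apply/negP => /(g1 _ _ Js1 Jt); rewrite hs1 /= => st.
    by move: (lt_le_trans st tneg); rewrite ltNge (ltW s0).
  have [| |u] := @IVT R g t s1 0 ts.
  - apply: continuous_itv => u hu; apply: is_derive_continuous (is_derive_fst (gd' u _)).
    exact: (is_interval_mem iJ Jt Js1).
  - by rewrite ge_min le_max tneg /g hs1 /= (ltW s0) orbT.
  - rewrite in_itv /= => hu gu; have Ju := is_interval_mem iJ Jt Js1 hu.
    have /eqP := gn0 u Ju; apply; rewrite [LHS]surjective_pairing g20 //.
    by rewrite -/(g u) gu.
have ang t : I t -> 0 < l.1 * cos (theta t) + l.2 * sin (theta t).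
  rewrite -{1}tJ => -[t' Jt' <-]; have It' := It _ Jt'.
  have [Ut _] := gU _ It'; have [Vt kt] := hU _ Ut.
  have hE : h (gam (tau t')) = (((h \o gam \o tau) t').1, 0).
    by rewrite -(g20 t' Jt') -surjective_pairing.
  have := lpos _ (g10 _ Jt'); rewrite -hE => /(_ Vt); rewrite kt.
  have [r r0 ->] := pol _ It'; rewrite /= [p.1 + _]addrC [p.2 + _]addrC !addrK.
  have -> : l.1 * (r * cos (theta (tau t'))) + l.2 * (r * sin (theta (tau t'))) =
    r * (l.1 * cos (theta (tau t')) + l.2 * sin (theta (tau t'))) by ring.
  by rewrite pmulr_rgt0.
(* A variation of pi would pass, by the intermediate value theorem, through the direction opposite
   to the initial one, where the linear form has the opposite sign. *)
have bnd t : I t -> `|theta t - theta t0| < pi.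
  move=> Itt; rewrite ltNge; apply/negP => far.
  have [v vpi [a [b [Ia [Ib [ab vb]]]]]] : exists2 v, v = theta t0 + pi \/ v = theta t0 - pi &
      exists a b, I a /\ I b /\ a <= b /\
        Num.min (theta a) (theta b) <= v <= Num.max (theta a) (theta b).
    have pi0 := pi_gt0 R.
    have [v [vpi vb]] : exists v, (v = theta t0 + pi \/ v = theta t0 - pi) /\
        Num.min (theta t0) (theta t) <= v <= Num.max (theta t0) (theta t).
      move: far; rewrite ler_normr => /orP[far|far].
        exists (theta t0 + pi); split; first by left.
        by rewrite ge_min le_max; apply/andP; split; apply/orP; [left|right]; lra.
      exists (theta t0 - pi); split; first by right.
      by rewrite ge_min le_max; apply/andP; split; apply/orP; [right|left]; lra.
    exists v => //; have [h1|/ltW h1] := leP t0 t; first by exists t0, t.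
    by exists t, t0; rewrite minC maxC.
  have [|u] := @IVT R theta a b v ab _ vb.
    apply: continuous_subspaceW tc => u; rewrite /= in_itv /=.
    exact: (is_interval_mem iI Ia Ib).
  rewrite in_itv /= => hu uv; have Iu := is_interval_mem iI Ia Ib hu.
  have := ang _ Iu; have := ang _ It0; rewrite uv.
  have cB x : cos (x - pi) = - cos x by rewrite -[in RHS](subrK pi x) cosDpi opprK.
  have sB x : sin (x - pi) = - sin x by rewrite -[in RHS](subrK pi x) sinDpi opprK.
  by case: vpi => ->; rewrite ?cosDpi ?sinDpi ?cB ?sB; lra.
have [t Itt] := unb (`|theta t0| + pi).
have := bnd t Itt; have := ler_normD (theta t - theta t0) (theta t0); rewrite subrK.
by lra.
Unshelve. all: by end_near. Qed.

(* A hyperbolic sector contains, on one of its two sides, a neighbourhood of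
   every point of the unstable separatrix of the flow box that is close to 0. *)
Lemma hyperbolic_sector_rectangle S : hyperbolic_sector X p S ->
  exists2 a, 0 < a & forall s0, 0 < s0 < a -> exists eta e0 : R,
    [/\ 0 < eta, e0 != 0 & forall s e, `|s - s0| <= eta ->
       Num.min 0 e0 <= e <= Num.max 0 e0 -> V (s, e) /\ S (k (s, e))].
Proof.
move=> hyp; have T0 : [set z : R * R | 0 <= z.1 /\ 0 <= z.2] 0 by rewrite /= lexx.
have [rho [phi sm]] := sector_map_exists T0 hyp.
have [r0 p0 pV pinj [pc car]] := sm.
set A := _ `&` _ in pV pinj pc car.
have A0 : A 0 by split=> //; split; rewrite /= normr0.
have AE x y : A (x, y) <-> [/\ 0 <= x, 0 <= y, x < rho & y < rho].
  split=> [[[/= x0 y0] [/= xr yr]]|[x0 y0 xr yr]].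
    by rewrite ger0_norm in xr; rewrite ?ger0_norm in yr.
  by split; split=> //=; rewrite ger0_norm.
have orb (I : set R) x y : open I -> is_interval I -> (forall t, I t -> A (x * expR t, y * expR (- t))) ->
    solution (fun z : R * R => (z.1, - z.2)) A I (fun t => (x * expR t, y * expR (- t))).
  move=> oI iI IA; split=> // t It.
  have D1 : is_derive t 1 (fun t => x * expR t) (x * expR t).
    have D := is_deriveM (is_derive_cst x t (1 : R)) (is_derive_expR t).
    by apply: (is_derive_eq D); rewrite /GRing.scale /= mulr0 addr0.
  have D2 : is_derive t 1 (fun t => y * expR (- t)) (- (y * expR (- t))).
    have D := is_deriveM (is_derive_cst y t (1 : R))
      (is_derive1_comp (is_derive_expR (- t)) (is_deriveN (is_derive_id t (1 : R)))).
    by apply: (is_derive_eq D); rewrite /GRing.scale /= mulr0 addr0 mulrN1 mulrN.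
  exact: is_derive_pair D1 D2.
pose c := rho / 2; have c0 : 0 < c by rewrite divr_gt0.
have cr : c < rho by rewrite ltr_pdivrMr // ltr_pMr // ltr1n.
pose I0 := [set t : R | t < 0].
have oI0 : open I0 by exact: open_lt.
have iI0 : is_interval I0 by move=> x y _ /= y0 z /andP[_ zy]; rewrite /I0 /= (le_lt_trans zy).
have axA t : I0 t -> A (c * expR t, 0 * expR (- t)).
  move=> t0; rewrite mul0r; apply/AE; split=> //; first by rewrite mulr_ge0 ?expR_ge0 ?ltW.
  by apply: le_lt_trans cr; rewrite ler_piMr ?(ltW c0) // -expR0 ler_expR ltW.
have axn0 t : I0 t -> (c * expR t, 0 * expR (- t)) != 0 :> R * R.
  by move=> _; rewrite xpair_eqE negb_and mulf_neq0 // gt_eqF ?expR_gt0.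
have [ax2 ax1] := sector_orbit sm A0 (orb _ _ _ oI0 iI0 axA) axn0.
have Ax x : 0 <= x < c -> A (x, 0).
  by move=> /andP[x0 xc]; apply/AE; split=> //; exact: lt_trans cr.
have logE x : 0 < x < c -> exists2 t, I0 t & x = c * expR t.
  move=> /andP[x0 xc]; exists (ln (x / c)).
    by rewrite /I0 /= ln_lt0 // divr_gt0 //= ltr_pdivrMr // mul1r.
  by rewrite lnK ?posrE ?divr_gt0 // mulrC divfK // gt_eqF.
pose psi x := (phi (x, 0)).1.
have psi_inc x y : 0 < x -> x < y -> y < c -> psi x < psi y.
  move=> x0 xy yc; have [|t It xt] := logE x; first by rewrite x0 (lt_trans xy).
  have [|u Iu yu] := logE y; first by rewrite (lt_trans x0).
  have tu : t < u by rewrite -ltr_expR -(ltr_pM2l c0) -xt -yu.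
  by have := ax1 _ _ It Iu tu; rewrite -xt -yu !mul0r.
have phic w (P : set (R * R)) : A w -> nbhs (phi w) P -> \forall w' \near w, A w' -> P (phi w').
  by move=> Aw HP; have := pc w Aw _ HP.
have nb2 (a b e : R) : 0 < e -> nbhs (a, b) [set w : R * R | `|w.1 - a| < e /\ `|w.2 - b| < e].
  move=> e0; apply/nbhs_ballP; exists e => // -[x y] [/= h1 h2].
  by rewrite /ball /= in h1 h2; rewrite distrC; split; rewrite // distrC.
have near_axis (w : R * R) (e : R) : A w -> 0 < e -> exists2 r, 0 < r & forall w', A w' ->
    `|w'.1 - w.1| < r -> `|w'.2 - w.2| < r -> `|(phi w').1 - (phi w).1| < e /\ `|(phi w').2 - (phi w).2| < e.
  move=> Aw e0; have := phic w [set v | `|v.1 - (phi w).1| < e /\ `|v.2 - (phi w).2| < e] Aw.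
  have := nb2 (phi w).1 (phi w).2 e e0; rewrite -surjective_pairing => hh /(_ hh).
  move=> /nbhs_ballP[r /= rr Hr]; exists r => // w' Aw' h1 h2; apply: Hr => //.
  by split; rewrite /ball /= distrC.
(* The positive axis of the saddle is a single orbit ending at 0 in the past: the height of its
   image is constant and tends to that of [phi 0]. *)
have psi2 x : 0 < x < c -> (phi (x, 0)).2 = 0.
  move=> xc; apply/eqP; rewrite -normr_le0; apply/ler_addgt0Pr => e e0; rewrite add0r.
  have [r rr Hr] := near_axis 0 e A0 e0.
  pose y := Num.min (r / 2) (x / 2); have /andP[x0 xc'] := xc.
  have y0 : 0 < y by rewrite lt_min !divr_gt0.
  have yr : y < r by rewrite gt_min ltr_pdivrMr // ltr_pMr // ltr1n.
  have yc : y < c by apply: lt_trans xc'; rewrite gt_min orbC ltr_pdivrMr // ltr_pMr // ltr1n.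
  have [|t It xt] := logE x; first by [].
  have [|u Iu yu] := logE y; first by rewrite y0.
  have := ax2 _ _ It Iu; rewrite -xt -yu !mul0r => ->.
  have [|||_] := Hr (y, 0); first by apply: Ax; rewrite ltW.
  - by rewrite /= subr0 gtr0_norm.
  - by rewrite /= subrr normr0.
  - by rewrite p0 /= subr0 => /ltW.
have psi_pos x : 0 < x < c -> 0 < psi x.
  move=> /andP[x0 xc].
  have x2 : 0 < x / 2 by rewrite divr_gt0.
  have x2x : x / 2 < x by rewrite ltr_pdivrMr // ltr_pMr // ltr1n.
  apply: le_lt_trans (psi_inc _ _ x2 x2x xc).
  rewrite -oppr_le0; apply/ler_addgt0Pr => e e0; rewrite add0r.
  have [r rr Hr] := near_axis 0 e A0 e0.
  pose y := Num.min (r / 2) (x / 4).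
  have y0 : 0 < y by rewrite lt_min !divr_gt0.
  have yr : y < r by rewrite gt_min ltr_pdivrMr // ltr_pMr // ltr1n.
  have yx : y < x / 2.
    by rewrite gt_min; apply/orP; right; lra.
  have [|||hh _] := Hr (y, 0); first by apply: Ax; rewrite ltW //= (lt_trans yx) // (lt_trans x2x).
  - by rewrite /= subr0 gtr0_norm.
  - by rewrite /= subrr normr0.
  have := psi_inc _ _ y0 yx (lt_trans x2x xc); rewrite p0 /= subr0 -/(psi y) in hh.
  by have := ler_norm (- psi y); rewrite normrN; lra.
have psic x : 0 < x < c -> {for x, continuous psi}.
  move=> /andP[x0 xc]; apply/cvgrPdist_lt => e e0.
  have [|r rr Hr] := near_axis (x, 0) e _ e0; first by apply: Ax; rewrite ltW.
  near=> y; rewrite distrC; have [|||//] := Hr (y, 0).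
  - apply: Ax; apply/andP; split; first by apply: ltW; near: y; exact: lt_nbhsr.
    by near: y; exact: lt_nbhsl.
  - by rewrite /= distrC; near: y; apply: cvgr_dist_lt => //; exact: cvg_id.
  - by rewrite /= subrr normr0.
pose xm := c / 2; have xmc : 0 < xm < c by rewrite /xm; apply/andP; split; lra.
exists (psi xm); first exact: psi_pos.
move=> s0 /andP[s00 s0m].
(* The point of the separatrix at abscissa [s0], and one on each side of it. *)
have [x0 x0c x0s] : exists2 x0, 0 < x0 < xm & psi x0 = s0.
  have [r rr Hr] := near_axis 0 s0 A0 s00.
  pose y := Num.min (r / 2) (xm / 2); have /andP[xm0 _] := xmc.
  have y0 : 0 < y by rewrite lt_min !divr_gt0.
  have yr : y < r by rewrite gt_min ltr_pdivrMr // ltr_pMr // ltr1n.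
  have ym : y < xm by rewrite gt_min orbC ltr_pdivrMr // ltr_pMr // ltr1n.
  have [|||hh _] := Hr (y, 0).
  - by apply: Ax; rewrite ltW //= (lt_trans ym) //; case/andP: xmc.
  - by rewrite /= subr0 gtr0_norm.
  - by rewrite /= subrr normr0.
  rewrite p0 /= subr0 -/(psi y) in hh.
  have ys : psi y < s0 by apply: le_lt_trans hh; exact: ler_norm.
  have [| |x] := @IVT R psi y xm s0 (ltW ym).
  - apply: continuous_itv => x /andP[x1 x2]; apply: psic.
    by rewrite (lt_le_trans y0) //= (le_lt_trans x2) //; case/andP: xmc.
  - by rewrite ge_min le_max (ltW ys) (ltW s0m) orbT.
  - rewrite in_itv /= => /andP[x1 x2] E; exists x => //.
    rewrite (lt_le_trans y0) //= lt_neqAle x2 andbT; apply/eqP => xE.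
    by rewrite -E xE ltxx in s0m.
have /andP[x00 x0m] := x0c; have /andP[xm0 xm1] := xmc.
have x0c' : 0 < x0 < c by rewrite x00 (lt_trans x0m).
pose xl := x0 / 2; pose xr := c - (c - xm) / 2.
have xl0 : 0 < xl by rewrite /xl; lra.
have xlx : xl < x0 by rewrite /xl; lra.
have xl2 : xl / 2 < xl by lra.
have xrx : x0 < xr by rewrite /xr; lra.
have xrc : xr < c by rewrite /xr; lra.
(* The division by 2 keeps a margin [eta] at each end, to be spent when the axis is replaced by
   nearby hyperbolas. *)
pose eta := Num.min (s0 - psi xl) (psi xr - s0) / 2.
have m1 : psi xl < s0 by rewrite -x0s; apply: psi_inc => //; case/andP: x0c'.
have m2 : s0 < psi xr by rewrite -x0s; apply: psi_inc.
have eta0 : 0 < eta by rewrite divr_gt0 // lt_min !subr_gt0 m1 m2.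
have eta1 : 2 * eta <= s0 - psi xl by rewrite /eta mulrC divfK // ge_min lexx.
have eta2 : 2 * eta <= psi xr - s0 by rewrite /eta mulrC divfK // ge_min lexx orbT.
have Axl : A (xl, 0) by apply: Ax; rewrite ltW //= (lt_trans xlx) //; case/andP: x0c'.
have Axr : A (xr, 0) by apply: Ax; rewrite xrc ltW // (lt_trans x00).
have [rl rl0 Hl] := near_axis _ _ Axl eta0.
have [rr rr0 Hr] := near_axis _ _ Axr eta0.
(* The hyperbola [xy = q] between the abscissas [xl] and [xr]. *)
pose b1 := Num.min (Num.min rl rr) rho.
have b10 : 0 < b1 by rewrite !lt_min rl0 rr0 r0.
pose q1 := b1 * (xl / 4).
have q10 : 0 < q1 by rewrite mulr_gt0 // divr_gt0.
have qb (q x : R) : q <= q1 -> xl / 2 < x -> q / x < b1.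
  move=> qq xx; have x0' : 0 < x by apply: lt_trans xx; rewrite divr_gt0.
  rewrite ltr_pdivrMr //; apply: le_lt_trans qq _.
  by rewrite ltr_pM2l //; lra.
have qA (q x : R) : 0 <= q -> q <= q1 -> xl / 2 < x -> x < c -> A (x, q / x).
  move=> q0 qq xlx' xxr; have x0' : 0 < x by apply: lt_trans xlx'; rewrite divr_gt0.
  apply/AE; split; first exact: ltW.
  - by rewrite divr_ge0 // ltW.
  - exact: lt_trans cr.
  - by have := qb q x qq xlx'; rewrite lt_min => /andP[].
have qA' (q x : R) : 0 <= q -> q <= q1 -> xl <= x -> x <= xr -> A (x, q / x).
  move=> q0 qq lx xr'.
  by apply: qA => //; [exact: lt_le_trans lx|exact: le_lt_trans xrc].
(* The points of one hyperbola between [xl] and [xr] lie on one orbit of the saddle, parametrised by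
   (exp t, q exp (-t)), hence are sent to one height. *)
have hyper (q x y : R) : 0 <= q -> q <= q1 -> xl <= x -> x <= xr -> xl <= y -> y <= xr ->
    (phi (x, q / x)).2 = (phi (y, q / y)).2.
  move=> q0 qq lx xr' ly yr.
  pose I := [set t : R | xl / 2 < expR t /\ expR t < c].
  have oI : open I.
    have -> : I = (@expR R) @^-1` `]xl / 2, c[%classic.
      by apply/seteqP; split => t; rewrite /= in_itv /=; [move=> [-> ->]|move=> /andP].
    by apply: open_comp; [move=> t _; exact: continuous_expR|exact: interval_open].
  have iI : is_interval I.
    move=> t u [t1 _] [_ u2] v /andP[tv vu]; split.
      by apply: lt_le_trans t1 _; rewrite ler_expR.
    by apply: le_lt_trans u2; rewrite ler_expR.
  have E t : q * expR (- t) = q / expR t by rewrite expRN.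
  have IA t : I t -> A (1 * expR t, q * expR (- t)).
    by move=> [t1 t2]; rewrite mul1r E; apply: qA.
  have n0 t : I t -> (1 * expR t, q * expR (- t)) != 0 :> R * R.
    by move=> _; rewrite xpair_eqE negb_and mul1r gt_eqF ?expR_gt0.
  have [hy2 _] := sector_orbit sm A0 (orb _ _ _ oI iI IA) n0.
  have xp : 0 < x by apply: lt_le_trans lx.
  have yp : 0 < y by apply: lt_le_trans ly.
  have := hy2 (ln x) (ln y); rewrite !mul1r !E !lnK ?posrE //.
  by rewrite /I /= !lnK ?posrE //; apply; split; [exact: lt_le_trans lx|exact: le_lt_trans xrc|exact: lt_le_trans ly|exact: le_lt_trans xrc].
pose ep (q : R) := (phi (x0, q / x0)).2.
have fc (q x : R) : 0 <= q -> q <= q1 -> xl <= x -> x <= xr ->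
    {for x, continuous (fun x : R => (phi (x, q / x)).1)}.
  move=> q0 qq lx xr'; apply/cvgrPdist_lt => e e0.
  have xp : 0 < x by apply: lt_le_trans lx.
  have [|r rp Hw] := near_axis (x, q / x) e _ e0; first exact: qA'.
  have ic : {for x, continuous (fun x : R => q / x)}.
    by apply: continuousM; [exact: cst_continuous|apply: inv_continuous; rewrite gt_eqF].
  near=> y; rewrite distrC; have [|||//] := Hw (y, q / y).
  - apply: qA => //; near: y.
      by apply: lt_nbhsr; exact: lt_le_trans lx.
    by apply: lt_nbhsl; exact: le_lt_trans xrc.
  - by rewrite /= distrC; near: y; apply: cvgr_dist_lt => //; exact: cvg_id.
  - by rewrite /= distrC; near: y; apply: cvgr_dist_lt.
have xlr : xl <= xr by rewrite ltW // (lt_trans xlx).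
(* Along the hyperbola of parameter [q] the abscissa of the image starts below psi xl + eta and ends
   above psi xr - eta, so it takes every value within [eta] of [s0]. *)
have cover (q s : R) : 0 <= q -> q <= q1 -> `|s - s0| <= eta ->
    exists2 x, xl <= x <= xr & phi (x, q / x) = (s, ep q).
  move=> q0 qq; rewrite ler_norml => /andP[sl sr].
  have qbx x : xl <= x -> `|q / x| < b1.
    move=> lx; rewrite ger0_norm; first by apply: qb => //; exact: lt_le_trans lx.
    by rewrite divr_ge0 // ltW // (lt_le_trans xl0).
  have el : (phi (xl, q / xl)).1 < psi xl + eta.
    have [|||] := Hl (xl, q / xl); first by apply: qA'.
    - by rewrite /= subrr normr0.
    - by rewrite /= subr0; have := qbx xl (lexx _); rewrite !lt_min => /andP[/andP[]].
    by rewrite -/(psi xl) ltr_norml => /andP[_]; rewrite ltrBlDl.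
  have er : psi xr - eta < (phi (xr, q / xr)).1.
    have [|||] := Hr (xr, q / xr); first by apply: qA'.
    - by rewrite /= subrr normr0.
    - rewrite /= subr0; have := qbx xr (ltW (lt_trans xlx xrx)).
      by rewrite !lt_min => /andP[/andP[]].
    by rewrite -/(psi xr) ltr_norml => /andP[+ _]; rewrite ltrBrDr addrC.
  have sl1 : psi xl + eta <= s by move: eta1 sl; clear; lra.
  have sr1 : s <= psi xr - eta by move: eta2 sr; clear; lra.
  have [| |x] := @IVT R (fun x : R => (phi (x, q / x)).1) xl xr s xlr.
  - by apply: continuous_itv => x /andP[x1 x2]; exact: fc.
  - by rewrite ge_min le_max (ltW (lt_le_trans el sl1)) (ltW (le_lt_trans sr1 er)) orbT.
  - rewrite in_itv /= => /andP[x1 x2] E; exists x; first by rewrite x1.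
    rewrite [LHS]surjective_pairing E (hyper q x x0) // ltW //.
(* Two hyperbolas of the same height would both pass through the point of abscissa [s0] at that
   height, against the injectivity of [phi]. *)
have ep_inj (q q' : R) : 0 <= q -> q <= q1 -> 0 <= q' -> q' <= q1 -> ep q = ep q' -> q = q'.
  move=> qp qq qp' qq' E.
  have s0s : `|s0 - s0| <= eta by rewrite subrr normr0 ltW.
  have [x /andP[x1 x2] Ex] := cover q s0 qp qq s0s.
  have [x' /andP[x1' x2'] Ex'] := cover q' s0 qp' qq' s0s.
  have [E1 E2] : (x, q / x) = (x', q' / x').
    by apply: pinj; [exact: qA'|exact: qA'|rewrite Ex Ex' E].
  have xp : 0 < x := lt_le_trans xl0 x1.
  by rewrite -(divfK (lt0r_neq0 xp) q) E2 E1 divfK // -E1 gt_eqF.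
have ep0 : ep 0 = 0 by rewrite /ep mul0r; apply: psi2.
(* Clamping extends [ep] continuously to all real parameters, so that the endpoints 0 and [q1] are
   treated as interior points in the intermediate value theorem. *)
pose cl (q : R) := Num.max 0 (Num.min q q1).
have clE (q : R) : 0 <= q -> q <= q1 -> cl q = q.
  by move=> h1 h2; rewrite /cl (min_idPl h2) (max_idPr h1).
have cl1 (q : R) : 0 <= cl q <= q1.
  by rewrite /cl le_max lexx /= ge_max ge_min lexx orbT (ltW q10).
have cl2 (q q' : R) : `|cl q - cl q'| <= `|q - q'|.
  exact: clamp_dist (ltW q10).
have epc (q : R) : {for q, continuous (fun q : R => ep (cl q))}.
  apply/cvgrPdist_lt => e e0; have /andP[c1 c2] := cl1 q.
  have [|r rp Hw] := near_axis (x0, cl q / x0) e _ e0; first by apply: qA' => //; exact: ltW.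
  near=> y; rewrite distrC; have /andP[c3 c4] := cl1 y.
  have [|||//] := Hw (x0, cl y / x0).
  - by apply: qA' => //; exact: ltW.
  - by rewrite /= subrr normr0.
  - rewrite /= -mulrBl normrM normfV (gtr0_norm x00) ltr_pdivrMr //.
    apply: le_lt_trans (cl2 _ _) _; rewrite distrC; near: y.
    by apply: cvgr_dist_lt; [exact: cvg_id|exact: mulr_gt0].
exists eta, (ep q1); split=> //.
  apply/eqP => E; have := ep_inj 0 q1 (lexx _) (ltW q10) (ltW q10) (lexx _).
  by rewrite ep0 E => /(_ erefl) q1e; rewrite q1e ltxx in q10.
move=> s e ss ee.
have [| |q] := @IVT R (fun q : R => ep (cl q)) 0 q1 e (ltW q10).
- by apply: continuous_itv => q _; exact: epc.
- by rewrite !clE ?lexx ?(ltW q10) // ep0.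
rewrite in_itv /= => /andP[qp qq]; rewrite clE // => qe.
have [x /andP[x1' x2'] Ex] := cover q s qp qq ss.
by rewrite -qe -Ex; apply: pV; exact: qA'.
Unshelve. all: by end_near. Qed.

(** Every hyperbolic sector occupies one of the two sides of the positive half-axis near a given
    point of it. Among three sectors two occupy the same side, and their interiors meet. *)
Lemma saddle_type_flow_box : ~ saddle_type X p.
Proof.
have [[oU Up] [oV V0] [hp hU] [k0 kV] [hcont kcont e1 e2]] := XE.
move=> [S [[triv _] Shyp]].
have /choice[a Ha] : forall i, exists a, 0 < a /\ forall s0, 0 < s0 < a -> exists eta e0 : R,
    [/\ 0 < eta, e0 != 0 & forall s e, `|s - s0| <= eta ->
       Num.min 0 e0 <= e <= Num.max 0 e0 -> V (s, e) /\ S i (k (s, e))].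
  by move=> i; have [a a0 Ha] := hyperbolic_sector_rectangle (Shyp i); exists a.
pose s0 := Num.min (Num.min (a 0) (a 1)) (a 2) / 2.
have a0 i : 0 < a i by have [] := Ha i.
have m0 : 0 < Num.min (Num.min (a 0) (a 1)) (a 2) by rewrite !lt_min !a0.
have s00 : 0 < s0 by rewrite divr_gt0.
have s0m : s0 < Num.min (Num.min (a 0) (a 1)) (a 2).
  by rewrite /s0 ltr_pdivrMr // ltr_pMr // ltr1n.
move: (s0m); rewrite !lt_min => /andP[/andP[sa0 sa1] sa2].
have rect i : s0 < a i -> exists eta e0 : R,
    [/\ 0 < eta, e0 != 0 & forall s e, `|s - s0| <= eta ->
       Num.min 0 e0 <= e <= Num.max 0 e0 -> V (s, e) /\ S i (k (s, e))].
  by move=> si; have [_] := Ha i; apply; rewrite s00.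
(* When [e0] and [e0'] have the same sign, both rectangles contain the open set [Q], whose preimage
   under the chart lies in both sectors. *)
have clash i j eta e0 eta' e0' : i != j -> 0 < eta -> 0 < eta' -> 0 < e0 * e0' ->
   (forall s e, `|s - s0| <= eta ->
       Num.min 0 e0 <= e <= Num.max 0 e0 -> V (s, e) /\ S i (k (s, e))) ->
   (forall s e, `|s - s0| <= eta' ->
       Num.min 0 e0' <= e <= Num.max 0 e0' -> V (s, e) /\ S j (k (s, e))) -> False.
  move=> ij et0 et0' ee Hi Hj.
  pose Q := [set w : R * R | `|w.1 - s0| < Num.min eta eta' /\ (0 < w.2 * e0 /\ `|w.2| < Num.min `|e0| `|e0'|)].
  have e0n : e0 != 0 by apply/eqP => E; rewrite E mul0r ltxx in ee.
  have e0n' : e0' != 0 by apply/eqP => E; rewrite E mulr0 ltxx in ee.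
  have oQ : open Q.
    rewrite openE => w [w1 [w2 w3]].
    have c1 : {for w, continuous (fun v : R * R => `|v.1 - s0|)}.
      apply: (@continuous_comp _ _ _ (fun v : R * R => v.1 - s0) Num.Def.normr).
        by apply: continuousB; [exact: cvg_fst|exact: cst_continuous].
      exact: norm_continuous.
    have c2 : {for w, continuous (fun v : R * R => v.2 * e0)}.
      by apply: continuousM; [exact: cvg_snd|exact: cst_continuous].
    have c3 : {for w, continuous (fun v : R * R => `|v.2|)}.
      apply: (@continuous_comp _ _ _ (fun v : R * R => v.2) Num.Def.normr).
        exact: cvg_snd.
      exact: norm_continuous.
    near=> v; split; first by near: v; apply: (cvgr_lt _ c1); exact: w1.
    split; first by near: v; apply: (cvgr_gt _ c2); exact: w2.
    by near: v; apply: (cvgr_lt _ c3); exact: w3.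
  have bet (e x : R) : 0 < e * x -> `|e| < `|x| -> Num.min 0 x <= e <= Num.max 0 x.
    move=> ex lt; have [x0|x0] := leP 0 x.
      have x0' : 0 < x by rewrite lt_def x0 andbT; apply/eqP => E; rewrite E mulr0 ltxx in ex.
      rewrite pmulr_lgt0 // in ex; rewrite (gtr0_norm ex) (gtr0_norm x0') in lt.
      by rewrite !ltW.
    rewrite nmulr_lgt0 // in ex; rewrite (ltr0_norm ex) (ltr0_norm x0) ltrN2 in lt.
    by rewrite !ltW.
  have QS w : Q w -> V w /\ S i (k w) /\ S j (k w).
    case: w => s e [/=]; rewrite !lt_min => /andP[w1 w1'] [w2 /andP[w3 w3']].
    have w2' : 0 < e * e0'.
      have e02 : 0 < e0 ^+ 2 by rewrite lt_def sqr_ge0 sqrf_eq0 e0n.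
      rewrite -(pmulr_lgt0 _ e02).
      have -> : e * e0' * e0 ^+ 2 = (e * e0) * (e0 * e0') by ring.
      exact: mulr_gt0.
    have [? ?] := Hi s e (ltW w1) (bet _ _ w2 w3).
    by have [_ ?] := Hj s e (ltW w1') (bet _ _ w2' w3').
  pose W := U `&` h @^-1` Q.
  have oW : open W by apply: open_preimage.
  have WS z : W z -> S i z /\ S j z.
    by move=> [Uz /QS[_]]; have [_ ->] := hU _ Uz.
  pose t := Num.min `|e0| `|e0'| / 2.
  have t0 : 0 < Num.min `|e0| `|e0'| by rewrite lt_min !normr_gt0 e0n.
  pose e := Num.sg e0 * t.
  have Qq : Q (s0, e).
    split; rewrite /= ?subrr ?normr0 ?lt_min ?et0 //; split.
      by rewrite /e mulrAC -normrEsg mulr_gt0 ?normr_gt0 // divr_gt0.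
    rewrite -!lt_min /e normrM normr_sg e0n mul1r gtr0_norm ?divr_gt0 //.
    by rewrite /t ltr_pdivrMr // ltr_pMr // ltr1n.
  have [Vq _] := QS _ Qq; have [Uk hk] := kV _ Vq.
  have Wk : W (k (s0, e)) by split=> //=; rewrite hk.
  have /eqP := ij; apply; apply: triv => //; exists (k (s0, e)); split.
    by apply: filterS (open_nbhs_nbhs (conj oW Wk)) => z /WS[].
  by apply: filterS (open_nbhs_nbhs (conj oW Wk)) => z /WS[].
have [eta1 [f1 [et1 n1 H1]]] := rect 0 sa0.
have [eta2 [f2 [et2 n2 H2]]] := rect 1 sa1.
have [eta3 [f3 [et3 n3 H3]]] := rect 2 sa2.
have sgn x y : x != 0 -> y != 0 -> 0 < x * y \/ x * y < 0 :> R.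
  by move=> xn yn; apply/orP; rewrite orbC -neq_lt mulf_neq0.
have [s12|s12] := sgn _ _ n1 n2; first exact: (clash 0 1 eta1 f1 eta2 f2).
have [s13|s13] := sgn _ _ n1 n3; first exact: (clash 0 2 eta1 f1 eta3 f3).
apply: (clash 1 2 eta2 f2 eta3 f3) => //.
have f12 : 0 < f1 ^+ 2 by rewrite lt_def sqr_ge0 sqrf_eq0 n1.
rewrite -(pmulr_lgt0 _ f12).
have -> : f2 * f3 * f1 ^+ 2 = (f1 * f2) * (f1 * f3) by ring.
by rewrite nmulr_lgt0.
Unshelve. all: by end_near. Qed.

End Sectors.

(** * A flow box around a cusp *)

Section TwoVariables.
Variable R : realType.
Implicit Types (u s t x : R).

Lemma derive_increasing_open (f df : R -> R) (a b : R) : a < b ->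
  (forall x, a <= x <= b -> is_derive x 1 f (df x)) ->
  (forall x, a < x < b -> 0 < df x) -> f a < f b.
Proof.
move=> ab fd df0; have [| |c] := @MVT _ f df a b ab.
- by move=> x; rewrite in_itv /= => /andP[ax xb]; apply: fd; rewrite !ltW.
- by apply: continuous_itv => x /fd; apply: is_derive_continuous.
rewrite in_itv /= => cab E; by rewrite -subr_gt0 E mulr_gt0 ?df0 // subr_gt0.
Qed.

Lemma increasing_inverse (s l : R -> R) (I : set R) : open I -> is_interval I ->
  (forall t, I t -> is_derive t 1 s (l t)) -> (forall t, I t -> 0 < l t) ->
  exists tau : R -> R, [/\ open (s @` I), is_interval (s @` I),
    forall t, I t -> tau (s t) = t &
    forall x, (s @` I) x -> is_derive x 1 tau (l (tau x))^-1].
Proof.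
move=> oI iI sd l0.
have sI : {in I &, {homo s : x y / x < y}}.
  move=> x y; rewrite !inE => Ix Iy xy.
  have sub w : x <= w <= y -> I w by exact: (is_interval_mem iI Ix Iy).
  by apply: (derive_increasing xy) => w /sub; [exact: sd|exact: l0].
have sc t : I t -> {for t, continuous s} by move=> /sd; apply: is_derive_continuous.
have [oK iK] := increasing_image oI iI sc sI.
pose tau x := xget 0 [set t | I t /\ s t = x].
have tauE t : I t -> tau (s t) = t.
  move=> It; apply: xget_subset1 => // y z [Iy sy] [Iz sz].
  by apply: (increasing_inj sI); rewrite ?inE // sy.
exists tau; split=> // _ [t It <-]; rewrite tauE //.
apply: is_derive_inverse (sd t It) _; last by rewrite gt_eqF // l0.
- near=> y; apply: tauE; near: y; exact: open_nbhs_nbhs.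
- near=> y; apply: sc; near: y; exact: open_nbhs_nbhs.
Unshelve. all: by end_near. Qed.

Variables (F Fu Fs : R -> R -> R).
Hypothesis Fud : forall u s, is_derive u 1 (F^~ s) (Fu u s).
Hypothesis Fsd : forall u s, is_derive s 1 (F u) (Fs u s).

Lemma caratheodory2 u0 s0 :
  {for (u0, s0), continuous (fun z : R * R => Fu z.1 z.2)} ->
  exists (A : R * R -> R) (B : R -> R),
    [/\ {for (u0, s0), continuous A}, {for s0, continuous B},
        A (u0, s0) = Fu u0 s0, B s0 = Fs u0 s0 &
        forall u s, F u s - F u0 s0 = A (u, s) * (u - u0) + B s * (s - s0)].
Proof.
move=> Fuc; have /is_derive1_caratheodory[B [BE Bc Bs]] := Fsd u0 s0.
pose A (z : R * R) := if z.1 == u0 then Fu u0 z.2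
  else (F z.1 z.2 - F u0 z.2) / (z.1 - u0).
have AE u s : F u s - F u0 s = A (u, s) * (u - u0).
  rewrite /A /=; case: eqP => [->|/eqP un]; first by rewrite !subrr mulr0.
  by rewrite divfK // subr_eq0.
exists A, B; split=> //; first last.
- by move=> u s; rewrite -AE -BE; ring.
- by rewrite /A /= eqxx.
have mv u s : exists2 x, `|x - u0| <= `|u - u0| & A (u, s) = Fu x s.
  rewrite /A /=; case: eqP => [->|/eqP un]; first by exists u0.
  have [uu|uu] := leP u0 u.
    have [x xu E] := mvt uu (fun x _ => Fud x s).
    exists x; last by rewrite E mulfK // subr_eq0.
    by case/andP: xu => x1 x2; rewrite !ger0_norm ?subr_ge0 // lerD2r.
  have [x xu E] := mvt (ltW uu) (fun x _ => Fud x s).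
  exists x; last first.
    have -> : F u s - F u0 s = Fu x s * (u - u0) by rewrite -opprB E; ring.
    by rewrite mulfK // subr_eq0.
  by case/andP: xu => x1 x2; rewrite !ler0_norm ?subr_le0 ?(ltW uu) // lerN2 lerD2r.
have A0 : A (u0, s0) = Fu u0 s0 by rewrite /A /= eqxx.
apply/cvgrPdist_lt => e e0; rewrite A0.
move/cvgrPdist_lt: Fuc => /(_ e e0) /nbhs_ballP[r /= r0 Hr].
suff : \forall z \near (u0, s0), `|Fu u0 s0 - A z| < e by [].
apply/nbhs_ballP; exists r => // -[u s] [/= h1 h2].
have [x xu ->] := mv u s; apply: (Hr (x, s)); split=> //=.
by rewrite /ball /= distrC; apply: le_lt_trans xu _; rewrite distrC.
Qed.

Lemma derive_total (a b : R -> R) t da db :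
  {for (a t, b t), continuous (fun z : R * R => Fu z.1 z.2)} ->
  is_derive t 1 a da -> is_derive t 1 b db ->
  is_derive t 1 (fun t => F (a t) (b t)) (Fu (a t) (b t) * da + Fs (a t) (b t) * db).
Proof.
move=> /caratheodory2[A [B [Ac Bc A0 B0 E]]] ad bd.
have ac := is_derive_continuous ad; have bc := is_derive_continuous bd.
move: ad bd => /is_derive1_caratheodory[al [aE aC a0]] /is_derive1_caratheodory[be [bE bC b0]].
apply/is_derive1_caratheodory.
exists (fun x => A (a x, b x) * al x + B (b x) * be x); split.
- by move=> x; rewrite E aE bE; ring.
- apply: continuousD; apply: continuousM => //.
    apply: (@continuous_comp _ _ _ (fun x => (a x, b x)) A); last exact: Ac.
    exact: continuous_pair.
  by apply: (@continuous_comp _ _ _ b B).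
- by rewrite A0 B0 a0 b0.
Qed.

(** The Caratheodory identity is solved for the increment of [a], whose coefficient stays nonzero
    near [t] by continuity of [a]; differentiability of [a] is thus an output. *)
Lemma derive_implicit (a y : R -> R) t dy :
  {for (a t, t), continuous (fun z : R * R => Fu z.1 z.2)} -> Fu (a t) t != 0 ->
  {for t, continuous a} -> (\forall x \near t, F (a x) x = y x) ->
  is_derive t 1 y dy -> is_derive t 1 a ((dy - Fs (a t) t) / Fu (a t) t).
Proof.
move=> /caratheodory2[A [B [Ac Bc A0 B0 E]]] Fn ac Fy yd.
have {}yd : is_derive t 1 (fun x => F (a x) x) dy.
  by apply: near_eq_is_derive yd; near=> x; symmetry; near: x.
move: yd => /is_derive1_caratheodory[eta [yE yC y0]].
have Anear : \forall x \near t, A (a x, x) != 0.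
  have : {for t, continuous (fun x => A (a x, x))}.
    apply: (@continuous_comp _ _ _ (fun x => (a x, x)) A); last exact: Ac.
    by apply: continuous_pair => //; exact: cvg_id.
  move=> c; have An : A (a t, t) != 0 by rewrite A0.
  have /cvgrPdist_lt /(_ `|A (a t, t)|) := c; rewrite normr_gt0 => /(_ An).
  apply: filterS => x; apply: contraTneq => ->.
  by rewrite subr0 ltxx.
apply/is_derive1_caratheodory.
(* Where the coefficient vanishes the plain difference quotient is used, so that the identity holds
   for every x; near [t] this branch is not taken. *)
exists (fun x => if A (a x, x) == 0 then (a x - a t) / (x - t)
  else (eta x - B x) / A (a x, x)); split.
- move=> x; case: eqP => [A00|/eqP An]; last first.
    have : (eta x - B x) * (x - t) = A (a x, x) * (a x - a t).
      by rewrite mulrBl -yE E; ring.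
    by move=> h; rewrite mulrAC h mulrAC mulfV // mul1r.
  have [xt|xt] := eqVneq x t; last by rewrite divfK // subr_eq0.
  by rewrite xt !subrr mulr0.
- have c : {for t, continuous (fun x => (eta x - B x) / A (a x, x))}.
    apply: continuousM; first exact: continuousB.
    apply: continuousV; first by rewrite A0.
    apply: (@continuous_comp _ _ _ (fun x => (a x, x)) A); last exact: Ac.
    by apply: continuous_pair => //; exact: cvg_id.
  have An : A (a t, t) != 0 by rewrite A0.
  rewrite /prop_for /continuous_at (negPf An).
  apply: cvg_trans c; apply: near_eq_cvg; near=> x.
  by rewrite ifF //; apply: negbTE; near: x.
- have An : A (a t, t) != 0 by rewrite A0.
  by rewrite (negPf An) A0 B0 y0.
Unshelve. all: by end_near. Qed.

End TwoVariables.

(** Values outside the range of [Phi] on [-r, r] are sent to the nearer endpoint. The inverse is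
    then defined and continuous for every y, which yields a scalar equation with global bounds; the
    clipping is later shown to be inactive on the graphs in use. *)
Lemma clipped_inverse (R : realType) (r d : R) (Phi : R -> R -> R) : 0 < r ->
  (forall z : R * R, {for z, continuous (fun z : R * R => Phi z.1 z.2)}) ->
  (forall s u v, `|s| < d -> - r <= u -> u < v -> v <= r -> Phi u s < Phi v s) ->
  exists ups : R -> R -> R,
    [/\ forall s y, - r <= ups s y <= r,
        forall s y, `|s| < d -> ups s y < r -> y <= Phi (ups s y) s,
        forall s y, `|s| < d -> - r < ups s y -> Phi (ups s y) s <= y,
        forall s u, `|s| < d -> - r <= u <= r -> ups s (Phi u s) = u &
        forall s y, `|s| < d -> {for (s, y), continuous (fun z : R * R => ups z.1 z.2)}].
Proof.
move=> r0 Phic Phi_inc.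
have ex (z : R * R) : exists u, - r <= u <= r /\ (`|z.1| < d ->
    (u < r -> z.2 <= Phi u z.1) /\ (- r < u -> Phi u z.1 <= z.2)).
  case: z => s y /=; have rr : - r <= r by lra.
  have [h1|h1] := leP y (Phi (- r) s).
    by exists (- r); rewrite lexx; split=> // _; rewrite ltxx.
  have [h2|h2] := leP (Phi r s) y.
    by exists r; rewrite lexx rr; split=> // _; rewrite ltxx.
  have [| |u] := @IVT R (Phi^~ s) (- r) r y rr.
  - apply: continuous_itv => u _.
    apply: (@continuous_comp _ _ _ (fun u => (u, s)) (fun z : R * R => Phi z.1 z.2)); last exact: Phic.
    by apply: continuous_pair; [exact: cvg_id|exact: cst_continuous].
  - by rewrite ge_min le_max (ltW h1) (ltW h2) orbT.
  - by rewrite in_itv /= => hu <-; exists u; rewrite hu.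
have [ups' Hups] := choice ex; pose ups s y := ups' (s, y).
have H1 s y : - r <= ups s y <= r by have [] := Hups (s, y).
have H2 s y : `|s| < d -> ups s y < r -> y <= Phi (ups s y) s.
  by move=> sd; have [_ /(_ sd)[]] := Hups (s, y).
have H3 s y : `|s| < d -> - r < ups s y -> Phi (ups s y) s <= y.
  by move=> sd; have [_ /(_ sd)[]] := Hups (s, y).
exists ups; split=> // [s u sd /andP[u1 u2]|s y sd].
  have /andP[v1 v2] := H1 s (Phi u s).
  apply/eqP; rewrite eq_le !leNgt; apply/andP; split; apply/negP => lt.
    have := Phi_inc s _ _ sd u1 lt v2; have := H3 s (Phi u s) sd (le_lt_trans u1 lt); lra.
  have := Phi_inc s _ _ sd v1 lt u2; have := H2 s (Phi u s) sd (lt_le_trans lt u2); lra.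
have /andP[v1 v2] := H1 s y; set u0 := ups s y in v1 v2.
have sc (u : R) : {for (s, y), continuous (fun z : R * R => Phi u z.1 - z.2)}.
  apply: continuousB; last exact: cvg_snd.
  apply: (@continuous_comp _ _ _ (fun z : R * R => (u, z.1)) (fun z : R * R => Phi z.1 z.2)); last exact: Phic.
  by apply: continuous_pair; [exact: cst_continuous|exact: cvg_fst].
have sdn : \forall z \near (s, y), `|z.1| < d.
  exact: (@near_fst _ _ (fun x => `|x| < d) s y (near_norm_lt sd)).
apply/cvgrPdist_lt => e e0 /=; rewrite -/u0.
have up : \forall z \near (s, y), ups z.1 z.2 < u0 + e.
  have [h|h] := leP (u0 + e) r; last first.
    near=> z; apply: le_lt_trans h; by have /andP[] := H1 z.1 z.2.
  have lt : 0 < Phi (u0 + e) s - y.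
    have h1 : u0 < r by lra.
    have h2 : u0 < u0 + e by lra.
    by have := H2 s y sd h1; have := Phi_inc s _ _ sd v1 h2 h; rewrite -/u0; lra.
  near=> z; have zd : `|z.1| < d by near: z.
  have h' : 0 < Phi (u0 + e) z.1 - z.2.
    by near: z; apply: (cvgr_gt _ (sc (u0 + e))); exact: lt.
  rewrite ltNge; apply/negP => le; have /andP[_ vr] := H1 z.1 z.2.
  have g1 : - r < ups z.1 z.2 by lra.
  have := H3 z.1 z.2 zd g1; have g2 : - r <= u0 + e by lra.
  move: le; rewrite le_eqVlt => /orP[/eqP <-|lt']; first by lra.
  by have := Phi_inc z.1 _ _ zd g2 lt' vr; lra.
have lo : \forall z \near (s, y), u0 - e < ups z.1 z.2.
  have [h|h] := leP (- r) (u0 - e); last first.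
    near=> z; apply: lt_le_trans h _; by have /andP[] := H1 z.1 z.2.
  have lt : Phi (u0 - e) s - y < 0.
    have h1 : - r < u0 by lra.
    have h2 : u0 - e < u0 by lra.
    by have := H3 s y sd h1; have := Phi_inc s _ _ sd h h2 v2; rewrite -/u0; lra.
  near=> z; have zd : `|z.1| < d by near: z.
  have h' : Phi (u0 - e) z.1 - z.2 < 0.
    by near: z; apply: (cvgr_lt _ (sc (u0 - e))); exact: lt.
  rewrite ltNge; apply/negP => le; have /andP[vr _] := H1 z.1 z.2.
  have g1 : ups z.1 z.2 < r by lra.
  have := H2 z.1 z.2 zd g1; have g2 : u0 - e <= r by lra.
  move: le; rewrite le_eqVlt => /orP[/eqP ->|lt']; first by lra.
  by have := Phi_inc z.1 _ _ zd vr lt' g2; lra.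
apply: filterS2 up lo => z h1 h2.
by rewrite ltr_norml; apply/andP; split; lra.
Unshelve. all: by end_near. Qed.

Lemma last_zero (R : realType) (y : R -> R) (a b : R) : a <= b ->
  (forall x, a <= x <= b -> {for x, continuous y}) -> 0 <= y a -> y b < 0 ->
  exists2 x0, a <= x0 < b & y x0 = 0 /\ forall x, x0 < x <= b -> y x < 0.
Proof.
move=> ab yc ya yb; pose A := [set x : R | a <= x <= b /\ 0 <= y x].
have sA : has_sup A by split; [exists a; rewrite /A /= lexx ab|exists b => x [/andP[]]].
have Aa : A a by rewrite /A /= lexx ab.
pose x0 := sup A.
have ax0 : a <= x0 by apply: ub_le_sup => //; exact: sA.2.
have x0b : x0 <= b by apply: ge_sup; [exact: sA.1|move=> x [/andP[]]].
have after x : x0 < x <= b -> y x < 0.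
  move=> /andP[x0x xb]; rewrite ltNge; apply/negP => yx.
  have : x <= x0 by apply: ub_le_sup; [exact: sA.2|rewrite /A /= xb (le_trans ax0 (ltW x0x))].
  by rewrite leNgt x0x.
have y0 : {for x0, continuous y} by apply: yc; rewrite ax0.
have yx0 : 0 <= y x0.
  rewrite leNgt; apply/negP => neg.
  have : \forall x \near x0, y x < 0 by apply: (cvgr_lt _ y0).
  move=> /nbhs_ballP[e /= e0 He].
  have [x Ax xe] := sup_adherent e0 sA; have [_ yx] := Ax.
  have xx0 : x <= x0 by apply: ub_le_sup => //; exact: sA.2.
  have : y x < 0.
    by apply: He; rewrite /ball /= ger0_norm ?subr_ge0 // ltrBlDr addrC -ltrBlDr.
  by rewrite ltNge yx.
have x0b' : x0 < b.
  by rewrite lt_neqAle x0b andbT; apply/eqP => E; rewrite E leNgt yb in yx0.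
exists x0; first by rewrite ax0.
split=> //; apply/eqP; rewrite eq_le yx0 andbT leNgt; apply/negP => pos.
have : \forall x \near x0, 0 < y x by apply: (cvgr_gt _ y0).
move=> /nbhs_ballP[e /= e0 He].
pose x := Num.min (x0 + e / 2) b.
have x0x : x0 < x by rewrite lt_min x0b' ltrDl divr_gt0.
have xb : x <= b by rewrite ge_min lexx orbT.
have := after x; rewrite x0x xb => /(_ isT).
have : 0 < y x.
  apply: He; rewrite /ball /= distrC gtr0_norm ?subr_gt0 // ltrBlDl.
  by rewrite gt_min ltrD2l ltr_pdivrMr // ltr_pMr // ltr1n.
by move=> h1 h2; rewrite ltNge (ltW h1) in h2.
Qed.

Lemma slope_ge0 (R : realFieldType) (x g0 g y : R) :
  0 < x * g0 -> x * (g0 - g) <= - y / 2 -> 0 <= 2 * x * g - y.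
Proof. by move=> h1 h2; lra. Qed.

(** * The chart of a field u' = V, s' = P with P positive off the origin *)

Section Chart.
Variable R : realType.
Implicit Types (u s t y e : R) (z : R * R).
Variables (X : R * R -> R * R) (p : R * R) (c c' : R * R -> R * R).
Variables (r K C : R) (V P w Phi Ys D : R -> R -> R) (mu : R * R -> R).
(** This is dy/ds along an orbit for y = [Phi u s]: since du/ds = V / P and the u-derivative of
    [Phi] is w P, the singular denominator cancels. *)
Let Gt u s := w u s * V u s + Ys u s.
Let box z := `|z.1| <= r /\ `|z.2| <= r.

Hypothesis r0 : 0 < r.
Hypothesis r1 : r <= 1.
Hypothesis K0 : 0 <= K.
Hypothesis Pc : forall z, {for z, continuous (fun z => P z.1 z.2)}.
Hypothesis Phic : forall z, {for z, continuous (fun z => Phi z.1 z.2)}.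
Hypothesis dPhic : forall z, {for z, continuous (fun z => w z.1 z.2 * P z.1 z.2)}.
Hypothesis Gtc : forall z, {for z, continuous (fun z => Gt z.1 z.2)}.
Hypothesis P00 : P 0 0 = 0.
Hypothesis Ppos : forall u s, box (u, s) -> (u, s) != 0 -> 0 < P u s.
Hypothesis w0 : forall u s, box (u, s) -> 0 < w u s.
Hypothesis Phi_u : forall u s, is_derive u 1 (Phi^~ s) (w u s * P u s).
Hypothesis Phi_s : forall u s, is_derive s 1 (Phi u) (Ys u s).
Hypothesis Phi0 : forall s, Phi 0 s = 0.
Hypothesis Gt_u : forall u s, is_derive u 1 (Gt^~ s) (D u s).
Hypothesis D_le : forall u s, box (u, s) -> `|s| * `|D u s| <= w u s * P u s / 2.
Hypothesis Gt_le : forall u s, box (u, s) -> `|Gt u s| <= K.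
Hypothesis Gt_pos : forall s, 0 < s <= r -> 0 < Gt 0 s.
Hypothesis VP_le : forall u s, box (u, s) ->
  `|V u s| <= C * (`|u| + `|s|) /\ `|P u s| <= C * (`|u| + `|s|).
Hypothesis mu_pos : forall z, box (c z) -> 0 < mu z <= 1.
Hypothesis muc : forall z, box (c z) -> {for z, continuous mu}.
Hypothesis Xp : X p = 0.
Hypothesis cp : c p = 0.
Hypothesis c0 : c' 0 = p.
Hypothesis cc : forall z, {for z, continuous c}.
Hypothesis cc' : forall z, box z -> {for z, continuous c'}.
Hypothesis cK : forall z, box (c z) -> c' (c z) = z.
Hypothesis cK' : forall z, box z -> c (c' z) = z.
Hypothesis Xc : forall (gam : R -> R * R) t, is_derive t 1 gam (X (gam t)) ->
  box (c (gam t)) ->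
  is_derive t 1 (fun t => (c (gam t)).1) (mu (gam t) * V (c (gam t)).1 (c (gam t)).2) /\
  is_derive t 1 (fun t => (c (gam t)).2) (mu (gam t) * P (c (gam t)).1 (c (gam t)).2).
Hypothesis Xc' : forall (a b : R -> R) (l t : R), box (a t, b t) ->
  is_derive t 1 a (l * V (a t) (b t)) -> is_derive t 1 b (l * P (a t) (b t)) ->
  is_derive t 1 (fun t => c' (a t, b t))
    ((l / mu (c' (a t, b t))) *: X (c' (a t, b t))).

Lemma Phi_increasing s u v : `|s| <= r -> - r <= u -> u < v -> v <= r -> Phi u s < Phi v s.
Proof.
move=> sr ru uv vr.
have bx x : u <= x <= v -> box (x, s).
  by move=> /andP[ux xv]; split=> //=; rewrite ler_norml; apply/andP; split; lra.
have pos x : u <= x <= v -> x != 0 -> 0 < w x s * P x s.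
  move=> xuv xn; rewrite mulr_gt0 ?w0 ?Ppos //; try exact: bx.
  by rewrite xpair_eqE (negPf xn).
have der (x : R) : is_derive x 1 (Phi^~ s) (w x s * P x s) by exact: Phi_u.
have seg (a b : R) : u <= a -> a < b -> b <= v -> 0 <= a \/ b <= 0 -> Phi a s < Phi b s.
  move=> ua ab bv h; apply: (derive_increasing_open ab (fun x _ => der x)) => x /andP[ax xb].
  apply: pos; first by apply/andP; split; lra.
  by apply/eqP => x0; case: h; lra.
have [u0|u0] := leP 0 u; first by apply: (seg u v) => //; left.
have [v0|v0] := leP v 0; first by apply: (seg u v) => //; right.
apply: (@lt_trans _ _ (Phi 0 s)).
  by apply: seg; rewrite ?lexx ?(ltW v0) //; right.
by apply: seg; rewrite ?lexx ?(ltW u0) //; left.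
Qed.

(** The bound on [D] compares the u-derivative of [Gt] with half that of [Phi]. So e Gt + Phi / 2 is
    nondecreasing in u for e = |s| and e = -|s|, which is the Lipschitz bound in the variable y =
    Phi. *)
Lemma Gt_lipschitz s u v : `|s| <= r -> - r <= u -> u <= v -> v <= r ->
  `|s| * `|Gt v s - Gt u s| <= (Phi v s - Phi u s) / 2.
Proof.
move=> sr ru uv vr.
have bx x : u <= x <= v -> box (x, s).
  by move=> /andP[ux xv]; split=> //=; rewrite ler_norml; apply/andP; split; lra.
have key (e : R) : `|e| = `|s| -> e * Gt u s + Phi u s / 2 <= e * Gt v s + Phi v s / 2.
  move=> es.
  have FD x : u <= x <= v -> is_derive x 1 (fun x => e * Gt x s + Phi x s / 2) (e * D x s + w x s * P x s / 2).
    move=> _; have D1 := is_deriveM (is_derive_cst e x (1 : R)) (Gt_u x s).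
    have D2 := is_deriveM (Phi_u x s) (is_derive_cst (2^-1 : R) x (1 : R)).
    have DD := is_deriveD D1 D2.
    by apply: (is_derive_eq DD); rewrite /GRing.scale /= !mulr0 !addr0 add0r [_^-1 * _]mulrC.
  apply: (derive_nondecreasing uv FD) => x /bx /D_le; rewrite -es -normrM ler_norml.
  by move=> /andP[+ _]; rewrite -subr_ge0 opprK.
have k1 := key `|s| (normr_id s).
have k2 := key (- `|s|); rewrite normrN normr_id in k2; have {}k2 := k2 erefl.
by rewrite -[X in X * _]normr_id -normrM ler_norml; apply/andP; split; lra.
Qed.

(** The new coordinates are s and the label of the solution graph through (s, [Phi u s]): the label
    is constant along orbits while s increases. The statement on (s, 0) provides the half-plane that
    rules out foci. *)
Lemma chart_exists : exists (U W : set (R * R)) (h k : R * R -> R * R),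
  [/\ equivalence X p (@flow_box R) 0 U W h k,
      forall s, 0 < s -> W (s, 0) -> 0 < (c (k (s, 0))).1 &
      forall z, U z -> X z = 0 -> z = p].
Proof.
have rP : Phi (- r) 0 < 0 < Phi r 0.
  have := @Phi_increasing 0 (- r) 0; have := @Phi_increasing 0 0 r; rewrite !Phi0 normr0 lexx.
  by move=> h1 h2; apply/andP; split; [apply: h2|apply: h1]; have := r0; lra.
have /andP[rP1 rP2] := rP.
(* Heights of absolute value at most [m] are interior values of [Phi] on [-r, r], at s = 0 and then,
   by continuity, for |s| < d1. *)
pose m := Num.min (- Phi (- r) 0) (Phi r 0) / 2.
have m0 : 0 < m by rewrite divr_gt0 // lt_min oppr_gt0 rP1.
have [d1 d10 Hd1] : exists2 d1, 0 < d1 & forall s, `|s| < d1 -> m < Phi r s /\ Phi (- r) s < - m.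
  have n1 : \forall s \near (0 : R), m < Phi r s /\ Phi (- r) s < - m.
    have cc1 (u : R) : {for 0, continuous (Phi u)}.
      by apply: is_derive_continuous (Phi_s u 0).
    have h1 : m < Phi r 0 by have := ge_min (Phi r 0) (- Phi (- r) 0) (Phi r 0); rewrite lexx orbT /m; lra.
    have h2 : Phi (- r) 0 < - m.
      by have := ge_min (- Phi (- r) 0) (- Phi (- r) 0) (Phi r 0); rewrite lexx /m; lra.
    near=> s; split; near: s.
      by apply: (cvgr_gt _ (cc1 r)).
    by apply: (cvgr_lt _ (cc1 (- r))).
  move/nbhs_ballP: n1 => [e /= e0 He]; exists e => // s se; apply: He.
  by rewrite /ball /= sub0r normrN.
(* With K d <= m / 2 and labels of absolute value below m / 2, a graph stays at heights below [m],
   where the inverse of [Phi] is not clipped. *)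
pose d := Num.min (Num.min r d1) (m / (2 * (K + 1))).
have d0 : 0 < d by rewrite !lt_min r0 d10 divr_gt0 // mulr_gt0 // ltr_wpDl.
have dr : d <= r by rewrite /d !ge_min lexx.
have dd1 : d <= d1 by rewrite /d !ge_min lexx orbT.
have dle1 : d <= 1 by apply: le_trans dr r1.
have Kd : K * d <= m / 2.
  have h : d <= m / (2 * (K + 1)) by rewrite /d ge_min lexx orbT.
  apply: le_trans (ler_wpM2l K0 h) _.
  have -> : K * (m / (2 * (K + 1))) = m / 2 * (K / (K + 1)) by field; rewrite gt_eqF // ltr_wpDl.
  have m2 : 0 <= m / 2 by rewrite divr_ge0 // ltW.
  by rewrite ler_piMr // ler_pdivrMr ?ltr_wpDl // mul1r lerDl.
have [ups [U1 U2 U3 UK Uc]] := clipped_inverse r0 Phic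
  (fun s u v sd => @Phi_increasing s u v (le_trans (ltW sd) dr)).
have ubox s y : `|s| < d -> box (ups s y, s).
  move=> sd; split; rewrite /=; first by rewrite ler_norml U1.
  exact: le_trans (ltW sd) dr.
pose G s y := Gt (ups s y) s.
have Gc s y : `|s| < d -> {for (s, y), continuous (fun z => G z.1 z.2)}.
  move=> sd; apply: (@continuous_comp _ _ _ (fun z => (ups z.1 z.2, z.1)) (fun z => Gt z.1 z.2)); last exact: Gtc.
  by apply: continuous_pair; [exact: Uc|exact: cvg_fst].
have Gb s y : `|s| < d -> `|G s y| <= K by move=> sd; apply: Gt_le; exact: ubox.
have Glip s y y' : `|s| < d -> `|s| * `|G s y - G s y'| <= `|y - y'| / 2.
  move=> sd; have sr : `|s| <= r by rewrite (le_trans (ltW sd)).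
  wlog uu : y y' / ups s y <= ups s y' => [hw|].
    by have [|/ltW] := leP (ups s y) (ups s y') => h; [|rewrite (distrC (G s y)) (distrC y)]; exact: hw.
  have /andP[a1 a2] := U1 s y; have /andP[b1 b2] := U1 s y'.
  rewrite (distrC (G s y)) (distrC y); apply: le_trans (Gt_lipschitz sr a1 uu b2) _.
  rewrite ler_wpM2r ?invr_ge0 //.
  have [E|lt] : ups s y = ups s y' \/ ups s y < ups s y'.
    by move: uu; rewrite le_eqVlt => /orP[/eqP|]; [left|right].
    by rewrite E subrr normr_ge0.
  apply: le_trans (ler_norm _).
  by have := U2 s y sd (lt_le_trans lt b2); have := U3 s y' sd (le_lt_trans a1 lt); lra.
have [Y HY] := solution_family d0 dle1 K0 Gc Gb Glip.
have Y0 e : Y e 0 = e := (HY e).1.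
have Yd e s : `|s| < d -> is_derive s 1 (Y e) (G s (Y e s)) := (HY e).2 s.
have [E EK] := family_label d0 dle1 K0 Gb Glip Y0 Yd.
have EY := label_family d0 K0 Gb Glip Y0 Yd EK.
have drift := family_drift Gb Y0 Yd.
have Yc := family_continuous d0 dle1 K0 Gb Glip Y0 Yd.
have Ec := label_continuous d0 K0 Gb Glip Y0 Yd EK.
pose e1 := Num.min (m / 2) 1.
have e10 : 0 < e1 by rewrite lt_min ltr01 divr_gt0.
have em : e1 <= m / 2 by rewrite /e1 ge_min lexx.
have e11 : e1 <= 1 by rewrite /e1 ge_min lexx orbT.
have inside e s : `|e| < e1 -> `|s| < d ->
    [/\ - r < ups s (Y e s), ups s (Y e s) < r & Phi (ups s (Y e s)) s = Y e s].
  move=> ee sd; have := drift e s sd.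
  have h1 : K * `|s| <= m / 2 by apply: le_trans (ler_wpM2l K0 (ltW sd)) Kd.
  have [p1 p2] := Hd1 s (lt_le_trans sd dd1).
  rewrite ler_norml => /andP[h2 h3]; move: ee; rewrite ltr_norml => /andP[h4 h5].
  have /andP[u1 u2] := U1 s (Y e s).
  have v1 : - r < ups s (Y e s).
    rewrite lt_neqAle u1 andbT; apply/eqP => Eq.
    have h6 : ups s (Y e s) < r by rewrite -Eq (lt_trans _ r0) // oppr_lt0.
    by move: (U2 s (Y e s) sd h6); rewrite -Eq; lra.
  have v2 : ups s (Y e s) < r.
    rewrite lt_neqAle u2 andbT; apply/eqP => Eq.
    by move: (U3 s (Y e s) sd v1); rewrite Eq; lra.
  split=> //; apply/eqP; rewrite eq_le.
  by rewrite (U3 s _ sd v1) (U2 s _ sd v2).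
pose W := [set z : R * R | `|z.1| < d /\ `|z.2| < e1].
pose A := [set z : R * R | `|(c z).1| < r /\ `|(c z).2| < d].
pose h z := ((c z).2, E (c z).2 (Phi (c z).1 (c z).2)).
pose k z := c' (ups z.1 (Y z.2 z.1), z.1).
pose U := A `&` h @^-1` W.
have osq (a b : R) : open [set z : R * R | `|z.1| < a /\ `|z.2| < b].
  rewrite openE => -[x y] [/= x1 y1].
  have n1 := @near_fst _ R (fun t => `|t| < a) x y (near_norm_lt x1).
  have n2 := @near_snd R _ (fun t => `|t| < b) x y (near_norm_lt y1).
  by apply: filterS2 n1 n2.
have oA : open A.
  have -> : A = c @^-1` [set z : R * R | `|z.1| < r /\ `|z.2| < d] by [].
  by apply: open_comp => // z _; exact: cc.
have bA z : A z -> box (c z) by move=> [a1 a2]; split; [exact: ltW|apply/ltW/(lt_le_trans a2)].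
have c1c z : {for z, continuous (fun z => (c z).1)}.
  by apply: (@continuous_comp _ _ _ c fst); [exact: cc|exact: cvg_fst].
have c2c z : {for z, continuous (fun z => (c z).2)}.
  by apply: (@continuous_comp _ _ _ c snd); [exact: cc|exact: cvg_snd].
have hc z : A z -> {for z, continuous h}.
  move=> [_ sd]; apply: continuous_pair; first exact: c2c.
  apply: (@continuous_comp _ _ _ (fun z => ((c z).2, Phi (c z).1 (c z).2)) (fun v : R * R => E v.1 v.2)); last exact: Ec.
  apply: continuous_pair; first exact: c2c.
  apply: (@continuous_comp _ _ _ c (fun v => Phi v.1 v.2)); [exact: cc|exact: Phic].
have upsYc s e : `|s| < d -> {for (s, e), continuous (fun z => ups z.1 (Y z.2 z.1))}.
  move=> sd.
  apply: (@continuous_comp _ _ _ (fun z => (z.1, Y z.2 z.1)) (fun v => ups v.1 v.2)); last exact: Uc.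
  by apply: continuous_pair; [exact: cvg_fst|exact: Yc].
have d00 : `|0 : R| < d by rewrite normr0.
have ups00 : ups 0 (Y 0 0) = 0 by rewrite Y0 -{2}(Phi0 0); apply: UK => //; rewrite oppr_le0 ltW.
have E00 : E 0 0 = 0 by have := EY 0 0 d00; rewrite Y0.
have h0 : h p = 0 by rewrite /h cp /= Phi0 E00.
have k0 : k 0 = p by rewrite /k /= ups00.
have W0 : W 0 by split; rewrite /= normr0.
have Ap : A p by split; rewrite /= cp normr0.
have hU z : U z -> W (h z) /\ k (h z) = z.
  move=> [Az Wz]; split=> //; have [a1 a2] := Az; rewrite /k /h /= EK // UK //.
    by rewrite -surjective_pairing cK //; exact: bA.
  by rewrite -ler_norml ltW.
have ck z : W z -> c (k z) = (ups z.1 (Y z.2 z.1), z.1).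
  by move=> [sd _]; rewrite /k cK' //; exact: ubox.
have kV z : W z -> U (k z) /\ h (k z) = z.
  move=> Wz; have [sd ed] := Wz; have [i1 i2 i3] := inside _ _ ed sd.
  have hk : h (k z) = z by rewrite /h ck //= i3 EY // -surjective_pairing.
  split=> //; split; last by rewrite /= hk.
  by rewrite /A /= ck //=; split=> //; rewrite ltr_norml i1.
have oU : open U by apply: open_preimage => //; exact: osq.
have ngp z : U z -> z != p -> c z != 0.
  move=> [Az _]; apply: contraNneq => cz; rewrite -(cK (bA _ Az)) cz c0 //.
have Pp z : U z -> z != p -> 0 < mu z * P (c z).1 (c z).2.
  move=> Uz np; have nz := ngp z Uz np; have bz := bA _ Uz.1.
  by have /andP[mz _] := mu_pos bz; apply: mulr_gt0 => //; apply: Ppos; rewrite -surjective_pairing.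
exists U, W, h, k; split; first last.
(* An equilibrium is a constant solution; [Xc] applied to it shows that the speed mu P of s vanishes
   there, which happens only at p. *)
- move=> z Uz Xz; apply/eqP; apply: contraT => np; have := Pp z Uz np.
  have Dz : is_derive (0 : R) 1 (fun _ : R => z) (X z).
    by rewrite Xz; exact: is_derive_cst.
  have [_ D2] := @Xc (fun=> z) 0 Dz (bA _ Uz.1).
  have D0 := is_derive_cst (c z).2 (0 : R) (1 : R).
  by rewrite -(@derive_val _ _ _ _ _ _ _ D2) (@derive_val _ _ _ _ _ _ _ D0) ltxx.
- move=> s s0 [/= sd ed]; rewrite ck //=.
  have [_ _ i3] := inside 0 s ed sd.
  have sr t : 0 < t -> `|t| < d -> 0 < t <= r.
    by move=> t0 td; rewrite t0 (le_trans (ler_norm _)) // (le_trans (ltW td)).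
  have G0 t : 0 < t -> `|t| < d -> 0 < G t 0.
    move=> t0 td; have E0 : ups t 0 = 0.
      by have := UK t 0 td; rewrite Phi0; apply; rewrite oppr_le0 ltW.
    by rewrite /G E0; apply: Gt_pos; exact: sr.
  (* After the last zero [x0] before [t] the graph is negative, and G(x, Y) >= G(x, 0) - |Y| / (2x)
     > Y / (2x) makes Y^2 / x nonincreasing. But Y^2 / x tends to 0 at [x0], since Y is O(x - x0)
     there. *)
  have neg t : 0 < t -> `|t| < d -> Y 0 t < 0 -> False.
    move=> t0 td Yt.
    have yc x : 0 <= x <= t -> {for x, continuous (Y 0)}.
      by move=> xt; apply: is_derive_continuous (Yd 0 x (ball_mem d00 td xt)).
    have [||x0 /andP[x00 x0t] [Yx0 Yneg]] := @last_zero R (Y 0) 0 t (ltW t0) yc.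
    + by rewrite Y0.
    + exact: Yt.
    have td' x : x0 <= x <= t -> `|x| < d.
      by move=> /andP[x1 x2]; apply: (ball_mem d00 td); rewrite (le_trans x00).
    have mon x1 : x0 < x1 -> x1 <= t -> Y 0 t ^+ 2 * x1 <= Y 0 x1 ^+ 2 * t.
      move=> x01 x1t.
      have x1p x : x1 <= x <= t -> 0 < x by move=> /andP[+ _]; apply: lt_le_trans; exact: le_lt_trans x01.
      have sub x : x1 <= x <= t -> `|x| < d.
        by move=> /andP[y1 y2]; apply: td'; rewrite y2 (le_trans (ltW x01)).
      have [x xx Ex] := mvt x1t (fun x hx => is_deriveM (is_deriveX 2 (Yd 0 x (sub x hx)))
         (@is_deriveV R id x _ 1 (lt0r_neq0 (x1p x hx)) (is_derive_id x (1 : R)))).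
      have xp := x1p x xx; have xd := sub x xx.
      have Yx : Y 0 x < 0 by case/andP: xx => y1 y2; apply: Yneg; rewrite y2 (lt_le_trans x01).
      have GL := Glip x (Y 0 x) 0 xd; rewrite subr0 (gtr0_norm xp) (ltr0_norm Yx) in GL.
      have G0x := G0 x xp xd.
      have key : 0 <= 2 * x * G x (Y 0 x) - Y 0 x.
        have := ler_wpM2l (ltW xp) (ler_norm (G x 0 - G x (Y 0 x))); rewrite distrC.
        move=> hl; exact: slope_ge0 (mulr_gt0 xp G0x) (le_trans hl GL).
      have le0 : Y 0 t ^+ 2 / t - Y 0 x1 ^+ 2 / x1 <= 0.
        rewrite [_ - _]Ex mulr_le0_ge0 ?subr_ge0 // /GRing.scale /= expr1 mulr1.
        have -> : Y 0 x ^+ 2 * - x ^- 2 + x^-1 * (2 * Y 0 x * G x (Y 0 x)) =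
           Y 0 x * (2 * x * G x (Y 0 x) - Y 0 x) / x ^+ 2 by field; rewrite gt_eqF.
        by rewrite pmulr_lle0 ?invr_gt0 ?exprn_gt0 // mulr_le0_ge0 // ltW.
      move: le0; rewrite subr_le0 ler_pdivrMr // mulrAC ler_pdivlMr //.
      by apply: x1p; rewrite lexx.
    have : Y 0 t ^+ 2 <= 0.
      apply: (@le0_geometric _ _ (K ^+ 2 * (t - x0) * t)) => n.
      pose q := (2 ^+ n)^-1 : R; have q0 : 0 < q by rewrite invr_gt0 exprn_gt0.
      have q1 : q <= 1 by rewrite invf_le1 ?exprn_gt0 // exprn_ege1 // ler1n.
      have tx : 0 < t - x0 by rewrite subr_gt0.
      pose x1 := x0 + (t - x0) * q.
      have x01 : x0 < x1 by rewrite ltrDl mulr_gt0.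
      have x1t : x1 <= t by rewrite -lerBrDl ler_piMr // ltW.
      have sub x : x0 <= x <= x1 -> `|x| < d.
        by move=> /andP[y1 y2]; apply: td'; rewrite y1 (le_trans y2).
      have [x xx Ex] := mvt (ltW x01) (fun x hx => Yd 0 x (sub x hx)).
      have Yx1 : `|Y 0 x1| <= K * (x1 - x0).
        have -> : Y 0 x1 = G x (Y 0 x) * (x1 - x0) by rewrite -Ex Yx0 subr0.
        rewrite normrM (gtr0_norm (_ : 0 < x1 - x0)) ?subr_gt0 //.
        by rewrite ler_wpM2r ?subr_ge0 ?(ltW x01) // Gb // sub.
      have x1p : 0 < x1 by apply: le_lt_trans x01.
      have hm := mon x1 x01 x1t; rewrite -(ler_pM2r x1p).
      apply: le_trans hm _.
      have sq : Y 0 x1 ^+ 2 <= (K * (x1 - x0)) ^+ 2.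
        by rewrite -[X in X <= _](real_normK (num_real _)) ler_sqr ?nnegrE // mulr_ge0 // subr_ge0 ltW.
      apply: le_trans (ler_wpM2r (ltW t0) sq) _.
      have -> : (K * (x1 - x0)) ^+ 2 * t = K ^+ 2 * (x1 - x0) * t * (x1 - x0) by ring.
      have -> : K ^+ 2 * (t - x0) * t / 2 ^+ n * x1 = K ^+ 2 * (x1 - x0) * t * x1.
        by rewrite /x1 -/q; ring.
      rewrite ler_wpM2l //; last by rewrite lerBlDr lerDl.
      by rewrite !mulr_ge0 ?sqr_ge0 // ?subr_ge0 ltW.
    by rewrite leNgt lt_def sqr_ge0 sqrf_eq0 lt_eqF.
  have Ys0 : 0 < Y 0 s.
    rewrite lt_neqAle eq_sym; apply/andP; split; last first.
      by rewrite leNgt; apply/negP; exact: neg.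
    (* A zero at s would have the positive slope G(s, 0), hence be preceded by negative values,
       which [neg] excludes. *)
    apply/negP => /eqP Ys0.
    have := Yd 0 s sd; rewrite Ys0 => /is_derive1_caratheodory[g [gE gc gs]].
    have gp : \forall x \near s, 0 < g x.
      by apply: (cvgr_gt _ gc); rewrite gs; exact: G0.
    have sn : \forall x \near s, 0 < x by exact: lt_nbhsr.
    have [e e0 He] : exists2 e, 0 < e & forall x, `|s - x| < e -> [/\ 0 < g x, 0 < x & `|x| < d].
      have nn : \forall x \near s, [/\ 0 < g x, 0 < x & `|x| < d].
        by apply: filterS3 gp sn (near_norm_lt sd) => x; split.
      by move: nn => /nbhs_ballP[e /= e0 He]; exists e.
    have [g1 x1 x2] : [/\ 0 < g (s - e / 2), 0 < s - e / 2 & `|s - e / 2| < d].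
      apply: He; rewrite opprB addrC subrK gtr0_norm ?divr_gt0 //.
      by rewrite ltr_pdivrMr // ltr_pMr // ltr1n.
    apply: (neg _ x1 x2); have := gE (s - e / 2); rewrite Ys0 subr0 => ->.
    by rewrite addrAC subrr add0r pmulr_rlt0 // oppr_lt0 divr_gt0.
  rewrite ltNge; apply/negP => le; move: le.
  have /andP[u1 u2] := U1 s (Y 0 s).
  rewrite le_eqVlt => /orP[/eqP Eu|lt]; first by move: Ys0; rewrite -i3 Eu Phi0 ltxx.
  have := @Phi_increasing s _ 0 (le_trans (ltW sd) dr) u1 lt (ltW r0).
  by rewrite i3 Phi0 ltNge (ltW Ys0).
(* The speed [m] required by [flow_box_chart] is mu P, the rate of change of s along X. *)
apply: (@flow_box_chart R X p U W h k (fun z => mu (k z) * P (ups z.1 (Y z.2 z.1)) z.1)) => //.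
- by split=> //=; rewrite h0.
- by apply: osq.
- by move=> z [z1 z2]; split; [exact: ltW (lt_le_trans z1 dle1)|exact: ltW (lt_le_trans z2 e11)].
- by move=> z [Az _]; exact: hc.
- move=> [s e] [/= sd ed]; apply: (@continuous_comp _ _ _ (fun z => (ups z.1 (Y z.2 z.1), z.1)) c').
    by apply: continuous_pair; [exact: upsYc|exact: cvg_fst].
  by apply: cc'; exact: ubox.
- move=> I gam [oI iI gU gd].
  case: (pselect (exists2 t, I t & gam t = p)) => [hit|nohit]; [by left|right].
  have gp t : I t -> gam t != p by move=> It; apply/eqP => Eg; apply: nohit; exists t.
  have Xg t : I t -> is_derive t 1 (fun t => (c (gam t)).1) (mu (gam t) * V (c (gam t)).1 (c (gam t)).2) /\
     is_derive t 1 (fun t => (c (gam t)).2) (mu (gam t) * P (c (gam t)).1 (c (gam t)).2).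
    by move=> It; apply: Xc; [exact: gd|apply: bA; exact: (gU t It).1].
  have l0 t : I t -> 0 < mu (gam t) * P (c (gam t)).1 (c (gam t)).2.
    by move=> It; apply: Pp; [exact: gU|exact: gp].
  split=> [t It|].
    by exists (mu (gam t) * P (c (gam t)).1 (c (gam t)).2); [exact: l0|exact: (Xg t It).2].
  have [tau [oK iK tauE taud]] := increasing_inverse oI iI (fun t It => (Xg t It).2) l0.
  set s := fun t => (c (gam t)).2 in oK iK tauE taud.
  pose z x := Phi (c (gam (tau x))).1 (c (gam (tau x))).2.
  (* Along an orbit s is an admissible parameter. In the chain rule the rate mu P of s divides out,
     and [Phi] of the orbit solves the scalar equation. *)
  have zd x : (s @` I) x -> is_derive x 1 z (G x (z x)).
    move=> Kx; have [t It tx] := Kx; have tt : tau x = t by rewrite -tx tauE.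
    have [D1 D2] := Xg t It.
    have DD := @derive_total R Phi _ Ys Phi_u Phi_s _ _ t _ _ (@dPhic ((c (gam t)).1, (c (gam t)).2)) D1 D2.
    have := taud x Kx; rewrite tt => Dt.
    have D3 := @is_derive1_comp R (fun t => Phi (c (gam t)).1 (c (gam t)).2) tau x _ _.
    rewrite tt in D3; have {D3} := D3 _ _ DD Dt.
    have Ut := gU t It; have [at1 at2] := Ut.1.
    have Gz : G x (z x) = Gt (c (gam t)).1 (c (gam t)).2.
      by rewrite /G /z tt -tx /s UK // -ler_norml ltW.
    move=> D4; apply: (is_derive_eq D4); rewrite Gz /Gt.
    have := l0 t It; set P' := P _ _; set V' := V _ _; set mm := mu _ => mP.
    have : mm * P' != 0 by rewrite gt_eqF.
    by rewrite mulf_eq0 negb_or => /andP[m0' P0']; field; rewrite P0' m0'.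
  (* Uniqueness for the scalar equation identifies the orbit with the graph through its first point,
     so the label does not vary. *)
  have lab x1 x2 : (s @` I) x1 -> (s @` I) x2 -> x1 <= x2 -> E x1 (z x1) = E x2 (z x2).
    move=> K1 K2 x12.
    have sd x : (s @` I) x -> `|x| < d by move=> [t It <-]; have [[]] := gU t It.
    have sub x : x1 <= x <= x2 -> (s @` I) x by exact: (is_interval_mem iK K1 K2).
    have -> : z x2 = Y (E x1 (z x1)) x2.
      apply: (@solution_unique R d K G K0 Gb Glip z (Y (E x1 (z x1))) x1 x2 x1).
      + exact: sd.
      + exact: sd.
      + by move=> x /sub; exact: zd.
      + by move=> x /sub /sd; exact: Yd.
      + by rewrite lexx.
      + by rewrite EK //; exact: sd.
      + by rewrite x12 lexx.
    by rewrite EY //; exact: sd.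
  have hz t : I t -> (h (gam t)).2 = E (s t) (z (s t)) by move=> It; rewrite /h /z /= tauE.
  move=> t1 t2 It1 It2; rewrite !hz //.
  have K1 : (s @` I) (s t1) by exists t1.
  have K2 : (s @` I) (s t2) by exists t2.
  by have [le|/ltW le] := leP (s t1) (s t2); [exact: lab|symmetry; exact: lab].
- move=> I gam [oI iI gU gd] s t Is It gs.
  have bg x : I x -> box (c (gam x)) by move=> Ix; apply: bA; exact: (gU x Ix).1.
  have [|||e2 e3] := @gronwall_zero R (fun t => (c (gam t)).1) (fun t => (c (gam t)).2) I C iI _ s t Is It.
  + move=> x Ix; have [D1 D2] := Xc (gd x Ix) (bg x Ix).
    exists (mu (gam x) * V (c (gam x)).1 (c (gam x)).2), (mu (gam x) * P (c (gam x)).1 (c (gam x)).2).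
    have /andP[m1 m2] := mu_pos (bg x Ix).
    have [V1 P1] := VP_le (u := (c (gam x)).1) (s := (c (gam x)).2) (bg x Ix).
    have mn : `|mu (gam x)| <= 1 by rewrite gtr0_norm.
    split=> //; rewrite normrM.
      by apply: le_trans V1; rewrite ler_piMl.
    by apply: le_trans P1; rewrite ler_piMl.
  + by rewrite gs cp.
  + by rewrite gs cp.
  by rewrite -(cK (bg t It)) [c _]surjective_pairing e2 e3 c0.
- move=> [s e] Wz zn; have [/= sd ed] := Wz; have [i1 i2 i3] := inside _ _ ed sd.
  set u := ups s (Y e s) in i1 i2 i3 *.
  have bu : box (u, s) by exact: ubox.
  have un : (u, s) != 0.
    apply: contraNneq zn => -[u0 s0]; move: i3; rewrite u0 s0 Phi0 Y0 => <-.
    exact: eqxx.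
  have P0 := Ppos bu un.
  have bk : box (c (k (s, e))) by rewrite ck.
  have /andP[m1 m2] := mu_pos bk.
  have ac : {for s, continuous (fun s => ups s (Y e s))}.
    apply: (@continuous_comp _ _ _ (fun s => (s, e)) (fun z => ups z.1 (Y z.2 z.1))); last exact: upsYc.
    by apply: continuous_pair; [exact: cvg_id|exact: cst_continuous].
  have pc : {for s, continuous (fun s => (ups s (Y e s), s))}.
    by apply: continuous_pair => //; exact: cvg_id.
  split; first by rewrite mulr_gt0.
    apply: continuousM.
      apply: (@continuous_comp _ _ _ (fun s => k (s, e)) mu); last exact: muc.
      by apply: (@continuous_comp _ _ _ (fun s => (ups s (Y e s), s)) c'); last exact: cc'.
    by apply: (@continuous_comp _ _ _ (fun s => (ups s (Y e s), s)) (fun z => P z.1 z.2)); last exact: Pc.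
  have wP : w u s * P u s != 0 by rewrite mulf_neq0 // gt_eqF // w0.
  have near_in : \forall x \near s, Phi (ups x (Y e x)) x = Y e x.
    by apply: filterS (near_norm_lt sd) => x xd; have [] := inside _ _ ed xd.
  have Da := @derive_implicit R Phi _ Ys Phi_u Phi_s (fun s => ups s (Y e s)) (Y e) s _ (@dPhic (ups s (Y e s), s)) wP ac near_in (Yd e s sd).
  have Db := is_derive_id s (1 : R).
  have Dk := @Xc' (fun s => ups s (Y e s)) id (P u s)^-1 s bu _ _.
  have -> : (mu (k (s, e)) * P u s)^-1 = (P u s)^-1 / mu (k (s, e)) by rewrite invfM mulrC.
  apply: Dk.
    apply: (is_derive_eq Da); rewrite -/u /G -/u /Gt addrK.
    by move: wP; rewrite mulf_eq0 negb_or => /andP[wn Pn]; field; rewrite Pn wn.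
  by apply: (is_derive_eq Db); rewrite mulVf // gt_eqF.
Unshelve. all: by end_near. Qed.

End Chart.

(** * Power series *)

(** A separate name, so that the ring structure declared below is the Cauchy product and not the
    pointwise one. Iterated twice it is convertible with [fps2]. *)
Definition powser (K : comNzRingType) := nat -> K.

Section SeriesRing.
Variable K : comNzRingType.
Implicit Types f g h : powser K.

HB.instance Definition _ := gen_eqMixin (powser K).
HB.instance Definition _ := gen_choiceMixin (powser K).

Definition powser_add f g : powser K := fun n => f n + g n.
Definition powser_opp f : powser K := fun n => - f n.
Definition powser_zero : powser K := fun=> 0.
Definition powser_mul f g : powser K := fun n => \sum_(i < n.+1) f i * g (n - i)%N.
Definition powser_one : powser K := fun n => (n == 0)%:R.

Fact powser_addA : associative powser_add.
Proof. by move=> f g h; apply/funext => n; exact: addrA. Qed.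
Fact powser_addC : commutative powser_add.
Proof. by move=> f g; apply/funext => n; exact: addrC. Qed.
Fact powser_add0 : left_id powser_zero powser_add.
Proof. by move=> f; apply/funext => n; exact: add0r. Qed.
Fact powser_addN : left_inverse powser_zero powser_opp powser_add.
Proof. by move=> f; apply/funext => n; exact: addNr. Qed.

HB.instance Definition _ := GRing.isZmodule.Build (powser K)
  powser_addA powser_addC powser_add0 powser_addN.

Definition truncate n f : {poly K} := \poly_(i < n) f i.

Lemma coef_truncate n f i : (i < n)%N -> (truncate n f)`_i = f i.
Proof. by move=> h; rewrite coef_poly h. Qed.

Lemma powser_mul_truncate f g n : powser_mul f g n = (truncate n.+1 f * truncate n.+1 g)`_n.
Proof.
by rewrite coefM; apply: eq_bigr => i _; rewrite !coef_truncate // ltnS leq_subr.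
Qed.

Fact powser_mulC : commutative powser_mul.
Proof. by move=> f g; apply/funext => n; rewrite !powser_mul_truncate mulrC. Qed.

(** The coefficient of index n of a product depends on coefficients up to n only, so the ring laws
    of series are inherited from polynomials agreeing with them up to n. *)
Lemma powser_mul_coef (P Q : {poly K}) f g n :
  (forall i, (i <= n)%N -> P`_i = f i) -> (forall i, (i <= n)%N -> Q`_i = g i) ->
  powser_mul f g n = (P * Q)`_n.
Proof.
move=> Pf Qg; rewrite coefM; apply: eq_bigr => i _.
by rewrite Pf -1?ltnS // Qg // leq_subr.
Qed.

Fact powser_mulA : associative powser_mul.
Proof.
move=> f g h; apply/funext => n; pose T := truncate n.+1.
have TE u i : (i <= n)%N -> (T u)`_i = u i by move=> le; rewrite coef_truncate.
have TM u v i : (i <= n)%N -> (T u * T v)`_i = powser_mul u v i.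
  by move=> le; rewrite (@powser_mul_coef (T u) (T v)) // => j /leq_trans/(_ le); exact: TE.
rewrite (@powser_mul_coef (T f) (T g * T h)) => [|//|i]; [|exact: TE|exact: TM].
by rewrite (@powser_mul_coef (T f * T g) (T h)) ?mulrA // => i; [exact: TM|exact: TE].
Qed.

Fact powser_mul1 : left_id powser_one powser_mul.
Proof.
move=> f; apply/funext => n; rewrite /powser_mul big_ord_recl /= mul1r subn0.
by rewrite big1 ?addr0 // => i _; rewrite mul0r.
Qed.

Fact powser_mulDl : left_distributive powser_mul powser_add.
Proof.
move=> f g h; apply/funext => n; rewrite /powser_mul /powser_add -big_split /=.
by apply: eq_bigr => i _; rewrite mulrDl.
Qed.

Fact powser_one_neq0 : powser_one != 0.
Proof. by apply/eqP => /(congr1 (fun f => f 0%N)) /eqP; rewrite oner_eq0. Qed.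

HB.instance Definition _ := GRing.Zmodule_isComNzRing.Build (powser K)
  powser_mulA powser_mulC powser_mul1 powser_mulDl powser_one_neq0.

Lemma powserM f g n : (f * g) n = \sum_(i < n.+1) f i * g (n - i)%N.
Proof. by []. Qed.

Lemma powserM0 f g : (f * g) 0%N = f 0%N * g 0%N.
Proof. by rewrite powserM big_ord_recl big_ord0 addr0. Qed.

Lemma powserD f g n : (f + g) n = f n + g n. Proof. by []. Qed.
Lemma powserN f n : (- f) n = - f n. Proof. by []. Qed.
Lemma powser0 n : (0 : powser K) n = 0. Proof. by []. Qed.
Lemma powser1 n : (1 : powser K) n = (n == 0)%:R. Proof. by []. Qed.

Lemma powser_sum I (r : seq I) (P : pred I) (F : I -> powser K) n :
  (\sum_(i <- r | P i) F i) n = \sum_(i <- r | P i) F i n.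
Proof. by apply: (big_morph (fun f : powser K => f n)). Qed.

Definition powserC (c : K) : powser K := fun n => if n == 0%N then c else 0.
Definition powserX : powser K := fun n => (n == 1)%:R.

Lemma powserCM c f n : (powserC c * f) n = c * f n.
Proof.
rewrite powserM big_ord_recl /= subn0 big1 ?addr0 // => i _.
by rewrite /powserC /= mul0r.
Qed.

Fact powserC_additive : zmod_morphism powserC.
Proof. by move=> a b; apply/funext => -[|n]; rewrite /= powserD powserN //= subr0. Qed.
HB.instance Definition _ := GRing.isZmodMorphism.Build _ _ powserC powserC_additive.
Fact powserC_multiplicative : monoid_morphism powserC.
Proof.
split; first by apply/funext => -[|n].
by move=> a b; apply/funext => n; rewrite powserCM /powserC; case: n => [|n] //=; rewrite mulr0.
Qed.
HB.instance Definition _ := GRing.isMonoidMorphism.Build _ _ powserC powserC_multiplicative.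

Lemma powserXM f n : (powserX * f) n = if n is m.+1 then f m else 0.
Proof.
case: n => [|n]; first by rewrite powserM0 mul0r.
rewrite powserM big_ord_recl /= mul0r add0r big_ord_recl /= mul1r subn1 /=.
by rewrite big1 ?addr0 // => i _; rewrite mul0r.
Qed.

Definition order_ge n f := forall m, (m < n)%N -> f m = 0.

Lemma order_ge0 f : order_ge 0 f. Proof. by []. Qed.

Lemma order_geW m n f : (m <= n)%N -> order_ge n f -> order_ge m f.
Proof. by move=> mn h k km; apply: h; exact: leq_trans mn. Qed.

Lemma order_geD n f g : order_ge n f -> order_ge n g -> order_ge n (f + g).
Proof. by move=> hf hg m mn; rewrite powserD hf // hg // addr0. Qed.

Lemma order_geN n f : order_ge n f -> order_ge n (- f).
Proof. by move=> hf m mn; rewrite powserN hf // oppr0. Qed.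

Lemma order_ge_sum n I (r : seq I) (P : pred I) (F : I -> powser K) :
  (forall i, P i -> order_ge n (F i)) -> order_ge n (\sum_(i <- r | P i) F i).
Proof. by move=> h m mn; rewrite powser_sum big1 // => i /h; exact. Qed.

Lemma order_geM m n f g : order_ge m f -> order_ge n g ->
  order_ge (m + n) (f * g) /\ (f * g) (m + n)%N = f m * g n.
Proof.
move=> hf hg; split=> [k km|].
  rewrite powserM big1 // => i _; have [im|mi] := ltnP i m; first by rewrite hf ?mul0r.
  have ik : (i <= k)%N by rewrite -ltnS.
  by rewrite [g _]hg ?mulr0 // ltn_subLR // (leq_trans km) // leq_add2r.
have mo : (m < (m + n).+1)%N by rewrite ltnS leq_addr.
rewrite powserM (bigD1 (Ordinal mo)) //= addKn big1 ?addr0 // => i im.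
have {}im : (i : nat) != m by apply: contraNneq im => im; apply/eqP/val_inj.
have [lt|gt] := ltnP i m; first by rewrite hf ?mul0r.
rewrite [g _]hg ?mulr0 // ltn_subLR ?ltn_add2r; first by rewrite ltn_neqAle eq_sym im gt.
by rewrite -ltnS.
Qed.

Lemma order_geX m f : order_ge m f -> forall k, order_ge (k * m) (f ^+ k).
Proof.
move=> hf; elim=> [|k IH]; first by rewrite mul0n.
by rewrite exprS mulSn; exact: (order_geM hf IH).1.
Qed.

Lemma order_ge_eq0 f : (forall n, order_ge n f) -> f = 0.
Proof. by move=> h; apply/funext => n; exact: (h n.+1). Qed.

Lemma powser_order f : f != 0 -> exists2 n, order_ge n f & f n != 0.
Proof.
move=> f0; have : exists n, f n != 0.
  apply: contrapT => h; move/eqP: f0; apply; apply/funext => n.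
  by apply/eqP; apply: contrapT => /negP ?; apply: h; exists n.
move=> ex; exists (ex_minn ex); case: ex_minnP => // m _ mn k km.
by apply/eqP; apply: contraTT km => /mn; rewrite -leqNgt.
Qed.

Definition no_zero_divisor (A : comNzRingType) :=
  forall a b : A, a * b = 0 -> a = 0 \/ b = 0.

Lemma powser_no_zero_divisor : no_zero_divisor K -> no_zero_divisor (powser K).
Proof.
move=> dom f g fg; apply: contrapT => /not_orP[/eqP/powser_order[m hf fm] /eqP/powser_order[n hg gn]].
have [_] := order_geM hf hg; rewrite fg powser0 => /esym/dom[] /eqP.
  by rewrite (negPf fm).
by rewrite (negPf gn).
Qed.

Lemma powser_inv f : (exists c, f 0%N * c = 1) -> exists g, f * g = 1.
Proof.
case=> c fc; pose h : powser K := 1 - powserC c * f.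
have h1 : order_ge 1 h.
  by move=> [|//] _; rewrite /h powserD powserN powserCM mulrC fc subrr.
(* The geometric series of h, read diagonally: as h has no constant term, longer partial sums have
   the same coefficient of index n. *)
pose g : powser K := fun n => (\sum_(k < n.+1) h ^+ k) n.
have gE n N : (n <= N)%N -> g n = (\sum_(k < N.+1) h ^+ k) n.
  move=> nN; rewrite /g !powser_sum (big_ord_widen N.+1 (fun k => (h ^+ k) n)) ?ltnS //.
  rewrite big_mkcond; apply: eq_bigr => k _; case: ltnP => // nk.
  by rewrite (@order_geX _ _ h1 k) // muln1.
suff hg : (1 - h) * g = 1.
  by exists (powserC c * g); rewrite mulrCA mulrA -hg /h opprB addrCA subrr addr0.
apply/funext => n; rewrite powserM.
rewrite (eq_bigr (fun i : 'I_n.+1 => (1 - h) i * (\sum_(k < n.+1) h ^+ k) (n - i)%N)); last first.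
  by move=> i _; rewrite (gE _ n) // leq_subr.
rewrite -powserM -opprB mulNr -subrX1 opprB powserD powserN.
by rewrite (@order_geX _ _ h1 n.+1) ?muln1 // subr0.
Qed.

End SeriesRing.

Section SeriesMap.
Variables (K L : comNzRingType) (phi : {rmorphism K -> L}).

Definition powser_map (f : powser K) : powser L := fun n => phi (f n).

Fact powser_map_additive : zmod_morphism powser_map.
Proof. by move=> f g; apply/funext => n; exact: rmorphB. Qed.
HB.instance Definition _ := GRing.isZmodMorphism.Build _ _ powser_map powser_map_additive.
Fact powser_map_multiplicative : monoid_morphism powser_map.
Proof.
split; first by apply/funext => n; exact: rmorph_nat.
move=> f g; apply/funext => n; rewrite powserM /powser_map powserM rmorph_sum.
by apply: eq_bigr => i _; rewrite rmorphM.
Qed.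
HB.instance Definition _ := GRing.isMonoidMorphism.Build _ _ powser_map powser_map_multiplicative.

End SeriesMap.

(** * Substitution of series without constant term in a series in two variables *)

Section Substitution.
Variables (L : comNzRingType) (s t : powser L).
Hypotheses (s1 : order_ge 1 s) (t1 : order_ge 1 t).
Implicit Types (F G : powser (powser L)) (q : {poly {poly L}}).

Definition eval2 q : powser L := (map_poly (fun c => (map_poly (@powserC L) c).[t]) q).[s].

Let ev_t : {poly L} -> powser L := fun c => (map_poly (@powserC L) c).[t].
Fact ev_t_additive : zmod_morphism ev_t.
Proof. by move=> a b; rewrite /ev_t rmorphB hornerD hornerN. Qed.
HB.instance Definition _ := GRing.isZmodMorphism.Build _ _ ev_t ev_t_additive.
Fact ev_t_multiplicative : monoid_morphism ev_t.
Proof.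
by split=> [|a b]; rewrite /ev_t ?rmorph1 ?hornerC // rmorphM hornerM.
Qed.
HB.instance Definition _ := GRing.isMonoidMorphism.Build _ _ ev_t ev_t_multiplicative.

Lemma eval2B q r : eval2 (q - r) = eval2 q - eval2 r.
Proof. by rewrite /eval2 (rmorphB (map_poly ev_t)) hornerD hornerN. Qed.

Lemma eval2M q r : eval2 (q * r) = eval2 q * eval2 r.
Proof. by rewrite /eval2 (rmorphM (map_poly ev_t)) hornerM. Qed.

Lemma eval2_X : eval2 'X = s.
Proof. by rewrite /eval2 (map_polyX ev_t) hornerX. Qed.

Lemma eval2_Y : eval2 'X%:P = t.
Proof. by rewrite /eval2 (map_polyC ev_t) hornerC /= /ev_t map_polyX hornerX. Qed.

Lemma eval2_C c : eval2 c%:P%:P = powserC c.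
Proof. by rewrite /eval2 (map_polyC ev_t) hornerC /= /ev_t map_polyC hornerC. Qed.

(** A monomial with an exponent at least N becomes a multiple of [s ^+ N] or [t ^+ N], hence of
    order at least N. *)
Lemma eval2_small N q : (forall i j, (i < N)%N -> (j < N)%N -> q`_i`_j = 0) ->
  order_ge N (eval2 q).
Proof.
have pw (u : powser L) k : order_ge 1 u -> order_ge k (u ^+ k).
  by move=> u1; have := @order_geX _ _ _ u1 k; rewrite muln1.
move=> hq; rewrite /eval2 horner_coef; apply: order_ge_sum => i _.
rewrite (coef_map ev_t) /ev_t; have [Ni|iN] := leqP N i.
  rewrite mulrC -[N]addn0 => m mN.
  exact: (order_geM (order_geW Ni (pw _ _ s1)) (@order_ge0 _ _)).1.
rewrite -[N]addn0 => m mN; apply: ((order_geM (m := N) (n := 0) _ _).1) mN => // {m}.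
change (order_ge N (map_poly (@powserC L) q`_i).[t]).
rewrite horner_coef; apply: order_ge_sum => j _; rewrite coef_map /=.
have [Nj|jN] := leqP N j; last by rewrite hq // rmorph0 mul0r.
rewrite mulrC -[N]addn0 => m mN.
exact: (order_geM (order_geW Nj (pw _ _ t1)) (@order_ge0 _ _)).1.
Qed.

Definition trunc2 N F : {poly {poly L}} := \poly_(i < N) truncate N (F i).

Lemma coef_trunc2 N F i j : (i < N)%N -> (j < N)%N -> (trunc2 N F)`_i`_j = F i j.
Proof. by move=> iN jN; rewrite coef_poly iN coef_truncate. Qed.

(* As [s] and [t] have no constant term, the coefficient of index [n] only
   depends on a truncation of [F]. *)
Definition subst2 F : powser L := fun n => eval2 (trunc2 n.+1 F) n.

Lemma subst2_eval N F q : (forall i j, (i < N)%N -> (j < N)%N -> q`_i`_j = F i j) ->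
  order_ge N (subst2 F - eval2 q).
Proof.
move=> hq m mN; rewrite powserD powserN /subst2 -powserN -powserD -eval2B.
apply: (@eval2_small m.+1) => // i j im jm; rewrite !coefB coef_trunc2 // hq ?subrr //.
  exact: leq_trans mN.
exact: leq_trans mN.
Qed.

Fact subst2_additive : zmod_morphism subst2.
Proof.
move=> F G; apply/funext => n.
have h u i j : (i < n.+1)%N -> (j < n.+1)%N -> (trunc2 n.+1 u)`_i`_j = u i j by exact: coef_trunc2.
have /subst2_eval/(_ n (ltnSn n)) : forall i j, (i < n.+1)%N -> (j < n.+1)%N ->
    (trunc2 n.+1 F - trunc2 n.+1 G)`_i`_j = (F - G) i j.
  by move=> i j im jm; rewrite !coefB !h.
by move=> /eqP; rewrite powserD powserN subr_eq0 eval2B => /eqP.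
Qed.

Fact subst2_multiplicative : monoid_morphism subst2.
Proof.
split.
  apply/funext => n; have /subst2_eval/(_ n (ltnSn n)) : forall i j, (i < n.+1)%N -> (j < n.+1)%N ->
    (1 : {poly {poly L}})`_i`_j = (1 : powser (powser L)) i j.
    by move=> [|i] [|j] _ _; rewrite coef1 /= ?coef0 ?coef1.
  move=> /eqP; rewrite powserD powserN subr_eq0 => /eqP ->.
  by rewrite /eval2 (rmorph1 (map_poly ev_t)) hornerC.
move=> F G; apply: subr0_eq; apply: order_ge_eq0 => N.
pose f := trunc2 N F; pose g := trunc2 N G.
have h u i j : (i < N)%N -> (j < N)%N -> (trunc2 N u)`_i`_j = u i j by exact: coef_trunc2.
have e1 : order_ge N (subst2 (F * G) - eval2 (f * g)).
  apply: subst2_eval => i j iN jN; rewrite coefM powserM powser_sum coef_sum.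
  apply: eq_bigr => a _; rewrite coefM powserM; apply: eq_bigr => b _.
  have aN : (a < N)%N by apply: leq_trans iN; rewrite ltnS -ltnS.
  have bN : (b < N)%N by apply: leq_trans jN; rewrite ltnS -ltnS.
  by rewrite !h // (leq_ltn_trans (leq_subr _ _)).
have eF : order_ge N (subst2 F - eval2 f) by apply: subst2_eval => i j; exact: h.
have eG : order_ge N (subst2 G - eval2 g) by apply: subst2_eval => i j; exact: h.
have -> : subst2 (F * G) - subst2 F * subst2 G = (subst2 (F * G) - eval2 (f * g)) -
   ((subst2 F - eval2 f) * subst2 G + (subst2 G - eval2 g) * eval2 f).
  by rewrite eval2M; ring.
apply: order_geD => //; apply: order_geN; apply: order_geD => m mN; rewrite -[N]addn0 in mN.
  exact: (order_geM eF (@order_ge0 _ _)).1.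
exact: (order_geM eG (@order_ge0 _ _)).1.
Qed.

End Substitution.

(** * Taylor series of rational functions *)

Section Evaluation.
Variable R : realType.
Implicit Types (q f g : {poly {poly R}}) (z : R * R).

(** In iterated polynomials the outer variable stands for x and the inner one for y; the degree in x
    is thus [size] and constants of K[y] are polynomials of size at most 1. *)
Definition ev q z : R := q.[z.1%:P].[z.2].

Definition dX q : {poly {poly R}} := q^`().
Definition dY q : {poly {poly R}} := map_poly (@deriv R) q.

Lemma evD f g z : ev (f + g) z = ev f z + ev g z. Proof. by rewrite /ev !hornerD. Qed.
Lemma evN f z : ev (- f) z = - ev f z. Proof. by rewrite /ev !hornerN. Qed.
Lemma evM f g z : ev (f * g) z = ev f z * ev g z. Proof. by rewrite /ev !hornerM. Qed.
Lemma evC c z : ev c%:P%:P z = c. Proof. by rewrite /ev !hornerC. Qed.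
Lemma evX z : ev 'X z = z.1. Proof. by rewrite /ev hornerX hornerC. Qed.
Lemma evY z : ev 'X%:P z = z.2. Proof. by rewrite /ev hornerC hornerX. Qed.
Lemma ev1 z : ev 1 z = 1. Proof. by rewrite /ev !hornerC. Qed.
Lemma evXn f n z : ev (f ^+ n) z = ev f z ^+ n. Proof. by rewrite /ev !horner_exp. Qed.
Definition evE := (evD, evN, evM, evC, evX, evY, ev1, evXn).

Lemma poly2_ind (Q : {poly {poly R}} -> Prop) :
  (forall c, Q c%:P%:P) -> Q 'X -> Q 'X%:P ->
  (forall f g, Q f -> Q g -> Q (f + g)) -> (forall f g, Q f -> Q g -> Q (f * g)) ->
  forall f, Q f.
Proof.
move=> QC QX QY QD QM; have QP (c : {poly R}) : Q c%:P.
  elim/poly_ind: c => [|c a IH]; first exact: (QC 0).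
  by rewrite polyCD polyCM; apply: QD => //; exact: QM.
by elim/poly_ind => [|f c IH]; [exact: (QC 0)|apply: QD => //; exact: QM].
Qed.

Lemma dX_M f g : dX (f * g) = dX f * g + f * dX g. Proof. exact: derivM. Qed.

Lemma dY_M f g : dY (f * g) = dY f * g + f * dY g.
Proof.
apply/polyP => n; rewrite coefD !coefM coef_map coefM raddf_sum -big_split.
by apply: eq_bigr => i _; rewrite /= !coef_map /= derivM.
Qed.

Lemma dX_D f g : dX (f + g) = dX f + dX g. Proof. exact: derivD. Qed.
Lemma dY_D f g : dY (f + g) = dY f + dY g. Proof. exact: raddfD. Qed.
Lemma dX_N f : dX (- f) = - dX f. Proof. exact: derivN. Qed.
Lemma dY_N f : dY (- f) = - dY f. Proof. exact: raddfN. Qed.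
Lemma dX_C c : dX c%:P = 0. Proof. exact: derivC. Qed.
Lemma dY_C c : dY c%:P%:P = 0. Proof. by rewrite /dY map_polyC /= derivC. Qed.
Lemma dX_X : dX 'X = 1. Proof. exact: derivX. Qed.
Lemma dY_Y : dY 'X%:P = 1. Proof. by rewrite /dY map_polyC /= derivX. Qed.
Lemma dY_X : dY 'X = 0.
Proof.
apply/polyP => n; rewrite coef_map coefX coef0 /=.
by case: eqP => _; rewrite ?deriv0 // -[1]/(1%:P) derivC.
Qed.

Lemma dXY f : dX (dY f) = dY (dX f).
Proof. by apply/polyP => n; rewrite coef_deriv !coef_map coef_deriv /= raddfMn. Qed.

Lemma ev_is_derive (V : normedModType R) (a b : V -> R) (x v : V) da db q :
  is_derive x v a da -> is_derive x v b db ->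
  is_derive x v (fun x => ev q (a x, b x)) (ev (dX q) (a x, b x) * da + ev (dY q) (a x, b x) * db).
Proof.
move=> ad bd; elim/poly2_ind: q => [c| | |f g|f g] /=.
- have -> : (fun x => ev c%:P%:P (a x, b x)) = cst c by apply/funext => y; rewrite evC.
  by apply: (is_derive_eq (is_derive_cst c x v)); rewrite dX_C dY_C /ev !horner0 !mul0r addr0.
- have -> : (fun x => ev 'X (a x, b x)) = a by apply/funext => y; rewrite evX.
  by apply: (is_derive_eq ad); rewrite dX_X dY_X ev1 /ev !horner0 mul0r addr0 mul1r.
- have -> : (fun x => ev 'X%:P (a x, b x)) = b by apply/funext => y; rewrite evY.
  by apply: (is_derive_eq bd); rewrite dX_C dY_Y ev1 /ev !horner0 mul0r add0r mul1r.
- move=> fd gd; have -> : (fun x => ev (f + g) (a x, b x)) = (fun x => ev f (a x, b x)) + (fun x => ev g (a x, b x)).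
    by apply/funext => y; rewrite evD.
  by apply: (is_derive_eq (is_deriveD fd gd)); rewrite dX_D dY_D !evD; ring.
move=> fd gd; have -> : (fun x => ev (f * g) (a x, b x)) = (fun x => ev f (a x, b x)) * (fun x => ev g (a x, b x)).
  by apply/funext => y; rewrite evM.
by apply: (is_derive_eq (is_deriveM fd gd)); rewrite dX_M dY_M !evD !evM /GRing.scale /=; ring.
Qed.

Lemma fst_is_derive z (v : R * R) : is_derive z v fst v.1.
Proof.
have D : (h^-1 *: ((fst \o shift z) (h *: v) - z.1)) @[h --> 0^'] --> v.1.
  apply: cvg_near_cst; near=> h.
  have h0 : h != 0 by near: h; exact: nbhs_dnbhs_neq.
  by rewrite /= addrK /GRing.scale /= mulKf.
by split; [apply/cvg_ex; exists v.1|exact: cvg_lim D].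
Unshelve. all: by end_near. Qed.

Lemma snd_is_derive z (v : R * R) : is_derive z v snd v.2.
Proof.
have D : (h^-1 *: ((snd \o shift z) (h *: v) - z.2)) @[h --> 0^'] --> v.2.
  apply: cvg_near_cst; near=> h.
  have h0 : h != 0 by near: h; exact: nbhs_dnbhs_neq.
  by rewrite /= addrK /GRing.scale /= mulKf.
by split; [apply/cvg_ex; exists v.2|exact: cvg_lim D].
Unshelve. all: by end_near. Qed.

Definition dpoly (i : 'I_2) q := if i == 0 then dX q else dY q.

Lemma dpoly_is_derive i q z : is_derive z (dir R i) (ev q) (ev (dpoly i q) z).
Proof.
have := @ev_is_derive _ fst snd z (dir R i) _ _ q (fst_is_derive _ _) (snd_is_derive _ _).
have -> : (fun x => ev q (x.1, x.2)) = ev q by apply/funext => -[].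
case: z => x y /= D; apply: (is_derive_eq D); rewrite /dpoly /dir.
by case: eqP => _; rewrite /= ?mulr0 ?mulr1 ?addr0 ?add0r.
Qed.

Lemma ev_continuous q : continuous (ev q).
Proof.
elim/poly2_ind: q => [c| | |f g fd gd|f g fd gd] z.
- have -> : ev c%:P%:P = cst c by apply/funext => y; rewrite evC.
  exact: cst_continuous.
- have -> : ev 'X = fst by apply/funext => y; rewrite evX.
  exact: cvg_fst.
- have -> : ev 'X%:P = snd by apply/funext => y; rewrite evY.
  exact: cvg_snd.
- have -> : ev (f + g) = ev f + ev g by apply/funext => y; rewrite evD.
  by apply: continuousD; [exact: fd|exact: gd].
have -> : ev (f * g) = ev f * ev g by apply/funext => y; rewrite evM.
by apply: continuousM; [exact: fd|exact: gd].
Qed.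

End Evaluation.

Section RationalFunctions.
Variables (R : realType) (p : R * R).
Implicit Types (F G : R * R -> R) (N D : {poly {poly R}}).

(** This class of germs is stable under products and partial derivatives, with explicit quotients.
    Commutation of derivatives and the Leibniz rule hold near p without any theory of analytic
    functions. *)
Definition rational_near F := exists N D, ev D p != 0 /\
  \forall z \near p, F z = ev N z / ev D z.

Lemma near_ev_neq0 D : ev D p != 0 -> \forall z \near p, ev D z != 0.
Proof.
move=> Dp; have /cvgrPdist_lt/(_ `|ev D p|) := @ev_continuous R D p.
rewrite normr_gt0 => /(_ Dp); apply: filterS => z; apply: contraTneq => ->.
by rewrite subr0 ltxx.
Qed.

Lemma ev_rational N : rational_near (ev N).
Proof.
by exists N, 1; rewrite ev1 oner_eq0; split=> //; near=> z; rewrite ev1 divr1.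
Unshelve. all: by end_near. Qed.

Lemma rationalM F G : rational_near F -> rational_near G -> rational_near (F * G).
Proof.
move=> [N [D [D0 FE]]] [N' [D' [D0' GE]]]; exists (N * N'), (D * D').
rewrite evM mulf_neq0 //; split=> //; near=> z.
have d : ev D z != 0 by near: z; exact: near_ev_neq0.
have d' : ev D' z != 0 by near: z; exact: near_ev_neq0.
have -> : (F * G) z = (ev N z / ev D z) * (ev N' z / ev D' z) by congr (_ * _); near: z.
by rewrite !evE; field; rewrite d d'.
Unshelve. all: by end_near. Qed.

Lemma rational_eq F G : (\forall z \near p, F z = G z) -> rational_near G -> rational_near F.
Proof.
move=> FG [N [D [D0 GE]]]; exists N, D; split=> //.
by near=> z; rewrite (near FG z) //; near: z.
Unshelve. all: by end_near. Qed.

Definition dquot i N D := dpoly i N * D - N * dpoly i D.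

Lemma quotient_is_derive i N D z : ev D z != 0 ->
  is_derive z (dir R i) (fun z => ev N z / ev D z) (ev (dquot i N D) z / ev (D ^+ 2) z).
Proof.
move=> Dz; have DD := dpoly_is_derive i D z; have Dv := @derivableV _ _ (ev D) z (dir R i) Dz (@ex_derive _ _ _ _ _ _ _ DD).
have E := @deriveV _ _ (ev D) z (dir R i) Dz (@ex_derive _ _ _ _ _ _ _ DD).
have DV := DeriveDef Dv E.
apply: (is_derive_eq (is_deriveM (dpoly_is_derive i N z) DV)).
by rewrite /dquot !evE (@derive_val _ _ _ _ _ _ _ DD) /GRing.scale /=; field.
Qed.

Lemma partial_near i F N D : ev D p != 0 -> (\forall z \near p, F z = ev N z / ev D z) ->
  \forall z \near p, is_derive z (dir R i) F (ev (dquot i N D) z / ev (D ^+ 2) z).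
Proof.
move=> D0 /near_join FE; near=> z.
have Dz : ev D z != 0 by near: z; exact: near_ev_neq0.
apply: near_eq_is_derive (quotient_is_derive i N Dz).
by have := near FE z; move=> /(_ _) h; apply: filterS (h _) => //= w ->.
Unshelve. all: by end_near. Qed.

Lemma rational_derive i F : rational_near F -> rational_near ('D_(dir R i) F).
Proof.
move=> [N [D [D0 FE]]]; exists (dquot i N D), (D ^+ 2).
rewrite evXn expf_neq0 //; split=> //.
by apply: filterS (partial_near i D0 FE) => z [].
Qed.

Lemma rational_near_derivable i F : rational_near F ->
  \forall z \near p, is_derive z (dir R i) F ('D_(dir R i) F z).
Proof.
move=> [N [D [D0 FE]]]; apply: filterS (partial_near i D0 FE) => z [? _].
exact: DeriveDef.
Qed.

Lemma rational_deriveM i F G : rational_near F -> rational_near G ->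
  \forall z \near p, 'D_(dir R i) (F * G) z = ('D_(dir R i) F * G + F * 'D_(dir R i) G) z.
Proof.
move=> /(rational_near_derivable i) hF /(rational_near_derivable i) hG.
apply: filterS2 hF hG => z dF dG; have := is_deriveM dF dG.
by move=> [_ ->]; rewrite addrC /GRing.scale /= mulrC.
Qed.

Lemma rational_deriveD i F G : rational_near F -> rational_near G ->
  \forall z \near p, 'D_(dir R i) (F + G) z = ('D_(dir R i) F + 'D_(dir R i) G) z.
Proof.
move=> /(rational_near_derivable i) hF /(rational_near_derivable i) hG.
by apply: filterS2 hF hG => z dF dG; have := is_deriveD dF dG => -[_ ->].
Qed.

Lemma near_derive i F G : (\forall z \near p, F z = G z) ->
  \forall z \near p, 'D_(dir R i) F z = 'D_(dir R i) G z.
Proof. by move=> /near_join; apply: filterS => z; exact: near_eq_derive. Qed.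

Lemma rational_deriveC F : rational_near F ->
  \forall z \near p, 'D_(dir R 0) ('D_(dir R 1) F) z = 'D_(dir R 1) ('D_(dir R 0) F) z.
Proof.
move=> [N [D [D0 FE]]].
have D2 : ev (D ^+ 2) p != 0 by rewrite evXn expf_neq0.
have d i : \forall z \near p, 'D_(dir R i) F z = ev (dquot i N D) z / ev (D ^+ 2) z.
  by apply: filterS (partial_near i D0 FE) => z [].
have d01 := partial_near 0 D2 (d 1); have d10 := partial_near 1 D2 (d 0).
near=> z; have [_ ->] : is_derive z (dir R 0) ('D_(dir R 1) F) (ev (dquot 0 (dquot 1 N D) (D ^+ 2)) z / ev ((D ^+ 2) ^+ 2) z) by near: z.
have [_ ->] : is_derive z (dir R 1) ('D_(dir R 0) F) (ev (dquot 1 (dquot 0 N D) (D ^+ 2)) z / ev ((D ^+ 2) ^+ 2) z) by near: z.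
congr (ev _ z / _); rewrite /dquot /dpoly /= !expr2.
by rewrite !(dX_M, dY_M, dX_D, dY_D, dX_N, dY_N) dXY (dXY D); ring.
Unshelve. all: by end_near. Qed.

End RationalFunctions.

Section SeriesDerivation.
Variable K : comNzRingType.
Implicit Types f g : powser K.

Definition powser_deriv f : powser K := fun n => f n.+1 *+ n.+1.

Lemma powser_derivM f g : powser_deriv (f * g) = powser_deriv f * g + f * powser_deriv g.
Proof.
apply/funext => n; pose T := @truncate K n.+2.
have TE u i : (i <= n.+1)%N -> (T u)`_i = u i by move=> le; rewrite coef_truncate.
have TD u i : (i <= n)%N -> ((T u)^`())`_i = powser_deriv u i by move=> le; rewrite coef_deriv TE.
have h u i : (i <= n)%N -> (T u)`_i = u i by move=> le; rewrite TE // leqW.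
rewrite powserD -[(powser_deriv f * g) n](esym (powser_mul_coef (TD f) (h g))).
rewrite -[(f * powser_deriv g) n](esym (powser_mul_coef (h f) (TD g))).
rewrite -coefD -derivM coef_deriv /powser_deriv.
by rewrite -[(f * g) n.+1](esym (powser_mul_coef (TE f) (TE g))).
Qed.

Lemma powserMn f m n : (f *+ m) n = f n *+ m.
Proof. by elim: m => [|m IH]; rewrite ?mulr0n // !mulrS -IH. Qed.

End SeriesDerivation.

Section PartialDerivations.
Variable K : comNzRingType.
Implicit Types S T : powser (powser K).

Definition ds S : powser (powser K) := powser_deriv S.
Definition dt S : powser (powser K) := fun i => powser_deriv (S i).

Lemma dt_M S T : dt (S * T) = dt S * T + S * dt T.
Proof.
apply/funext => i; rewrite powserD !powserM -big_split /= /dt powserM.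
have derD (u v : powser K) : powser_deriv (u + v) = powser_deriv u + powser_deriv v.
  by apply/funext => n; rewrite /powser_deriv !powserD mulrnDl.
have der0 : powser_deriv (0 : powser K) = 0 by apply/funext => n; rewrite /powser_deriv mul0rn.
rewrite (big_morph _ derD der0); apply: eq_bigr => a _; exact: powser_derivM.
Qed.

End PartialDerivations.

Section Taylor.
Variables (R : realType) (p : R * R).
Implicit Types (F G : R * R -> R) (S : powser (powser R)).

Local Notation D := (fun (i : 'I_2) (F : R * R -> R) => ('D_(dir R i) F : R * R -> R)).

Lemma iter_near i n F G : (\forall z \near p, F z = G z) ->
  \forall z \near p, iter n (D i) F z = iter n (D i) G z.
Proof. by move=> FG; elim: n => //= n; exact: near_derive. Qed.

Lemma partial_eq i j F G : (\forall z \near p, F z = G z) -> partial i j F p = partial i j G p.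
Proof. by move=> FG; exact: nbhs_singleton (iter_near 0 i (iter_near 1 j FG)). Qed.

Lemma rational_iter i n F : rational_near p F -> rational_near p (iter n (D i) F).
Proof. by move=> Fr; elim: n => //= n; exact: rational_derive. Qed.

Lemma partial_dt i j F : partial i j (D 1 F) p = partial i j.+1 F p.
Proof. by rewrite /partial -iterSr. Qed.

(** [partial] differentiates in y first, so the additional x-derivative has to be moved across all
    the y-derivatives. *)
Lemma partial_ds i j F : rational_near p F -> partial i j (D 0 F) p = partial i.+1 j F p.
Proof.
move=> Fr; rewrite /partial iterSr.
suff h : \forall z \near p, iter j (D 1) (D 0 F) z = D 0 (iter j (D 1) F) z.
  exact: nbhs_singleton (iter_near 0 i h).
elim: j => [|j IH]; first by near=> z.
have hc := rational_deriveC (rational_iter 1 j Fr).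
apply: filterS2 (near_derive 1 IH) hc => z /= -> ->.
by [].
Unshelve. all: by end_near. Qed.

Definition taylor2 F : powser (powser R) := taylor F p.

Lemma fact_neq0 n : (n`!%:R : R) != 0.
Proof. by rewrite pnatr_eq0 -lt0n fact_gt0. Qed.

Lemma taylor_dt F : taylor2 (D 1 F) = dt (taylor2 F).
Proof.
apply/funext => i; apply/funext => j; rewrite /taylor2 /taylor /dt /powser_deriv partial_dt.
rewrite factS natrM -mulr_natr; field.
by rewrite !fact_neq0 addrC natr1 pnatr_eq0.
Qed.

Lemma taylor_ds F : rational_near p F -> taylor2 (D 0 F) = ds (taylor2 F).
Proof.
move=> Fr; apply/funext => i; apply/funext => j.
rewrite /taylor2 /taylor /ds /powser_deriv powserMn partial_ds //.
rewrite factS natrM -mulr_natr; field.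
by rewrite !fact_neq0 addrC natr1 pnatr_eq0.
Qed.

Lemma taylor_eq F G : (\forall z \near p, F z = G z) -> taylor2 F = taylor2 G.
Proof. by move=> FG; apply/funext => i; apply/funext => j; rewrite /taylor2 /taylor (partial_eq _ _ FG). Qed.

Lemma taylor00 F : taylor2 F 0%N 0%N = F p.
Proof. by rewrite /taylor2 /taylor /partial /= mulr1 divr1. Qed.

Lemma partialD i j F G : rational_near p F -> rational_near p G ->
  partial i j (F + G) p = partial i j F p + partial i j G p.
Proof.
move=> Fr Gr; have h k n F' G' : rational_near p F' -> rational_near p G' ->
   \forall z \near p, iter n (D k) (F' + G') z = (iter n (D k) F' + iter n (D k) G') z.
  move=> Fr' Gr'; elim: n => [|n IH]; first by near=> z.
  apply: filterS2 (near_derive k IH) (rational_deriveD k (rational_iter k n Fr') (rational_iter k n Gr')) => z /= -> ->.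
  by [].
have h1 := iter_near 0 i (h 1 j _ _ Fr Gr).
have h2 := h 0 i _ _ (rational_iter 1 j Fr) (rational_iter 1 j Gr).
by rewrite /partial (nbhs_singleton h1) (nbhs_singleton h2).
Unshelve. all: by end_near. Qed.

Lemma taylorD F G : rational_near p F -> rational_near p G ->
  taylor2 (F + G) = taylor2 F + taylor2 G.
Proof.
move=> Fr Gr; apply/funext => i; apply/funext => j.
by rewrite !powserD /taylor2 /taylor partialD // mulrDl.
Qed.

(** Both sides obey the Leibniz rule, and in characteristic 0 a coefficient of positive index is
    recovered from the differentiated series. Induction on the indices, for all F and G at once,
    leaves the value at p. *)
Lemma taylorM F G : rational_near p F -> rational_near p G ->
  taylor2 (F * G) = taylor2 F * taylor2 G.
Proof.
suff h i j F' G' : rational_near p F' -> rational_near p G' ->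
    taylor2 (F' * G') i j = (taylor2 F' * taylor2 G') i j.
  by move=> Fr Gr; apply/funext => i; apply/funext => j; exact: h.
have step k F1 G1 : rational_near p F1 -> rational_near p G1 ->
    taylor2 (D k (F1 * G1)) = taylor2 (D k F1 * G1) + taylor2 (F1 * D k G1).
  move=> Fr Gr; rewrite (taylor_eq (rational_deriveM k Fr Gr)) taylorD //.
    by apply: rationalM => //; exact: rational_derive.
  by apply: rationalM => //; exact: rational_derive.
have natS_inj n (a b : R) : a *+ n.+1 = b *+ n.+1 -> a = b.
  by move=> /eqP; rewrite -subr_eq0 -mulrnBl mulrn_eq0 /= subr_eq0 => /eqP.
elim: i j F' G' => [|i IH] j F' G'.
  elim: j F' G' => [|j IH] F' G' Fr Gr; first by rewrite !powserM0 !taylor00.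
  apply: (natS_inj j); have := congr1 (fun S => S 0%N j) (step 1 _ _ Fr Gr).
  rewrite taylor_dt !powserD !IH //; try exact: rational_derive.
  by rewrite !taylor_dt -!powserD -dt_M.
move=> Fr Gr; apply: (natS_inj i); have := congr1 (fun S => S i j) (step 0 _ _ Fr Gr).
rewrite (taylor_ds (rationalM Fr Gr)) !powserD !IH //; try exact: rational_derive.
rewrite !taylor_ds // -!powserD -powser_derivM /ds /powser_deriv !powserMn.
exact.
Qed.

End Taylor.

(** * Ideals of power series and multiplicities *)

Lemma nontrivial_kernel (K : fieldType) (I J : finType) (M : I -> J -> K) :
  (#|J| < #|I|)%N ->
  exists2 c : I -> K, exists i, c i != 0 & forall j, \sum_i c i * M i j = 0.
Proof.
move=> JI; pose A := \matrix_(a < #|I|, b < #|J|) M (enum_val a) (enum_val b).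
have : kermx A != 0.
  by rewrite -mxrank_eq0 mxrank_ker subn_eq0 -ltnNge (leq_ltn_trans (rank_leq_col A)).
move=> /rowV0Pn[v /sub_kermxP vA /rV0Pn[a va]].
exists (fun i => v 0 (enum_rank i)); first by exists (enum_val a); rewrite enum_valK.
move=> j; have := congr1 (fun w : 'rV_#|J| => w 0 (enum_rank j)) vA.
rewrite !mxE => E; rewrite -[RHS]E (reindex (@enum_val I [pred x | true])) /=; last first.
  by exists enum_rank => x _; rewrite ?enum_valK ?enum_rankK.
by apply: eq_bigr => b _; rewrite mxE enum_valK enum_rankK.
Qed.

Section TwoVariableSeries.
Variable K : fieldType.
Notation S2 := (powser (powser K)).
Implicit Types (F G H A B : S2).

Definition s_ : S2 := powserX _.
Definition t_ : S2 := powserC (powserX _).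
Definition const2 (c : K) : S2 := powserC (powserC c).

Lemma const2M c F i j : (const2 c * F) i j = c * F i j.
Proof. by rewrite powserCM powserCM. Qed.

Lemma powser2M00 F G : (F * G) 0%N 0%N = F 0%N 0%N * G 0%N 0%N.
Proof. by rewrite !powserM0. Qed.

Lemma powser_split (A : comNzRingType) (f : powser A) :
  f = powserC (f 0%N) + powserX _ * (fun n => f n.+1).
Proof.
by apply/funext => n; rewrite powserD powserXM /powserC; case: n => [|n]; rewrite ?addr0 ?add0r.
Qed.

Lemma powser2_split F : exists A B, F = const2 (F 0%N 0%N) + s_ * A + t_ * B /\
  A 0%N 0%N = F 1%N 0%N /\ B 0%N 0%N = F 0%N 1%N.
Proof.
exists (fun n => F n.+1), (powserC (fun n => F 0%N n.+1)); split=> //.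
rewrite {1}[F]powser_split {1}[F 0%N]powser_split rmorphD rmorphM /const2 /s_ /t_.
by rewrite addrAC.
Qed.

Lemma powser2_dom F G : F * G = 0 -> F = 0 \/ G = 0.
Proof.
apply: powser_no_zero_divisor; apply: powser_no_zero_divisor => a b /eqP.
by rewrite mulf_eq0 => /orP[/eqP|/eqP]; [left|right].
Qed.

Lemma powser2_inv F : F 0%N 0%N != 0 -> exists G, F * G = 1.
Proof. by move=> F0; apply: powser_inv; apply: powser_inv; exists (F 0%N 0%N)^-1; rewrite mulfV. Qed.

Lemma fps2_mulE F G : fps2_mul F G = F * G.
Proof.
apply/funext => i; apply/funext => j; rewrite powserM powser_sum.
by apply: eq_bigr => a _; rewrite powserM.
Qed.

Lemma fps2_oneE : fps2_one K = (1 : S2).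
Proof.
apply/funext => i; apply/funext => j; rewrite /fps2_one powser1.
by case: i => [|i]; rewrite //= powser1.
Qed.

Definition in_ideal F G : set S2 := [set H | exists A B, H = A * F + B * G].

Lemma fps2_idealE F G : fps2_ideal F G = in_ideal F G.
Proof.
apply/seteqP; split=> H [A [B E]]; exists A, B; rewrite E !fps2_mulE //.
Qed.

Lemma in_idealD F G H H' : in_ideal F G H -> in_ideal F G H' -> in_ideal F G (H + H').
Proof. by move=> [A [B ->]] [A' [B' ->]]; exists (A + A'), (B + B'); ring. Qed.

Lemma in_idealM F G H A : in_ideal F G H -> in_ideal F G (A * H).
Proof. by move=> [A' [B' ->]]; exists (A * A'), (A * B'); ring. Qed.

Lemma in_ideal_sum F G I (r : seq I) (P : pred I) (E : I -> S2) :
  (forall i, P i -> in_ideal F G (E i)) -> in_ideal F G (\sum_(i <- r | P i) E i).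
Proof.
move=> h; apply: (big_ind (in_ideal F G)) => //; last by move=> x y; exact: in_idealD.
by exists 0, 0; rewrite !mul0r addr0.
Qed.

Lemma in_ideal_l F G : in_ideal F G F. Proof. by exists 1, 0; rewrite mul1r mul0r addr0. Qed.
Lemma in_ideal_r F G : in_ideal F G G. Proof. by exists 0, 1; rewrite mul1r mul0r add0r. Qed.

Lemma in_ideal_sub F G F' G' : in_ideal F' G' F -> in_ideal F' G' G ->
  in_ideal F G `<=` in_ideal F' G'.
Proof. by move=> hF hG _ [A [B ->]]; apply: in_idealD; exact: in_idealM. Qed.

Lemma linear_combE n (c : 'I_n -> K) (b : 'I_n -> fps2 K) :
  (fun i j => \sum_l c l * b l i j) = \sum_l const2 (c l) * (b l : S2).
Proof.
apply/funext => i; apply/funext => j; rewrite !powser_sum.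
by apply: eq_bigr => l _; rewrite const2M.
Qed.

Variable R : realType.

Lemma quotient_dim_le F G k (e : 'I_k -> S2) :
  (forall H, exists c : 'I_k -> K, in_ideal F G (H - \sum_l const2 (c l) * e l)) ->
  (quotient_dim R (fps2_ideal F G) <= (k%:R)%:E)%E.
Proof.
move=> span; apply: ge_ereal_sup => _ [n [b ind] <-]; rewrite lee_fin ler_nat leqNgt.
apply/negP => kn; have [M HM] := choice (fun l => span (b l)).
have [|c [l cl] cM] := @nontrivial_kernel K 'I_n 'I_k M; first by rewrite !card_ord.
move/eqP: cl; apply; apply: ind; rewrite fps2_idealE linear_combE.
have -> : \sum_l const2 (c l) * (b l : S2) =
    \sum_l const2 (c l) * (b l - \sum_m const2 (M l m) * e m).
  under [RHS]eq_bigr do rewrite mulrBr; rewrite sumrB.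
  rewrite [X in _ - X](_ : _ = 0) ?subr0 //.
  under eq_bigr do rewrite mulr_sumr; rewrite exchange_big big1 //= => m _.
  under eq_bigr do rewrite mulrA; rewrite -mulr_suml.
  rewrite (_ : \sum_i const2 (c i) * const2 (M i m) = const2 (\sum_i c i * M i m)).
    by rewrite cM /const2 !rmorph0 mul0r.
  by rewrite /const2 !rmorph_sum; apply: eq_bigr => i _; rewrite !rmorphM.
by apply: in_ideal_sum => i _; exact: in_idealM.
Qed.

Lemma quotient_dim_ge F G k (e : 'I_k -> S2) :
  (forall c : 'I_k -> K, in_ideal F G (\sum_l const2 (c l) * e l) -> forall l, c l = 0) ->
  ((k%:R)%:E <= quotient_dim R (fps2_ideal F G))%E.
Proof.
move=> ind; apply: ereal_sup_ubound; exists k => //; exists e => c.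
by rewrite fps2_idealE linear_combE; exact: ind.
Qed.

Lemma quotient_dim_gen F G F' G' : in_ideal F G F' -> in_ideal F G G' ->
  in_ideal F' G' F -> in_ideal F' G' G ->
  quotient_dim R (fps2_ideal F G) = quotient_dim R (fps2_ideal F' G').
Proof.
move=> h1 h2 h3 h4; congr quotient_dim; rewrite !fps2_idealE.
by apply/seteqP; split; exact: in_ideal_sub.
Qed.

Lemma powserXn_inj (A : comNzRingType) n (f : powser A) m : (powserX A ^+ n * f) (n + m)%N = f m.
Proof.
by elim: n => [|n IH]; rewrite ?expr0 ?mul1r // exprS -mulrA addSn powserXM.
Qed.

Lemma powserXn_small (A : comNzRingType) n (f : powser A) m : (m < n)%N -> (powserX A ^+ n * f) m = 0.
Proof.
elim: n m => [//|n IH] m mn; rewrite exprS -mulrA powserXM.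
by case: m mn => // m mn; exact: IH.
Qed.

(* Powers of [s] and [t] in the ideal make (F, G) a regular sequence. *)
Lemma regular F G k k' : G != 0 -> in_ideal F G (s_ ^+ k) -> in_ideal F G (t_ ^+ k') ->
  forall H A, F * H = A * G -> exists B, H = B * G.
Proof.
move=> G0 [a [b Es]] [a' [b' Et]] H A E.
pose g := a * A + b * H; pose g' := a' * A + b' * H.
have sG : s_ ^+ k * H = g * G by rewrite Es /g mulrDl mulrDl -!mulrA (mulrC F) [H * F]mulrC E; ring.
have tG : t_ ^+ k' * H = g' * G by rewrite Et /g' mulrDl mulrDl -!mulrA E; ring.
have gg : t_ ^+ k' * g = s_ ^+ k * g'.
  have : G * (t_ ^+ k' * g - s_ ^+ k * g') = 0.
    have -> : G * (t_ ^+ k' * g - s_ ^+ k * g') = t_ ^+ k' * (g * G) - s_ ^+ k * (g' * G) by ring.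
    by rewrite -sG -tG; ring.
  by move=> /powser2_dom[/eqP|/eqP]; [rewrite (negPf G0)|rewrite subr_eq0 => /eqP].
have gi i : (i < k)%N -> g i = 0.
  move=> ik; have := congr1 (fun S : S2 => S i) gg; rewrite powserXn_small //.
  rewrite /t_ -rmorphXn powserCM => gi; apply/funext => j.
  by rewrite -(powserXn_inj k' (g i) j) gi.
pose q : S2 := fun i => g (k + i)%N; have gE : g = s_ ^+ k * q.
  apply/funext => i; have [ik|ki] := ltnP i k; first by rewrite gi // powserXn_small.
  by rewrite -(subnKC ki) powserXn_inj.
exists q; apply/eqP; rewrite -subr_eq0; apply/eqP.
have : s_ ^+ k * (H - q * G) = 0.
  by rewrite mulrBr sG mulrA -gE subrr.
move=> /powser2_dom[s0|//]; have := congr1 (fun S : S2 => (S * 1) k 0%N) s0.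
have := @powserXn_inj (powser K) k 1 0; rewrite addn0 /s_ => -> /eqP.
by rewrite mulr1 /= powser1 oner_eq0.
Qed.

End TwoVariableSeries.

(** * The order of a Takens form *)

Section SubstitutionOrder.
Variables (K : fieldType) (P1 : powser (powser K)).
Notation S2 := (powser (powser K)).
Implicit Types H : S2.
Hypothesis P10 : P1 0%N 0%N = 0.

Lemma expr_fps2 H k : iter k (fps2_mul H) (fps2_one K) = H ^+ k.
Proof. by elim: k => [|k IH]; [rewrite fps2_oneE|rewrite iterS IH fps2_mulE exprS]. Qed.

Lemma expr_small H k i j : H 0%N 0%N = 0 -> (i + j < k)%N -> (H ^+ k) i j = 0.
Proof.
move=> H0; elim: k i j => // k IH i j ik; rewrite exprS powserM powser_sum.
apply: big1 => a _; rewrite powserM big1 // => b _.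
have [/eqP|ab] := posnP (a + b); first by rewrite addn_eq0 => /andP[/eqP -> /eqP ->]; rewrite H0 mul0r.
rewrite IH ?mulr0 //; have := ltn_ord a; have := ltn_ord b; lia.
Qed.

(* [f (P1)] is [P1 ^ k] times a unit when [f] has order [k]. *)
Lemma subst_order (f : nat -> K) k : (forall l, (l < k)%N -> f l = 0) ->
  fps2_subst f P1 = P1 ^+ k * (fps2_subst (fun l => f (k + l)%N) P1 : S2).
Proof.
move=> fk.
have big g N i j : (i + j < N)%N -> (fps2_subst g P1 : S2) i j = (\sum_(l < N) const2 (g l) * P1 ^+ l) i j.
  move=> ijN; rewrite /fps2_subst !powser_sum (big_ord_widen N (fun l => g l * iter l (fps2_mul P1) (fps2_one K) i j)) //.
  rewrite big_mkcond; apply: eq_bigr => l _; rewrite const2M expr_fps2.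
  by case: ltnP => // h; rewrite expr_small ?mulr0.
apply/funext => i; apply/funext => j; pose N := (i + j).+1.
rewrite (big f (k + N)%N); last by rewrite /N; lia.
rewrite big_split_ord /= big1 ?add0r; last first.
  by move=> l _; rewrite fk // /const2 !rmorph0 mul0r.
rewrite (_ : \sum_(l < N) const2 (f (k + l)%N) * P1 ^+ (k + l) =
   P1 ^+ k * \sum_(l < N) const2 (f (k + l)%N) * P1 ^+ l); last first.
  by rewrite mulr_sumr; apply: eq_bigr => l _; rewrite exprD; ring.
rewrite -!fps2_mulE; apply: eq_bigr => a _; apply: eq_bigr => b _; congr (_ * _).
rewrite (big _ N) //.
by rewrite /N; have := ltn_ord a; have := ltn_ord b; lia.
Qed.

End SubstitutionOrder.

Section Coordinates.
Variable (K : fieldType) (P1 P2 : powser (powser K)).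
Notation S2 := (powser (powser K)).
Implicit Types (F G H A B : S2).
Hypothesis P10 : P1 0%N 0%N = 0.
Hypothesis P20 : P2 0%N 0%N = 0.
Hypothesis det0 : P1 1%N 0%N * P2 0%N 1%N - P1 0%N 1%N * P2 1%N 0%N != 0.

(** Cramer's rule: P1 and P2 are combinations of s and t with a matrix of series whose determinant
    is a unit. The formal inverse of the change of coordinates is not constructed. *)
Lemma coordinates_st : in_ideal P1 P2 (s_ K) /\ in_ideal P1 P2 (t_ K).
Proof.
have [a11 [a12 [E1 [c11 c12]]]] := powser2_split P1.
have [a21 [a22 [E2 [c21 c22]]]] := powser2_split P2.
have [|e He] := @powser2_inv K (a11 * a22 - a12 * a21).
  by rewrite !powserD !powserN !powser2M00 c11 c12 c21 c22.
rewrite P10 /const2 !rmorph0 add0r in E1; rewrite P20 /const2 !rmorph0 add0r in E2.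
split; [exists (e * a22), (- (e * a12))|exists (- (e * a21)), (e * a11)]; rewrite E1 E2.
  have -> : e * a22 * (s_ K * a11 + t_ K * a12) + - (e * a12) * (s_ K * a21 + t_ K * a22) =
     s_ K * ((a11 * a22 - a12 * a21) * e) by ring.
  by rewrite He mulr1.
have -> : - (e * a21) * (s_ K * a11 + t_ K * a12) + e * a11 * (s_ K * a21 + t_ K * a22) =
   t_ K * ((a11 * a22 - a12 * a21) * e) by ring.
by rewrite He mulr1.
Qed.

Lemma coordinates_span H : exists A B, H = const2 (H 0%N 0%N) + A * P1 + B * P2.
Proof.
have [A [B [E _]]] := powser2_split H.
have [[a [b Es]] [a' [b' Et]]] := coordinates_st.
by exists (a * A + a' * B), (b * A + b' * B); rewrite {1}E Es Et; ring.
Qed.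

Lemma coordinates_span_pow k H : exists (c : 'I_k -> K) A B,
  H = \sum_l const2 (c l) * P1 ^+ l + A * P1 ^+ k + B * P2.
Proof.
elim: k H => [|k IH] H.
  by exists (fun=> 0), H, 0; rewrite big_ord0 expr0; ring.
have [A [B E]] := coordinates_span H; have [c [A' [B' E']]] := IH A.
exists (fun l => if unlift ord0 l is Some m then c m else H 0%N 0%N), A', (B' * P1 + B).
rewrite big_ord_recl unlift_none expr0 mulr1 {1}E E'.
under [in RHS]eq_bigr do rewrite liftK exprS mulrCA.
by rewrite -mulr_sumr exprS; ring.
Qed.

(** The constant term gives c 0 = 0. The rest is divisible by P1, which can be cancelled modulo P2
    because (P1, P2) is a regular sequence. *)
Lemma coordinates_free k (c : 'I_k -> K) :
  in_ideal P2 (P1 ^+ k) (\sum_l const2 (c l) * P1 ^+ l) -> forall l, c l = 0.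
Proof.
have [sI tI] := coordinates_st.
have P2n0 : P2 != 0.
  by apply: contraNneq det0 => ->; rewrite mulr0 mulr0 subrr.
have reg := @regular K P1 P2 1 1 P2n0; rewrite !expr1 in reg; have {}reg := reg sI tI.
elim: k c => [|k IH] c; first by move=> _ [].
move=> [A [B E]].
have c0 : c ord0 = 0.
  have := congr1 (fun S : S2 => S 0%N 0%N) E.
  rewrite /= !powserD !powser_sum powser2M00 P20 mulr0 add0r.
  rewrite exprS powser2M00 [(P1 * _) _ _]powser2M00 P10 mul0r mulr0.
  rewrite big_ord_recl const2M (_ : (P1 ^+ _) _ _ = 1) ?mulr1 //.
  by rewrite big1 ?addr0 // => i _; rewrite exprS powser2M00 [(P1 * _) _ _]powser2M00 P10 mul0r mulr0.
have [B' EB'] : exists B', \sum_(l < k) const2 (c (lift ord0 l)) * P1 ^+ l - B * P1 ^+ k = B' * P2.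
  apply: (reg _ A); apply/eqP; rewrite -subr_eq0; apply/eqP.
  move: E; rewrite big_ord_recl c0 {1}/const2 !rmorph0 mul0r add0r.
  under eq_bigr do rewrite exprS mulrCA.
  by rewrite -mulr_sumr exprS => E; rewrite mulrBr E; ring.
have h := IH (fun l => c (lift ord0 l)).
have {}h : forall l, c (lift ord0 l) = 0.
  by apply: h; exists B', B; rewrite -EB' subrK.
by move=> l; case: (unliftP ord0 l) => [m|] ->.
Qed.

Lemma coordinates_dim (R : realType) k :
  quotient_dim R (fps2_ideal P2 (P1 ^+ k)) = (k%:R)%:E.
Proof.
apply/eqP; rewrite eq_le; apply/andP; split.
  apply: (@quotient_dim_le K R P2 (P1 ^+ k) k (fun l => P1 ^+ l)) => H.
  have [c [A [B E]]] := coordinates_span_pow k H.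
  by exists c, B, A; rewrite E; ring.
by apply: (@quotient_dim_ge K R P2 (P1 ^+ k) k (fun l => P1 ^+ l)) => c; exact: coordinates_free.
Qed.

Lemma coordinates_dim0 (R : realType) : quotient_dim R (fps2_ideal P2 (0 : S2)) = +oo%E.
Proof.
apply: eq_infty => r; pose k := `|Num.ceil r|%N.
apply: (@le_trans _ _ (k%:R)%:E).
  by rewrite lee_fin (le_trans (ceil_ge r)) // /k pmulrn ler_int lez_abs.
apply: (@quotient_dim_ge K R P2 0 k (fun l => P1 ^+ l)) => c [A [B E]].
by apply: coordinates_free; exists A, 0; rewrite E mulr0 mul0r.
Qed.

Variables (X1 X2 : S2) (f g : nat -> K).
Hypothesis E1 : ds P1 * X1 + dt P1 * X2 = P2.
Hypothesis E2 : ds P2 * X1 + dt P2 * X2 = (fps2_subst f P1 : S2) + P2 * (fps2_subst g P1 : S2).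

(** The conjugacy equations say that the Jacobian matrix of the change of coordinates sends (X1, X2)
    to (P2, f(P1) + P2 g(P1)). Its determinant is a unit, so both pairs generate the same ideal. *)
Lemma takens_ideal (R : realType) : quotient_dim R (fps2_ideal X1 X2) =
  quotient_dim R (fps2_ideal P2 (fps2_subst f P1)).
Proof.
set S := (fps2_subst f P1 : S2); set T := (fps2_subst g P1 : S2).
have ES : S = ds P2 * X1 + dt P2 * X2 - P2 * T by rewrite E2 addrK.
have [|e He] := @powser2_inv K (ds P1 * dt P2 - dt P1 * ds P2).
  by rewrite !powserD !powserN !powser2M00; exact: det0.
apply: (@quotient_dim_gen K R X1 X2 P2 S).
- by exists (ds P1), (dt P1); rewrite E1.
- exists (ds P2 - ds P1 * T), (dt P2 - dt P1 * T); rewrite ES.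
  by rewrite -[P2 * T](congr1 ( *%R^~ T) E1); ring.
- exists (e * (dt P2 - dt P1 * T)), (- (e * dt P1)); rewrite -[X1 in LHS]mulr1 -He ES.
  have -> : e * (dt P2 - dt P1 * T) * P2 = e * (dt P2 - dt P1 * T) * (ds P1 * X1 + dt P1 * X2) by rewrite E1.
  by rewrite -[P2 * T](congr1 ( *%R^~ T) E1); ring.
exists (e * (ds P1 * T - ds P2)), (e * ds P1); rewrite -[X2 in LHS]mulr1 -He ES.
have -> : e * (ds P1 * T - ds P2) * P2 = e * (ds P1 * T - ds P2) * (ds P1 * X1 + dt P1 * X2) by rewrite E1.
by rewrite -[P2 * T](congr1 ( *%R^~ T) E1); ring.
Qed.

End Coordinates.

Section Takens.
Variable R : realType.
Notation toC := (powser_map (powser_map (real_complex R))).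

Lemma real_complex_neq0 (x : R) : x != 0 -> (x%:C)%C != 0.
Proof. by apply: contra => /eqP [->]. Qed.

Lemma toCE (F : powser (powser R)) i j : toC F i j = (F i j)%:C%C.
Proof. by []. Qed.

Lemma toC_subst (f : nat -> R) (P : powser (powser R)) :
  toC (fps2_subst f P) = fps2_subst (fun k => (f k)%:C%C) (toC P) :> powser (powser R[i]).
Proof.
apply/funext => i; apply/funext => j; rewrite toCE /fps2_subst rmorph_sum.
apply: eq_bigr => k _; rewrite rmorphM !expr_fps2; congr (_ * _).
exact: (congr1 (fun S : powser (powser R[i]) => S i j) (rmorphXn toC k P)).
Qed.

Lemma takens_multiplicity (X : R * R -> R * R) p (f g : nat -> R) : takens_form X p f g ->
  fps_ord f = multiplicity (vf_comp X 0) (vf_comp X 1) p.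
Proof.
move=> [P1 [P2 [[P10 P20 det] [E1 E2]]]].
pose Q1 := toC (P1 : powser (powser R)); pose Q2 := toC (P2 : powser (powser R)).
pose f' k := (f k)%:C%C; pose g' k := (g k)%:C%C.
have Q10 : Q1 0%N 0%N = 0 by exact: (congr1 (real_complex R) P10).
have Q20 : Q2 0%N 0%N = 0 by exact: (congr1 (real_complex R) P20).
have det' : Q1 1%N 0%N * Q2 0%N 1%N - Q1 0%N 1%N * Q2 1%N 0%N != 0.
  by have := real_complex_neq0 det; rewrite rmorphB !rmorphM.
pose Y i := toC (taylor (vf_comp X i) p : powser (powser R)).
have dsE (F : powser (powser R)) : fps2_ds F = ds F.
  by apply/funext => i; apply/funext => j; rewrite /ds /powser_deriv powserMn.
have dsC (F : powser (powser R)) : toC (ds F) = ds (toC F).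
  by apply/funext => i; apply/funext => j; rewrite toCE /ds /powser_deriv !powserMn rmorphMn.
have dtC (F : powser (powser R)) : toC (dt F) = dt (toC F).
  by apply/funext => i; apply/funext => j; rewrite toCE /dt /powser_deriv rmorphMn.
have E1' : ds Q1 * Y 0 + dt Q1 * Y 1 = Q2.
  rewrite /Q1 /Q2 /Y -dsC -dtC -!rmorphM -rmorphD; congr (toC _).
  by rewrite -E1 -dsE -!fps2_mulE.
have E2' : ds Q2 * Y 0 + dt Q2 * Y 1 = (fps2_subst f' Q1 : powser (powser R[i])) + Q2 * (fps2_subst g' Q1 : powser (powser R[i])).
  rewrite /Q1 /Q2 /Y -!toC_subst -dsC -dtC -!rmorphM -!rmorphD; congr (toC _).
  by rewrite -dsE -!fps2_mulE; exact: E2.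
have ->: multiplicity (vf_comp X 0) (vf_comp X 1) p = quotient_dim R (fps2_ideal (Y 0) (Y 1)) by [].
rewrite (takens_ideal det' E1' E2').
have [[k fk]|f0] := pselect (exists k, f k != 0); last first.
  have {}f0 k : f k = 0 by apply/eqP; apply: contrapT => /negP h; apply: f0; exists k.
  rewrite (_ : fps2_subst f' Q1 = (0 : powser (powser R[i]))); last first.
    apply/funext => i; apply/funext => j; rewrite /fps2_subst big1 // => k _.
    by rewrite /f' f0 rmorph0 mul0r.
  rewrite (coordinates_dim0 Q10 Q20 det') /fps_ord.
  rewrite (_ : [set k | f k != 0] = set0) ?image_set0 ?ereal_inf0 //.
  by apply/seteqP; split=> k //=; rewrite f0 eqxx.
have ex : exists k, f k != 0 by exists k.
have [m fm mmin] := ex_minnP ex.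
have fl l : (l < m)%N -> f l = 0.
  by move=> lm; apply/eqP; apply: contraTT lm => /mmin; rewrite -leqNgt.
have ->: fps_ord f = (m%:R)%:E.
  apply/eqP; rewrite eq_le; apply/andP; split; first by apply: ereal_inf_lbound; exists m.
  by apply: le_ereal_inf_tmp => _ [l /= /mmin ml <-]; rewrite lee_fin ler_nat.
rewrite (subst_order Q10 (_ : forall l, (l < m)%N -> f' l = 0)); last by move=> l /fl; rewrite /f' => ->; rewrite rmorph0.
set W := (fps2_subst _ Q1 : powser (powser R[i])).
have [|V WV] := @powser2_inv _ W.
  rewrite /W /fps2_subst big_ord1 /= /fps2_one eqxx mulr1 addn0 /f'.
  exact: real_complex_neq0.
rewrite -(coordinates_dim Q10 Q20 det' R m); symmetry; apply: quotient_dim_gen.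
- exact: in_ideal_l.
- by exists 0, V; rewrite mul0r add0r mulrCA [V * _]mulrC WV mulr1.
- exact: in_ideal_l.
by rewrite mulrC; apply: in_idealM; exact: in_ideal_r.
Qed.

End Takens.

(** * Laurent polynomials and multiplicities *)

Section Laurent.
Variable R : realType.
Implicit Types (A B : laurent R) (z p : R * R).

Definition exponents_le k A :=
  forall m, m \in finsupp A -> (`|m.1| <= k)%N /\ (`|m.2| <= k)%N.

Lemma exponents_le_exists A : exists k, exponents_le k A.
Proof.
exists (\sum_(m <- finsupp A) (`|m.1| + `|m.2|))%N => m mA.
by rewrite (big_fsetD1 m) //=; split; lia.
Qed.

(* The polynomial [(x y)^k A]. *)
Definition lpoly k A : {poly {poly R}} :=
  \sum_(m <- finsupp A) (A m)%:P%:P * 'X^`|m.1 + k%:Z| * ('X%:P) ^+ `|m.2 + k%:Z|.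

Lemma ev_sum (I : Type) (r : seq I) (f : I -> {poly {poly R}}) z :
  ev (\sum_(i <- r) f i) z = \sum_(i <- r) ev (f i) z.
Proof.
have e0 : ev 0 z = 0 by rewrite /ev !horner0.
exact: (big_morph (fun f => ev f z) (fun f g => evD f g z) e0).
Qed.

Lemma ev_lpoly k A z : exponents_le k A -> z.1 != 0 -> z.2 != 0 ->
  ev (lpoly k A) z = (z.1 * z.2) ^+ k * laurent_eval A z.
Proof.
move=> kA z1 z2; rewrite /lpoly ev_sum /laurent_eval mulr_sumr.
rewrite big_seq [RHS]big_seq; apply: eq_bigr => m /kA[m1 m2]; rewrite !evE.
have h (x : R) (i : int) : x != 0 -> (`|i| <= k)%N -> x ^+ `|i + k%:Z| = x ^+ k * x ^ i.
  move=> x0 ik; rewrite -[RHS]/(x ^ (k%:Z) * x ^ i) -expfzDr // addrC.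
  have E : k%:Z + i = Posz (absz (k%:Z + i)) by lia.
  by rewrite {2}E.
by rewrite !h // exprMn; ring.
Qed.

Lemma coef_lpoly k A i j : exponents_le k A -> (lpoly k A)`_i`_j = A (i%:Z - k%:Z, j%:Z - k%:Z).
Proof.
move=> kA; rewrite /lpoly coef_sum coef_sum.
have h m : m \in finsupp A -> ((A m)%:P%:P * 'X^`|m.1 + k%:Z| * ('X%:P) ^+ `|m.2 + k%:Z|)`_i`_j =
    if m == (i%:Z - k%:Z, j%:Z - k%:Z) then A m else 0.
  move=> /kA[m1 m2]; rewrite -mulrA -rmorphXn /= coefCM coefMC coefXn.
  rewrite coefCM mulr_natl coefMn coefXn.
  case: m m1 m2 => a b /= m1 m2; rewrite xpair_eqE.
  have -> : (a == i%:Z - k%:Z) = (i == absz (a + k%:Z)) by apply/eqP/eqP; lia.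
  have -> : (b == j%:Z - k%:Z) = (j == absz (b + k%:Z)) by apply/eqP/eqP; lia.
  by case: eqP => _; case: eqP => _; rewrite /= ?mulr1 ?mulr0 ?mulr0n ?mulr1n.
rewrite big_seq (eq_bigr _ h) -big_seq.
have [mA|mA] := boolP ((i%:Z - k%:Z, j%:Z - k%:Z) \in finsupp A).
  rewrite (big_fsetD1 _ mA) /= eqxx big1_fset ?addr0 //.
  by move=> m; rewrite !inE => /andP[/negPf mm _] _; rewrite mm.
rewrite fsfun_dflt // big1_fset // => m mA' _; case: eqP => // E.
by rewrite -E mA' in mA.
Qed.

Lemma near_torus p : p.1 != 0 -> p.2 != 0 -> \forall z \near p, z.1 != 0 /\ z.2 != 0.
Proof.
case: p => a b /= a0 b0; have n1 := @near_fst _ R (fun t => t != 0) a b (open_nbhs_nbhs (conj (@open_neq _ _) a0)).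
have n2 := @near_snd R _ (fun t => t != 0) a b (open_nbhs_nbhs (conj (@open_neq _ _) b0)).
by apply: filterS2 n1 n2.
Qed.

Lemma laurent_rational A p : p.1 != 0 -> p.2 != 0 -> rational_near p (laurent_eval A).
Proof.
move=> p1 p2; have [k kA] := exponents_le_exists A.
exists (lpoly k A), (('X * 'X%:P) ^+ k); rewrite !evE expf_neq0 ?mulf_neq0 //.
split=> //; apply: filterS (near_torus p1 p2) => z [z1 z2].
by rewrite ev_lpoly // !evE mulrAC mulfV ?mul1r // expf_neq0 ?mulf_neq0.
Qed.

Lemma rationalV p (F : R * R -> R) : F p != 0 -> rational_near p F ->
  rational_near p (fun z => (F z)^-1).
Proof.
move=> F0 [N [D [D0 FE]]]; have E := nbhs_singleton FE.
exists D, N; split; last by apply: filterS FE => z ->; rewrite invfM invrK mulrC.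
by apply: contraNneq F0 => N0; rewrite E N0 mul0r.
Qed.

Lemma multiplicity_units p (F G F' G' U V U' V' : R * R -> R) :
  [/\ rational_near p U, rational_near p V, rational_near p U' & rational_near p V'] ->
  [/\ rational_near p F, rational_near p G, rational_near p F' & rational_near p G'] ->
  (\forall z \near p, [/\ F z = U z * F' z, G z = V z * G' z, F' z = U' z * F z & G' z = V' z * G z]) ->
  multiplicity F G p = multiplicity F' G' p.
Proof.
move=> [rU rV rU' rV'] [rF rG rF' rG'] nE.
have key (S T W : R * R -> R) : rational_near p T -> rational_near p W ->
    (\forall z \near p, S z = T z * W z) ->
    taylorC S p = (taylorC T p : powser (powser R[i])) * taylorC W p.
  move=> rT rW E; have E' := taylor_eq E; rewrite taylorM // in E'.
  have := rmorphM (powser_map (powser_map (real_complex R))) (taylor2 p T) (taylor2 p W).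
  by rewrite -E'.
apply: quotient_dim_gen.
- exists (taylorC U' p), 0; rewrite mul0r addr0; apply: key => //; by apply: filterS nE => z [].
- exists 0, (taylorC V' p); rewrite mul0r add0r; apply: key => //; by apply: filterS nE => z [].
- exists (taylorC U p), 0; rewrite mul0r addr0; apply: key => //; by apply: filterS nE => z [].
- exists 0, (taylorC V p); rewrite mul0r add0r; apply: key => //; by apply: filterS nE => z [].
Qed.

Section Field.
Variables (A B g1 g2 : laurent R) (p : R * R).
Hypotheses (p1 : p.1 != 0) (p2 : p.2 != 0).
Hypothesis hg : laurent_eval g1 p * laurent_eval g2 p != 0.
Let X := laurent_field A B g1 g2.

Let g10 : laurent_eval g1 p != 0. Proof. by move: hg; rewrite mulf_eq0 negb_or => /andP[]. Qed.
Let g20 : laurent_eval g2 p != 0. Proof. by move: hg; rewrite mulf_eq0 negb_or => /andP[]. Qed.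

Lemma fst_rational : rational_near p fst.
Proof. by have := ev_rational p 'X; congr (rational_near p _); apply/funext => z; rewrite evX. Qed.

Lemma snd_rational : rational_near p snd.
Proof. by have := ev_rational p 'X%:P; congr (rational_near p _); apply/funext => z; rewrite evY. Qed.

Lemma rational_neq0 (F : R * R -> R) : rational_near p F -> F p != 0 -> \forall z \near p, F z != 0.
Proof.
move=> [N [D [D0 FE]]]; rewrite (nbhs_singleton FE) => F0.
have N0 : ev N p != 0 by apply: contraNneq F0 => ->; rewrite mul0r.
apply: filterS3 FE (near_ev_neq0 N0) (near_ev_neq0 D0) => z -> h1 h2.
by rewrite mulf_neq0 // invr_neq0.
Qed.

Lemma field_rational i : rational_near p (vf_comp X i).
Proof.
have h (c : R * R -> R) (C g : laurent R) : rational_near p c -> laurent_eval g p != 0 ->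
    rational_near p (fun z => c z * (laurent_eval C z / laurent_eval g z)).
  move=> rc gp; apply: (@rationalM _ _ c); first exact: rc.
  apply: (@rationalM _ _ (laurent_eval C)); first exact: laurent_rational.
  by apply: rationalV => //; exact: laurent_rational.
rewrite /vf_comp; case: (i == 0); apply: h => //; [exact: fst_rational|exact: snd_rational].
Qed.

Lemma field_multiplicity :
  multiplicity (vf_comp X 0) (vf_comp X 1) p = multiplicity (laurent_eval A) (laurent_eval B) p.
Proof.
have rV (c : R * R -> R) (g : laurent R) : rational_near p c -> laurent_eval g p != 0 ->
    rational_near p (fun z => c z / laurent_eval g z).
  move=> rc gp; apply: (@rationalM _ _ c) => //.
  by apply: rationalV => //; exact: laurent_rational.
have rV' (c : R * R -> R) (g : laurent R) : rational_near p c -> c p != 0 ->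
    rational_near p (fun z => laurent_eval g z / c z).
  move=> rc cp; apply: (@rationalM _ _ (laurent_eval g)); first exact: laurent_rational.
  exact: rationalV.
apply: (@multiplicity_units p _ _ _ _ (fun z => z.1 / laurent_eval g1 z)
  (fun z => z.2 / laurent_eval g2 z) (fun z => laurent_eval g1 z / z.1) (fun z => laurent_eval g2 z / z.2)).
- split; [apply: rV => //; exact: fst_rational|apply: rV => //; exact: snd_rational|
    apply: (rV' fst) => //; exact: fst_rational|apply: (rV' snd) => //; exact: snd_rational].
- by split; [exact: field_rational|exact: field_rational|exact: laurent_rational|exact: laurent_rational].
have n1 := rational_neq0 (laurent_rational g1 p1 p2) g10.
have n2 := rational_neq0 (laurent_rational g2 p1 p2) g20.
apply: filterS3 n1 n2 (near_torus p1 p2) => z h1 h2 [z1 z2].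
by rewrite /vf_comp /= /X; split; field; rewrite ?h1 ?h2 ?z1 ?z2.
Qed.

End Field.

End Laurent.

(** * Second-order jets along a curve and the coefficient a *)

Section Quadratic.
Variable K : fieldType.
Notation S2 := (powser (powser K)).

Lemma powser2_split2 (F : S2) : exists A B C : S2,
  F = const2 (F 0%N 0%N) + s_ K * const2 (F 1%N 0%N) + t_ K * const2 (F 0%N 1%N) +
      s_ K ^+ 2 * A + s_ K * t_ K * B + t_ K ^+ 2 * C /\
  [/\ A 0%N 0%N = F 2%N 0%N, B 0%N 0%N = F 1%N 1%N & C 0%N 0%N = F 0%N 2%N].
Proof.
pose u : powser K := fun n => F 0%N n.+2.
pose v : powser K := fun n => F 1%N n.+1; pose W : S2 := fun n => F n.+2.
exists W, (powserC v), (powserC u); split=> //.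
have E0 : F 0%N = powserC (F 0%N 0%N) + powserX K * (powserC (F 0%N 1%N) + powserX K * u).
  exact: etrans (powser_split (F 0%N)) (congr1 (fun g => powserC _ + powserX K * g) (powser_split (fun n => F 0%N n.+1))).
have E1 : F 1%N = powserC (F 1%N 0%N) + powserX K * v := powser_split (F 1%N).
have E : F = powserC (F 0%N) + s_ K * (powserC (F 1%N) + s_ K * W).
  exact: etrans (powser_split F) (congr1 (fun g => powserC _ + powserX _ * g) (powser_split (fun n => F n.+1))).
rewrite {1}E {1}E0 {1}E1 !(rmorphD, rmorphM) /const2 /t_; ring.
Qed.

Variables (s t : powser K).
Hypotheses (s1 : order_ge 1 s) (t1 : order_ge 1 t).

Lemma subst2_const c : subst2 s t (const2 c) = powserC c.
Proof.
apply: subr0_eq; apply: order_ge_eq0 => N.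
rewrite -(eval2_C s t).
apply: subst2_eval => // i j _ _; rewrite coefC /const2 /powserC.
by case: i => [|i]; rewrite ?coefC ?coef0 //; case: j.
Qed.

Lemma subst2_s : subst2 s t (s_ K) = s.
Proof.
apply: subr0_eq; apply: order_ge_eq0 => N.
rewrite -[X in order_ge N (_ - X)](eval2_X s t).
apply: subst2_eval => // i j _ _; rewrite coefX /s_ /powserX.
by case: eqP => _; rewrite ?coefC ?coef0 //=; case: j.
Qed.

Lemma subst2_t : subst2 s t (t_ K) = t.
Proof.
apply: subr0_eq; apply: order_ge_eq0 => N.
rewrite -[X in order_ge N (_ - X)](eval2_Y s t).
apply: subst2_eval => // i j _ _; rewrite coefC /t_ /powserX /powserC.
by case: i => [|i]; rewrite ?coefX ?coef0.
Qed.

Lemma subst2_coef (F : S2) : F 0%N 0%N = 0 ->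
  [/\ subst2 s t F 0%N = 0,
      subst2 s t F 1%N = F 1%N 0%N * s 1%N + F 0%N 1%N * t 1%N &
      subst2 s t F 2%N = F 1%N 0%N * s 2%N + F 0%N 1%N * t 2%N +
        F 2%N 0%N * s 1%N ^+ 2 + F 1%N 1%N * (s 1%N * t 1%N) + F 0%N 2%N * t 1%N ^+ 2].
Proof.
move=> F0; have [A [B [C [E [A0 B0 C0]]]]] := powser2_split2 F.
have [H1 HM] := subst2_multiplicative s1 t1; have HB := subst2_additive s1 t1.
set H := subst2 s t in H1 HM HB *.
have H0 : H 0 = 0 by rewrite -(subrr 0) HB subrr.
have HD x y : H (x + y) = H x + H y by rewrite -{1}[y]opprK HB -[- y]sub0r HB H0 sub0r opprK.
have Hs : H (s_ K) = s by exact: subst2_s.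
have Ht : H (t_ K) = t by exact: subst2_t.
have Hc c : H (const2 c) = powserC c by exact: subst2_const.
have EH : H F = s * powserC (F 1%N 0%N) + t * powserC (F 0%N 1%N) + s * s * H A + s * t * H B + t * t * H C.
  by rewrite {1}E !expr2 !HD !HM Hs Ht !Hc F0 rmorph0 add0r.
have q (a b : powser K) (C' : S2) : order_ge 1 a -> order_ge 1 b ->
   [/\ (a * b * H C') 0%N = 0, (a * b * H C') 1%N = 0 & (a * b * H C') 2%N = a 1%N * b 1%N * C' 0%N 0%N].
  move=> a1 b1; have [hab eab] := order_geM a1 b1.
  have [habc eabc] := order_geM hab (@order_ge0 _ (H C')).
  split; [exact: habc|exact: habc|rewrite -[2%N]/(1 + 1 + 0)%N eabc eab; congr (_ * _)].
  have [A' [B' [E' _]]] := powser2_split C'.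
  rewrite {1}E' !HD !HM Hs Ht Hc !powserD !powserM0 (s1 (isT : (0 < 1)%N)) (t1 (isT : (0 < 1)%N)).
  by rewrite !mul0r !addr0.
have [u0 u1 u2] := q s s A s1 s1; have [v0 v1 v2] := q s t B s1 t1.
have [w0 w1 w2] := q t t C t1 t1.
have cs (a : powser K) c n : (a * powserC c) n = a n * c by rewrite mulrC powserCM mulrC.
rewrite EH !powserD u0 u1 u2 v0 v1 v2 w0 w1 w2 !cs (s1 (isT : (0 < 1)%N)) (t1 (isT : (0 < 1)%N)) A0 B0 C0.
by split; ring.
Qed.

End Quadratic.

(** Restriction to a smooth curve on which F and G have order 3 sends the ideal into series of order
    3. A linear form L of order exactly 1 along the curve keeps 1, L, L^2 independent. *)
Lemma multiplicity_ge3 (R : realType) (K : fieldType) (F G : powser (powser K)) (s t : powser K) :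
  order_ge 1 s -> order_ge 1 t -> (s 1%N != 0) || (t 1%N != 0) ->
  order_ge 3 (subst2 s t F) -> order_ge 3 (subst2 s t G) ->
  ((3%:R)%:E <= quotient_dim R (fps2_ideal F G))%E.
Proof.
move=> s1 t1 st oF oG.
have [l1 [l2 E1]] : exists l1 l2, l1 * s 1%N + l2 * t 1%N = 1.
  have [s0|s0] := eqVneq (s 1%N) 0; last by exists (s 1%N)^-1, 0; rewrite mulVf // mul0r addr0.
  by rewrite s0 eqxx in st; exists 0, (t 1%N)^-1; rewrite mulVf // mul0r add0r.
pose L := const2 l1 * s_ K + const2 l2 * t_ K.
apply: (@quotient_dim_ge K R F G 3 (fun l => L ^+ l)) => c [U [V E]].
have [H1 HM] := subst2_multiplicative s1 t1; have HB := subst2_additive s1 t1.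
set H := subst2 s t in H1 HM HB oF oG *.
have H0 : H 0 = 0 by rewrite -(subrr 0) HB subrr.
have HD x y : H (x + y) = H x + H y by rewrite -{1}[y]opprK HB -[- y]sub0r HB H0 sub0r opprK.
have Hc d : H (const2 d) = powserC d by exact: subst2_const.
pose l : powser K := powserC l1 * s + powserC l2 * t.
have HL : H L = l by rewrite HD !HM !Hc /H subst2_s // subst2_t.
have lE m : l m = l1 * s m + l2 * t m by rewrite /l powserD !powserCM.
have l_1 : order_ge 1 l by case=> // _; rewrite lE (s1 0%N isT) (t1 0%N isT) !mulr0 addr0.
have [ll_0 ll_2] := order_geM l_1 l_1.
have l1E : l 1%N = 1 by rewrite lE.
have small m : (m < 3)%N -> H (U * F + V * G) m = 0.
  move=> m3; rewrite HD !HM powserD (order_geM (@order_ge0 _ _) oF).1 //.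
  by rewrite (order_geM (@order_ge0 _ _) oG).1 // addr0.
have EH : H (\sum_l const2 (c l) * L ^+ l) =
    powserC (c 0) + powserC (c 1) * l + powserC (c ord_max) * (l * l).
  have i1 : lift ord0 ord0 = 1 :> 'I_3 by apply/val_inj.
  have i2 : lift ord0 (lift ord0 ord0) = ord_max :> 'I_3 by apply/val_inj.
  rewrite !big_ord_recl big_ord0 addr0 i1 i2 !HD !HM !Hc expr0 H1 mulr1 addrA.
  by rewrite -[H (L ^+ _)]/(H L) HL.
have q m : (m < 3)%N -> powserC (c 0) m + c 1 * l m + c ord_max * (l * l) m = 0.
  by move=> m3; rewrite -[RHS](small m m3) -E EH !powserD !powserCM.
have c0 : c 0 = 0.
  by have := q 0%N isT; rewrite (l_1 0%N isT) (ll_0 0%N isT) !mulr0 !addr0.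
have c1 : c 1 = 0.
  by have := q 1%N isT; rewrite c0 l1E (ll_0 1%N isT) mulr0 addr0 mulr1 rmorph0 add0r.
have c2 : c ord_max = 0.
  by have := q 2%N isT; rewrite c0 c1 mul0r rmorph0 !add0r -[2%N]/(1 + 1)%N ll_2 l1E !mulr1.
case=> -[|[|[|//]]] h.
- by rewrite -c0; congr c; apply/val_inj.
- by rewrite -c1; congr c; apply/val_inj.
- by rewrite -c2; congr c; apply/val_inj.
Qed.

Section DualBasis.
Variables (K : realType) (q0 q1 p0 p1 : 'cV[K]_2).
Hypotheses (h00 : dotp q0 p0 = 1) (h11 : dotp q1 p1 = 1) (h01 : dotp q0 p1 = 0) (h10 : dotp q1 p0 = 0).

Lemma dual_basis (w : 'cV[K]_2) : w = dotp w p0 *: q0 + dotp w p1 *: q1.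
Proof.
have h0 : (0 : 'I_2) = ord0 by []. have h1 : lift ord0 ord0 = (1 : 'I_2) by apply/val_inj.
pose P := \matrix_(i < 2, j < 2) (if i == 0 then p0 j 0 else p1 j 0).
pose Q := \matrix_(i < 2, j < 2) (if j == 0 then q0 i 0 else q1 i 0).
have PQ : P *m Q = 1%:M.
  apply/matrixP => i j; move: h00 h11 h01 h10; rewrite !mxE /dotp !big_ord_recl !big_ord0 !mxE !addr0.
  have [->|->] : i = 0 \/ i = 1 by case: i => -[|[|//]] ?; [left|right]; apply/val_inj.
    by have [->|->] : j = 0 \/ j = 1 by [case: j => -[|[|//]] ?; [left|right]; apply/val_inj] => /= a b c d;
      rewrite ?[p0 _ _ * _]mulrC.
  by have [->|->] : j = 0 \/ j = 1 by [case: j => -[|[|//]] ?; [left|right]; apply/val_inj] => /= a b c d;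
    rewrite ?[p1 _ _ * _]mulrC.
have := mulmx1C PQ => /(congr1 (fun M => M *m w)); rewrite mul1mx -mulmxA => {1}<-.
apply/matrixP => i j; rewrite !mxE ord1 /dotp !big_ord_recl !big_ord0 !mxE !big_ord_recl !big_ord0 !mxE /=.
by rewrite !h1; ring.
Qed.

End DualBasis.

Section BogdanovTakens.
Variables (R : realType) (X : R * R -> R * R) (p : R * R).
Hypothesis rX : forall i, rational_near p (vf_comp X i).
Let T i : powser (powser R) := taylor2 p (vf_comp X i).

Lemma DX_taylor i : DX X p i 0 = T i 1%N 0%N /\ DX X p i 1 = T i 0%N 1%N.
Proof.
by split; rewrite !mxE /T /taylor2 /taylor /partial [RHS]/= ?mulr1 ?mul1r divr1.
Qed.

Definition quad (F : powser (powser R)) (x y : R) :=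
  F 2%N 0%N * x ^+ 2 + F 1%N 1%N * (x * y) + F 0%N 2%N * y ^+ 2.

Lemma D2X_taylor q i : D2X X p q q i 0 = 2 * quad (T i) (q 0 0) (q 1 0).
Proof.
have h1 : lift ord0 ord0 = (1 : 'I_2) by apply/val_inj.
pose d j k := 'D_(dir R j) ('D_(dir R k) (vf_comp X i)) p.
have d00 : T i 2%N 0%N = d 0 0 / 2 by rewrite -[2 in RHS]mulr1.
have d11 : T i 1%N 1%N = d 0 1 by rewrite /T /taylor2 /taylor (_ : (1`!%:R * 1`!%:R : R) = 1) ?divr1 // mulr1.
have d02 : T i 0%N 2%N = d 1 1 / 2 by rewrite -[2 in RHS]mul1r.
have d10 : d 1 0 = d 0 1 by rewrite /d -(nbhs_singleton (rational_deriveC (rX i))).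
rewrite /quad d00 d11 d02 mxE -[LHS]/(\sum_(j < 2) \sum_(k < 2) q j 0 * q k 0 * d j k).
move: d d10 {d00 d11 d02} => d d10.
by rewrite !big_ord_recl !big_ord0 !h1 !addr0 d10; field.
Qed.

(** Along p + r q0 + k r^2 q1 the field has no linear term, as J q0 = 0, and its quadratic term is k
    q0 + w / 2 with w = D2X(q0, q0). If a = 0 then w is a multiple of q0, and one value of k cancels
    both. *)
Lemma bt_multiplicity : X p = 0 -> bt_coefficient X p 0 ->
  ((3%:R)%:E <= multiplicity (vf_comp X 0%R) (vf_comp X 1%R) p)%E.
Proof.
move=> Xp [q0 [q1 [pp0 [pp1 [[q0n ker J1 _ _] [[h00 h11 h01 h10] a0]]]]]].
have Jq0 : DX X p *m q0 = 0 by apply/ker; exists 1; rewrite scale1r.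
pose w := D2X X p q0 q0; have w1 : dotp w pp1 = 0.
  move: a0 => /esym/eqP; rewrite mulf_eq0 invr_eq0 pnatr_eq0 /= => /eqP E.
  by rewrite -[RHS]E; apply: eq_bigr => i _; rewrite mulrC.
have wE : w = dotp w pp0 *: q0 by rewrite {1}[w](dual_basis h00 h11 h01 h10) w1 scale0r addr0.
(* This [k] solves k q0 + w / 2 = 0, because w = <w, p0> q0. *)
pose k := - dotp w pp0 / 2; pose c (r : R) : R[i] := (r%:C)%C.
pose s j : powser R[i] := fun n => if n == 1%N then c (q0 j 0) else if n == 2%N then c (k * q1 j 0) else 0.
have s1 j : order_ge 1 (s j) by case.
have h1 : lift ord0 ord0 = (1 : 'I_2) by apply/val_inj.
have Y3 i : order_ge 3 (subst2 (s 0) (s 1) (taylorC (vf_comp X i) p)).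
  have Y0 : taylorC (vf_comp X i) p 0%N 0%N = 0.
    rewrite /taylorC (_ : taylor _ _ _ _ = 0) ?rmorph0 // -[LHS]/(taylor2 p (vf_comp X i) 0%N 0%N) taylor00.
    by rewrite /vf_comp Xp; case: (i == 0).
  have [e0 e1 e2] := subst2_coef (s1 0) (s1 1) Y0.
  have [j0 j1] := DX_taylor i.
  have l0 := congr1 (fun v : 'cV_2 => v i 0) Jq0.
  have l1 := congr1 (fun v : 'cV_2 => v i 0) J1.
  have q2 := D2X_taylor q0 i; rewrite -/w wE in q2.
  rewrite mxE !big_ord_recl !big_ord0 h1 j0 j1 addr0 [RHS]mxE in l0.
  rewrite mxE !big_ord_recl !big_ord0 h1 j0 j1 addr0 in l1.
  case=> [|[|[|//]]] _; [exact: e0|rewrite e1|rewrite e2].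
    by rewrite /taylorC /s /= -!rmorphM -rmorphD l0 rmorph0.
  rewrite /taylorC /s /= -!(rmorphM, rmorphXn, rmorphD).
  rewrite (_ : _ + _ = 0) ?rmorph0 //.
  move: q2 l1; rewrite mxE /quad /T /taylor2 => q2 l1.
  have -> : forall a b d e f x1 x2 y1 y2 : R, a * (k * x1) + b * (k * x2) + d * y1 ^+ 2 + e * (y1 * y2) + f * y2 ^+ 2 =
     k * (a * x1 + b * x2) + (d * y1 ^+ 2 + e * (y1 * y2) + f * y2 ^+ 2) by move=> *; ring.
  by rewrite l1 /k; move: q2; clear; lra.
apply: (@multiplicity_ge3 R _ _ _ (s 0) (s 1)) => //.
rewrite /s /= -negb_and; apply: contra q0n => /andP[/eqP/(congr1 (@complex.Re R)) /= a /eqP/(congr1 (@complex.Re R)) /= b].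
apply/eqP/matrixP => i j; rewrite ord1 mxE.
by case: i => -[|[|//]] hi; [rewrite -a|rewrite -b]; congr (q0 _ _); apply/val_inj.
Qed.

End BogdanovTakens.

(** * Quadratic normal form of a nilpotent singularity *)

Section Composition.
Variable R : realType.
Notation P2 := {poly {poly R}}.
Implicit Types (f g N : P2) (z : R * R).
Variables Zx Zy : P2.

Let ev_c : {poly R} -> P2 := fun c => (map_poly (fun a : R => a%:P%:P) c).[Zy].
Let polyCC : R -> P2 := fun a => a%:P%:P.
Fact polyCC_additive : zmod_morphism polyCC. Proof. by move=> a b; rewrite /polyCC !rmorphB. Qed.
HB.instance Definition _ := GRing.isZmodMorphism.Build _ _ polyCC polyCC_additive.
Fact polyCC_multiplicative : monoid_morphism polyCC.
Proof. by split=> [|a b]; rewrite /polyCC ?rmorph1 // !rmorphM. Qed.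
HB.instance Definition _ := GRing.isMonoidMorphism.Build _ _ polyCC polyCC_multiplicative.
Fact ev_c_additive : zmod_morphism ev_c.
Proof. by move=> a b; rewrite /ev_c (rmorphB (map_poly polyCC)) hornerD hornerN. Qed.
HB.instance Definition _ := GRing.isZmodMorphism.Build _ _ ev_c ev_c_additive.
Fact ev_c_multiplicative : monoid_morphism ev_c.
Proof.
split=> [|a b]; rewrite /ev_c ?(rmorph1 (map_poly polyCC)) ?hornerC //.
by rewrite (rmorphM (map_poly polyCC)) hornerM.
Qed.
HB.instance Definition _ := GRing.isMonoidMorphism.Build _ _ ev_c ev_c_multiplicative.

Definition psubst N : P2 := (map_poly ev_c N).[Zx].

Lemma compD f g : psubst (f + g) = psubst f + psubst g.
Proof. by rewrite /psubst rmorphD hornerD. Qed.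
Lemma compM f g : psubst (f * g) = psubst f * psubst g.
Proof. by rewrite /psubst rmorphM hornerM. Qed.
Lemma compC c : psubst c%:P%:P = c%:P%:P.
Proof. by rewrite /psubst map_polyC hornerC /= /ev_c (map_polyC polyCC) hornerC. Qed.
Lemma compX : psubst 'X = Zx. Proof. by rewrite /psubst map_polyX hornerX. Qed.
Lemma compY : psubst 'X%:P = Zy.
Proof. by rewrite /psubst map_polyC hornerC /= /ev_c (map_polyX polyCC) hornerX. Qed.

Lemma ev_comp N z : ev (psubst N) z = ev N (ev Zx z, ev Zy z).
Proof.
elim/poly2_ind: N => [c| | |f g Ef Eg|f g Ef Eg].
- by rewrite compC !evC.
- by rewrite compX evX.
- by rewrite compY evY.
- by rewrite compD !evD Ef Eg.
- by rewrite compM !evM Ef Eg.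
Qed.

Lemma comp0 : psubst 0 = 0. Proof. exact: (compC 0). Qed.
Lemma comp1 : psubst 1 = 1. Proof. exact: (compC 1). Qed.

Lemma dX_comp N : dX (psubst N) = psubst (dX N) * dX Zx + psubst (dY N) * dX Zy.
Proof.
elim/poly2_ind: N => [c| | |f g Ef Eg|f g Ef Eg].
- by rewrite compC dY_C !dX_C comp0 !mul0r addr0.
- by rewrite compX dX_X dY_X comp0 comp1 mul0r mul1r addr0.
- by rewrite compY dX_C dY_Y comp0 comp1 mul0r mul1r add0r.
- by rewrite compD !dX_D !dY_D !compD Ef Eg; ring.
- by rewrite compM !dX_M !dY_M !compD !compM Ef Eg; ring.
Qed.

Lemma dY_comp N : dY (psubst N) = psubst (dX N) * dY Zx + psubst (dY N) * dY Zy.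
Proof.
elim/poly2_ind: N => [c| | |f g Ef Eg|f g Ef Eg].
- by rewrite compC !dY_C !dX_C comp0 !mul0r addr0.
- by rewrite compX dX_X dY_X comp0 comp1 mul0r mul1r addr0.
- by rewrite compY dX_C dY_Y comp0 comp1 mul0r mul1r add0r.
- by rewrite compD !dX_D !dY_D !compD Ef Eg; ring.
- by rewrite compM !dX_M !dY_M !compD !compM Ef Eg; ring.
Qed.

End Composition.

Section LowOrder.
Variable R : realType.
Notation P2 := {poly {poly R}}.
Implicit Types (Q : P2) (z : R * R) (u s m : R).

Lemma antiderivative_X Q : exists F : P2, dX F = Q /\ forall s, ev F (0, s) = 0.
Proof.
(* For i = 0 the inverse of 0 is 0 by convention: the constant term in x vanishes, which is the
   normalisation on the axis x = 0. *)
exists (\poly_(i < (size Q).+1) ((i%:R^-1)%:P * Q`_i.-1)); split.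
  apply/polyP => i; rewrite coef_deriv coef_poly ltnS.
  case: ltnP => [_|iQ]; last by rewrite mul0rn nth_default.
  by rewrite -mulrnAl -polyCMn -[X in X%:P]mulr_natr mulVf ?mul1r // pnatr_eq0.
by move=> s; rewrite /ev /= horner_coef0 coef_poly /= invr0 mul0r horner0.
Qed.

Lemma coef00 Q : Q`_0`_0 = ev Q (0, 0).
Proof. by rewrite /ev /= !horner_coef0. Qed.

Lemma coef10 Q : Q`_1`_0 = ev (dX Q) (0, 0).
Proof. by rewrite -coef00 coef_deriv mulr1n. Qed.

Lemma coef01 Q : Q`_0`_1 = ev (dY Q) (0, 0).
Proof. by rewrite -coef00 coef_map /= coef_deriv mulr1n. Qed.

Lemma coef20 Q : Q`_2`_0 = ev (dX (dX Q)) (0, 0) / 2.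
Proof. by rewrite -coef00 !coef_deriv mulr1n coefMn -[_ *+ 2]mulr_natr mulfK // pnatr_eq0. Qed.

Lemma coef11 Q : Q`_1`_1 = ev (dY (dX Q)) (0, 0).
Proof. by rewrite -coef00 coef_map /= !coef_deriv !mulr1n. Qed.

Lemma coef02 Q : Q`_0`_2 = ev (dY (dY Q)) (0, 0) / 2.
Proof.
by rewrite -coef00 !coef_map /= !coef_deriv mulr1n -[_ *+ 2]mulr_natr mulfK // pnatr_eq0.
Qed.

Lemma ev_coef Q u s : ev Q (u, s) = \sum_(i < size Q) \sum_(j < size Q`_i) Q`_i`_j * s ^+ j * u ^+ i.
Proof.
rewrite /ev /= [Q.[_]]horner_coef horner_sum; apply: eq_bigr => i _.
by rewrite hornerM horner_exp hornerC horner_coef mulr_suml.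
Qed.

Lemma ev_bound Q k : (forall i j, (i + j < k)%N -> Q`_i`_j = 0) ->
  exists2 C, 0 <= C & forall u s m, `|u| <= m -> `|s| <= m -> m <= 1 ->
    `|ev Q (u, s)| <= C * m ^+ k.
Proof.
move=> hQ; exists (\sum_(i < size Q) \sum_(j < size Q`_i) `|Q`_i`_j|).
  by apply: sumr_ge0 => i _; apply: sumr_ge0 => j _; exact: normr_ge0.
move=> u s m um sm m1; have m0 : 0 <= m by apply: le_trans um.
rewrite ev_coef mulr_suml (le_trans (ler_norm_sum _ _ _)) //.
apply: ler_sum => i _; rewrite mulr_suml (le_trans (ler_norm_sum _ _ _)) //.
apply: ler_sum => j _; have [ijk|kij] := ltnP (i + j) k.
  by rewrite hQ // !mul0r !normr0 mul0r.
rewrite !normrM !normrX -mulrA ler_wpM2l //.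
apply: (@le_trans _ _ (m ^+ j * m ^+ i)).
  by rewrite ler_pM ?exprn_ge0 // lerXn2r ?nnegrE.
by rewrite -exprD addnC -(subnK kij) exprD ler_piMl ?exprn_ge0 // exprn_ile1.
Qed.

Lemma order1 Q : ev Q (0, 0) = 0 -> forall i j, (i + j < 1)%N -> Q`_i`_j = 0.
Proof. by move=> h [|i] [|j] // _; rewrite coef00. Qed.

Lemma order2 Q : ev Q (0, 0) = 0 -> ev (dX Q) (0, 0) = 0 -> ev (dY Q) (0, 0) = 0 ->
  forall i j, (i + j < 2)%N -> Q`_i`_j = 0.
Proof. by move=> h h1 h2 [|[|i]] [|[|j]] // _; rewrite ?coef00 ?coef10 ?coef01. Qed.

Lemma order3 Q : ev Q (0, 0) = 0 -> ev (dX Q) (0, 0) = 0 -> ev (dY Q) (0, 0) = 0 ->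
  ev (dX (dX Q)) (0, 0) = 0 -> ev (dY (dX Q)) (0, 0) = 0 -> ev (dY (dY Q)) (0, 0) = 0 ->
  forall i j, (i + j < 3)%N -> Q`_i`_j = 0.
Proof.
move=> h h1 h2 h3 h4 h5 [|[|[|i]]] [|[|[|j]]] // _;
  by rewrite ?coef00 ?coef10 ?coef01 ?coef20 ?coef11 ?coef02 // ?h3 ?h5 mul0r.
Qed.

End LowOrder.

Section NormalForm.
Variable R : realType.
Notation P2 := {poly {poly R}}.
Variables (V P : P2) (l A B M : R).
Hypotheses (l0 : 0 < l) (A0 : 0 < A) (M0 : 0 < M) (AM : 16 * B ^+ 2 <= A * M).
Local Notation ev0 Q := (ev Q (0, 0)).
Hypotheses (V0 : ev0 V = 0) (Vu : ev0 (dX V) = 0) (Vs : ev0 (dY V) = l).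
Hypotheses (P0 : ev0 P = 0) (Pu : ev0 (dX P) = 0) (Ps : ev0 (dY P) = 0).
Hypotheses (Puu : ev0 (dX (dX P)) = 2 * A) (Pus : ev0 (dY (dX P)) = 0)
  (Pss : ev0 (dY (dY P)) = 2 * M).
Hypothesis HB : ev0 (dX (dX V)) = B.

(** The u-derivative of w V + Ph_s is n V + w (V_u + P_s); its coefficient of s at the origin is n l
    + V_us + 2 M, and this [n] makes it zero. *)
Let n := - (ev0 (dY (dX V)) + 2 * M) / l.
Definition nf_w : P2 := 1%:P%:P + n%:P%:P * 'X.

(** Near 0 the form A u^2 + M s^2 dominates the cubic error of P, so P > 0. After the choice of [n]
    the derivative of [Gt] is B u + O(2), and |s| times it is compared with P by the inequality
    between B^2 and A M. *)
Lemma normal_form_bounds : exists (Ph : P2) (r0 K C : R),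
  let Gt := nf_w * V + dY Ph in
  [/\ dX Ph = nf_w * P, forall s, ev Ph (0, s) = 0, 0 < r0 & 0 <= K] /\
  forall r, 0 < r -> r <= r0 ->
  [/\ forall u s, `|u| <= r -> `|s| <= r -> (u, s) != 0 -> 0 < ev P (u, s),
      forall u s, `|u| <= r -> `|s| <= r -> 0 < ev nf_w (u, s),
      forall u s, `|u| <= r -> `|s| <= r ->
        `|s| * `|ev (dX Gt) (u, s)| <= ev nf_w (u, s) * ev P (u, s) / 2,
      forall u s, `|u| <= r -> `|s| <= r -> `|ev Gt (u, s)| <= K &
      (forall s, 0 < s <= r -> 0 < ev Gt (0, s)) /\
      forall u s, `|u| <= r -> `|s| <= r ->
        `|ev V (u, s)| <= C * (`|u| + `|s|) /\ `|ev P (u, s)| <= C * (`|u| + `|s|)].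
Proof.
set w := nf_w; have [Ph [Phu Ph0]] := antiderivative_X (w * P).
pose Gt := w * V + dY Ph; pose D := dX Gt.
have wu : dX w = n%:P%:P by rewrite /w /nf_w dX_D dX_M dX_X !dX_C; ring.
have ws : dY w = 0.
  by rewrite /w /nf_w dY_D dY_M dY_X !dY_C; ring.
have DE : D = n%:P%:P * V + w * (dX V + dY P).
  by rewrite /D /Gt dX_D dX_M dXY Phu dY_M wu ws; ring.
have wE z : ev w z = 1 + n * z.1 by rewrite /w /nf_w !evE.
clearbody w; have w00 : ev0 w = 1 by rewrite wE mulr0 addr0.
have [C1 C10 HV1] := ev_bound (order1 V0).
have [C2 C20 HP1] := ev_bound (order1 P0).
pose P3 := P - (A%:P%:P * 'X ^+ 2 + M%:P%:P * 'X%:P ^+ 2).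
have [C3 C30 HP3] : exists2 C, 0 <= C & forall u s m, `|u| <= m -> `|s| <= m -> m <= 1 ->
    `|ev P3 (u, s)| <= C * m ^+ 3.
  have e1 : dX P3 = dX P - A%:P%:P * ('X + 'X).
    by rewrite /P3 !expr2 dX_D dX_N dX_D !dX_M !dX_C dX_X; ring.
  have e2 : dY P3 = dY P - M%:P%:P * ('X%:P + 'X%:P).
    by rewrite /P3 !expr2 dY_D dY_N dY_D !dY_M !dY_C dY_X dY_Y; ring.
  have e3 : dX (dX P3) = dX (dX P) - A%:P%:P * (1 + 1).
    by rewrite e1 dX_D dX_N dX_M dX_C dX_D dX_X; ring.
  have e4 : dY (dX P3) = dY (dX P).
    by rewrite e1 dY_D dY_N dY_M dY_C dY_D dY_X; ring.
  have e5 : dY (dY P3) = dY (dY P) - M%:P%:P * (1 + 1).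
    by rewrite e2 dY_D dY_N dY_M dY_C dY_D dY_Y; ring.
  apply: ev_bound; apply: order3.
  - by rewrite /P3 !evE P0 /=; ring.
  - by rewrite e1 !evE Pu /=; ring.
  - by rewrite e2 !evE Ps /=; ring.
  - by rewrite e3 !evE Puu; ring.
  - by rewrite e4.
  - by rewrite e5 !evE Pss; ring.
pose D2 := D - B%:P%:P * 'X.
have D20 : ev0 D2 = 0 by rewrite /D2 DE !evE V0 Vu Ps /=; ring.
have D2u : ev0 (dX D2) = 0.
  have -> : dX D2 = n%:P%:P * dX V + (n%:P%:P * (dX V + dY P) + w * (dX (dX V) + dY (dX P))) - B%:P%:P.
    by rewrite /D2 dX_D dX_N dX_M dX_C dX_X DE dX_D !dX_M wu dX_C (dX_D (dX V)) dXY; ring.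
  by rewrite !evE Vu Ps HB w00 Pus; ring.
have D2s : ev0 (dY D2) = 0.
  have -> : dY D2 = n%:P%:P * dY V + w * (dY (dX V) + dY (dY P)).
    by rewrite /D2 dY_D dY_N dY_M dY_C dY_X DE dY_D !dY_M ws dY_C (dY_D (dX V)); ring.
  by rewrite !evE Vs Pss w00 /n; field; rewrite gt_eqF.
have [C4 C40 HD2] := ev_bound (order2 D20 D2u D2s).
have [K K0 HK] := @ev_bound R Gt 0 (fun i j => fun h => False_ind _ (notF h)).
pose V2 := V - l%:P%:P * 'X%:P.
have [C5 C50 HV2] : exists2 C, 0 <= C & forall u s m, `|u| <= m -> `|s| <= m -> m <= 1 ->
    `|ev V2 (u, s)| <= C * m ^+ 2.
  apply: ev_bound; apply: order2.
  - by rewrite /V2 !evE V0 /=; ring.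
  - have -> : dX V2 = dX V by rewrite /V2 dX_D dX_N dX_M !dX_C; ring.
    exact: Vu.
  - have -> : dY V2 = dY V - l%:P%:P by rewrite /V2 dY_D dY_N dY_M dY_C dY_Y; ring.
    by rewrite !evE Vs subrr.
pose k := Num.min A M; have k0 : 0 < k by rewrite lt_min A0.
(* The four bounds respectively give m <= 1, w >= 3/4, error terms at most k/8 of the quadratic
   form, and V >= l s / 2 on the axis u = 0. *)
pose r0 := Num.min 1 (Num.min (1 / (4 * (`|n| + 1))) (Num.min (k / (8 * (C3 + C4 + 1))) (l / (2 * (C5 + 1))))).
have r00 : 0 < r0.
  by rewrite !lt_min ltr01 !divr_gt0 // ?mulr_gt0 // ltr_wpDl // addr_ge0.
exists Ph, r0, K, (C1 + C2); split=> // r rp rr0.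
move: rr0; rewrite !le_min => /and4P[r1 rn rk rl].
have {}rn : `|n| * r <= 1 / 4.
  have np : 0 < 4 * (`|n| + 1) by rewrite mulr_gt0 // ltr_wpDl.
  by move: rn; rewrite ler_pdivlMr // => rn; lra.
have {}rk : (C3 + C4) * r <= k / 8.
  have np : 0 < 8 * (C3 + C4 + 1) by rewrite mulr_gt0 // ltr_wpDl // addr_ge0.
  by move: rk; rewrite ler_pdivlMr // => rk; lra.
have {}rl : C5 * r <= l / 2.
  have np : 0 < 2 * (C5 + 1) by rewrite mulr_gt0 // ltr_wpDl.
  by move: rl; rewrite ler_pdivlMr // => rl; lra.
have wb u s : `|u| <= r -> 3 / 4 <= ev w (u, s).
  move=> ur; rewrite wE /=; have : `|n * u| <= 1 / 4.
    by rewrite normrM (le_trans _ rn) // ler_wpM2l.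
  by rewrite ler_norml => /andP[]; lra.
have mx u s : `|u| <= r -> `|s| <= r -> exists m, [/\ `|u| <= m, `|s| <= m, m <= r & m ^+ 2 <= u ^+ 2 + s ^+ 2].
  move=> ur sr; exists (Num.max `|u| `|s|); rewrite !le_max !lexx orbT ge_max ur sr; split=> //.
  rewrite /Num.max; case: ifP => _; rewrite real_normK ?num_real //.
    by rewrite lerDr sqr_ge0.
  by rewrite lerDl sqr_ge0.
have quad u s m : m ^+ 2 <= u ^+ 2 + s ^+ 2 -> k * m ^+ 2 <= A * u ^+ 2 + M * s ^+ 2.
  move=> h; apply: le_trans (ler_wpM2l (ltW k0) h) _.
  by rewrite mulrDr lerD // ler_wpM2r ?sqr_ge0 // /k ge_min lexx ?orbT.
have PE u s m : `|u| <= m -> `|s| <= m -> m <= r ->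
    A * u ^+ 2 + M * s ^+ 2 - C3 * r * m ^+ 2 <= ev P (u, s).
  move=> um sm mr; have m0 : 0 <= m by apply: le_trans um.
  have := HP3 u s m um sm (le_trans mr r1); rewrite /P3 !evE /= ler_norml => /andP[h _].
  have : C3 * m ^+ 3 <= C3 * r * m ^+ 2.
    by rewrite -mulrA ler_wpM2l // exprS ler_wpM2r ?sqr_ge0.
  lra.
split.
- move=> u s ur sr un; have [m [um sm mr mm]] := mx u s ur sr.
  have m2 : 0 < m ^+ 2.
    rewrite exprn_gt0 // lt_neqAle (le_trans _ um) // andbT eq_sym.
    apply: contraNneq un => mz; move: um sm; rewrite mz !normr_le0 => /eqP -> /eqP ->.
    exact: eqxx.
  apply: lt_le_trans (PE u s m um sm mr); have := quad u s m mm.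
  have := ler_wpM2r (ltW m2) rk; have := mulr_gt0 k0 m2.
  have := mulr_ge0 (mulr_ge0 C40 (ltW rp)) (ltW m2); lra.
- by move=> u s ur _; have := wb u s ur; lra.
- move=> u s ur sr; have [m [um sm mr mm]] := mx u s ur sr.
  have m0 : 0 <= m by apply: le_trans um.
  have h1 : `|ev D (u, s)| <= `|B| * `|u| + C4 * m ^+ 2.
    have := HD2 u s m um sm (le_trans mr r1); rewrite /D2 !evE /= => h.
    rewrite -normrM -[ev D _](subrK (B * u)) (le_trans (ler_normD _ _)) // addrC lerD2l //.
  have h2 : `|s| * `|ev D (u, s)| <= `|B| * `|u| * `|s| + C4 * r * m ^+ 2.
    apply: le_trans (ler_wpM2l (normr_ge0 s) h1) _.
    rewrite mulrDr mulrC lerD2l mulrCA -mulrA ler_wpM2l // ler_wpM2r ?sqr_ge0 //.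
  (* Completing the square; this is where 16 B^2 <= A M is spent. The resulting 1/8 stays below the
     3/8 coming from w / 2, and the difference absorbs the errors. *)
  have h3 : 8 * (`|B| * `|u| * `|s|) <= A * u ^+ 2 + M * s ^+ 2.
    rewrite -subr_ge0 -(pmulr_rge0 _ A0).
    have -> : A * (A * u ^+ 2 + M * s ^+ 2 - 8 * (`|B| * `|u| * `|s|)) =
       (A * `|u| - 4 * `|B| * `|s|) ^+ 2 + (A * M - 16 * B ^+ 2) * s ^+ 2.
      rewrite -[u ^+ 2](real_normK (num_real u)) -[s ^+ 2](real_normK (num_real s)).
      by rewrite -[B ^+ 2](real_normK (num_real B)); ring.
    by rewrite addr_ge0 ?sqr_ge0 // mulr_ge0 ?sqr_ge0 // subr_ge0.
  have h4 := PE u s m um sm mr; have h5 := quad u s m mm; have h6 := wb u s ur.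
  have h7 := ler_wpM2r (sqr_ge0 m) rk.
  apply: le_trans h2 _.
  have h8 : 0 <= ev P (u, s).
    have := mulr_ge0 (mulr_ge0 C40 (ltW rp)) (sqr_ge0 m); have := mulr_ge0 (ltW k0) (sqr_ge0 m); lra.
  have h9 := ler_wpM2r h8 h6.
  have h10 := mulr_ge0 (mulr_ge0 C30 (ltW rp)) (sqr_ge0 m).
  have h11 := mulr_ge0 (mulr_ge0 C40 (ltW rp)) (sqr_ge0 m).
  have h12 := mulr_ge0 (ltW k0) (sqr_ge0 m).
  lra.
- move=> u s ur sr; have := HK u s r ur sr r1; by rewrite expr0 mulr1.
split.
  move=> s /andP[s0 sr].
  have Y0 : ev (dY Ph) (0, s) = 0.
    have D1 := ev_is_derive Ph (is_derive_cst (0 : R) s (1 : R)) (is_derive_id s (1 : R)).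
    rewrite /= mulr0 add0r mulr1 in D1; rewrite -(@derive_val _ _ _ _ _ _ _ D1).
    rewrite (_ : (fun x => _) = cst 0); last by apply/funext => x; exact: Ph0.
    exact: derive_cst.
  rewrite evD evM Y0 addr0; apply: mulr_gt0; first by have := wb 0 s; rewrite normr0 => /(_ (ltW rp)); lra.
  have := HV2 0 s s; rewrite normr0 (gtr0_norm s0) => /(_ (ltW s0) (lexx s) (le_trans sr r1)).
  rewrite /V2 !evE /= ler_norml => /andP[h _].
  have : C5 * s ^+ 2 <= l / 2 * s.
    rewrite expr2 mulrA ler_wpM2r ?(ltW s0) // (le_trans _ rl) // ler_wpM2l //.
  have := mulr_gt0 l0 s0; lra.
move=> u s ur sr; have u1 := normr_ge0 u; have s1 := normr_ge0 s.
have big : exists m, [/\ `|u| <= m, `|s| <= m, m <= 1 & m <= `|u| + `|s|].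
  exists (Num.max `|u| `|s|); rewrite !le_max !lexx orbT !ge_max (le_trans ur r1) (le_trans sr r1).
  by rewrite lerDl lerDr u1 s1.
have [m [um sm m1 ms]] := big; have m0 : 0 <= m by apply: le_trans um.
have hC (C C' x : R) : 0 <= C -> 0 <= C' -> x <= C * m ^+ 1 -> x <= (C + C') * (`|u| + `|s|).
  move=> c0 c0' h; apply: le_trans h _; rewrite expr1 (le_trans (ler_wpM2l c0 ms)) //.
  by rewrite ler_wpM2r ?addr_ge0 // lerDl.
by split; [apply: hC (HV1 u s m um sm m1)|rewrite addrC; apply: hC (HP1 u s m um sm m1)].
Qed.

End NormalForm.

(** * Two-jets of the field after a quadratic shear *)

Section ShearedJets.
Variable R : realType.
Notation P2 := {poly {poly R}}.
Local Notation ev0 Q := (ev Q (0, 0)).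

Lemma ev_0 z : ev (0 : P2) z = 0. Proof. by rewrite /ev !horner0. Qed.

Lemma dX_lin (u v : R) (F G : P2) : dX (u%:P%:P * F + v%:P%:P * G) = u%:P%:P * dX F + v%:P%:P * dX G.
Proof. by rewrite dX_D !dX_M !dX_C; ring. Qed.

Lemma dY_lin (u v : R) (F G : P2) : dY (u%:P%:P * F + v%:P%:P * G) = u%:P%:P * dY F + v%:P%:P * dY G.
Proof. by rewrite dY_D !dY_M !dY_C; ring. Qed.

(** V and P are the components of the field on u and on s = linear + al u^2; the term 2 al u V is
    the derivative of al u^2. It adds 2 al l to the mixed derivative of Q, so the hypothesis 2 al l
    = -b cancels that derivative. *)
Lemma sheared_jets_aux (c1 c2 V P Q : P2) (x0 y0 e0 f0 e1 f1 l al b j1 j2 A m1 m2 k1 k2 : R) :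
  V = e0%:P%:P * c1 + f0%:P%:P * c2 -> Q = e1%:P%:P * c1 + f1%:P%:P * c2 ->
  P = Q + (2 * al)%:P%:P * ('X * V) ->
  e0 * x0 + f0 * y0 = 1 -> e1 * x0 + f1 * y0 = 0 -> 2 * al * l = - b ->
  b = e1 * k1 + f1 * k2 -> 2 * A = e1 * j1 + f1 * j2 ->
  [/\ ev0 c1 = 0, ev0 (dX c1) = 0, ev0 (dY c1) = l * x0 &
    [/\ ev0 (dX (dX c1)) = j1 - 2 * al * (l * x0), ev0 (dY (dX c1)) = k1 & ev0 (dY (dY c1)) = m1]] ->
  [/\ ev0 c2 = 0, ev0 (dX c2) = 0, ev0 (dY c2) = l * y0 &
    [/\ ev0 (dX (dX c2)) = j2 - 2 * al * (l * y0), ev0 (dY (dX c2)) = k2 & ev0 (dY (dY c2)) = m2]] ->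
  [/\ ev0 V = 0, ev0 (dX V) = 0, ev0 (dY V) = l & ev0 (dX (dX V)) = e0 * j1 + f0 * j2 + b] /\
  [/\ ev0 P = 0, ev0 (dX P) = 0, ev0 (dY P) = 0 &
    [/\ ev0 (dX (dX P)) = 2 * A, ev0 (dY (dX P)) = 0 & ev0 (dY (dY P)) = e1 * m1 + f1 * m2]].
Proof.
move=> VE QE PE E00 E10 al2 bE AE [a0 au as' [auu aus ass]] [b0 bu bs [buu bus bss]].
have lin (u v : R) (F G : P2) : ev0 (u%:P%:P * F + v%:P%:P * G) = u * ev0 F + v * ev0 G by rewrite !evE.
have V0 : ev0 V = 0 by rewrite VE lin a0 b0; ring.
have Vu : ev0 (dX V) = 0 by rewrite VE dX_lin lin au bu; ring.
have Vs : ev0 (dY V) = l by rewrite VE dY_lin lin as' bs -[RHS]mulr1 -E00; ring.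
have Vuu : ev0 (dX (dX V)) = e0 * j1 + f0 * j2 + b.
  rewrite VE !dX_lin lin auu buu.
  transitivity (e0 * j1 + f0 * j2 - 2 * al * l * (e0 * x0 + f0 * y0)); first by ring.
  by rewrite E00 al2; ring.
have Q0 : ev0 Q = 0 by rewrite QE lin a0 b0; ring.
have Qu : ev0 (dX Q) = 0 by rewrite QE dX_lin lin au bu; ring.
have Qs : ev0 (dY Q) = 0.
  by rewrite QE dY_lin lin as' bs; transitivity (l * (e1 * x0 + f1 * y0)); [ring|rewrite E10 mulr0].
have Quu : ev0 (dX (dX Q)) = 2 * A.
  rewrite QE !dX_lin lin auu buu AE.
  transitivity (e1 * j1 + f1 * j2 - 2 * al * l * (e1 * x0 + f1 * y0)); first by ring.
  by rewrite E10; ring.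
have Qus : ev0 (dY (dX Q)) = b by rewrite QE dX_lin dY_lin lin aus bus bE.
have Qss : ev0 (dY (dY Q)) = e1 * m1 + f1 * m2 by rewrite QE !dY_lin lin ass bss.
clear VE QE; pose c := (2 * al)%:P%:P : P2.
have dP : dX P = dX Q + c * (V + 'X * dX V) by rewrite PE dX_D !dX_M dX_C dX_X mul0r add0r mul1r.
have dP' : dY P = dY Q + c * ('X * dY V) by rewrite PE dY_D !dY_M dY_C dY_X mul0r add0r mul0r add0r.
split=> //; split.
- by rewrite PE !evD !evM V0 Q0 !mulr0 addr0.
- by rewrite dP evD evM evD evM V0 Vu Qu; ring.
- by rewrite dP' evD evM evM evX Qs /= mul0r mulr0 addr0.
split.
- have -> : dX (dX P) = dX (dX Q) + c * (dX V + (dX V + 'X * dX (dX V))).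
    by rewrite dP dX_D dX_M dX_C mul0r add0r dX_D dX_M dX_X mul1r.
  by rewrite evD evM evD evD evM evX Quu Vu /= mul0r !addr0 mulr0 addr0.
- have -> : dY (dX P) = dY (dX Q) + c * (dY V + 'X * dY (dX V)).
    by rewrite dP dY_D dY_M dY_C mul0r add0r dY_D dY_M dY_X mul0r add0r.
  by rewrite evD evM evD evM evX Qus Vs evC /= mul0r addr0 al2 subrr.
have -> : dY (dY P) = dY (dY Q) + c * ('X * dY (dY V)).
  by rewrite dP' dY_D dY_M dY_C mul0r add0r dY_M dY_X mul0r add0r.
by rewrite evD evM evM evX Qss /= mul0r mulr0 addr0.
Qed.

Lemma psubst_jets (Zx Zy N : P2) (q : R * R) (x0 y0 x1 y1 a1 a2 : R) :
  (ev0 Zx, ev0 Zy) = q -> ev0 (dX Zx) = x0 -> ev0 (dX Zy) = y0 ->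
  ev0 (dY Zx) = x1 -> ev0 (dY Zy) = y1 -> ev0 (dX (dX Zx)) = a1 -> ev0 (dX (dX Zy)) = a2 ->
  [/\ dY (dX Zx) = 0, dY (dX Zy) = 0, dY (dY Zx) = 0 & dY (dY Zy) = 0] ->
  let C := psubst Zx Zy N in
  [/\ ev0 C = ev N q, ev0 (dX C) = ev (dX N) q * x0 + ev (dY N) q * y0,
    ev0 (dY C) = ev (dX N) q * x1 + ev (dY N) q * y1 &
    [/\ ev0 (dX (dX C)) = ev (dX (dX N)) q * (x0 * x0) + ev (dY (dX N)) q * (x0 * y0 + y0 * x0) +
          ev (dY (dY N)) q * (y0 * y0) + (ev (dX N) q * a1 + ev (dY N) q * a2),
        ev0 (dY (dX C)) = ev (dX (dX N)) q * (x0 * x1) + ev (dY (dX N)) q * (x0 * y1 + y0 * x1) +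
          ev (dY (dY N)) q * (y0 * y1) &
        ev0 (dY (dY C)) = ev (dX (dX N)) q * (x1 * x1) + ev (dY (dX N)) q * (x1 * y1 + y1 * x1) +
          ev (dY (dY N)) q * (y1 * y1)]].
Proof.
move=> Zq vxu vyu vxs vys vxx vyy [xus yus xss yss] C.
have c0 N' : ev0 (psubst Zx Zy N') = ev N' q by rewrite ev_comp Zq.
have Eu N' := dX_comp Zx Zy N'; have Es N' := dY_comp Zx Zy N'.
rewrite /C {C}; split=> //.
- by rewrite Eu evD !evM !c0 vxu vyu.
- by rewrite Es evD !evM !c0 vxs vys.
split.
- rewrite Eu dX_D !dX_M !Eu !evD !evM !evD !evM !c0 vxu vyu vxx vyy dXY.
  by move: (ev _ q) (ev _ q) (ev _ q) (ev _ q) (ev _ q) => *; ring.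
- rewrite Eu dY_D !dY_M !Es !evD !evM !evD !evM !c0 vxu vyu vxs vys xus yus !ev_0 dXY.
  by move: (ev _ q) (ev _ q) (ev _ q) (ev _ q) (ev _ q) => *; ring.
- rewrite Es dY_D !dY_M !Es !evD !evM !evD !evM !c0 vxs vys xss yss !ev_0 dXY.
  by move: (ev _ q) (ev _ q) (ev _ q) (ev _ q) (ev _ q) => *; ring.
Qed.

End ShearedJets.

(** * The chart at a nilpotent singularity given by a Jordan basis *)

Section NilpotentChart.
Variable R : realType.
Notation P2 := {poly {poly R}}.
Variables (X : R * R -> R * R) (p : R * R) (mu : R * R -> R) (N1 N2 : P2).
Hypothesis HX : \forall z \near p,
  [/\ X z = mu z *: (ev N1 z, ev N2 z), 0 < mu z <= 1 & {for z, continuous mu}].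
Hypotheses (N1p : ev N1 p = 0) (N2p : ev N2 p = 0).
Variables (x0 y0 x1 y1 e0 f0 e1 f1 l : R).
Hypotheses (l0 : 0 < l) (E00 : e0 * x0 + f0 * y0 = 1) (E01 : e0 * x1 + f0 * y1 = 0)
  (E10 : e1 * x0 + f1 * y0 = 0) (E11 : e1 * x1 + f1 * y1 = 1).
Hypotheses (I00 : x0 * e0 + x1 * e1 = 1) (I01 : x0 * f0 + x1 * f1 = 0)
  (I10 : y0 * e0 + y1 * e1 = 0) (I11 : y0 * f0 + y1 * f1 = 1).
Definition jet1 (N : P2) (a b : R) := ev (dX N) p * a + ev (dY N) p * b.
Definition jet2 (N : P2) (a b c d : R) :=
  ev (dX (dX N)) p * (a * c) + ev (dY (dX N)) p * (a * d + b * c) + ev (dY (dY N)) p * (b * d).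
Hypotheses (J10 : jet1 N1 x0 y0 = 0) (J20 : jet1 N2 x0 y0 = 0)
  (J11 : jet1 N1 x1 y1 = l * x0) (J21 : jet1 N2 x1 y1 = l * y0).
(** (x0, y0) and (x1, y1) form a Jordan basis, with (e0, f0), (e1, f1) dual to it. A and M are the
    coefficients of u^2 and s^2 in s', b is the mixed derivative of s' before the shear, and B is
    the second u-derivative of u', its summand b being the effect of the shear. *)
Let A := (e1 * jet2 N1 x0 y0 x0 y0 + f1 * jet2 N2 x0 y0 x0 y0) / 2.
Let M := (e1 * jet2 N1 x1 y1 x1 y1 + f1 * jet2 N2 x1 y1 x1 y1) / 2.
Let b := e1 * jet2 N1 x0 y0 x1 y1 + f1 * jet2 N2 x0 y0 x1 y1.
Let B := e0 * jet2 N1 x0 y0 x0 y0 + f0 * jet2 N2 x0 y0 x0 y0 + b.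
Hypotheses (A0 : 0 < A) (M0 : 0 < M) (AM : 16 * B ^+ 2 <= A * M).

(** The coefficient of the shear that removes the mixed derivative [b] of s'; [S] expresses the
    unsheared coordinate through the new ones. *)
Let al := - b / (2 * l).
Let S := ('X%:P - al%:P%:P * 'X ^+ 2) : P2.
Let Zx := (p.1)%:P%:P + x0%:P%:P * 'X + x1%:P%:P * S.
Let Zy := (p.2)%:P%:P + y0%:P%:P * 'X + y1%:P%:P * S.
Local Notation ev0 Q := (ev Q (0, 0)).

Lemma shear_derivatives (d x y : R) : let Z := d%:P%:P + x%:P%:P * 'X + y%:P%:P * S in
  [/\ dX Z = x%:P%:P - ((al + al) * y)%:P%:P * 'X, dY Z = y%:P%:P,
      dX (dX Z) = - ((al + al) * y)%:P%:P & dY (dX Z) = 0 /\ dY (dY Z) = 0].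
Proof.
move=> Z; have e1' : dX Z = x%:P%:P - ((al + al) * y)%:P%:P * 'X.
  rewrite /Z /S !expr2 !dX_D !dX_M dX_D dX_N !dX_M !dX_C dX_X.
  rewrite !(polyCM, polyCD).
  by move: (x%:P%:P : P2) (al%:P%:P : P2) (y%:P%:P : P2) => ax ay az; ring.
have e2' : dY Z = y%:P%:P.
  by rewrite /Z /S !expr2 !dY_D !dY_M dY_D dY_N !dY_M !dY_C dY_X dY_Y; ring.
split=> //; first by rewrite e1' dX_D dX_N dX_M !dX_C dX_X; ring.
by rewrite e1' e2' dY_D dY_N dY_M !dY_C dY_X; split; ring.
Qed.

Lemma comp_jets N : [/\ ev0 (psubst Zx Zy N) = ev N p, ev0 (dX (psubst Zx Zy N)) = jet1 N x0 y0,
    ev0 (dY (psubst Zx Zy N)) = jet1 N x1 y1 &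
    [/\ ev0 (dX (dX (psubst Zx Zy N))) = jet2 N x0 y0 x0 y0 - 2 * al * jet1 N x1 y1,
        ev0 (dY (dX (psubst Zx Zy N))) = jet2 N x0 y0 x1 y1 &
        ev0 (dY (dY (psubst Zx Zy N))) = jet2 N x1 y1 x1 y1]].
Proof.
have [xu xs xuu [xus xss]] := shear_derivatives p.1 x0 x1.
have [yu ys yuu [yus yss]] := shear_derivatives p.2 y0 y1.
have h := @psubst_jets R Zx Zy N p x0 y0 x1 y1 (- (2 * al * x1)) (- (2 * al * y1)).
have Zp : (ev0 Zx, ev0 Zy) = p.
  by rewrite [RHS]surjective_pairing /Zx /Zy /S !evE /=; congr pair; ring.
have [|||||||h1 h2 h3 [h4 h5 h6]] := h Zp.
- by rewrite xu !evE /=; ring.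
- by rewrite yu !evE /=; ring.
- by rewrite xs evC.
- by rewrite ys evC.
- by rewrite xuu evN evC; ring.
- by rewrite yuu evN evC; ring.
- by split.
split=> //; split=> //; rewrite h4 /jet1 /jet2.
by move: (ev _ p) (ev _ p) (ev _ p) (ev _ p) (ev _ p) => *; ring.
Qed.

Let V := e0%:P%:P * psubst Zx Zy N1 + f0%:P%:P * psubst Zx Zy N2.
Let P := e1%:P%:P * psubst Zx Zy N1 + f1%:P%:P * psubst Zx Zy N2 + (2 * al)%:P%:P * ('X * V).

Let al2 : 2 * al * l = - b.
Proof. by rewrite /al; field; rewrite gt_eqF. Qed.

Lemma sheared_jets : [/\ ev0 V = 0, ev0 (dX V) = 0, ev0 (dY V) = l & ev0 (dX (dX V)) = B] /\
  [/\ ev0 P = 0, ev0 (dX P) = 0, ev0 (dY P) = 0 &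
    [/\ ev0 (dX (dX P)) = 2 * A, ev0 (dY (dX P)) = 0 & ev0 (dY (dY P)) = 2 * M]].
Proof.
have j1 := comp_jets N1; have j2 := comp_jets N2.
rewrite N1p J10 J11 in j1; rewrite N2p J20 J21 in j2.
have AE : 2 * A = e1 * jet2 N1 x0 y0 x0 y0 + f1 * jet2 N2 x0 y0 x0 y0 by rewrite /A mulrCA mulfV ?mulr1 ?pnatr_eq0.
have ME : e1 * jet2 N1 x1 y1 x1 y1 + f1 * jet2 N2 x1 y1 x1 y1 = 2 * M by rewrite /M mulrCA mulfV ?mulr1 ?pnatr_eq0.
rewrite -ME.
exact: (@sheared_jets_aux R (psubst Zx Zy N1) (psubst Zx Zy N2) V P _ x0 y0 e0 f0 e1 f1 l al b _ _ A _ _ _ _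
  erefl erefl erefl E00 E10 al2 erefl AE j1 j2).
Qed.

Let c (z : R * R) : R * R :=
  let u := e0 * (z.1 - p.1) + f0 * (z.2 - p.2) in
  (u, e1 * (z.1 - p.1) + f1 * (z.2 - p.2) + al * u ^+ 2).
Let c' (z : R * R) : R * R := (ev Zx z, ev Zy z).

Let c'E z : c' z = (p.1 + x0 * z.1 + x1 * (z.2 - al * z.1 ^+ 2), p.2 + y0 * z.1 + y1 * (z.2 - al * z.1 ^+ 2)).
Proof. by rewrite /c' /Zx /Zy /S !evE. Qed.

Lemma nilpotent_chart : exists (U W : set (R * R)) (h k : R * R -> R * R),
  [/\ equivalence X p (@flow_box R) 0 U W h k,
      forall s, 0 < s -> W (s, 0) ->
        0 < e0 * ((k (s, 0)).1 - p.1) + f0 * ((k (s, 0)).2 - p.2) &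
      forall z, U z -> X z = 0 -> z = p].
Proof.
have [[V0 Vu Vs Vuu] [P0 Pu Ps [Puu Pus Pss]]] := sheared_jets.
have [Ph [r0 [K [C [[Phu Ph0 r00 K0] H]]]]] := normal_form_bounds l0 A0 M0 AM V0 Vu Vs P0 Pu Ps Puu Pus Pss Vuu.
have cK z : c' (c z) = z.
  case: z => z1 z2; rewrite c'E /c /=; congr pair.
    have -> : p.1 + x0 * (e0 * (z1 - p.1) + f0 * (z2 - p.2)) +
      x1 * (e1 * (z1 - p.1) + f1 * (z2 - p.2) + al * (e0 * (z1 - p.1) + f0 * (z2 - p.2)) ^+ 2 -
       al * (e0 * (z1 - p.1) + f0 * (z2 - p.2)) ^+ 2) =
      p.1 + (x0 * e0 + x1 * e1) * (z1 - p.1) + (x0 * f0 + x1 * f1) * (z2 - p.2) by ring.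
    by rewrite I00 I01; ring.
  have -> : p.2 + y0 * (e0 * (z1 - p.1) + f0 * (z2 - p.2)) +
    y1 * (e1 * (z1 - p.1) + f1 * (z2 - p.2) + al * (e0 * (z1 - p.1) + f0 * (z2 - p.2)) ^+ 2 -
     al * (e0 * (z1 - p.1) + f0 * (z2 - p.2)) ^+ 2) =
    p.2 + (y0 * e0 + y1 * e1) * (z1 - p.1) + (y0 * f0 + y1 * f1) * (z2 - p.2) by ring.
  by rewrite I10 I11; ring.
have cK' z : c (c' z) = z.
  case: z => u s; rewrite c'E /c /=.
  have -> : e0 * (p.1 + x0 * u + x1 * (s - al * u ^+ 2) - p.1) + f0 * (p.2 + y0 * u + y1 * (s - al * u ^+ 2) - p.2) =
    (e0 * x0 + f0 * y0) * u + (e0 * x1 + f0 * y1) * (s - al * u ^+ 2) by ring.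
  have -> : e1 * (p.1 + x0 * u + x1 * (s - al * u ^+ 2) - p.1) + f1 * (p.2 + y0 * u + y1 * (s - al * u ^+ 2) - p.2) =
    (e1 * x0 + f1 * y0) * u + (e1 * x1 + f1 * y1) * (s - al * u ^+ 2) by ring.
  by rewrite E00 E01 E10 E11; congr pair; ring.
have cc' : continuous c' by move=> z; apply: continuous_pair; exact: ev_continuous.
have c0 : c' 0 = p by rewrite c'E /= expr0n /= !mulr0 subr0 !mulr0 !addr0 -surjective_pairing.
have cp : c p = 0 by rewrite -c0 cK'.
have [r1 r10 Hr] : exists2 r1, 0 < r1 & forall z, `|(c z).1| <= r1 -> `|(c z).2| <= r1 ->
    [/\ X z = mu z *: (ev N1 z, ev N2 z), 0 < mu z <= 1 & {for z, continuous mu}].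
  have : nbhs (c' 0) [set z | [/\ X z = mu z *: (ev N1 z, ev N2 z), 0 < mu z <= 1 & {for z, continuous mu}]].
    by rewrite c0.
  move=> /cc' /nbhs_ballP[d /= d0 Hd]; exists (d / 2); first by rewrite divr_gt0.
  have dd : d / 2 < d by rewrite ltr_pdivrMr // ltr_pMr // ltr1n.
  move=> z z1 z2; have := Hd (c z); rewrite /= cK; apply.
  by split; rewrite /ball /= sub0r normrN (le_lt_trans _ dd).
pose r := Num.min (Num.min 1 r0) r1.
have rp : 0 < r by rewrite !lt_min ltr01 r00.
have rr0 : r <= r0 by rewrite !ge_min lexx orbT.
have rr1 : r <= r1 by rewrite ge_min lexx orbT.
have r_1 : r <= 1 by rewrite !ge_min lexx.
have [Ppos wpos Dle Gle [Gpos VPle]] := H r rp rr0.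
set w := nf_w V l M in Phu Dle Gle Gpos wpos; pose Gt := w * V + dY Ph.
have evu (Q : P2) (u s : R) : is_derive u 1 (fun u => ev Q (u, s)) (ev (dX Q) (u, s)).
  have := ev_is_derive Q (is_derive_id u (1 : R)) (is_derive_cst s u (1 : R)).
  by rewrite /= mulr0 addr0 mulr1.
have evs (Q : P2) (u s : R) : is_derive s 1 (fun s => ev Q (u, s)) (ev (dY Q) (u, s)).
  have := ev_is_derive Q (is_derive_cst u s (1 : R)) (is_derive_id s (1 : R)).
  by rewrite /= mulr0 add0r mulr1.
have evc (Q : P2) : continuous (fun z : R * R => ev Q (z.1, z.2)).
  have -> : (fun z : R * R => ev Q (z.1, z.2)) = ev Q by apply/funext => -[].
  exact: ev_continuous.
have field z : ev N1 z = x0 * ev V (c z) + x1 * (ev P (c z) - 2 * al * (c z).1 * ev V (c z)) /\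
    ev N2 z = y0 * ev V (c z) + y1 * (ev P (c z) - 2 * al * (c z).1 * ev V (c z)).
  have VE : ev V (c z) = e0 * ev N1 z + f0 * ev N2 z by rewrite /V !evE !ev_comp -[(ev Zx _, _)]/(c' (c z)) cK.
  have PE : ev P (c z) - 2 * al * (c z).1 * ev V (c z) = e1 * ev N1 z + f1 * ev N2 z.
    by rewrite /P !evE !ev_comp -[(ev Zx _, _)]/(c' (c z)) cK; ring.
  rewrite PE VE; split.
    have -> : x0 * (e0 * ev N1 z + f0 * ev N2 z) + x1 * (e1 * ev N1 z + f1 * ev N2 z) =
       (x0 * e0 + x1 * e1) * ev N1 z + (x0 * f0 + x1 * f1) * ev N2 z by ring.
    by rewrite I00 I01; ring.
  have -> : y0 * (e0 * ev N1 z + f0 * ev N2 z) + y1 * (e1 * ev N1 z + f1 * ev N2 z) =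
     (y0 * e0 + y1 * e1) * ev N1 z + (y0 * f0 + y1 * f1) * ev N2 z by ring.
  by rewrite I10 I11; ring.
have wPE : (fun z : R * R => ev w (z.1, z.2) * ev P (z.1, z.2)) = (fun z => ev (w * P) (z.1, z.2)).
  by apply/funext => y; rewrite evM.
have GtE : (fun z : R * R => ev w (z.1, z.2) * ev V (z.1, z.2) + ev (dY Ph) (z.1, z.2)) = (fun z => ev Gt (z.1, z.2)).
  by apply/funext => y; rewrite /Gt (evD (w * V)) (evM w).
have GtuE (s : R) : (fun u => ev w (u, s) * ev V (u, s) + ev (dY Ph) (u, s)) = (fun u => ev Gt (u, s)).
  by apply/funext => y; rewrite /Gt (evD (w * V)) (evM w).
apply: (@chart_exists R X p c c' r K C (fun u s => ev V (u, s)) (fun u s => ev P (u, s))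
  (fun u s => ev w (u, s)) (fun u s => ev Ph (u, s)) (fun u s => ev (dY Ph) (u, s))
  (fun u s => ev (dX Gt) (u, s)) mu).
- exact: rp.
- exact: r_1.
- exact: K0.
- by move=> z; exact: evc.
- by move=> z; exact: evc.
- by move=> z; have := evc (w * P) z; rewrite -wPE.
- by move=> z; have := evc Gt z; rewrite -GtE.
- by move=> u s [/= ur sr]; exact: Ppos.
- by move=> u s [/= ur sr]; exact: wpos.
- by move=> u s; rewrite -evM -Phu; exact: evu.
- exact: Ph0.
- by move=> u s; have := evu Gt u s; rewrite -GtuE.
- by move=> u s [/= ur sr]; exact: Dle.
- by move=> u s [/= ur sr]; have := Gle u s ur sr; rewrite (evD (w * V)) (evM w).
- by move=> s sr; have := Gpos s sr; rewrite (evD (w * V)) (evM w).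
- by move=> u s [/= ur sr]; exact: VPle.
- by move=> z [z1 z2]; have [] := Hr z (le_trans z1 rr1) (le_trans z2 rr1).
- by move=> z [z1 z2]; have [] := Hr z (le_trans z1 rr1) (le_trans z2 rr1).
- have [|| -> _ _] := Hr p; try by rewrite cp normr0 ltW.
  by rewrite N1p N2p; exact: scaler0.
- exact: cp.
- exact: c0.
- move=> z; have cu : {for z, continuous (fun z : R * R => e0 * (z.1 - p.1) + f0 * (z.2 - p.2))}.
    rewrite (_ : (fun z => _) = ev (e0%:P%:P * ('X - (p.1)%:P%:P) + f0%:P%:P * ('X%:P - (p.2)%:P%:P))).
      exact: ev_continuous.
    by apply/funext => y; rewrite !evE.
  apply: continuous_pair => //=.
  rewrite (_ : (fun y => _) = ev (e1%:P%:P * ('X - (p.1)%:P%:P) + f1%:P%:P * ('X%:P - (p.2)%:P%:P) +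
     al%:P%:P * (e0%:P%:P * ('X - (p.1)%:P%:P) + f0%:P%:P * ('X%:P - (p.2)%:P%:P)) ^+ 2)).
    exact: ev_continuous.
  by apply/funext => y; rewrite !evE.
- by move=> z _; exact: cc'.
- by move=> z _; exact: cK.
- by move=> z _; exact: cK'.
- move=> gam t gd [g1 g2]; have [Xg _ _] := Hr (gam t) (le_trans g1 rr1) (le_trans g2 rr1).
  have [F1 F2] := field (gam t); rewrite -!surjective_pairing.
  have d1 := is_derive_fst gd; have d2 := is_derive_snd gd.
  have [L [Lu Ls LE]] : exists L : R -> R -> P2, [/\ forall e f, dX (L e f) = e%:P%:P,
      forall e f, dY (L e f) = f%:P%:P & forall e f z, ev (L e f) z = e * (z.1 - p.1) + f * (z.2 - p.2)].
    exists (fun e f => e%:P%:P * ('X - (p.1)%:P%:P) + f%:P%:P * ('X%:P - (p.2)%:P%:P)); split=> e f.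
    - by rewrite dX_D !dX_M !dX_D !dX_N !dX_C dX_X; ring.
    - by rewrite dY_D !dY_M !dY_D !dY_N !dY_C dY_X dY_Y; ring.
    - by move=> z; rewrite !evE.
  have Du := ev_is_derive (L e0 f0) d1 d2.
  have Ds := ev_is_derive (L e1 f1 + al%:P%:P * (L e0 f0 * L e0 f0)) d1 d2.
  split.
    have -> : (fun t => (c (gam t)).1) = (fun x => ev (L e0 f0) ((gam x).1, (gam x).2)).
      by apply/funext => x; rewrite LE.
    apply: (is_derive_eq Du); rewrite Lu Ls !evC Xg /= F1 F2 /GRing.scale /=.
    set v := ev V _; set q := (ev P _ - _).
    have -> : e0 * (mu (gam t) * (x0 * v + x1 * q)) + f0 * (mu (gam t) * (y0 * v + y1 * q)) =
      mu (gam t) * ((e0 * x0 + f0 * y0) * v + (e0 * x1 + f0 * y1) * q) by ring.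
    by rewrite E00 E01; ring.
  have -> : (fun t => (c (gam t)).2) = (fun x => ev (L e1 f1 + al%:P%:P * (L e0 f0 * L e0 f0)) ((gam x).1, (gam x).2)).
    by apply/funext => x; rewrite evD !evM !LE evC /c /= expr2.
  move: F1 F2; move: (ev P (c (gam t))) (ev V (c (gam t))) => q' v F1 F2.
  apply: (is_derive_eq Ds); rewrite dX_D dY_D !dX_M !dY_M !dX_C !dY_C !Lu !Ls !evE -surjective_pairing !LE.
  rewrite -[e0 * _ + f0 * _]/((c (gam t)).1) Xg /= F1 F2 /GRing.scale /=.
  move: (e0 * _ + f0 * _) => u; set q := (q' - _).
  have -> : q' = q + 2 * al * u * v by rewrite /q subrK.
  transitivity (mu (gam t) * ((e1 * x0 + f1 * y0) * v + (e1 * x1 + f1 * y1) * q + 2 * al * u * ((e0 * x0 + f0 * y0) * v + (e0 * x1 + f0 * y1) * q))).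
    by ring.
  by rewrite E00 E01 E10 E11; ring.
move=> a b' l' t [/= ar br] ad bd.
have Dx := ev_is_derive Zx ad bd; have Dy := ev_is_derive Zy ad bd.
have bz : `|(c (c' (a t, b' t))).1| <= r1 /\ `|(c (c' (a t, b' t))).2| <= r1.
  by rewrite cK' /= (le_trans ar) ?(le_trans br).
have [Xg m0 _] := Hr _ bz.1 bz.2; have [F1 F2] := field (c' (a t, b' t)).
have mn : mu (c' (a t, b' t)) != 0 by rewrite gt_eqF //; case/andP: m0.
rewrite cK' in F1 F2.
have [xu xs _ _] := shear_derivatives p.1 x0 x1.
have [yu ys _ _] := shear_derivatives p.2 y0 y1.
apply: (is_derive_eq (is_derive_pair Dx Dy)); rewrite Xg F1 F2 /= scalerA divfK //.
rewrite xu xs yu ys !evE /=; congr pair; rewrite /GRing.scale /=; ring.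
Qed.

End NilpotentChart.

(** * Points with a <> 0 are cusps *)

Section Cusp.
Variable R : realType.
Notation P2 := {poly {poly R}}.

Lemma cusp_model_chart : exists (U W : set (R * R)) (h k : R * R -> R * R),
  equivalence (fun z : R * R => (z.2, z.1 ^+ 2)) 0 (@flow_box R) 0 U W h k.
Proof.
have dX2 : dX ('X ^+ 2 : P2) = 'X + 'X by rewrite expr2 dX_M dX_X; ring.
have dY2 : dY ('X ^+ 2 : P2) = 0 by rewrite expr2 dY_M dY_X; ring.
have dY1 : dY (1 : P2) = 0.
  apply: (@addrI _ (dY 1)); rewrite addr0 -dY_D -[in RHS](mulr1 1) dY_M; ring.
have dX1 : dX (1 : P2) = 0 by exact: dX_C.
have j1 a b : jet1 0 ('X%:P : P2) a b = b.
  by rewrite /jet1 dX_C dY_Y ev_0 ev1; ring.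
have j2 a b : jet1 0 ('X ^+ 2 : P2) a b = 0.
  by rewrite /jet1 dX2 dY2 ev_0 !evE /=; ring.
have k1 a b c d : jet2 0 ('X%:P : P2) a b c d = 0.
  have h : dX (0 : P2) = 0 by exact: dX_C.
  have h' : dY (0 : P2) = 0 by exact: (dY_C 0).
  by rewrite /jet2 dX_C dY_Y dY1 h h' !ev_0; ring.
have k2 a b c d : jet2 0 ('X ^+ 2 : P2) a b c d = 2 * (a * c).
  have h' : dY (0 : P2) = 0 by exact: (dY_C 0).
  by rewrite /jet2 dX2 dY2 dX_D dX_X dY_D dY_X h' addr0 !ev_0 !evE; ring.
suff [U [W [h [k [XE _ _]]]]] : exists (U W : set (R * R)) (h k : R * R -> R * R),
  [/\ equivalence (fun z : R * R => (z.2, z.1 ^+ 2)) 0 (@flow_box R) 0 U W h k,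
      forall s, 0 < s -> W (s, 0) ->
        0 < 1 * ((k (s, 0)).1 - (0 : R * R).1) + - 1 * ((k (s, 0)).2 - (0 : R * R).2) &
      forall z, U z -> (z.2, z.1 ^+ 2) = 0 -> z = 0] by exists U, W, h, k.
have HX : \forall z \near (0 : R * R), [/\ (z.2, z.1 ^+ 2) = (1 : R) *: (ev 'X%:P z, ev ('X ^+ 2) z),
    0 < (1 : R) <= 1 & {for z, continuous (fun=> 1 : R)}].
  by near=> z; rewrite scale1r !evE ltr01 lexx; split=> //; exact: cst_continuous.
have n1 : ev ('X%:P : P2) 0 = 0 by rewrite evY.
have n2 : ev ('X ^+ 2 : P2) 0 = 0 by rewrite evXn evX /= expr0n.
(* The Jordan basis is q0 = (1, 0), q1 = (1, 1): with (0, 1) in place of q1 one would get M = 0,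
   while this choice gives A = M = 1 and B = 0. *)
by apply: (@nilpotent_chart R _ 0 (fun=> 1) _ _ HX n1 n2 1 0 1 1 1 (-1) 0 1 1);
  rewrite ?j1 ?j2 ?k1 ?k2; lra.
Unshelve. all: by end_near. Qed.

Lemma bt_coefficientN (X : R * R -> R * R) p a : bt_coefficient X p a -> bt_coefficient X p (- a).
Proof.
move=> [q0 [q1 [p0 [p1 [[q0n ker J1 h2 h3] [[h00 h11 h01 h10] aE]]]]]].
have dN (u v : 'cV[R]_2) : dotp (- u) v = - dotp u v.
  by rewrite /dotp -sumrN; apply: eq_bigr => i _; rewrite mxE mulNr.
have dN' (u v : 'cV[R]_2) : dotp u (- v) = - dotp u v.
  by rewrite /dotp -sumrN; apply: eq_bigr => i _; rewrite mxE mulrN.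
exists (- q0), (- q1), (- p0), (- p1); split; [split|split; [split|]].
- by rewrite oppr_eq0.
- move=> q; rewrite ker; split=> -[c ->]; exists (- c); by rewrite ?scalerN ?scaleNr ?opprK.
- by rewrite mulmxN J1.
- by rewrite mulmxN h2 oppr0.
- by rewrite mulmxN h3.
- by rewrite dN dN' opprK.
- by rewrite dN dN' opprK.
- by rewrite dN dN' opprK.
- by rewrite dN dN' opprK.
rewrite aE dN mulrN; congr (- (_ * dotp _ _)); apply/matrixP => i j; rewrite !mxE.
by apply: eq_bigr => k _; apply: eq_bigr => l _; rewrite !mxE mulrNN.
Qed.

Lemma powser2_coef (F G : powser (powser R)) :
  [/\ (F * G) 0%N 0%N = F 0%N 0%N * G 0%N 0%N,
      (F * G) 1%N 0%N = F 0%N 0%N * G 1%N 0%N + F 1%N 0%N * G 0%N 0%N,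
      (F * G) 0%N 1%N = F 0%N 0%N * G 0%N 1%N + F 0%N 1%N * G 0%N 0%N &
    [/\ (F * G) 2%N 0%N = F 0%N 0%N * G 2%N 0%N + F 1%N 0%N * G 1%N 0%N + F 2%N 0%N * G 0%N 0%N,
        (F * G) 1%N 1%N = F 0%N 0%N * G 1%N 1%N + F 0%N 1%N * G 1%N 0%N +
          F 1%N 0%N * G 0%N 1%N + F 1%N 1%N * G 0%N 0%N &
        (F * G) 0%N 2%N = F 0%N 0%N * G 0%N 2%N + F 0%N 1%N * G 0%N 1%N + F 0%N 2%N * G 0%N 0%N]].
Proof.
by split; [| | |split]; rewrite -fps2_mulE /fps2_mul !big_ord_recl !big_ord0 /bump /= ?subnn ?subn0 ?addr0 ?addrA.
Qed.

Lemma taylor_poly (N : P2) p :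
  [/\ taylor2 p (ev N) 0%N 0%N = ev N p, taylor2 p (ev N) 1%N 0%N = ev (dX N) p,
      taylor2 p (ev N) 0%N 1%N = ev (dY N) p &
    [/\ taylor2 p (ev N) 2%N 0%N = ev (dX (dX N)) p / 2, taylor2 p (ev N) 1%N 1%N = ev (dY (dX N)) p &
        taylor2 p (ev N) 0%N 2%N = ev (dY (dY N)) p / 2]].
Proof.
have dE (i : 'I_2) (M : P2) : ('D_(dir R i) (ev M) : R * R -> R) = ev (dpoly i M).
  by apply/funext => z; have [_ ->] := dpoly_is_derive i M z.
have h1 (i : 'I_2) : 'D_(dir R i) (ev N) p = ev (dpoly i N) p by rewrite -dE.
have h2 (i j : 'I_2) : 'D_(dir R i) ('D_(dir R j) (ev N) : R * R -> R) p = ev (dpoly i (dpoly j N)) p by rewrite -!dE.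
have f11 : (1`!%:R * 1`!%:R : R) = 1 by rewrite mulr1.
split; [exact: taylor00| | |split].
- by rewrite -[RHS](h1 0) /taylor2 /taylor (_ : (1`!%:R * 0`!%:R : R) = 1) ?divr1 // mulr1.
- by rewrite -[RHS](h1 1) /taylor2 /taylor (_ : (0`!%:R * 1`!%:R : R) = 1) ?divr1 // mulr1.
- by rewrite -[ev _ p](h2 0 0) -[2 in RHS]mulr1.
- by rewrite -dXY -[RHS](h2 0 1) /taylor2 /taylor f11 divr1.
- by rewrite -[ev _ p](h2 1 1) -[2 in RHS]mul1r.
Qed.

Variables (X : R * R -> R * R) (p : R * R) (N1 N2 q : P2).
Hypothesis rX : forall i, rational_near p (vf_comp X i).
Hypothesis HX : \forall z \near p, X z = (ev N1 z / ev q z, ev N2 z / ev q z).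
Hypothesis q0 : 0 < ev q p.
Hypothesis Xp : X p = 0.

(** Replacing X by a positive multiple keeps its orbits. The factor 2 in [c] makes the remaining
    multiplier ev q p / (2 ev q z) equal to 1/2 at p, hence at most 1 nearby. On kernel vectors the
    derivatives of the denominator drop out of the second jet. *)
Lemma scaled_jets i (N := if i == 0 then N1 else N2) : let c := 2 / ev q p in
  [/\ ev (c%:P%:P * N) p = 0,
      forall a b, jet1 p (c%:P%:P * N) a b = 2 * (DX X p i 0 * a + DX X p i 1 * b) &
      forall a b, DX X p i 0 * a + DX X p i 1 * b = 0 ->
        jet2 p (c%:P%:P * N) a b a b = 4 * quad (taylor2 p (vf_comp X i)) a b].
Proof.
move=> c; have qn : ev q p != 0 by rewrite gt_eqF.
have E : taylor2 p (ev N) = taylor2 p (vf_comp X i) * taylor2 p (ev q).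
  rewrite -(taylorM (rX i) (ev_rational p q)); apply: taylor_eq.
  apply: filterS2 HX (near_ev_neq0 qn) => z Xz qz; rewrite /GRing.mul /= /mul_fun /vf_comp Xz /N.
  by case: (i == 0); rewrite /= divfK.
have [t00 t10 t01 [t20 t11 t02]] := taylor_poly N p.
have [s00 s10 s01 [s20 s11 s02]] := taylor_poly q p.
have X00 : taylor2 p (vf_comp X i) 0%N 0%N = 0 by rewrite taylor00 /vf_comp Xp; case: (i == 0).
have [j0 j1] := DX_taylor X p i.
move: E t00 t10 t01 t20 t11 t02 s00 s10 s01 X00 j0 j1.
move: (taylor2 p (ev N)) (taylor2 p (ev q)) (taylor2 p (vf_comp X i)) => TN G F -> t00 t10 t01 t20 t11 t02 s00 s10 s01 F00 j0 j1.
have [e00 e10 e01 [e20 e11 e02]] := powser2_coef F G.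
rewrite F00 mul0r t00 in e00; rewrite F00 mul0r add0r t10 s00 -j0 in e10.
rewrite F00 mul0r add0r t01 s00 -j1 in e01; rewrite F00 mul0r add0r t20 s10 s00 -j0 in e20.
rewrite F00 mul0r add0r t11 s10 s01 s00 -j0 -j1 in e11; rewrite F00 mul0r add0r t02 s01 s00 -j1 in e02.
have dXc (M : P2) : dX (c%:P%:P * M) = c%:P%:P * dX M by rewrite dX_M dX_C; ring.
have dYc (M : P2) : dY (c%:P%:P * M) = c%:P%:P * dY M by rewrite dY_M dY_C; ring.
split.
- by rewrite evM e00 mulr0.
- by move=> a b; rewrite /jet1 dXc dYc !evM !evC e10 e01 /c; field.
move=> a b ab; rewrite /jet2 !(dXc, dYc) !evM !evC /quad.
have -> : ev (dX (dX N)) p = 2 * (DX X p i 0 * ev (dX q) p + F 2%N 0%N * ev q p).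
  by rewrite -e20; field.
have -> : ev (dY (dY N)) p = 2 * (DX X p i 1 * ev (dY q) p + F 0%N 2%N * ev q p).
  by rewrite -e02; field.
rewrite e11; transitivity (4 * (F 2%N 0%N * a ^+ 2 + F 1%N 1%N * (a * b) +
   F 0%N 2%N * b ^+ 2) + 2 * c * (DX X p i 0 * a + DX X p i 1 * b) * (ev (dX q) p * a + ev (dY q) p * b)).
  by rewrite /c; field.
by rewrite ab mulr0 mul0r addr0.
Qed.

Lemma bt_chart a : bt_coefficient X p a -> a != 0 ->
  exists (U W : set (R * R)) (h k : R * R -> R * R) (l : R * R),
  [/\ equivalence X p (@flow_box R) 0 U W h k,
      forall s, 0 < s -> W (s, 0) ->
        0 < l.1 * ((k (s, 0)).1 - p.1) + l.2 * ((k (s, 0)).2 - p.2) &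
      forall z, U z -> X z = 0 -> z = p].
Proof.
wlog a0 : a / 0 < a => [hw hb an|].
  have [lt|gt] := ltP 0 a; first exact: hw lt hb an.
  by apply: (hw (- a)) (bt_coefficientN hb) _; rewrite ?oppr_eq0 // oppr_gt0 lt_neqAle an gt.
move=> [q_0 [q_1 [p_0 [p_1 [[q0n ker J1 _ _] [[h00 h11 h01 h10] aE]]]]]] _.
have Jq0 : DX X p *m q_0 = 0 by apply/ker; exists 1; rewrite scale1r.
have h1 : lift ord0 ord0 = (1 : 'I_2) by apply/val_inj.
have dE (u v : 'cV[R]_2) : dotp u v = u 0 0 * v 0 0 + u 1 0 * v 1 0.
  by rewrite /dotp !big_ord_recl big_ord0 addr0 h1.
have JE (u : 'cV[R]_2) i : (DX X p *m u) i 0 = DX X p i 0 * u 0 0 + DX X p i 1 * u 1 0.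
  by rewrite mxE !big_ord_recl big_ord0 addr0 h1.
have J0 i : DX X p i 0 * q_0 0 0 + DX X p i 1 * q_0 1 0 = 0 by rewrite -JE Jq0 mxE.
have J1' i : DX X p i 0 * q_1 0 0 + DX X p i 1 * q_1 1 0 = q_0 i 0 by rewrite -JE J1.
have id i (w : 'cV[R]_2) := congr1 (fun m : 'cV_2 => m i 0) (dual_basis h00 h11 h01 h10 w).
have dd0 (v : 'cV[R]_2) : dotp (delta_mx 0 0) v = v 0 0 by rewrite dE !mxE /= mul1r mul0r addr0.
have dd1 (v : 'cV[R]_2) : dotp (delta_mx 1 0) v = v 1 0 by rewrite dE !mxE /= mul1r mul0r add0r.
have i00 := id 0 (delta_mx 0 0); have i01 := id 0 (delta_mx 1 0).
have i10 := id 1 (delta_mx 0 0); have i11 := id 1 (delta_mx 1 0).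
rewrite !mxE !dd0 /= in i00 i10; rewrite !mxE !dd1 /= in i01 i11.
rewrite !dE in h00 h11 h01 h10.
have [z1 j1 k1] := scaled_jets 0; have [z2 j2 k2] := scaled_jets 1.
rewrite /= in z1 j1 k1 z2 j2 k2.
set c := 2 / ev q p in z1 j1 k1 z2 j2 k2; set M1 := _ * N1 in z1 j1 k1; set M2 := _ * N2 in z2 j2 k2.
have aE' : 2 * a = (p_1 0 0 * jet2 p M1 (q_0 0 0) (q_0 1 0) (q_0 0 0) (q_0 1 0) +
    p_1 1 0 * jet2 p M2 (q_0 0 0) (q_0 1 0) (q_0 0 0) (q_0 1 0)) / 2.
  have D2 := D2X_taylor rX q_0.
  rewrite (k1 _ _ (J0 0)) (k2 _ _ (J0 1)) aE dE (D2 0) (D2 1).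
  by move: (quad _ _ _) (quad _ _ _) => Q Q'; field.
move: J0 J1' => J0 J1'; clear k1 k2 aE JE id Jq0 J1 ker.
pose x0 := q_0 0 0; pose y0 := q_0 1 0; pose x1 := q_1 0 0; pose y1 := q_1 1 0.
pose e0 := p_0 0 0; pose f0 := p_0 1 0; pose e1 := p_1 0 0; pose f1 := p_1 1 0.
have Ja := J0 0; have Jb := J0 1; have Jc := J1' 0; have Jd := J1' 1.
rewrite -/x0 -/y0 -/x1 -/y1 -/e0 -/f0 -/e1 -/f1 in h00 h11 h01 h10 i00 i01 i10 i11 Ja Jb Jc Jd aE'.
have {}j1 u v := j1 u v; have {}j2 u v := j2 u v.
move: x0 y0 x1 y1 e0 f0 e1 f1 h00 h11 h01 h10 i00 i01 i10 i11 Ja Jb Jc Jd aE' => x0 y0 x1 y1 e0 f0 e1 f1.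
move=> h00 h11 h01 h10 i00 i01 i10 i11 Ja Jb Jc Jd aE; clear J0 J1' dd0 dd1 dE q0n.
pose jj M := jet2 p M.
pose A := 2 * a; have A0 : 0 < A by rewrite mulr_gt0.
pose c0 := (e1 * jet2 p M1 x1 y1 x1 y1 + f1 * jet2 p M2 x1 y1 x1 y1) / 2.
pose b0 := e1 * jet2 p M1 x0 y0 x1 y1 + f1 * jet2 p M2 x0 y0 x1 y1.
pose B := e0 * jet2 p M1 x0 y0 x0 y0 + f0 * jet2 p M2 x0 y0 x0 y0 + b0.
(* Passing to q1 + g q0, with dual p0 - g p1, preserves the Jordan relations and the value of B, and
   turns M into c0 + g b0 + g^2 A. The choice g A = t then ensures A M >= 16 B^2 + 1. *)
pose t := `|b0| + 1 + `|A * c0| + 16 * B ^+ 2; pose g := t / A.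
have gA : g * A = t by rewrite /g divfK // gt_eqF.
pose M := c0 + g * b0 + g ^+ 2 * A.
have jadd N a1 b1 a2 b2 c1 d1 : jet2 p N a1 b1 (a2 + g * c1) (b2 + g * d1) = jet2 p N a1 b1 a2 b2 + g * jet2 p N a1 b1 c1 d1.
  by rewrite /jet2; ring.
have jsym N a1 b1 a2 b2 : jet2 p N a1 b1 a2 b2 = jet2 p N a2 b2 a1 b1 by rewrite /jet2; ring.
have ME : (e1 * jet2 p M1 (x1 + g * x0) (y1 + g * y0) (x1 + g * x0) (y1 + g * y0) +
    f1 * jet2 p M2 (x1 + g * x0) (y1 + g * y0) (x1 + g * x0) (y1 + g * y0)) / 2 = M.
  rewrite /M /A aE /b0 /c0 !jadd !(jsym _ (x1 + g * x0)) !jadd !(jsym _ x1 y1 x0).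
  by move: (jet2 p M1) (jet2 p M2) => *; field.
have BE : (e0 - g * e1) * jet2 p M1 x0 y0 x0 y0 + (f0 - g * f1) * jet2 p M2 x0 y0 x0 y0 +
   (e1 * jet2 p M1 x0 y0 (x1 + g * x0) (y1 + g * y0) + f1 * jet2 p M2 x0 y0 (x1 + g * x0) (y1 + g * y0)) = B.
  rewrite !jadd /B /b0; ring.
have AM : 16 * B ^+ 2 + 1 <= A * M.
  have -> : A * M = A * c0 + t * (t + b0) by rewrite /M -gA; ring.
  have n0 := normr_ge0 b0; have n1 := ler_norm (- b0); rewrite normrN in n1.
  have n2 := ler_norm (- (A * c0)); rewrite normrN in n2.
  have n3 := sqr_ge0 B; have n4 := normr_ge0 (A * c0).
  have tb : 1 <= t + b0 by rewrite /t; lra.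
  have t0 : 0 <= t by rewrite /t; lra.
  have := ler_wpM2l t0 tb; rewrite mulr1 => h; apply: le_trans (_ : A * c0 + t <= _); last by rewrite lerD2l.
  by rewrite /t; lra.
have M0 : 0 < M by rewrite -(pmulr_rgt0 _ A0); apply: lt_le_trans AM; have := sqr_ge0 B; lra.
suff [U [W [h [k [XE foc iso]]]]] : exists (U W : set (R * R)) (h k : R * R -> R * R),
  [/\ equivalence X p (@flow_box R) 0 U W h k,
      forall s, 0 < s -> W (s, 0) ->
        0 < (e0 - g * e1) * ((k (s, 0)).1 - p.1) + (f0 - g * f1) * ((k (s, 0)).2 - p.2) &
      forall z, U z -> X z = 0 -> z = p].
  by exists U, W, h, k, (e0 - g * e1, f0 - g * f1).
have qn : ev q p != 0 by rewrite gt_eqF.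
have HX' : \forall z \near p, [/\ X z = (ev q p / (2 * ev q z)) *: (ev M1 z, ev M2 z),
    0 < ev q p / (2 * ev q z) <= 1 & {for z, continuous (fun z => ev q p / (2 * ev q z))}].
  have qh : \forall z \near p, ev q p / 2 < ev q z.
    apply: (cvgr_gt _ (@ev_continuous R q p)).
    by rewrite ltr_pdivrMr // ltr_pMr // ltr1n.
  apply: filterS2 HX qh => z Xz qz; have q2 : 0 < ev q p / 2 by rewrite divr_gt0.
  have qz0 : 0 < ev q z by apply: lt_trans qz.
  have qzn : ev q z != 0 by rewrite gt_eqF.
  split.
  - by rewrite Xz /M1 /M2 !evM !evC /c; apply: injective_projections; rewrite /= /GRing.scale /=; field; rewrite qn qzn.
  - rewrite divr_gt0 ?mulr_gt0 //= ler_pdivrMr ?mulr_gt0 // mul1r -ler_pdivrMl //.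
    by rewrite mulrC ltW.
  - apply: continuousM; first exact: cst_continuous.
    apply: continuousV; first by rewrite mulf_neq0.
    by apply: continuousM; [exact: cst_continuous|exact: ev_continuous].
clear HX qn.
have m00 : e0 * x0 + f0 * y0 = 1 by rewrite -h00; ring.
have m01 : e0 * x1 + f0 * y1 = 0 by rewrite -h10; ring.
have m10 : e1 * x0 + f1 * y0 = 0 by rewrite -h01; ring.
have m11 : e1 * x1 + f1 * y1 = 1 by rewrite -h11; ring.
have {}i00 : x0 * e0 + x1 * e1 = 1 by rewrite [RHS]i00; ring.
have {}i01 : x0 * f0 + x1 * f1 = 0 by rewrite [RHS]i01; ring.
have {}i10 : y0 * e0 + y1 * e1 = 0 by rewrite [RHS]i10; ring.
have {}i11 : y0 * f0 + y1 * f1 = 1 by rewrite [RHS]i11; ring.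
apply: (@nilpotent_chart R X p _ _ _ HX' z1 z2 x0 y0 (x1 + g * x0) (y1 + g * y0)
  (e0 - g * e1) (f0 - g * f1) e1 f1 2).
- by [].
- transitivity (e0 * x0 + f0 * y0 - g * (e1 * x0 + f1 * y0)); first by ring.
  by rewrite m00 m10; ring.
- transitivity (e0 * x1 + f0 * y1 + g * (e0 * x0 + f0 * y0) - g * (e1 * x1 + f1 * y1) - g ^+ 2 * (e1 * x0 + f1 * y0)); first by ring.
  by rewrite m00 m01 m10 m11; ring.
- exact: m10.
- transitivity (e1 * x1 + f1 * y1 + g * (e1 * x0 + f1 * y0)); first by ring.
  by rewrite m11 m10; ring.
- by rewrite -i00; ring.
- by rewrite -i01; ring.
- by rewrite -i10; ring.
- by rewrite -i11; ring.
- by rewrite j1 Ja mulr0.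
- by rewrite j2 Jb mulr0.
- rewrite j1; transitivity (2 * (DX X p 0 0 * x1 + DX X p 0 1 * y1) + 2 * g * (DX X p 0 0 * x0 + DX X p 0 1 * y0)).
    by move: (DX X p 0 0) (DX X p 0 1) => *; ring.
  by rewrite Jc Ja mulr0 addr0.
- rewrite j2; transitivity (2 * (DX X p 1 0 * x1 + DX X p 1 1 * y1) + 2 * g * (DX X p 1 0 * x0 + DX X p 1 1 * y0)).
    by move: (DX X p 1 0) (DX X p 1 1) => *; ring.
  by rewrite Jd Jb mulr0 addr0.
- by rewrite -aE.
- by rewrite ME.
by rewrite BE ME -aE; apply: le_trans AM; rewrite lerDl.
Qed.

Lemma bt_isolated a : bt_coefficient X p a -> a != 0 -> isolated_equilibrium X p.
Proof.
move=> ha a0; have [U [W [h [k [l [XE _ iso]]]]]] := bt_chart ha a0.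
have [[oU Up] _ _ _ _] := XE; split=> //.
by apply: filterS (open_nbhs_nbhs (conj oU Up)) => z; exact: iso.
Qed.

Lemma bt_cusp a : bt_coefficient X p a -> a != 0 ->
  [/\ topologically_cusp X p, ~ saddle_type X p, ~ focus_type X p & ~ elliptic_type X p].
Proof.
move=> ha a0; have [U [W [h [k [l [XE foc _]]]]]] := bt_chart ha a0.
split.
- have [U' [W' [h' [k' E']]]] := cusp_model_chart.
  have [U2 [W2 E2]] := equivalence_trans XE (equivalence_sym E').
  exact: equivalence_locally_equivalent E2.
- exact: saddle_type_flow_box XE.
- exact: (@focus_type_flow_box R X p U W h k XE l foc).
- exact: elliptic_type_flow_box XE.
Qed.

End Cusp.

(** * Common factors of polynomials in two variables *)

Section CommonFactors.
Variable K : fieldType.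
Notation P2 := {poly {poly K}}.
Implicit Types (A B g h : P2) (c : {poly K}).

Lemma irreducible_divisor c : (1 < size c)%N -> exists2 q, irreducible_poly q & q %| c.
Proof.
have [n] := ubnP (size c); elim: n c => // n IH c cn c1.
have [irr|] := pselect (forall q : {poly K}, size q != 1%N -> q %| c -> q %= c); first by exists c => //.
move=> /existsNP[q] /not_implyP[q1] /not_implyP[qc /negP nqc].
have c0 : c != 0 by rewrite -size_poly_gt0; exact: leq_trans c1.
have q0 : q != 0 by apply: contraNneq c0 => q0; rewrite q0 dvd0p in qc.
have lt : (size q < size c)%N.
  by rewrite ltn_neqAle dvdp_leq // andbT dvdp_size_eqp.
have [||r irr rq] := IH q.
- exact: leq_trans lt _.
- by have : (0 < size q)%N by [rewrite size_poly_gt0]; case: (size q) q1 => [|[]].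
by exists r => //; exact: dvdp_trans rq qc.
Qed.

(** Gauss's lemma: if g and h have coefficients not divisible by q, the first such ones contribute
    to the product the only term of its coefficient that q does not divide. *)
Lemma dvd_const_prime q g h : irreducible_poly q ->
  (forall i, q %| (g * h)`_i) -> (forall i, q %| g`_i) \/ (forall i, q %| h`_i).
Proof.
move=> irr gh; apply: contrapT => /not_orP[/existsNP hg /existsNP hh].
have min (f : P2) : (exists i, ~ q %| f`_i) ->
    exists2 i, ~~ (q %| f`_i) & forall j, (j < i)%N -> q %| f`_j.
  move=> [i /negP fi]; have ex : exists i, ~~ (q %| f`_i) by exists i.
  exists (ex_minn ex); case: ex_minnP => // m fm mmin j jm.
  by apply: contraTT jm => /mmin; rewrite -leqNgt.
have [i gi imin] := min _ hg; have [j hj jmin] := min _ hh.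
have := gh (i + j)%N; rewrite coefM.
have ij : (i < (i + j).+1)%N by rewrite ltnS leq_addr.
rewrite (bigD1 (Ordinal ij)) //= addKn dvdp_addl.
  by rewrite Gauss_dvdpr ?(negbTE hj) // irreducible_poly_coprime.
apply: (big_ind (fun u => q %| u)) => [|u v|k /eqP ki]; [exact: dvdp0|exact: dvdp_add|].
have [lt|le] := ltnP k i; first by rewrite dvdp_mulr // imin.
have ki' : (i < k)%N by rewrite ltn_neqAle le andbT; apply/eqP => E; apply: ki; apply/val_inj.
rewrite dvdp_mull // jmin //; have := ltn_ord k; lia.
Qed.

Lemma dvd_constP q g : q != 0 -> (forall i, q %| g`_i) -> exists g', g = q%:P * g'.
Proof.
move=> q0 h; exists (map_poly (fun c => c %/ q) g).
apply/polyP => i; rewrite coefCM coef_map_id0 ?div0p //.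
by rewrite mulrC divpK.
Qed.

(** The denominator c in K[y] is removed one irreducible factor at a time: by Gauss's lemma each
    divides g, or else both cofactors, and dividing by it keeps the degree of g in x. *)
Lemma gauss_factor c g h1 h2 A B : c != 0 -> (1 < size g)%N ->
  c%:P * A = g * h1 -> c%:P * B = g * h2 ->
  exists E A' B', [/\ A = E * A', B = E * B' & (1 < size E)%N].
Proof.
have [n] := ubnP (size c); elim: n c g h1 h2 => // n IH c g h1 h2 cn c0 g1 EA EB.
have [c1|/irreducible_divisor[q irr /dvdpP[r cE]]] := leqP (size c) 1.
  have cE := size1_polyC c1; set d := c`_0 in cE.
  have d0 : d != 0 by apply: contraNneq c0 => d0; rewrite cE d0.
  have dK (F : P2) : (d^-1)%:P%:P * (c%:P * F) = F.
    by rewrite mulrA -rmorphM cE -rmorphM mulVf // mul1r.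
  exists g, ((d^-1)%:P%:P * h1), ((d^-1)%:P%:P * h2); split=> //.
    by rewrite -[LHS]dK EA mulrCA.
  by rewrite -[LHS]dK EB mulrCA.
have [r0 q0] : r != 0 /\ q != 0 by apply/andP; move: c0; rewrite cE mulf_eq0 negb_or.
have q1 : (1 < size q)%N by case: irr.
have rn : (size r < n)%N.
  have sr : (0 < size r)%N by rewrite size_poly_gt0.
  by move: cn q1 sr; rewrite cE size_mul //; move: (size r) (size q) => *; lia.
have qP0 : q%:P != 0 :> P2 by rewrite polyC_eq0.
have qc F f h : c%:P * F = f * h -> forall i, q %| (f * h)`_i.
  by move=> <- i; rewrite coefCM cE dvdp_mulr // dvdp_mull.
have qI F f : c%:P * F = q%:P * f -> r%:P * F = f.
  by rewrite cE mulrC rmorphM mulrA mulrC mulrA [_ * r%:P]mulrC mulrA => E; apply: (mulfI qP0); rewrite -E; ring.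
have [/dvd_constP[//|g' gE]|ng] := pselect (forall i, q %| g`_i).
  apply: (IH r g' h1 h2) => //.
  - by move: g1; rewrite gE size_Cmul.
  - by apply: qI; rewrite EA gE mulrA.
  - by apply: qI; rewrite EB gE mulrA.
have [//|/dvd_constP[//|h1' h1E]] := dvd_const_prime irr (qc _ _ _ EA).
have [//|/dvd_constP[//|h2' h2E]] := dvd_const_prime irr (qc _ _ _ EB).
apply: (IH r g h1' h2') => //.
- by apply: qI; rewrite EA h1E mulrCA.
- by apply: qI; rewrite EB h2E mulrCA.
Qed.

(** The resultant in x lies in the ideal. If it vanished, the pseudo-gcd would be a common factor up
    to denominators in K[y], and [gauss_factor] would turn it into a true one. *)
Lemma coprime_combination A B : A != 0 -> B != 0 ->
  (forall E A' B', A = E * A' -> B = E * B' -> (size E <= 1)%N) ->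
  exists2 r : {poly K}, r != 0 & exists U V : P2, r%:P = U * A + V * B.
Proof.
move=> A0 B0 cop.
have [A1|A1] := leqP (size A) 1.
  exists A`_0; first by rewrite -(polyC_eq0 A`_0) -size1_polyC.
  by exists 1, 0; rewrite mul1r mul0r addr0 -size1_polyC.
have [B1|B1] := leqP (size B) 1.
  exists B`_0; first by rewrite -(polyC_eq0 B`_0) -size1_polyC.
  by exists 0, 1; rewrite mul1r mul0r add0r -size1_polyC.
exists (resultant A B); last first.
  by have [[U V] _ E] := resultant_in_ideal A1 B1; exists U, V.
rewrite resultant_eq0; apply/negP => g1.
set g := Pdiv.Idomain.gcdp A B in g1.
have /Pdiv.Idomain.dvdpP[[c1 h1] /= c10 E1] : Pdiv.Idomain.dvdp g A by exact: Pdiv.Idomain.dvdp_gcdl.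
have /Pdiv.Idomain.dvdpP[[c2 h2] /= c20 E2] : Pdiv.Idomain.dvdp g B by exact: Pdiv.Idomain.dvdp_gcdr.
have [|//|||E [A' [B' [EA EB E1']]]] := @gauss_factor (c1 * c2) g (c2%:P * h1) (c1%:P * h2) A B.
- by rewrite mulf_neq0.
- by rewrite rmorphM mulrAC (mul_polyC c1 A) E1; ring.
- by rewrite rmorphM -mulrA !mul_polyC E2 -!mul_polyC; ring.
by have := cop _ _ _ EA EB; rewrite leqNgt E1'.
Qed.

(** The bound on [sizeY] also excludes common factors in y alone, which are units over K(y) but
    vanish on a line y = b. *)
Definition coprime2 A B :=
  forall E A' B', A = E * A' -> B = E * B' -> (size E <= 1)%N /\ (sizeY E <= 1)%N.

Lemma maximal_divisor A B : A != 0 -> B != 0 ->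
  exists D A' B', [/\ A = D * A', B = D * B' & coprime2 A' B'].
Proof.
have [n] := ubnP (size A + sizeY A); elim: n A B => // n IH A B An A0 B0.
have [cop|] := pselect (coprime2 A B); first by exists 1, A, B; rewrite !mul1r.
move=> /existsNP[E] /existsNP[A'] /existsNP[B'] /not_implyP[EA] /not_implyP[EB] h.
have [E0 A0'] : E != 0 /\ A' != 0 by apply/andP; move: A0; rewrite EA mulf_eq0 negb_or.
have B0' : B' != 0 by move: B0; rewrite EB mulf_eq0 negb_or => /andP[].
have [||//|D [A2 [B2 [EA' EB' cop]]]] := IH A' B'.
- move: An; rewrite EA !sizeYE rmorphM /= !size_mul ?swapXY_eq0 //.
  have sE : (0 < size E)%N by rewrite size_poly_gt0.
  have sE' : (0 < size (swapXY E))%N by rewrite size_poly_gt0 swapXY_eq0.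
  have sA : (0 < size A')%N by rewrite size_poly_gt0.
  have sA' : (0 < size (swapXY A'))%N by rewrite size_poly_gt0 swapXY_eq0.
  move: h; rewrite sizeYE => /not_andP[] /negP; rewrite -ltnNge;
    move: (size E) (size A') (size (swapXY E)) (size (swapXY A')) sE sE' sA sA' => *; lia.
- exact: A0'.
by exists (E * D), A2, B2; rewrite -!mulrA -EA' -EB'.
Qed.

Lemma coprime_restriction A B (b : K) : coprime2 A B ->
  map_poly (horner_eval b) A != 0 \/ map_poly (horner_eval b) B != 0.
Proof.
move=> cop; apply: contrapT => /not_orP[/negP/negPn/eqP hA /negP/negPn/eqP hB].
have fac (F : P2) : map_poly (horner_eval b) F = 0 -> exists F', F = ('X - b%:P)%:P * F'.
  move=> h; apply: dvd_constP; first by rewrite polyXsubC_eq0.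
  by move=> i; rewrite dvdp_XsubCl /root -[(F`_i).[b]]/(horner_eval b F`_i) -coef_map h coef0.
have [A' EA] := fac _ hA; have [B' EB] := fac _ hB.
have [_] := cop _ _ _ EA EB.
by rewrite sizeYE swapXY_polyC size_map_polyC size_XsubC.
Qed.

End CommonFactors.

(** * Convex hulls of finite sets *)

Section Hull.
Variable R : realType.
Implicit Types (C K S : set (R * R)) (x y z : R * R) (s : seq (R * R)).

Definition mix (t : R) x y : R * R := (t * x.1 + (1 - t) * y.1, t * x.2 + (1 - t) * y.2).

Definition mix_closed C := forall t x y, 0 <= t <= 1 -> C x -> C y -> C (mix t x y).

Lemma convex_setP C : convex_set C <-> mix_closed C.
Proof.
split=> h.
- move=> t x y /andP[t0 t1] Cx Cy.
  have := h x y (Itv01 t0 t1); rewrite !inE => /(_ Cx Cy).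
  by congr C; apply: injective_projections.
- move=> x y l; rewrite !inE => Cx Cy.
  have := h l%:num x y; rewrite ge0 le1 => /(_ isT Cx Cy).
  by congr C; apply: injective_projections.
Qed.

Lemma hull_sub S : S `<=` convex_hull S.
Proof. exact: sub_smallest. Qed.

Lemma hull_convex S : mix_closed (convex_hull S).
Proof.
move=> t x y t01 hx hy C [cC SC].
by move/convex_setP: (cC); apply => //; [apply: hx|apply: hy].
Qed.

Lemma hull_min S C : mix_closed C -> S `<=` C -> convex_hull S `<=` C.
Proof. by move=> cC SC; apply: smallest_sub => //; apply/convex_setP. Qed.

Lemma mix_continuous x : continuous (fun u : R * (R * R) => mix u.1 x u.2).
Proof.
have c (f : R * R -> R) (a : R) : continuous f ->
    continuous (fun u : R * (R * R) => u.1 * a + (1 - u.1) * f u.2).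
  move=> cf z; apply: cvgD; apply: cvgM.
  - exact: cvg_fst.
  - exact: cvg_cst.
  - by apply: cvgB; [exact: cvg_cst|exact: cvg_fst].
  - by apply: (cvg_comp snd f); [exact: cvg_snd|exact: cf].
move=> u; apply: (@continuous_pair _ _ _ (fun u : R * (R * R) => u.1 * x.1 + (1 - u.1) * u.2.1)
  (fun u => u.1 * x.2 + (1 - u.1) * u.2.2)).
  by apply: (c fst) => z; exact: cvg_fst.
by apply: (c snd) => z; exact: cvg_snd.
Qed.

(** Adding a point y replaces the hull C by the union of the segments from y to C, a continuous
    image of [0, 1] x C. *)
Lemma hull_compact s : compact (convex_hull [set` s]).
Proof.
case: s => [|x s].
  suff -> : convex_hull [set` [::]] = set0 :> set (R * R) by exact: compact0.
  by apply/seteqP; split=> // z; apply: hull_min => // t a b _ [].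
elim/last_ind: s => [|s y IH].
  suff -> : convex_hull [set` [:: x]] = [set x] by exact: compact_set1.
  apply/seteqP; split.
    apply: hull_min => [t a b _ -> ->|z /=]; last by rewrite inE => /eqP.
    by apply: injective_projections; rewrite /mix /=; ring.
  by move=> z ->; apply: hull_sub; rewrite /= inE.
pose C := convex_hull [set` x :: s].
pose J := [set mix u.1 y u.2 | u in (`[0, 1]%classic : set R) `*` C].
have cJ : compact J.
  apply: continuous_compact; last by apply: compact_setX; [exact: segment_compact|].
  by apply: continuous_subspaceT; exact: mix_continuous.
have CJ : C `<=` J.
  move=> z Cz; exists (0, z); first by split=> //=; rewrite in_itv /= lexx ler01.
  by apply: injective_projections; rewrite /mix /=; ring.
have Cx : C x by apply: hull_sub; rewrite /= mem_head.
have Jy : J y.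
  exists (1, x); first by split=> //=; rewrite in_itv /= lexx ler01.
  by apply: injective_projections; rewrite /mix /=; ring.
suff -> : convex_hull [set` x :: rcons s y] = J by [].
apply/seteqP; split.
  apply: hull_min; last first.
    move=> z /=; rewrite -rcons_cons mem_rcons inE => /orP[/eqP ->//|zs].
    by apply: CJ; exact: hull_sub.
  move=> l _ _ /andP[l0 l1] [[t c] /= [t01 Cc] <-] [[t' c'] /= [t01' Cc'] <-].
  rewrite /= in_itv /= in t01; rewrite /= in_itv /= in t01'.
  have [t0 t1] := andP t01; have [t0' t1'] := andP t01'.
  (* [a] and [b] are the weights of [c] and [c'] in the mixture. The weight of y is 1 - (a + b), and
     the remaining part is a + b times a point of C unless a + b = 0. *)
  pose a := l * (1 - t); pose b := (1 - l) * (1 - t').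
  have a0 : 0 <= a by rewrite mulr_ge0 // subr_ge0.
  have b0 : 0 <= b by rewrite mulr_ge0 // subr_ge0.
  have ab : l * t + (1 - l) * t' = 1 - (a + b) by rewrite /a /b; ring.
  have ab1 : a + b <= 1.
    by rewrite -subr_ge0 -ab addr_ge0 // mulr_ge0 // subr_ge0.
  have [ab0|ab0] := eqVneq (a + b) 0.
    have [a00 b00] : a = 0 /\ b = 0 by split; lra.
    have -> : mix l (mix t y c) (mix t' y c') = y; last exact: Jy.
    have e (u v w : R) : l * (t * u + (1 - t) * v) + (1 - l) * (t' * u + (1 - t') * w) =
      (1 - (a + b)) * u + a * v + b * w by rewrite /a /b; ring.
    by apply: injective_projections; rewrite /mix /= e a00 b00; ring.
  exists (1 - (a + b), mix (a / (a + b)) c c').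
    split=> /=; first by rewrite in_itv /= subr_ge0 ab1 gerBl addr_ge0.
    apply: hull_convex => //; rewrite divr_ge0 ?addr_ge0 //=.
    by rewrite ler_pdivrMr ?mul1r ?lerDl // lt_neqAle eq_sym ab0 addr_ge0.
  have e (u v w : R) : (1 - (a + b)) * u + (1 - (1 - (a + b))) * (a / (a + b) * v + (1 - a / (a + b)) * w) =
      l * (t * u + (1 - t) * v) + (1 - l) * (t' * u + (1 - t') * w).
    transitivity ((1 - (a + b)) * u + a * v + b * w); last by rewrite /a /b; ring.
    by field.
  by apply: injective_projections; rewrite /mix /= e.
move=> _ [[t c] /= [t01 Cc] <-]; apply: hull_convex.
- by rewrite /= in_itv in t01.
- by apply: hull_sub; rewrite /= -rcons_cons mem_rcons mem_head.
apply: (hull_min _ _ Cc); first exact: hull_convex.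
by move=> z /= zs; apply: hull_sub; rewrite /= -rcons_cons mem_rcons inE zs orbT.
Qed.

(** The functional is the scalar product with z - c, where c is a point of K nearest to z. *)
Lemma separation K z : K !=set0 -> compact K -> mix_closed K -> ~ K z ->
  exists l : R * R, forall w, K w -> l.1 * w.1 + l.2 * w.2 < l.1 * z.1 + l.2 * z.2.
Proof.
move=> K0 cK hK nKz; pose d w := (z.1 - w.1) * (z.1 - w.1) + (z.2 - w.2) * (z.2 - w.2).
have dc : continuous d.
  by move=> w; apply: cvgD; apply: cvgM; apply: cvgB; (exact: cvg_cst || exact: cvg_fst || exact: cvg_snd).
have [c] := compact_EVT_min K0 cK (continuous_subspaceT dc); rewrite inE => Kc cmin.
have cz : d c != 0.
  apply/eqP => /eqP; rewrite /d -!expr2 paddr_eq0 ?sqr_ge0 // !sqrf_eq0 !subr_eq0 => /andP[/eqP e1 /eqP e2].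
  by apply: nKz; rewrite [z]surjective_pairing e1 e2 -surjective_pairing.
have d0 : 0 < d c by rewrite lt_neqAle eq_sym cz /d -!expr2 addr_ge0 ?sqr_ge0.
exists (z.1 - c.1, z.2 - c.2) => w Kw /=.
pose v := (z.1 - c.1) * (w.1 - c.1) + (z.2 - c.2) * (w.2 - c.2).
suff v0 : v <= 0 by move: d0 v0; rewrite /d /v; nra.
rewrite leNgt; apply/negP => v0.
pose m := (w.1 - c.1) ^+ 2 + (w.2 - c.2) ^+ 2.
have m0 : 0 <= m by rewrite addr_ge0 ?sqr_ge0.
(* If the angle at c were acute, moving from c towards w by this fraction [t] of the segment would
   change the squared distance by -t v - t^2 v < 0. *)
pose t := v / (v + m); have vm : 0 < v + m by rewrite ltr_pwDl.
have t0 : 0 < t by rewrite divr_gt0.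
have t1 : t <= 1 by rewrite ler_pdivrMr // mul1r lerDl.
have := cmin (mix t w c); rewrite inE => /(_ (hK _ _ _ _ Kw Kc)); rewrite ltW //= t1 => /(_ isT).
have -> : d (mix t w c) = d c - 2 * t * v + t ^+ 2 * m by rewrite /d /v /m /mix /=; ring.
have tm : t * (v + m) = v by rewrite /t divfK // gt_eqF.
have : t ^+ 2 * m = t * (t * (v + m)) - t ^+ 2 * v by ring.
rewrite tm.
have tv : 0 < t * v by rewrite mulr_gt0.
have : 0 < t ^+ 2 * v by rewrite mulr_gt0 ?exprn_gt0.
lra.
Qed.

End Hull.

(** * Supports of products: Ostrowski's theorem *)

Section Ostrowski.
Variables (R : realType) (K : fieldType).
Notation P2 := {poly {poly K}}.
Implicit Types (q D A : P2).

Lemma coef2M D A i j : (D * A)`_i`_j =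
  \sum_(a < i.+1) \sum_(b < j.+1) D`_a`_b * A`_(i - a)`_(j - b).
Proof. by rewrite coefM coef_sum; apply: eq_bigr => a _; rewrite coefM. Qed.

Lemma coef2_neq0 q i j : q`_i`_j != 0 -> (i < size q)%N /\ (j < sizeY q)%N.
Proof.
move=> qij; split.
  by rewrite ltnNge; apply: contra qij => h; rewrite (nth_default 0 h) coef0.
apply: leq_trans (max_size_coefXY q i); rewrite ltnNge.
by apply: contra qij => h; rewrite nth_default.
Qed.

Lemma exists_coef2 q : q != 0 -> exists i j, q`_i`_j != 0.
Proof.
move=> q0; exists (size q).-1, (size (lead_coef q)).-1.
by rewrite -[q`_ _]/(lead_coef q) -[(lead_coef q)`_ _]/(lead_coef (lead_coef q)) !lead_coef_eq0.
Qed.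

Lemma lexicographic_max q (v : nat -> nat -> R) (w : nat -> nat -> nat) : q != 0 ->
  exists i j, q`_i`_j != 0 /\ forall a b, q`_a`_b != 0 ->
    v a b <= v i j /\ (v a b = v i j -> (w a b <= w i j)%N).
Proof.
move=> /exists_coef2[i [j qij]]; have [iq jq] := coef2_neq0 qij.
pose m0 : 'I_(size q) * 'I_(sizeY q) := (Ordinal iq, Ordinal jq).
pose P (m : 'I_(size q) * 'I_(sizeY q)) := q`_m.1`_m.2 != 0.
have P0 : P m0 by [].
case: (@Order.TotalTheory.arg_maxP _ _ _ m0 P (fun m => v m.1 m.2) P0) => m1 Pm1 m1max.
pose P' m := P m && (v m.1 m.2 == v m1.1 m1.2).
have P'1 : P' m1 by rewrite /P' Pm1 eqxx.
case: (@arg_maxnP _ m1 P' (fun m => w m.1 m.2) P'1) => m2 /andP[Pm2 /eqP vm2] m2max.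
exists m2.1, m2.2; split=> // a b qab; have [aq bq] := coef2_neq0 qab.
split; first by rewrite vm2; exact: (m1max (Ordinal aq, Ordinal bq)).
move=> vab; apply: (m2max (Ordinal aq, Ordinal bq)).
by rewrite /P' /P /= qab vab vm2 eqxx.
Qed.

(* The top term for a linear functional, ties being broken by an injective one, is multiplicative. *)
Lemma ostrowski D A (S : set (R * R)) (c : R * R) : D != 0 -> A != 0 ->
  compact S -> mix_closed S ->
  (forall i j, (D * A)`_i`_j != 0 -> S (i%:R - c.1, j%:R - c.2)) ->
  forall i j k l, D`_i`_j != 0 -> A`_k`_l != 0 -> S ((i + k)%:R - c.1, (j + l)%:R - c.2).
Proof.
move=> D0 A0 cS hS suppS i j k l Dij Akl; apply: contrapT => nS.
have S0 : S !=set0.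
  have [a [b ab]] := exists_coef2 (mulf_neq0 D0 A0).
  by eexists; exact: suppS ab.
have [u sep] := separation S0 cS hS nS.
pose v (a b : nat) : R := u.1 * a%:R + u.2 * b%:R.
(* On the support of D this is injective, as the degrees in y are below [sizeY D]; quotient and
   remainder by [sizeY D] recover the exponent. *)
pose w (a b : nat) := (sizeY D * a + b)%N.
have [i0 [j0 [Dij0 Dmax]]] := lexicographic_max v w D0.
have [k0 [l0 [Akl0 Amax]]] := lexicographic_max v w A0.
suff : (D * A)`_(i0 + k0)`_(j0 + l0) != 0.
  move=> /suppS/sep; rewrite !natrD /=.
  have [h1 _] := Dmax _ _ Dij; have [h2 _] := Amax _ _ Akl.
  by move: h1 h2; rewrite /v; lra.
rewrite coef2M.
have i0l : (i0 < (i0 + k0).+1)%N by rewrite ltnS leq_addr.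
have j0l : (j0 < (j0 + l0).+1)%N by rewrite ltnS leq_addr.
have vD (a b a' b' : nat) : v (a + a')%N (b + b')%N = v a b + v a' b' by rewrite /v !natrD; ring.
have zero (a : 'I_(i0 + k0).+1) (b : 'I_(j0 + l0).+1) : (a != i0 :> nat) || (b != j0 :> nat) ->
    D`_a`_b * A`_(i0 + k0 - a)`_(j0 + l0 - b) = 0.
  move=> ne; apply/eqP; apply: contraTT ne; rewrite mulf_eq0 negb_or => /andP[Dab Aab].
  have [d1 d2] := Dmax _ _ Dab; have [a1 a2] := Amax _ _ Aab.
  have ea : (a + (i0 + k0 - a) = i0 + k0)%N by rewrite subnKC // -ltnS.
  have eb : (b + (j0 + l0 - b) = j0 + l0)%N by rewrite subnKC // -ltnS.
  have vE : v a b + v (i0 + k0 - a)%N (j0 + l0 - b)%N = v i0 j0 + v k0 l0.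
    by rewrite -!vD ea eb.
  have {}d2 := d2 ltac:(lra); have {}a2 := a2 ltac:(lra).
  have [_ bN] := coef2_neq0 Dab; have [_ jN] := coef2_neq0 Dij0.
  move: d2 a2; rewrite /w => d2 a2.
  have ww : (sizeY D * a + b = sizeY D * i0 + j0)%N.
    have : (sizeY D * a + b + (sizeY D * (i0 + k0 - a) + (j0 + l0 - b)) =
            sizeY D * i0 + j0 + (sizeY D * k0 + l0))%N.
      by rewrite addnACA -mulnDr ea eb; ring.
    move: d2 a2; clear; move: (sizeY D * _)%N (sizeY D * i0)%N (sizeY D * k0)%N (sizeY D * _)%N => *; lia.
  have /= := congr1 (fun n => (n %/ sizeY D, n %% sizeY D))%N ww.
  rewrite ![(sizeY D * _)%N]mulnC !modnMDl !divnMDl; try by apply: leq_ltn_trans jN.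
  rewrite !modn_small // !divn_small // !addn0 => -[-> ->].
  by rewrite !eqxx.
rewrite (bigD1 (Ordinal i0l)) //= (bigD1 (Ordinal j0l)) //= !addKn.
rewrite big1 ?addr0 => [|b bj]; last by have := @zero (Ordinal i0l) b; rewrite /= addKn => ->; rewrite // bj orbT.
rewrite big1 ?addr0 ?mulf_neq0 // => a ai.
by rewrite big1 // => b _; apply: zero; rewrite ai.
Qed.

End Ostrowski.

(** * Counting lattice cells *)

Section Cells.
Variable R : realType.
Implicit Types (K S : set (R * R)) (m : int * int) (z : R * R) (n : nat) (M : set (int * int)).

(** Half-open cells of mesh 1/n, indexed by the lower left corner, partition the plane. The strict
    lower bounds later give strict inequalities between degrees. *)
Definition cell n m : set (R * R) :=
  `]m.1%:~R / n%:R, (m.1 + 1)%:~R / n%:R]%classic `*` `]m.2%:~R / n%:R, (m.2 + 1)%:~R / n%:R]%classic.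

Lemma cellP n m z : (0 < n)%N -> cell n m z <->
  (m.1%:~R < n%:R * z.1 <= m.1%:~R + 1) /\ (m.2%:~R < n%:R * z.2 <= m.2%:~R + 1).
Proof.
move=> n0; rewrite /cell /= !in_itv /= !intrD.
by rewrite !ltr_pdivrMr ?ltr0n // !ler_pdivlMr ?ltr0n // ![_ * n%:R]mulrC.
Qed.

Lemma cell_exists n z : (0 < n)%N -> exists m, cell n m z.
Proof.
move=> n0; exists (Num.ceil (n%:R * z.1) - 1, Num.ceil (n%:R * z.2) - 1).
apply/cellP => //=; rewrite -!intrD1 !subrK.
by split; exact: ceil_itv.
Qed.

Lemma cell_trivIset n M : (0 < n)%N -> trivIset M (cell n).
Proof.
move=> n0 m m' _ _ [z [/cellP-/(_ n0)[/andP[a1 a2] /andP[a3 a4]] /cellP-/(_ n0)[/andP[b1 b2] /andP[b3 b4]]]].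
have h (i j : int) (x : R) : i%:~R < x -> x <= i%:~R + 1 -> j%:~R < x -> x <= j%:~R + 1 -> i = j.
  move=> i1 i2 j1 j2.
  have : (i%:~R : R) < (j + 1)%:~R by rewrite intrD; apply: lt_le_trans j2.
  have : (j%:~R : R) < (i + 1)%:~R by rewrite intrD; apply: lt_le_trans i2.
  by clear; rewrite !ltr_int; lia.
by rewrite [m]surjective_pairing [m']surjective_pairing (h _ _ _ a1 a2 b1 b2) (h _ _ _ a3 a4 b3 b4).
Qed.

Lemma measurable_cell n m : measurable (cell n m).
Proof. exact: measurableX. Qed.

Lemma area_rectangle (A B : set (measurableTypeR R)) : measurable A -> measurable B ->
  area (A `*` B) = (lebesgue_measure A * lebesgue_measure B)%E.
Proof. exact: product_measure1E. Qed.

Lemma area_cell n m : (0 < n)%N -> area (cell n m) = ((n%:R ^+ 2)^-1)%:E :> \bar R.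
Proof.
move=> n0.
have h (i : int) : lebesgue_measure (`]i%:~R / n%:R, (i + 1)%:~R / n%:R]%classic : set R) = (n%:R^-1)%:E.
  rewrite lebesgue_measure_itv /= lte_fin ltr_pM2r ?invr_gt0 ?ltr0n // ltr_int ltzD1 lexx.
  by rewrite -EFinB -mulrBl intrD addrAC subrr add0r mul1r.
rewrite /cell area_rectangle // (h m.1) (h m.2) -EFinM; congr EFin.
by rewrite expr2 invfM.
Qed.

Lemma area_cells n M : (0 < n)%N -> finite_set M ->
  area (\bigcup_(m in M) cell n m) = ((#|` fset_set M|)%:R / n%:R ^+ 2)%:E :> \bar R.
Proof.
move=> n0 fM; rewrite /area measure_fin_bigcup //; first last.
- by move=> m _; exact: measurable_cell.
- exact: cell_trivIset.
rewrite fsbig_finite //= (eq_bigr (fun=> ((n%:R ^+ 2)^-1)%:E)); last by move=> m _; exact: area_cell.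
by rewrite sumEFin big_const_seq iter_addr_0 count_predT mulr_natl.
Qed.

(** The two lines z.1 = a and z.2 = b are null sets, so their points may be left out of the
    count. *)
Lemma area_le_cells n M K (a b : R) : (0 < n)%N -> finite_set M -> measurable K ->
  (forall z, K z -> a <= z.1 /\ b <= z.2) ->
  (forall m z, K z -> a < z.1 -> b < z.2 -> cell n m z -> M m) ->
  (area K <= ((#|` fset_set M|)%:R / n%:R ^+ 2)%:E)%E.
Proof.
move=> n0 fM mK Kab KM; rewrite -(area_cells n0 fM) /area.
pose mu := (@lebesgue_measure R \x @lebesgue_measure R)%E.
pose E := \bigcup_(m in M) cell n m.
pose L1 : set (R * R) := [set a] `*` setT; pose L2 : set (R * R) := setT `*` [set b].
have mE : measurable E by apply: fin_bigcup_measurable => // m _; exact: measurable_cell.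
have m1 : measurable L1 by apply: measurableX.
have m2 : measurable L2 by apply: measurableX.
have sub : K `<=` E `|` (L1 `|` L2).
  move=> z Kz; have [az bz] := Kab _ Kz.
  have [e|a1] := eqVneq a z.1; first by right; left.
  have [e|b1] := eqVneq b z.2; first by right; right.
  have [m mz] := cell_exists z n0; left; exists m => //.
  by apply: KM Kz _ _ mz; rewrite lt_neqAle ?a1 ?b1.
have L10 : area L1 = 0%E by rewrite area_rectangle // (lebesgue_measure_set1 a) mul0e.
have L20 : area L2 = 0%E by rewrite area_rectangle // (lebesgue_measure_set1 b) mule0.
apply: (@le_trans _ _ (mu (E `|` (L1 `|` L2)))).
  by apply: le_measure => //; rewrite inE //; apply: measurableU => //; exact: measurableU.
apply: le_trans (@measureU2 _ _ _ mu _ _ mE (measurableU _ _ m1 m2)) _.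
rewrite -[leRHS]adde0 leeD2l //; apply: le_trans (@measureU2 _ _ _ mu _ _ m1 m2) _.
by rewrite [X in (X + _)%E]L10 [X in (_ + X)%E]L20 adde0.
Qed.

Definition lattice_near n (s : nat) K : set (int * int) := [set m | exists2 z, K z &
  `|n%:R * z.1 - m.1%:~R| <= s%:R /\ `|n%:R * z.2 - m.2%:~R| <= s%:R].

Lemma lattice_near_finite n s K : compact K -> finite_set (lattice_near n s K).
Proof.
move=> /compact_bounded[B [_ hB]]; have {}hB := hB (B + 1) (ltr_pwDr ltr01 (lexx _)).
have [N hN] : exists N : nat, n%:R * (B + 1) + s%:R < N%:R :> R.
  by exists (Num.bound `|n%:R * (B + 1) + s%:R|); apply: le_lt_trans (ler_norm _) (archi_boundP (normr_ge0 _)).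
pose I : set int := [set (i%:Z - N%:Z)%R | i in `I_(N + N).+1].
apply: (@sub_finite_set _ _ (I `*` I)); last first.
  by apply: finite_setX; apply: finite_image; exact: finite_II.
have h (x : R) (i : int) : `|x| <= B + 1 -> `|n%:R * x - i%:~R| <= s%:R -> I i.
  move=> xB xi; have : `|i%:~R| < N%:R :> R.
    apply: le_lt_trans hN; rewrite -[i%:~R](subKr (n%:R * x)) ; apply: le_trans (ler_normB _ _) _.
    by rewrite lerD // normrM ger0_norm // ler_wpM2l.
  rewrite -intr_norm -[N%:R]/(N%:Z%:~R) ltr_int => iN.
  exists (absz (i + N%:Z)) => /=; clear -iN; lia.
move=> m [z Kz [h1 h2]]; have := hB z Kz; rewrite /= prod_normE ge_max => /andP[z1 z2].
by split; [exact: h z1 h1|exact: h z2 h2].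
Qed.

(** A compact K is the intersection of the finite unions [E j] of dyadic cells attached to lattice
    points near 2^j K. These unions decrease, so their areas converge to that of K. *)
Lemma area_ge_near (s : nat) K (c : \bar R) : (0 < s)%N -> compact K ->
  (forall j, (c <= ((#|` fset_set (lattice_near (2 ^ j) s K)|)%:R / (2 ^ j)%:R ^+ 2)%:E)%E) ->
  measurable K /\ (c <= area K)%E.
Proof.
move=> s0 cK hc; pose E j := \bigcup_(m in lattice_near (2 ^ j) s K) cell (2 ^ j) m.
have p2 j : (0 < 2 ^ j)%N by rewrite expn_gt0.
have fM j := @lattice_near_finite (2 ^ j) s K cK.
have mE j : measurable (E j) by apply: fin_bigcup_measurable => // m _; exact: measurable_cell.
have KE : \bigcap_j E j = K.
  apply/seteqP; split=> [z zE|z Kz j _]; last first.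
    have [m mz] := cell_exists z (p2 j); exists m => //; exists z => //.
    have s1 : 1 <= s%:R :> R by rewrite ler1n.
    by have /cellP-/(_ (p2 j))[] := mz; rewrite !ler_norml => h1 h2; split; move: h1 h2 s1; lra.
  have clK : closed K by apply: compact_closed cK; exact: norm_hausdorff.
  apply: clK => B /nbhs_ballP[e /= e0 eB].
  have [j hj] : exists j : nat, (s%:R + 1) / e < (2 ^ j)%:R :> R.
    exists (Num.bound ((s%:R + 1) / e)); apply: (@lt_trans _ _ (Num.bound ((s%:R + 1) / e))%:R); last first.
      by rewrite ltr_nat ltn_expl.
    by apply: archi_boundP; rewrite divr_ge0 ?addr_ge0 // ltW.
  have [m [w Kw [w1 w2]] mz] := zE j I; exists w; split=> //; apply: eB.
  have N0 : 0 < (2 ^ j)%:R :> R by rewrite ltr0n.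
  have /cellP-/(_ (p2 j))[h1 h2] := mz.
  have h (x y i : R) : `|(2 ^ j)%:R * y - i| <= s%:R -> i < (2 ^ j)%:R * x <= i + 1 -> `|x - y| < e.
    move=> yi xi; rewrite -(ltr_pM2l N0) -[X in X * `|_|]ger0_norm ?(ltW N0) // -normrM mulrBr.
    apply: (@le_lt_trans _ _ (s%:R + 1)); last by rewrite -ltr_pdivrMr.
    by move: yi xi; rewrite !ler_norml; lra.
  by split; [exact: h w1 h1|exact: h w2 h2].
(* The parent of a cell is found by halving its index; rounding costs at most 1/2, and s / 2 + 1 / 2
   <= s as s >= 1. *)
have dec j : E j.+1 `<=` E j.
  move=> z [m [w Kw [w1 w2]] /cellP-/(_ (p2 _))[h1 h2]].
  exists (divz m.1 2, divz m.2 2).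
    exists w => //=.
    have s1 : 1 <= s%:R :> R by rewrite ler1n.
    have h (x : R) (i : int) : `|(2 ^ j.+1)%:R * x - i%:~R| <= s%:R ->
        `|(2 ^ j)%:R * x - (divz i 2)%:~R| <= s%:R.
      have [i0 i1] : 0 <= (i - divz i 2 * 2)%:~R :> R /\ (i - divz i 2 * 2)%:~R <= 1 :> R.
        have i0 : 0 <= i - divz i 2 * 2 by clear; lia.
        have i1 : i - divz i 2 * 2 <= 1 by clear; lia.
        by move: i0 i1; rewrite -!(ler_int R).
      move: i0 i1 s1; rewrite intrB intrM expnS natrM !ler_norml; rewrite (_ : 2%:~R = 2 :> R) // -mulrA;
        clear; move: (i%:~R) ((divz i 2)%:~R) ((2 ^ j)%:R * x) => *; lra.
    by split; [exact: h w1|exact: h w2].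
  apply/cellP; rewrite ?p2 //=.
  have h (x : R) (i : int) : i%:~R < (2 ^ j.+1)%:R * x <= i%:~R + 1 ->
      (divz i 2)%:~R < (2 ^ j)%:R * x <= (divz i 2)%:~R + 1.
    have [i0 i1] : 0 <= (i - divz i 2 * 2)%:~R :> R /\ (i - divz i 2 * 2)%:~R <= 1 :> R.
      have i0 : 0 <= i - divz i 2 * 2 by clear; lia.
        have i1 : i - divz i 2 * 2 <= 1 by clear; lia.
        by move: i0 i1; rewrite -!(ler_int R).
    move: i0 i1; rewrite intrB intrM expnS natrM; rewrite (_ : 2%:~R = 2 :> R) // -mulrA;
        clear; move: (i%:~R) ((divz i 2)%:~R) ((2 ^ j)%:R * x) => *; lra.
  by split; [exact: h h1|exact: h h2].
have mK : measurable K by rewrite -KE; exact: bigcap_measurable.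
split=> //.
have cvg : (fun j => area (E j)) @ \oo --> area K.
  rewrite -KE; apply: nonincreasing_cvg_mu => //; last 2 first.
  - by rewrite KE.
  - by apply/nonincreasing_seqP => j; apply/subsetPset; exact: dec.
  by rewrite [X in (X < _)%E](area_cells (p2 0%N) (fM 0%N)) ltry.
apply: cvge_ge cvg; apply: nearW => j.
by rewrite (area_cells (p2 j) (fM j)); exact: hc.
Qed.

End Cells.

(** * Expansion of a polynomial at a point *)

Section PolySeries.
Variable A : comNzRingType.

Definition poly_powser (q : {poly A}) : powser A := fun i => q`_i.

Fact poly_powser_additive : zmod_morphism poly_powser.
Proof. by move=> q r; apply/funext => i; rewrite powserD powserN /poly_powser coefB. Qed.
HB.instance Definition _ := GRing.isZmodMorphism.Build _ _ poly_powser poly_powser_additive.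
Fact poly_powser_multiplicative : monoid_morphism poly_powser.
Proof.
by split=> [|q r]; apply/funext => i; rewrite /poly_powser ?coef1 // coefM powserM.
Qed.
HB.instance Definition _ := GRing.isMonoidMorphism.Build _ _ poly_powser poly_powser_multiplicative.

End PolySeries.

Section Expansion.
Variables (K : fieldType) (a b : K).
Notation P2 := {poly {poly K}}.
Notation S2 := (powser (powser K)).
Implicit Types (q r F G : P2).

Let shift_y : {poly K} -> {poly K} := comp_poly ('X + b%:P).
Let shift_x : P2 -> P2 := comp_poly ('X + a%:P%:P).

Definition expansion : P2 -> S2 :=
  powser_map (@poly_powser K) \o @poly_powser {poly K} \o shift_x \o map_poly shift_y.
HB.instance Definition _ := GRing.RMorphism.on expansion.

Lemma expansionD q r : expansion (q + r) = expansion q + expansion r.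
Proof. exact: rmorphD. Qed.
Lemma expansionB q r : expansion (q - r) = expansion q - expansion r.
Proof. exact: rmorphB. Qed.
Lemma expansionM q r : expansion (q * r) = expansion q * expansion r.
Proof. exact: rmorphM. Qed.
Lemma expansionX q n : expansion (q ^+ n) = expansion q ^+ n.
Proof. exact: rmorphXn. Qed.

Lemma expansion_coef q i j : expansion q i j = ((map_poly shift_y q) \Po ('X + a%:P%:P))`_i`_j.
Proof. by []. Qed.

Lemma expansion_inj q : expansion q = 0 -> q = 0.
Proof.
move=> h; have : map_poly shift_y q \Po ('X + a%:P%:P) = 0.
  apply/polyP => i; apply/polyP => j; rewrite -expansion_coef h coef0 coef0 //.
move=> /(congr1 (fun u => u \Po ('X - a%:P%:P))); rewrite comp_poly0 -polyCN.
rewrite -comp_polyA comp_polyD comp_polyX comp_polyC polyCN subrK comp_polyXr => {}h.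
apply/polyP => i; have := congr1 (fun u : P2 => u`_i \Po ('X - b%:P)) h.
rewrite coef_map coef0 comp_poly0 /= /shift_y -comp_polyA comp_polyD comp_polyX comp_polyC subrK.
by rewrite comp_polyXr.
Qed.

Lemma expansion_C c : expansion c%:P%:P = const2 c.
Proof.
apply/funext => i; apply/funext => j; rewrite expansion_coef map_polyC /= /shift_y !comp_polyC.
by rewrite coefC /const2 /powserC; case: i => [|i]; rewrite ?coef0 // coefC.
Qed.

Lemma expansion_X : expansion 'X = s_ K + const2 a.
Proof.
apply/funext => i; apply/funext => j; rewrite expansion_coef map_polyX comp_polyX coefD coefX coefC.
rewrite coefD powserD /s_ /powserX /const2 /powserC powserD; congr (_ + _).
  by case: (i == 1%N); rewrite ?coef0 // coef1.
by case: i => [|i]; rewrite ?coef0 // coefC.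
Qed.

Lemma expansion_Y : expansion 'X%:P = t_ K + const2 b.
Proof.
apply/funext => i; apply/funext => j; rewrite expansion_coef map_polyC /= /shift_y comp_polyX comp_polyC.
rewrite coefC /t_ /const2 /powserC /powserX powserD /=; case: i => [|i] /=; last by rewrite coef0 powserD addr0.
by rewrite coefD coefX coefC powserD.
Qed.

Lemma expansion_unit q : (expansion q) 0%N 0%N != 0 -> exists h, h * expansion q = 1.
Proof. by move=> /powser2_inv[h hE]; exists h; rewrite mulrC. Qed.

Lemma expansion00 q : expansion q 0%N 0%N = q.[a%:P].[b].
Proof.
rewrite expansion_coef -!horner_coef0 horner_comp !hornerE.
have -> : (map_poly shift_y q).[a%:P] = shift_y q.[a%:P].
  by rewrite -[RHS](horner_map (comp_poly ('X + b%:P)) q a%:P) /= comp_polyC.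
by rewrite /shift_y horner_comp !hornerE.
Qed.

(** Modulo powers of s and t every series is a polynomial in x - a and y - b. So elements of the
    local quotient have polynomial representatives, whose supports can be measured. *)
Lemma expansion_truncate (F G : S2) k k' (h : S2) :
  in_ideal F G (s_ K ^+ k) -> in_ideal F G (t_ K ^+ k') -> exists q, in_ideal F G (h - expansion q).
Proof.
move=> Fs Ft.
have hy (c : powser K) l : exists q (u : S2), powserC c - expansion q = t_ K ^+ l * u.
  elim: l c => [|l IH] c; first by exists 0, (powserC c); rewrite rmorph0 subr0 mul1r.
  have [q [u E]] := IH (fun i => c i.+1).
  exists ((c 0%N)%:P%:P + ('X%:P - b%:P%:P) * q), u.
  rewrite rmorphD rmorphM rmorphB /= !expansion_C expansion_Y addrK {1}[c]powser_split rmorphD rmorphM /=.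
  rewrite -/(t_ K) -/(const2 _) exprS -mulrA -E; ring.
have hx l (f : S2) : exists q (u v : S2), f - expansion q = s_ K ^+ l * u + t_ K ^+ k' * v.
  elim: l f => [|l IH] f; first by exists 0, f, 0; rewrite rmorph0 subr0 mul1r mulr0 addr0.
  have [q [u [v E]]] := IH (fun i => f i.+1).
  have [q' [u' E']] := hy (f 0%N) k'.
  exists (q' + ('X - a%:P%:P) * q), u, (u' + s_ K * v).
  rewrite rmorphD rmorphM rmorphB /= !expansion_C expansion_X addrK {1}[f]powser_split -/(s_ K).
  transitivity (powserC (f 0%N) - expansion q' + s_ K * ((fun i => f i.+1 : powser K) - expansion q)); first by ring.
  by rewrite E E' exprS; ring.
have [q [u [v E]]] := hx k h; exists q; rewrite E.
by apply: in_idealD; rewrite mulrC; exact: in_idealM.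
Qed.

Lemma expansion_const_y (r : {poly K}) : r != 0 -> exists k (h : S2), h * expansion r%:P = t_ K ^+ k.
Proof.
move=> r0; have [k [q qb rE]] := multiplicity_XsubC r b.
rewrite r0 /= in qb; exists k.
have [h hE] : exists h, h * expansion q%:P = 1 by apply: expansion_unit; rewrite expansion00 hornerC.
exists h; rewrite rE rmorphM /= rmorphM /= mulrA hE mul1r.
by rewrite rmorphXn rmorphXn rmorphB /= rmorphB /= expansion_Y expansion_C addrK.
Qed.

End Expansion.

Section RegularSequences.
Variable K : fieldType.
Notation S2 := (powser (powser K)).
Implicit Types (F G H : S2).

Definition regular_mod F G := forall H A, F * H = A * G -> exists B, H = B * G.

Lemma regular_mod_power F G n : G != 0 -> regular_mod F G -> regular_mod F (G ^+ n).
Proof.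
move=> G0 reg; elim: n => [|n IH] H A E; first by exists H; rewrite mulr1.
have [B HB] : exists B, H = B * G by apply: (reg _ (A * G ^+ n)); rewrite E exprSr mulrA.
have [|B' BE] := IH B A; last by exists B'; rewrite HB BE exprSr mulrA.
apply: subr0_eq; have : (F * B - A * G ^+ n) * G = 0.
  by rewrite mulrBl -mulrA -HB E exprSr mulrA subrr.
by move=> /powser2_dom[|/eqP] //; rewrite (negbTE G0).
Qed.

(** Modulo (F, G) the sum reduces to [h 0], which therefore vanishes. The rest is divisible by F,
    and F cancels modulo G. The hypothesis on [h] expresses that its values lie in a complement of
    (F, G). *)
Lemma independent_powers F G n (h : nat -> S2) : regular_mod F G ->
  (forall b, (b < n)%N -> in_ideal F G (h b) -> h b = 0) ->
  in_ideal (F ^+ n) G (\sum_(b < n) F ^+ b * h b) -> forall b, (b < n)%N -> h b = 0.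
Proof.
move=> reg; elim: n h => [//|n IH] h h0 [A [B E]].
move: E; rewrite big_ord_recl expr0 mul1r /=.
under eq_bigr do rewrite /bump /= add1n exprS -mulrA.
rewrite -mulr_sumr; set S := \sum_(i < n) _ => E.
have h00 : h 0%N = 0.
  apply: h0 => //; exists (A * F ^+ n - S), B; move: E; rewrite exprSr => E.
  by rewrite -[LHS](addrK (F * S)) E; ring.
have [C SC] : exists C, S - A * F ^+ n = C * G.
  by apply: (reg _ B); rewrite mulrBr; move: E; rewrite h00 add0r => ->; rewrite exprS; ring.
have IHn : forall b, (b < n)%N -> h b.+1 = 0.
  apply: (IH (fun b => h b.+1)); first by move=> b bn; exact: h0.
  by exists A, C; rewrite -/S -SC; ring.
by move=> [|b] // bn; exact: IHn.
Qed.

(** The sum is read as a polynomial in F whose coefficients are polynomials in G, and the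
    one-variable statement is applied modulo [G ^+ n], then modulo F. *)
Lemma independent_powers2 F G n (h : nat -> nat -> S2) : G != 0 ->
  regular_mod F G -> regular_mod G F ->
  (forall a b, (a < n)%N -> (b < n)%N -> in_ideal F G (h a b) -> h a b = 0) ->
  in_ideal (F ^+ n) (G ^+ n) (\sum_(a < n) \sum_(b < n) F ^+ a * G ^+ b * h a b) ->
  forall a b, (a < n)%N -> (b < n)%N -> h a b = 0.
Proof.
move=> G0 FG GF h0 hI.
have sw F' G' H : in_ideal F' G' H -> in_ideal G' F' H by move=> [A [B ->]]; exists B, A; rewrite addrC.
have inner a : (a < n)%N -> in_ideal F (G ^+ n) (\sum_(b < n) G ^+ b * h a b) ->
    forall b, (b < n)%N -> h a b = 0.
  move=> an hE; apply: (independent_powers GF) => [b bn /sw|]; first exact: h0.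
  exact: sw.
have H0 : forall a, (a < n)%N -> \sum_(b < n) G ^+ b * h a b = 0.
  apply: (@independent_powers F (G ^+ n) n (fun a => \sum_(b < n) G ^+ b * h a b)).
  - exact: regular_mod_power.
  - by move=> a an hE; rewrite big1 // => b _; rewrite (inner _ an hE) ?mulr0.
  - congr in_ideal : hI; apply: eq_bigr => a _; rewrite mulr_sumr.
    by apply: eq_bigr => b _; rewrite mulrA.
by move=> a b an; apply: inner => //; rewrite H0 //; exists 0, 0; rewrite !mul0r addr0.
Qed.

Lemma power_combination (A : comNzRingType) (r U V F G : A) m n : r = U * F + V * G ->
  exists N U' V', r ^+ N = U' * F ^+ m + V' * G ^+ n.
Proof.
have h (r' F' G' U' V' : A) k : r' = U' * F' + V' * G' ->
    exists U2 V2, r' ^+ k = U2 * F' + V2 * G' ^+ k.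
  move=> ->; elim: k => [|k [U2 [V2 E]]]; first by exists 0, 1; rewrite mul0r add0r mul1r.
  exists (U2 * (U' * F' + V' * G') + V2 * G' ^+ k * U'), (V2 * V').
  by rewrite exprSr E exprSr; ring.
move=> /(h _ _ _ _ _ n)[U1 [V1]]; rewrite addrC => /(h _ _ _ _ _ m)[V2 [U2 E]].
by exists (n * m)%N, U2, V2; rewrite exprM E addrC.
Qed.

End RegularSequences.

(** * The bound by the mixed volume *)

Section Supports.
Variables (R : realType) (K : fieldType).
Notation P2 := {poly {poly K}}.
Implicit Types (q r F G : P2) (S T : set (R * R)).

Definition supported q S := forall i j, q`_i`_j != 0 -> S (i%:R, j%:R).

Definition dilate (n : nat) S : set (R * R) := [set (n%:R * x.1, n%:R * x.2) | x in S].

Lemma minkowski_compact S T : compact S -> compact T -> compact (minkowski_sum S T).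
Proof.
move=> cS cT; have -> : minkowski_sum S T = (fun u => u.1 + u.2) @` (S `*` T).
  apply/seteqP; split=> [_ [x Sx [y Ty <-]]|_ [[x y] /= [Sx Ty] <-]]; first by exists (x, y).
  by exists x => //; exists y.
apply: continuous_compact; last exact: compact_setX.
by apply: continuous_subspaceT => u; exact: add_continuous.
Qed.

Lemma supported_sub q S T : S `<=` T -> supported q S -> supported q T.
Proof. by move=> ST qS i j /qS; exact: ST. Qed.

Lemma supportedM q r S T : supported q S -> supported r T -> supported (q * r) (minkowski_sum S T).
Proof.
move=> qS rT i j; apply: contraPP => nST.
apply/negP; rewrite negbK coef2M big1 // => a _; rewrite big1 // => b _.
apply/eqP; apply: contraPT isT; rewrite mulf_eq0 negb_or => /andP[/qS Sab /rT Tij]; exfalso; apply: nST.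
exists (a%:R, b%:R) => //; exists ((i - a)%:R, (j - b)%:R) => //=.
by apply: injective_projections; rewrite /= -!natrD !subnKC // -ltnS.
Qed.

Lemma dilateD S m n : mix_closed S -> minkowski_sum (dilate m S) (dilate n S) `<=` dilate (m + n) S.
Proof.
move=> cS _ [_ [x Sx <-] [_ [y Sy <-] <-]] /=.
have [mn0|mn0] := eqVneq (m + n)%N 0%N.
  have [-> ->] : m = 0%N /\ n = 0%N by lia.
  by exists x => //; apply: injective_projections; rewrite /= !mul0r !addr0.
have mn : (m%:R + n%:R : R) != 0 by rewrite -natrD pnatr_eq0.
exists (mix (m%:R / (m%:R + n%:R)) x y); last first.
  by apply: injective_projections; rewrite /= natrD; field.
apply: cS => //; rewrite divr_ge0 ?addr_ge0 //= ler_pdivrMr ?mul1r ?lerDl //.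
by rewrite lt_neqAle eq_sym mn addr_ge0.
Qed.

Lemma supportedX q S n : S !=set0 -> mix_closed S -> supported q S -> supported (q ^+ n) (dilate n S).
Proof.
move=> [z Sz] cS qS; elim: n => [|n IH].
  move=> i j; rewrite expr0 coef1; case: i => [|i]; rewrite ?coef0 ?eqxx // coef1.
  by case: j => [|j]; rewrite ?eqxx // => _; exists z; rewrite // !mul0r.
rewrite exprS -add1n; apply: supported_sub (dilateD cS) _; apply: supportedM IH.
by move=> i j /qS Sij; exists (i%:R, j%:R); rewrite // !mul1r.
Qed.

Definition monomial (e : nat * nat) : P2 := 'X ^+ e.1 * ('X%:P) ^+ e.2.

Lemma coef_monomial e i j : (monomial e)`_i`_j = ((i == e.1) && (j == e.2))%:R.
Proof.
rewrite /monomial -rmorphXn coefXnM; case: ltngtP => //= [lt|gt|->].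
- by rewrite coef0.
- by rewrite coefC subn_eq0 leqNgt gt coef0.
- by rewrite subnn coefC eqxx coefXn.
Qed.

Lemma supported_monomial e S : S (e.1%:R, e.2%:R) -> supported (monomial e) S.
Proof.
move=> Se i j; rewrite coef_monomial; case: (eqVneq i e.1) => [->|]; last by rewrite eqxx.
by case: (eqVneq j e.2) => [->|] //; rewrite eqxx.
Qed.

Lemma monomial_eq0 e : monomial e != 0.
Proof. by rewrite mulf_neq0 // expf_neq0 ?polyC_eq0 ?polyX_eq0. Qed.

End Supports.

(** * The inequality of areas from an independent family of polynomials *)

Section Counting.
Variables (R : realType) (K : fieldType) (p1 p2 : K).
Hypotheses (p10 : p1 != 0) (p20 : p2 != 0).
Notation P2 := {poly {poly K}}.
Notation S2 := (powser (powser K)).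
Notation T := (expansion p1 p2).
Variables (F G : P2) (P Q : set (R * R)) (t1 t2 : int * int).
Hypotheses (F0 : F != 0) (G0 : G != 0).
Hypotheses (cP : compact P) (cQ : compact Q) (hP : mix_closed P) (hQ : mix_closed Q).
Hypothesis suppF : forall i j, F`_i`_j != 0 -> P (i%:R - t1.1%:~R, j%:R - t1.2%:~R).
Hypothesis suppG : forall i j, G`_i`_j != 0 -> Q (i%:R - t2.1%:~R, j%:R - t2.2%:~R).
Hypothesis P0 : forall z, P z -> - t1.1%:~R <= z.1 /\ - t1.2%:~R <= z.2.
Hypothesis Q0 : forall z, Q z -> - t2.1%:~R <= z.1 /\ - t2.2%:~R <= z.2.
Hypothesis Q1 : forall z, Q z -> z.1 + t2.1%:~R <= (size G).-1%:R.
Hypothesis comb : exists2 r : {poly K}, r != 0 & exists U V, r%:P = U * F + V * G.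
Variables k k' : nat.
Hypothesis Is : in_ideal (T F) (T G) (s_ K ^+ k).
Hypothesis It : in_ideal (T F) (T G) (t_ K ^+ k').

Let shift (S : set (R * R)) (t : int * int) : set (R * R) :=
  [set z | S (z.1 - t.1%:~R, z.2 - t.2%:~R)].

Let shift_convex S t : mix_closed S -> mix_closed (shift S t).
Proof.
move=> cS u x y u01 Sx Sy; have := cS u _ _ u01 Sx Sy.
by congr S; apply: injective_projections; rewrite /mix /=; ring.
Qed.

Let expo (N : nat) (t m : int * int) : nat * nat :=
  (absz (m.1 + N%:Z * t.1), absz (m.2 + N%:Z * t.2)).

(* The cells met by [N S] off its lowest abscissa and ordinate, so that the
   exponents [m + N t] of their corners are nonnegative and below the top degree. *)
Let inner (N : nat) (S : set (R * R)) (t : int * int) : set (int * int) :=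
  [set m | exists z, [/\ S z, - t.1%:~R < z.1, - t.2%:~R < z.2 & cell N m z]].

Let inner_near N S t : (0 < N)%N -> inner N S t `<=` lattice_near N 1 S.
Proof.
move=> N0 m [z [Sz _ _ /cellP-/(_ N0)[h1 h2]]]; exists z => //.
by rewrite !ler_norml; split; move: h1 h2; lra.
Qed.

Let inner_ge0 N S t m : (0 < N)%N -> inner N S t m -> 0 <= m.1 + N%:Z * t.1 /\ 0 <= m.2 + N%:Z * t.2.
Proof.
move=> N0 [z [_ z1 z2 /cellP-/(_ N0)[/andP[_ h1] /andP[_ h2]]]].
have NR : 0 < N%:R :> R by rewrite ltr0n.
have h (i t' : int) (x : R) : - t'%:~R < x -> N%:R * x <= i%:~R + 1 -> 0 <= i + N%:Z * t'.
  move=> tx xi; have : (0 : R) < (i + N%:Z * t' + 1)%:~R.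
    rewrite !intrD intrM; have := ltr_pM2l NR (- t'%:~R) x; rewrite tx mulrN => lt.
    by rewrite -[N%:Z%:~R]/(N%:R : R); move: lt xi; move: (N%:R * _) (N%:R * x) => *; lra.
  by rewrite ltr0z; clear; lia.
by split; [exact: h z1 h1|exact: h z2 h2].
Qed.

Let expoK N t m : 0 <= m.1 + N%:Z * t.1 -> 0 <= m.2 + N%:Z * t.2 ->
  ((expo N t m).1%:R = m.1%:~R + N%:R * t.1%:~R :> R) /\ ((expo N t m).2%:R = m.2%:~R + N%:R * t.2%:~R :> R).
Proof.
move=> h1 h2; rewrite /expo /=.
by rewrite !natr_absz !ger0_norm // !intrD !intrM.
Qed.

Let expoE N t m i j : m.1 = i%:Z - N%:Z * t.1 -> m.2 = j%:Z - N%:Z * t.2 -> expo N t m = (i, j).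
Proof. by move=> e1 e2; rewrite /expo e1 e2 !subrK. Qed.

Let expo_inj N t m m' : 0 <= m.1 + N%:Z * t.1 -> 0 <= m.2 + N%:Z * t.2 ->
  0 <= m'.1 + N%:Z * t.1 -> 0 <= m'.2 + N%:Z * t.2 -> expo N t m = expo N t m' -> m = m'.
Proof.
move=> h1 h2 h3 h4 [e1 e2]; apply: injective_projections.
  by apply: (addIr (N%:Z * t.1)); rewrite -(gez0_abs h1) e1 gez0_abs.
by apply: (addIr (N%:Z * t.2)); rewrite -(gez0_abs h2) e2 gez0_abs.
Qed.

Variables (n : nat) (b : 'I_n -> P2) (d : nat).
Hypothesis ind : forall c : 'I_n -> K,
  in_ideal (T F) (T G) (\sum_l const2 (c l) * T (b l)) -> forall l, c l = 0.
Hypothesis bd : forall l i j, (b l)`_i`_j != 0 -> (i <= d)%N /\ (j <= d)%N.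

(** The padding monomials m1, m2 are units at p. Dividing by m1^N m2^N turns the relation into a
    combination of the f^i g^j h_ij lying in (f^N, g^N), where f = F / m1 and g = G / m2 generate
    the same ideal as F and G. *)
Lemma family_independent N (c : nat -> nat -> 'I_n -> K) (m1 m2 u v : P2) :
  m1.[p1%:P].[p2] != 0 -> m2.[p1%:P].[p2] != 0 ->
  \sum_(i < N) \sum_(j < N) (F ^+ i * m1 ^+ (N - i)) * (G ^+ j * m2 ^+ (N - j)) *
     (\sum_l (c i j l)%:P%:P * b l) + (G ^+ N * v + F ^+ N * u) = 0 ->
  forall i j l, (i < N)%N -> (j < N)%N -> c i j l = 0.
Proof.
rewrite -!expansion00 => /expansion_unit[w1 w1E] /expansion_unit[w2 w2E] E i j l iN jN.
pose f := w1 * T F; pose g := w2 * T G.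
have fE : T F = T m1 * f by rewrite mulrA [T m1 * _]mulrC w1E mul1r.
have gE : T G = T m2 * g by rewrite mulrA [T m2 * _]mulrC w2E mul1r.
have fT : in_ideal f g (T F) by rewrite fE; apply: in_idealM; exact: in_ideal_l.
have gT : in_ideal f g (T G) by rewrite gE; apply: in_idealM; exact: in_ideal_r.
have Tf : in_ideal (T F) (T G) f by apply: in_idealM; exact: in_ideal_l.
have Tg : in_ideal (T F) (T G) g by apply: in_idealM; exact: in_ideal_r.
have sub := in_ideal_sub fT gT; have bus := in_ideal_sub Tf Tg.
have f0 : f != 0.
  apply/eqP => f0; move/eqP: F0; apply; apply: (@expansion_inj _ p1 p2).
  by rewrite fE f0 mulr0.
have g0 : g != 0.
  apply/eqP => g0; move/eqP: G0; apply; apply: (@expansion_inj _ p1 p2).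
  by rewrite gE g0 mulr0.
have sw F' G' (H : S2) : in_ideal F' G' H -> in_ideal G' F' H by move=> [A [B ->]]; exists B, A; rewrite addrC.
have rfg : regular_mod f g by move=> H A; apply: (regular g0 (sub _ Is) (sub _ It)).
have rgf : regular_mod g f by move=> H A; apply: (regular f0 (sw _ _ _ (sub _ Is)) (sw _ _ _ (sub _ It))).
pose h i j := \sum_l const2 (c i j l) * T (b l).
have hI i' j' : in_ideal f g (h i' j') -> forall l, c i' j' l = 0 by move=> /bus/ind.
suff : h i j = 0.
  by move=> h0; apply: hI; rewrite h0; exists 0, 0; rewrite !mul0r addr0.
apply: (@independent_powers2 _ f g N h) => //.
  by move=> i' j' _ _ /hI h0; rewrite /h big1 // => l' _; rewrite h0 /const2 !rmorph0 mul0r.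
have pw (w x e y : S2) i' : (i' <= N)%N -> w * e = 1 -> w ^+ N * (x ^+ i' * e ^+ (N - i') * y) = (w * x) ^+ i' * y.
  move=> iN' we; rewrite -{1}(subnK iN') exprD exprMn.
  transitivity ((w * e) ^+ (N - i') * (w ^+ i' * x ^+ i' * y)); first by rewrite exprMn; ring.
  by rewrite we expr1n mul1r.
have := congr1 (fun q => w1 ^+ N * w2 ^+ N * T q) E.
rewrite rmorph0 mulr0 rmorphD /= mulrDr rmorphD /= !rmorphM /= !rmorphXn /=.
have -> : w1 ^+ N * w2 ^+ N * T (\sum_(i < N) \sum_(j < N) F ^+ i * m1 ^+ (N - i) * (G ^+ j * m2 ^+ (N - j)) *
     \sum_l (c i j l)%:P%:P * b l) = \sum_(i < N) \sum_(j < N) f ^+ i * g ^+ j * h i j.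
  rewrite rmorph_sum mulr_sumr; apply: eq_bigr => i' _; rewrite rmorph_sum mulr_sumr.
  apply: eq_bigr => j' _; rewrite !rmorphM !rmorphXn /= rmorph_sum /=.
  have -> : \sum_l0 T ((c i' j' l0)%:P%:P * b l0) = h i' j'.
    by apply: eq_bigr => l' _; rewrite rmorphM /= expansion_C.
  rewrite -[RHS]mulrA -(pw w1 (T F) (T m1)) ?(ltnW (ltn_ord i')) //.
  by rewrite -(pw w2 (T G) (T m2)) ?(ltnW (ltn_ord j')) //; ring.
set S := \sum_(i < N) _ => /eqP; rewrite addr_eq0 => /eqP ->.
exists (- (w2 ^+ N * T u)), (- (w1 ^+ N * T v)).
by rewrite /f /g !exprMn; ring.
Qed.

(** Some power of r in K[y] is a combination of F^N and G^N, so a power of r times u is a multiple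
    of G^N. Multiplication by r does not change the degree in x, which is too small in u. *)
Lemma no_syzygy N (u v : P2) : (size u <= N * (size G).-1)%N -> G ^+ N * v + F ^+ N * u = 0 -> u = 0 /\ v = 0.
Proof.
move=> su; rewrite addrC => /eqP; rewrite addr_eq0 => /eqP E.
have [r r0 [U [V rE]]] := comb.
have [M [U' [V' rM]]] := power_combination N N rE.
pose w := V' * u - U' * v.
have rw : r%:P ^+ M * u = G ^+ N * w.
  by rewrite rM mulrDl -(mulrA U') E /w; ring.
have rM0 : r ^+ M != 0 by rewrite expf_neq0.
have u0 : u = 0.
  have [w0|w0] := eqVneq w 0.
    move: rw; rewrite w0 mulr0 -rmorphXn => /eqP; rewrite mulf_eq0 polyC_eq0 (negbTE rM0) => /eqP //.
  have := congr1 (fun q : P2 => size q) rw; rewrite -rmorphXn size_Cmul //.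
  rewrite size_mul ?expf_neq0 // => sE; exfalso.
  have w1 : (0 < size w)%N by rewrite size_poly_gt0.
  have sG : (size (G ^+ N)).-1 = ((size G).-1 * N)%N by exact: size_exp.
  have g1 : (0 < size (G ^+ N))%N by rewrite size_poly_gt0 expf_neq0.
  have := su; rewrite sE [(N * _)%N]mulnC -sG.
  by case: (size (G ^+ N)) g1 => // g _; case: (size w) w1 => // e _; rewrite addSn addnS /= ltnNge leq_addr.
split=> //; move: E; rewrite u0 mulr0 => /esym/eqP; rewrite oppr_eq0 mulf_eq0 expf_eq0 (negbTE G0) andbF => /eqP //.
Qed.

Section Level.
Variable N : nat.
Hypothesis N0 : (0 < N)%N.
Let MP := inner N P t1.
Let MQ := inner N Q t2.
Let RR := lattice_near N d.+1 (minkowski_sum P Q).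
Let fMP : finite_set MP.
Proof. exact: sub_finite_set (inner_near N0) (lattice_near_finite _ _ cP). Qed.
Let fMQ : finite_set MQ.
Proof. exact: sub_finite_set (inner_near N0) (lattice_near_finite _ _ cQ). Qed.
Let cPQ : compact (minkowski_sum P Q).
Proof. exact: minkowski_compact. Qed.
Let fR : finite_set RR. Proof. exact: lattice_near_finite. Qed.
Let A1 : set (R * R) := shift P t1.
Let A2 : set (R * R) := shift Q t2.
Let SF : supported F A1. Proof. exact: suppF. Qed.
Let SG : supported G A2. Proof. exact: suppG. Qed.

(** The translation by N (t1 + t2) converts exponents of polynomials back to those of Laurent
    polynomials. *)
Let small (q : P2) := forall i j, q`_i`_j != 0 ->
  RR (i%:Z - N%:Z * (t1.1 + t2.1), j%:Z - N%:Z * (t1.2 + t2.2)).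

Let small_supported q (B : set (R * R)) : supported q (minkowski_sum (minkowski_sum (dilate N A1) (dilate N A2)) B) ->
  (forall z, B z -> 0 <= z.1 <= d%:R /\ 0 <= z.2 <= d%:R) -> small q.
Proof.
move=> qs Bd i j /qs[_ [_ [x1 Ax <-] [_ [x2 Ay <-] <-]] [e Be [e1 e2]]].
have [h1 h2] := Bd _ Be.
exists (x1.1 - t1.1%:~R + (x2.1 - t2.1%:~R), x1.2 - t1.2%:~R + (x2.2 - t2.2%:~R)).
  by exists (x1.1 - t1.1%:~R, x1.2 - t1.2%:~R) => //; exists (x2.1 - t2.1%:~R, x2.2 - t2.2%:~R).
rewrite !intrB !intrM !intrD /= -[i%:Z%:~R]/(i%:R : R) -[j%:Z%:~R]/(j%:R : R) -e1 -e2 -[N%:Z%:~R]/(N%:R : R).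
rewrite -natr1; move: h1 h2; rewrite !ler_norml /=.
by move=> /andP[u1 u2] /andP[v1 v2]; split; apply/andP; split; lra.
Qed.

Let small_family e1 e2 i j l : F`_e1.1`_e1.2 != 0 -> G`_e2.1`_e2.2 != 0 -> (i <= N)%N -> (j <= N)%N ->
  small ((F ^+ i * monomial K e1 ^+ (N - i)) * (G ^+ j * monomial K e2 ^+ (N - j)) * b l).
Proof.
move=> e1F e2G iN jN.
have h (q : P2) S e a : mix_closed S -> supported q S -> q`_e.1`_e.2 != 0 -> (a <= N)%N ->
    supported (q ^+ a * monomial K e ^+ (N - a)) (dilate N S).
  move=> cS qS eq aN; have Se := qS _ _ eq; have S0 : S !=set0 by eexists; exact: Se.
  rewrite -{2}(subnKC aN); apply: supported_sub (dilateD cS) _; apply: supportedM; apply: supportedX => //.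
  exact: supported_monomial.
apply: (@small_supported _ [set z | 0 <= z.1 <= d%:R /\ 0 <= z.2 <= d%:R]); last by [].
apply: supportedM; last by move=> i' j' /bd[h1 h2] /=; rewrite !ler0n !ler_nat.
by apply: supportedM; apply: h => //; exact: shift_convex.
Qed.

Let small_near q m S S' t t' : (small = fun q : P2 => forall i j, q`_i`_j != 0 ->
  RR (i%:Z - N%:Z * (t'.1 + t.1), j%:Z - N%:Z * (t'.2 + t.2))) ->
  (forall x y, S x -> S' y -> minkowski_sum P Q (x + y)) ->
  S !=set0 -> mix_closed S -> supported q (shift S t) -> inner N S' t' m ->
  small (q ^+ N * monomial K (expo N t' m)).
Proof.
move=> -> SS' [z0 Sz0] cS qS m' i j.
have [z [S'z z1 z2 /cellP-/(_ N0)[c1 c2]]] := m'; have [m1 m2] := inner_ge0 N0 m'.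
have St0 : shift S t !=set0.
  by exists (z0.1 + t.1%:~R, z0.2 + t.2%:~R); rewrite /shift /= !addrK -surjective_pairing.
have qN := supportedX (n := N) St0 (shift_convex (t := t) cS) qS.
have mS : supported (monomial K (expo N t' m)) [set ((expo N t' m).1%:R : R, (expo N t' m).2%:R : R)].
  exact: supported_monomial.
move=> /(supportedM qN mS)[_ [x Sx <-] [_ -> [e1 e2]]].
have [h1 h2] := expoK m1 m2; rewrite h1 in e1; rewrite h2 in e2.
exists ((x.1 - t.1%:~R, x.2 - t.2%:~R) + z); first by apply: SS' => //.
rewrite !intrB !intrM !intrD /= -[i%:Z%:~R]/(i%:R : R) -[j%:Z%:~R]/(j%:R : R) -e1 -e2 -[N%:Z%:~R]/(N%:R : R).
have d0 : 0 <= d%:R :> R by [].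
rewrite -natr1; move: c1 c2; rewrite !ler_norml /=.
by move=> /andP[u1 u2] /andP[v1 v2]; split; apply/andP; split; lra.
Qed.

(* The polynomials [F^i G^j b_l], padded by monomials, [F^N x^m] and [G^N x^m] have
   their exponents in [RR] and are linearly independent. *)
Lemma cell_count : (N * N * n + (#|` fset_set MP| + #|` fset_set MQ|) <= #|` fset_set RR|)%N.
Proof.
have [e1x [e1y e1F]] := exists_coef2 F0; have [e2x [e2y e2G]] := exists_coef2 G0.
pose e1 := (e1x, e1y); pose e2 := (e2x, e2y).
pose I := (('I_N * 'I_N) * 'I_n + (fset_set MP + fset_set MQ))%type.
pose fam (i : I) : P2 := match i with
  | inl (a, l) => (F ^+ a.1 * monomial K e1 ^+ (N - a.1)) * (G ^+ a.2 * monomial K e2 ^+ (N - a.2)) * b l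
  | inr (inl m) => G ^+ N * monomial K (expo N t1 (val m))
  | inr (inr m) => F ^+ N * monomial K (expo N t2 (val m)) end.
have smallf i : small (fam i).
  case: i => [[[i j] l]|[m|m]] /=.
  - by apply: small_family; rewrite // ltnW.
  - apply: (@small_near G (val m) Q P t2 t1) => //.
    + by move=> x y Qx Py; exists y => //; exists x => //; rewrite addrC.
    + by eexists; exact: suppG e2G.
    + by have := valP m; rewrite in_fset_set // inE.
  - apply: (@small_near F (val m) P Q t1 t2) => //.
    + by rewrite [t2.1 + _]addrC [t2.2 + _]addrC.
    + by move=> x y Px Qy; exists x => //; exists y.
    + by eexists; exact: suppF e1F.
    + by have := valP m; rewrite in_fset_set // inE.
rewrite leqNgt; apply/negP => lt.
pose t := (t1.1 + t2.1, t1.2 + t2.2).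
(* If there were more polynomials than exponents in [RR], a nontrivial combination would have all
   its coefficients in [RR] equal to 0, and those outside vanish by [smallf]. *)
have [|c [i0 /negP c0] kern] := @nontrivial_kernel K I (fset_set RR)
    (fun i m => (fam i)`_(expo N t (val m)).1`_(expo N t (val m)).2).
  by rewrite card_sum card_sum !card_prod !card_ord -!cardfE.
have total0 : \sum_i (c i)%:P%:P * fam i = 0.
  apply/polyP => i; apply/polyP => j; rewrite coef_sum coef_sum !coef0.
  have [inR|outR] := pselect (RR (i%:Z - N%:Z * t.1, j%:Z - N%:Z * t.2)).
    have mR : (i%:Z - N%:Z * t.1, j%:Z - N%:Z * t.2) \in fset_set RR by rewrite in_fset_set // inE.
    have := kern [` mR]%fset; rewrite (_ : expo N t _ = (i, j)); last exact: expoE.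
    move=> kij; rewrite -[RHS]kij /=.
    by apply: eq_bigr => a _; rewrite !coefCM.
  rewrite big1 // => a _; rewrite !coefCM.
  have [->|/smallf] := eqVneq ((fam a)`_i`_j) 0; first by rewrite mulr0.
  by [].
(* The coefficients are extended to all natural indices, with the index 0 as default value. *)
pose o := Ordinal N0; pose ca (i j : nat) l := c (inl ((insubd o i, insubd o j), l)).
pose v := \sum_(m : fset_set MP) (c (inr (inl m)))%:P%:P * monomial K (expo N t1 (val m)).
pose u := \sum_(m : fset_set MQ) (c (inr (inr m)))%:P%:P * monomial K (expo N t2 (val m)).
have E : \sum_(i < N) \sum_(j < N) (F ^+ i * monomial K e1 ^+ (N - i)) * (G ^+ j * monomial K e2 ^+ (N - j)) *
     (\sum_l (ca i j l)%:P%:P * b l) + (G ^+ N * v + F ^+ N * u) = 0.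
  transitivity (\sum_i (c i)%:P%:P * fam i); last exact: total0.
  rewrite /u /v !mulr_sumr big_sumType big_sumType /=; congr (_ + (_ + _)).
  - rewrite pair_bigA /=.
    under eq_bigr do rewrite mulr_sumr.
    rewrite pair_bigA /=; apply: eq_bigr => -[[i j] l] _ /=.
    by rewrite /ca !valKd; ring.
  - by apply: eq_bigr => m _; rewrite mulrCA.
  - by apply: eq_bigr => m _; rewrite mulrCA.
have monom e : (monomial K e).[p1%:P].[p2] != 0.
  by rewrite /monomial !hornerE /= mulf_neq0 ?expf_neq0.
have ca0 := family_independent (monom e1) (monom e2) E.
move: E; rewrite big1 ?add0r => [E|i _]; last first.
  rewrite big1 // => j _; rewrite [X in _ * X]big1 ?mulr0 // => l _.
  by rewrite ca0 // !rmorph0 mul0r.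
have coefm (M : {fset int * int}) (f : M -> K) t' (x : M) :
    (forall y : M, 0 <= (val y).1 + N%:Z * t'.1 /\ 0 <= (val y).2 + N%:Z * t'.2) ->
    (\sum_(m : M) (f m)%:P%:P * monomial K (expo N t' (val m)))`_(expo N t' (val x)).1`_(expo N t' (val x)).2 = f x.
  move=> pos; rewrite coef_sum coef_sum (bigD1 x) //= big1 ?addr0.
    by rewrite !coefCM coef_monomial !eqxx mulr1.
  move=> y yx; rewrite !coefCM coef_monomial.
  case: eqP => [h1|]; last by rewrite mulr0.
  case: eqP => [h2|]; last by rewrite mulr0.
  have [? ?] := pos x; have [? ?] := pos y.
  move/eqP: yx; case; apply: val_inj; apply: (@expo_inj N t') => //.
  by rewrite [LHS]surjective_pairing -h1 -h2.
have posP (y : fset_set MP) : 0 <= (val y).1 + N%:Z * t1.1 /\ 0 <= (val y).2 + N%:Z * t1.2.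
  by have := valP y; rewrite in_fset_set // inE; exact: inner_ge0.
have posQ (y : fset_set MQ) : 0 <= (val y).1 + N%:Z * t2.1 /\ 0 <= (val y).2 + N%:Z * t2.2.
  by have := valP y; rewrite in_fset_set // inE; exact: inner_ge0.
(* Corners lie strictly to the left of the points of N Q in their cells, and the largest abscissa of
   Q is at most the degree of G in x up to the shift: the degree of u is below N times that of G. *)
have [|u0 v0] := no_syzygy _ E.
  apply: leq_trans (size_sum _ _ _) _; apply/bigmax_leqP => m _.
  have mQ : MQ (val m) by have := valP m; rewrite in_fset_set // inE.
  apply/leq_sizeP => i le; apply/polyP => j; rewrite !coefCM coef_monomial coef0.
  case: eqP => [iE|]; last by rewrite mulr0.
  have [z [Qz _ _ /cellP-/(_ N0)[/andP[h1 _] _]]] := mQ.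
  have [p1' p2'] := posQ m; have [h2 _] := expoK p1' p2'.
  have := Q1 Qz; have NR : 0 < N%:R :> R by rewrite ltr0n.
  rewrite -(ler_pM2l NR) -natrM => h3.
  have : (i%:R : R) < (N * (size G).-1)%:R by rewrite iE h2; move: h1 h3; rewrite mulrDr; lra.
  by rewrite ltr_nat ltnNge le.
apply: c0; apply/eqP; case: i0 => [[[i j] l]|[m|m]].
- by have := ca0 i j l (ltn_ord i) (ltn_ord j); rewrite /ca !valKd.
- by rewrite -(coefm _ (fun m => c (inr (inl m))) t1 m posP) -/v v0 !coef0.
- by rewrite -(coefm _ (fun m => c (inr (inr m))) t2 m posQ) -/u u0 !coef0.
Qed.

End Level.

Lemma area_bound : ((n%:R)%:E + area P + area Q <= area (minkowski_sum P Q))%E.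
Proof.
have pow j : (0 < 2 ^ j)%N by rewrite expn_gt0.
(* With -oo as lower bound, only the measurability of compact sets is extracted. *)
have mP : measurable P by have [] := @area_ge_near R 1 P -oo%E isT cP (fun=> leNye _).
have mQ : measurable Q by have [] := @area_ge_near R 1 Q -oo%E isT cQ (fun=> leNye _).
have [] // := @area_ge_near R d.+1 (minkowski_sum P Q) ((n%:R)%:E + area P + area Q)%E isT (minkowski_compact cP cQ).
move=> j; have := cell_count (pow j); set N := (2 ^ j)%N => cnt.
have N0 : (0 < N)%N := pow j.
have fP : finite_set (inner N P t1) by exact: sub_finite_set (inner_near N0) (lattice_near_finite _ _ cP).
have fQ : finite_set (inner N Q t2) by exact: sub_finite_set (inner_near N0) (lattice_near_finite _ _ cQ).
have hp := area_le_cells N0 fP mP P0 (fun m z Pz z1 z2 mz => ex_intro _ z (And4 Pz z1 z2 mz)).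
have hq := area_le_cells N0 fQ mQ Q0 (fun m z Qz z1 z2 mz => ex_intro _ z (And4 Qz z1 z2 mz)).
apply: le_trans (leeD (leeD (lexx _) hp) hq) _; rewrite -!EFinD lee_fin.
have NR : 0 < N%:R ^+ 2 :> R by rewrite exprn_gt0 // ltr0n.
rewrite ler_pdivlMr // !mulrDl !divfK ?gt_eqF // mulrC -natrX -natrM -!natrD ler_nat.
by rewrite -mulnn -addnA.
Qed.

End Counting.

(** * Expansions of real polynomials *)

Section RealExpansion.
Variable R : realType.
Notation P2 := {poly {poly R}}.
Implicit Types (q r : P2) (p : R * R).

Lemma s_E (K : fieldType) i j : s_ K i j = ((i == 1%N) && (j == 0%N))%:R.
Proof. by rewrite /s_ /powserX; case: (i == 1%N). Qed.
Lemma t_E (K : fieldType) i j : t_ K i j = ((i == 0%N) && (j == 1%N))%:R.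
Proof. by rewrite /t_ /powserC; case: (i == 0%N). Qed.
Lemma const2E (K : fieldType) (c : K) i j : const2 c i j = if (i == 0%N) && (j == 0%N) then c else 0.
Proof. by rewrite /const2 /powserC; case: (i == 0%N). Qed.

Definition complexify : P2 -> {poly {poly R[i]}} := map_poly (map_poly (real_complex R)).
HB.instance Definition _ := GRing.RMorphism.on complexify.

Lemma complexify_coef q i j : (complexify q)`_i`_j = ((q`_i)`_j)%:C%C.
Proof. by rewrite /complexify coef_map coef_map. Qed.

Lemma partial_ev i j q p : partial i j (ev q) p = ev (iter i (@dX R) (iter j (@dY R) q)) p.
Proof.
have dE (k : 'I_2) r : ('D_(dir R k) (ev r) : R * R -> R) = ev (dpoly k r).
  by apply/funext => z; have [_ ->] := dpoly_is_derive k r z.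
have iE (k : 'I_2) n r : iter n (fun G => 'D_(dir R k) G) (ev r) = ev (iter n (dpoly k) r) :> (R * R -> R).
  by elim: n => //= n ->; rewrite dE.
by rewrite /partial (iE 1 j q) (iE 0 i).
Qed.

Let iter_dX0 n : iter n (@dX R) 0 = 0 :> P2.
Proof. by elim: n => //= n ->; rewrite /dX deriv0. Qed.
Let iter_dY0 n : iter n (@dY R) 0 = 0 :> P2.
Proof. by elim: n => //= n ->; rewrite /dY map_poly0. Qed.
Let ev0 p : ev 0 p = 0. Proof. by rewrite /ev !horner0. Qed.

Lemma taylor_C (c : R) p : taylor2 p (ev c%:P%:P) = const2 c.
Proof.
apply/funext => i; apply/funext => j; rewrite /taylor2 /taylor partial_ev.
case: j => [|j]; last first.
  by rewrite iterSr dY_C iter_dY0 iter_dX0 ev0 mul0r; case: i.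
case: i => [|i]; first by rewrite /= evC mulr1 divr1.
by rewrite /= -iterS iterSr dX_C iter_dX0 ev0 mul0r.
Qed.

Lemma taylor_X p : taylor2 p (ev 'X) = s_ R + const2 p.1.
Proof.
apply/funext => i; apply/funext => j; rewrite /taylor2 /taylor partial_ev !powserD s_E const2E.
case: j => [|j]; last by rewrite !andbF iterSr dY_X iter_dY0 iter_dX0 ev0 mul0r addr0.
case: i => [|[|i]].
- by rewrite /= evX mulr1 divr1 add0r.
- by rewrite /= dX_X ev1 mulr1 divr1 addr0.
by rewrite [iter 0 _ _]/= !iterSr dX_X -[1]/(1%:P) dX_C iter_dX0 ev0 mul0r addr0.
Qed.

Lemma taylor_Y p : taylor2 p (ev 'X%:P) = t_ R + const2 p.2.
Proof.
apply/funext => i; apply/funext => j; rewrite /taylor2 /taylor partial_ev !powserD t_E const2E.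
case: i => [|i]; last first.
  have -> : iter i.+1 (@dX R) (iter j (@dY R) 'X%:P) = 0 :> P2.
    rewrite iterSr (_ : dX _ = 0) ?iter_dX0 //.
    by elim: j => [|j IH] /=; rewrite ?dX_C // dXY IH /dY map_poly0.
  by rewrite ev0 mul0r addr0.
case: j => [|[|j]].
- by rewrite /= evY mulr1 divr1 add0r.
- by rewrite /= dY_Y ev1 mulr1 divr1 addr0.
have -> : iter j.+2 (@dY R) 'X%:P = 0 by rewrite !iterSr dY_Y -[1]/(1%:P%:P) dY_C iter_dY0.
by rewrite iter_dX0 ev0 mul0r addr0.
Qed.

Notation toC := (powser_map (powser_map (real_complex R))).

Lemma complexify_C c : complexify c%:P%:P = c%:C%C%:P%:P.
Proof. by rewrite /complexify map_polyC /= map_polyC. Qed.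
Lemma complexify_X : complexify 'X = 'X.
Proof. by rewrite /complexify map_polyX. Qed.
Lemma complexify_Y : complexify 'X%:P = 'X%:P.
Proof. by rewrite /complexify map_polyC /= map_polyX. Qed.

Let toCD (F G : powser (powser R)) : toC (F + G) = (toC F + toC G) :> powser (powser R[i]).
Proof. exact: rmorphD. Qed.
Let toCM (F G : powser (powser R)) : toC (F * G) = (toC F * toC G) :> powser (powser R[i]).
Proof. exact: rmorphM. Qed.
Let complexifyD q r : complexify (q + r) = complexify q + complexify r.
Proof. exact: rmorphD. Qed.
Let complexifyM q r : complexify (q * r) = complexify q * complexify r.
Proof. exact: rmorphM. Qed.

(** Both sides are multiplicative and additive in q, so agreement on constants, x and y suffices. It
    connects the analytic definition of the multiplicity with algebra. *)
Lemma taylorC_ev q p : taylorC (ev q) p = expansion p.1%:C%C p.2%:C%C (complexify q).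
Proof.
have constC c : toC (const2 c) = const2 c%:C%C.
  by apply/funext => -[|i]; apply/funext => -[|j].
change (toC (taylor2 p (ev q)) = expansion p.1%:C%C p.2%:C%C (complexify q)).
elim/poly2_ind: q => [c| | |f g hf hg|f g hf hg].
- by rewrite taylor_C constC complexify_C expansion_C.
- rewrite taylor_X complexify_X expansion_X [LHS]rmorphD; congr (_ + _); last exact: constC.
  by apply/funext => i; apply/funext => j; change ((s_ R i j)%:C%C = s_ R[i] i j); rewrite !s_E rmorph_nat.
- rewrite taylor_Y complexify_Y expansion_Y [LHS]rmorphD; congr (_ + _); last exact: constC.
  by apply/funext => i; apply/funext => j; change ((t_ R i j)%:C%C = t_ R[i] i j); rewrite !t_E rmorph_nat.
- rewrite [ev _](_ : _ = ev f + ev g); last by apply/funext => z; rewrite evD.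
  rewrite taylorD; [|exact: ev_rational|exact: ev_rational].
  by rewrite toCD hf hg complexifyD expansionD.
rewrite [ev _](_ : _ = ev f * ev g); last by apply/funext => z; rewrite evM.
rewrite taylorM; [|exact: ev_rational|exact: ev_rational].
by rewrite toCM hf hg complexifyM expansionM.
Qed.

End RealExpansion.

Lemma compact_area_lty (R : realType) (K : set (R * R)) : compact K -> (area K < +oo)%E.
Proof.
move=> cK; have mK : measurable K by have [] := @area_ge_near R 1 K -oo%E isT cK (fun=> leNye _).
have [B [_ hB]] := compact_bounded cK; have {}hB := hB (B + 1) (ltr_pwDr ltr01 (lexx _)).
have hK z : K z -> - (B + 1) <= z.1 /\ - (B + 1) <= z.2.
  move=> Kz; have := hB _ Kz; rewrite /= prod_normE ge_max => /andP[].
  by rewrite !ler_norml => /andP[-> _] /andP[-> _].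
apply: le_lt_trans (area_le_cells (n := 1) isT (lattice_near_finite 1 1 cK) mK hK _) (ltry _).
move=> m z Kz _ _ /cellP-/(_ isT)[h1 h2]; exists z => //.
by rewrite !ler_norml; split; move: h1 h2; lra.
Qed.

Lemma compact_area_fin (R : realType) (K : set (R * R)) : compact K -> area K \is a fin_num.
Proof.
by move=> cK; rewrite ge0_fin_numE; [exact: compact_area_lty|exact: measure_ge0].
Qed.

Section ExpansionOfCommonZeros.
Variables (K : fieldType) (a b : K).
Notation P2 := {poly {poly K}}.
Notation T := (expansion a b).

Lemma expansion_subX : T ('X - a%:P%:P) = s_ K.
Proof. by rewrite expansionB expansion_X expansion_C addrK. Qed.

Lemma expansion_subY : T ('X - b%:P)%:P = t_ K.
Proof. by rewrite polyCB expansionB expansion_Y expansion_C addrK. Qed.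

Lemma expansion_const_x (q : {poly K}) : q != 0 ->
  exists k h, h * T (map_poly polyC q) = s_ K ^+ k.
Proof.
move=> q0; have [k [r ra qE]] := multiplicity_XsubC q a.
rewrite q0 /= in ra; exists k.
have [h hE] : exists h, h * T (map_poly polyC r) = 1.
  apply: expansion_unit; rewrite expansion00 (horner_map (@polyC K)) hornerC.
  exact: ra.
exists h; rewrite qE rmorphM /= expansionM mulrA hE mul1r.
have -> : map_poly polyC (('X - a%:P) ^+ k) = ('X - a%:P%:P) ^+ k by rewrite rmorphXn rmorphB /= map_polyX map_polyC.
by rewrite expansionX expansion_subX.
Qed.

Lemma restriction_mod (q : P2) : exists q', q = map_poly polyC (map_poly (horner_eval b) q) + ('X - b%:P)%:P * q'.
Proof.
have [||q' E] := @dvd_constP K ('X - b%:P) (q - map_poly polyC (map_poly (horner_eval b) q)).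
- by rewrite polyXsubC_eq0.
- move=> i; rewrite dvdp_XsubCl /root coefB !coef_map /= hornerD hornerN hornerC.
  by rewrite /horner_eval subrr.
by exists q'; rewrite -E addrC subrK.
Qed.

(** At y = b, r is a unit times a power of t. A generator not vanishing identically on that line is
    a unit times a power of s modulo t; raising this relation to a power eliminates t. *)
Lemma expansion_axes (A B : P2) (r : {poly K}) :
  map_poly (horner_eval b) A != 0 \/ map_poly (horner_eval b) B != 0 -> r != 0 ->
  in_ideal (T A) (T B) (T r%:P) ->
  exists k k', in_ideal (T A) (T B) (s_ K ^+ k) /\ in_ideal (T A) (T B) (t_ K ^+ k').
Proof.
move=> AB0 r0 rI; have [k' [h hE]] := expansion_const_y a b r0.
have tI : in_ideal (T A) (T B) (t_ K ^+ k') by rewrite -hE; exact: in_idealM.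
suff hq (q : P2) : map_poly (horner_eval b) q != 0 -> in_ideal (T A) (T B) (T q) ->
    exists k, in_ideal (T A) (T B) (s_ K ^+ k).
  have [/hq[]|/hq[]] := AB0.
  - exact: in_ideal_l.
  - by move=> k kI; exists k, k'.
  - exact: in_ideal_r.
  - by move=> k kI; exists k, k'.
move=> /expansion_const_x[k [w wE]] qI; have [q' qE] := restriction_mod q.
have E : s_ K ^+ k = w * T q + (- (w * T q')) * t_ K.
  have Tq : T q = T (map_poly polyC (map_poly (horner_eval b) q)) + t_ K * T q'.
    by rewrite {1}qE expansionD expansionM expansion_subY.
  rewrite -wE Tq; move: (T (map_poly _ _)) (T q') => u v; ring.
have [N [U [V UV]]] := power_combination 1 k' E.
exists (k * N)%N; rewrite exprM UV expr1.
by apply: in_idealD; exact: in_idealM.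
Qed.

End ExpansionOfCommonZeros.

(** * Common factors of Laurent polynomials *)

Section PolyLaurent.
Variable R : realType.
Notation P2 := {poly {poly R}}.
Implicit Types (A B H : laurent R) (q D : P2) (m t : int * int) (z p : R * R).

Let pcoef t q m : R :=
  if (0 <= m.1 + t.1) && (0 <= m.2 + t.2) then q`_(absz (m.1 + t.1))`_(absz (m.2 + t.2)) else 0.

Let pkeys t q : {fset int * int} :=
  [fset ((val a.1)%:Z - t.1, (val a.2)%:Z - t.2) | a : 'I_(size q) * 'I_(sizeY q)]%fset.

(* The Laurent polynomial [q / (x^t.1 y^t.2)]. *)
Definition poly_laurent t q : laurent R := [fsfun m in pkeys t q => pcoef t q m | 0].

Lemma poly_laurentE t q m : poly_laurent t q m =
  if (0 <= m.1 + t.1) && (0 <= m.2 + t.2) then q`_(absz (m.1 + t.1))`_(absz (m.2 + t.2)) else 0.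
Proof.
rewrite /poly_laurent fsfunE; case: ifP => // /negbT mq.
rewrite -/(pcoef t q m); apply/eqP; rewrite eq_sym; apply: contraNT mq.
rewrite /pcoef; case: ifP => [/andP[m1 m2]|]; last by rewrite eqxx.
move=> /coef2_neq0[h1 h2]; apply/imfsetP; exists (Ordinal h1, Ordinal h2) => //=.
by rewrite !gez0_abs // !addrK -surjective_pairing.
Qed.

Lemma poly_laurent_coef t q i j : poly_laurent t q (i%:Z - t.1, j%:Z - t.2) = q`_i`_j.
Proof. by rewrite poly_laurentE /= !subrK. Qed.

Lemma poly_laurent_eval t q z : z.1 != 0 -> z.2 != 0 ->
  laurent_eval (poly_laurent t q) z = z.1 ^ (- t.1) * z.2 ^ (- t.2) * ev q z.
Proof.
move=> z1 z2; set A := poly_laurent t q.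
have -> : laurent_eval A z = \sum_(m <- pkeys t q) A m * z.1 ^ m.1 * z.2 ^ m.2.
  apply: big_fset_incl; first by apply/fsubsetP => m; rewrite mem_finsupp; apply: contraNT => mq; rewrite /A /poly_laurent fsfunE (negbTE mq).
  by move=> m _; rewrite mem_finsupp negbK => /eqP ->; rewrite !mul0r.
rewrite big_imfset /=; last first.
  move=> [i j] [i' j'] _ _ /= [/addIr[e1] /addIr[e2]].
  by congr (_, _); apply/val_inj.
have -> : ev q z = \sum_(i < size q) \sum_(j < sizeY q) q`_i`_j * z.1 ^+ i * z.2 ^+ j.
  rewrite /ev (horner_coef q) horner_sum; apply: eq_bigr => i _.
  rewrite hornerM -polyC_exp hornerC (horner_coef_wide _ (max_size_coefXY q i)) mulr_suml.
  by apply: eq_bigr => j _; rewrite mulrAC.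
rewrite pair_bigA mulr_sumr /= enumT; apply: eq_bigr => -[i j] _ /=.
by rewrite /A poly_laurent_coef !expfzDr // -!exprnP; ring.
Qed.

Lemma poly_laurent_factor t D q : laurent_factor (poly_laurent (0, 0) D) (poly_laurent t (D * q)).
Proof.
exists (poly_laurent t q) => m; set H := poly_laurent _ D; set Q := poly_laurent t q.
have HE (i j : nat) : H (i%:Z, j%:Z) = D`_i`_j by rewrite -[i%:Z]subr0 -[j%:Z]subr0 poly_laurent_coef.
have -> : \sum_(k <- finsupp H) H k * Q (m - k) =
    \sum_(i < size D) \sum_(j < sizeY D) D`_i`_j * Q (m - (i%:Z, j%:Z)).
  transitivity (\sum_(k <- pkeys (0, 0) D) H k * Q (m - k)).
    apply: big_fset_incl; first by apply/fsubsetP => k; rewrite mem_finsupp; apply: contraNT => kq; rewrite /H /poly_laurent fsfunE (negbTE kq).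
    by move=> k _; rewrite mem_finsupp negbK => /eqP ->; rewrite mul0r.
  rewrite big_imfset /=; last first.
    by move=> [i j] [i' j'] _ _ /= E; congr (_, _); apply/val_inj;
      [have := congr1 fst E|have := congr1 snd E]; rewrite /= !subr0 => -[].
  by rewrite pair_bigA /= enumT; apply: eq_bigr => -[i j] _ /=; rewrite !subr0 HE.
have QE (i j : nat) : Q (m - (i%:Z, j%:Z)) =
    if (i%:Z <= m.1 + t.1) && (j%:Z <= m.2 + t.2)
    then q`_(absz (m.1 + t.1) - i)`_(absz (m.2 + t.2) - j) else 0.
  rewrite poly_laurentE /= ![_ - _ + _]addrAC !subr_ge0; case: ifP => // /andP[h1 h2].
  by congr (q`_ _ `_ _); lia.
rewrite poly_laurentE; case: ifP => [/andP[m1 m2]|neg]; last first.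
  rewrite big1 // => i _; rewrite big1 // => j _; rewrite QE ifF ?mulr0 //.
  by apply: contraFF neg => /andP[h1 h2]; apply/andP; split; [exact: le_trans h1|exact: le_trans h2].
rewrite coef2M; set I := absz _; set J := absz _.
have eI i : (i%:Z <= m.1 + t.1) = (i <= I)%N by rewrite -(gez0_abs m1).
have eJ j : (j%:Z <= m.2 + t.2) = (j <= J)%N by rewrite -(gez0_abs m2).
pose T i j := D`_i`_j * Q (m - (i%:Z, j%:Z)).
have T0 i j : (i <= I)%N && (j <= J)%N = false -> T i j = 0.
  by move=> h; rewrite /T QE eI eJ h mulr0.
have -> : \sum_(a < I.+1) \sum_(b < J.+1) D`_a`_b * q`_(I - a)`_(J - b) =
    \sum_(a < I.+1) \sum_(b < J.+1) T a b.
  apply: eq_bigr => a _; apply: eq_bigr => b _; rewrite /T QE eI eJ.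
  by rewrite -ltnS ltn_ord -ltnS ltn_ord.
(* The sums run over the exponents up to (I, J) on one side and over those of D on the other; both
   are extended by zeros to a common rectangle. *)
pose N := (maxn I.+1 (size D))%N; pose M := (maxn J.+1 (sizeY D))%N.
have ext n l : (forall i j, (n <= i)%N || (l <= j)%N -> T i j = 0) -> (n <= N)%N -> (l <= M)%N ->
    \sum_(a < n) \sum_(b < l) T a b = \sum_(a < N) \sum_(b < M) T a b.
  move=> z nN lM; rewrite (big_ord_widen _ (fun a => \sum_(b < l) T a b) nN) big_mkcond /=.
  apply: eq_bigr => a _; case: ifP => [an|/negbT]; last first.
    by rewrite -leqNgt => na; rewrite big1 // => b _; rewrite z // na.
  rewrite (big_ord_widen _ (T a) lM) big_mkcond /=; apply: eq_bigr => b _.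
  by case: ifP => // /negbT; rewrite -leqNgt => lb; rewrite z // lb orbT.
rewrite (ext I.+1 J.+1) ?leq_maxl //; last by move=> i j h; apply: T0; move: h; clear; lia.
rewrite -(ext (size D) (sizeY D)) ?leq_maxr // => i j h.
rewrite /T; have [/coef2_neq0[h1 h2]|] := boolP (D`_i`_j != 0); last by rewrite negbK => /eqP ->; rewrite mul0r.
by move: h; rewrite leqNgt h1 leqNgt h2.
Qed.

Lemma laurent_eqP A B : (forall m, A m = B m) -> A = B.
Proof. by move=> h; apply/fsfunP. Qed.

(** Powers of x are stripped off, so that the coefficient of x^0 is nonzero; the factors D and A'
    taken from q inherit this property. *)
Lemma poly_laurent_exists A : (exists m, A m != 0) -> exists t q, A = poly_laurent t q /\ q`_0 != 0.
Proof.
move=> [m0 Am0]; have [k kA] := exponents_le_exists A.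
have AE : A = poly_laurent (k%:Z, k%:Z) (lpoly k A).
  apply: laurent_eqP => m; rewrite poly_laurentE coef_lpoly //=.
  case: ifP => [/andP[m1 m2]|h]; first by rewrite !gez0_abs // !addrK -surjective_pairing.
  apply: contraFeq h => Am; have mA : m \in finsupp A by rewrite mem_finsupp.
  have [h1 h2] := kA m mA.
  have bound (i : int) : (absz i <= k)%N -> 0 <= i + k%:Z by clear; lia.
  by rewrite !bound.
have q0 : lpoly k A != 0.
  by apply: contraNneq Am0 => q0; rewrite AE q0 poly_laurentE !coef0 if_same.
have [c [q qr qE]] := multiplicity_XsubC (lpoly k A) 0.
rewrite q0 polyC0 subr0 /root horner_coef0 /= in qr qE.
exists (k%:Z - c%:Z, k%:Z), q; split=> //; apply: laurent_eqP => m.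
rewrite {1}AE !poly_laurentE /= qE; case: (boolP (0 <= m.2 + k%:Z)) => m2; rewrite ?andbF ?andbT //.
have [m1|m1] := boolP (0 <= m.1 + k%:Z); last by rewrite ifF //; move: m1; clear; lia.
rewrite coefMXn; case: ifP => [h|h]; first by rewrite coef0 ifF //; move: m1 h; clear; lia.
by rewrite ifT; [congr (q`_ _ `_ _)|]; move: m1 h; clear; lia.
Qed.

(** D vanishes at p without being zero, so it is not a constant polynomial. *)
Lemma common_factor_poly t t' D q q' p : p.1 != 0 -> p.2 != 0 -> D != 0 -> ev D p = 0 ->
  common_factor_at (poly_laurent t (D * q)) (poly_laurent t' (D * q')) p.
Proof.
move=> p1 p2 D0 Dp; exists (poly_laurent (0, 0) D); split; try exact: poly_laurent_factor.
- apply: contrapT => h.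
  have c i j : (i, j) != (0%N, 0%N) -> D`_i`_j = 0.
    move=> ij; apply/eqP; apply: contraPT isT => Dij; exfalso; apply: h; exists (i%:Z, j%:Z).
      by apply: contraNneq ij => -[-> ->].
    by rewrite -[i%:Z]subr0 -[j%:Z]subr0 poly_laurent_coef.
  have DE : D = (D`_0`_0)%:P%:P.
    apply/polyP => i; apply/polyP => j; rewrite coefC; case: i => [|i]; rewrite ?coefC ?coef0.
      by case: j => [|j] //=; apply: c.
    by rewrite c ?if_same.
  by move/eqP: D0; apply; move: Dp; rewrite DE evC => ->; rewrite !polyC0.
- by rewrite poly_laurent_eval // Dp mulr0.
Qed.

End PolyLaurent.

(** * The multiplicity and the mixed volume of the Newton polygons *)

Section CoprimeTerms.
Variable K : fieldType.
Notation P2 := {poly {poly K}}.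

Lemma coprime_terms (A B : P2) w1 w2 m : A != 0 -> B != 0 -> A`_0 != 0 -> coprime2 A B ->
  exists2 r : {poly K}, r != 0 & exists U V : P2,
    r%:P = U * (monomial K (0%N, w1) * A) + V * (monomial K (m, w2) * B).
Proof.
move=> A0 B0 A00 cop.
have [|r r0 [U [V rE]]] := coprime_combination A0 B0.
  by move=> E A' B' EA EB; exact: (cop E A' B' EA EB).1.
have [A1 AE] : exists A1, A = (A`_0)%:P + 'X * A1.
  exists (\poly_(i < (size A).-1) A`_i.+1); apply/polyP => i.
  rewrite coefD coefC coefXM coef_poly; case: i => [|i]; rewrite /= ?addr0 // add0r.
  case: ifP => // /negbT; rewrite -leqNgt => h; rewrite nth_default //.
  by move: h; case: (size A).
have aE : (A`_0)%:P = 1 * A + (- A1) * 'X by rewrite {2}AE; ring.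
have [N [U' [V' E]]] := power_combination 1 m aE.
exists (r * A`_0 ^+ N * 'X ^+ (w1 + w2)); first by rewrite !mulf_neq0 ?expf_neq0 // polyX_eq0.
exists ('X%:P ^+ w2 * (U * (U' * A + V' * 'X ^+ m) + V * B * U')), ('X%:P ^+ w1 * V * V').
rewrite !rmorphM !rmorphXn /= E rE expr1 exprD /monomial /= expr0 mul1r.
move: ('X%:P ^+ w1) ('X%:P ^+ w2) ('X ^+ m) => x y z; ring.
Qed.

End CoprimeTerms.

Section NewtonPolygon.
Variable R : realType.
Implicit Types (A B : laurent R).

Lemma Newt_compact A : compact (Newt A).
Proof.
rewrite /Newt; have -> : [set (m.1%:~R, m.2%:~R) | m in [set` finsupp A]] =
    [set` [seq (m.1%:~R, m.2%:~R) : R * R | m <- finsupp A]].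
  apply/seteqP; split=> [_ [m /= mA <-]|z /= /mapP[m mA ->]]; last by exists m.
  by apply/mapP; exists m.
exact: hull_compact.
Qed.

Lemma Newt_mem A m : A m != 0 -> Newt A (m.1%:~R, m.2%:~R).
Proof. by move=> Am; apply: hull_sub; exists m; rewrite //= mem_finsupp. Qed.

Lemma Newt_bound A (l1 l2 c : R) : (forall m, A m != 0 -> l1 * m.1%:~R + l2 * m.2%:~R <= c) ->
  forall z, Newt A z -> l1 * z.1 + l2 * z.2 <= c.
Proof.
move=> h; apply: (@hull_min _ _ [set z | l1 * z.1 + l2 * z.2 <= c]); last first.
  by move=> _ [m /= mA <-]; apply: h; rewrite mem_finsupp in mA.
move=> t x y /andP[t0 t1] /= hx hy; rewrite /mix /=.
have e1 := ler_wpM2l t0 hx; have t2 : 0 <= 1 - t by lra.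
have e2 := ler_wpM2l t2 hy.
have -> : l1 * (t * x.1 + (1 - t) * y.1) + l2 * (t * x.2 + (1 - t) * y.2) =
  t * (l1 * x.1 + l2 * x.2) + (1 - t) * (l1 * y.1 + l2 * y.2) by ring.
apply: le_trans (lerD e1 e2) _; rewrite le_eqVlt; apply/orP; left; apply/eqP; ring.
Qed.

Lemma torus_rational (p : R * R) (t : int * int) : p.1 != 0 -> p.2 != 0 ->
  rational_near p (fun z => z.1 ^ (- t.1) * z.2 ^ (- t.2)).
Proof.
move=> p1 p2; apply: (@rational_eq _ _ _ (laurent_eval (poly_laurent t 1))).
  apply: filterS (near_torus p1 p2) => z [z1 z2].
  by rewrite poly_laurent_eval // ev1 mulr1.
exact: laurent_rational.
Qed.

Lemma common_factorization A B p : p.1 != 0 -> p.2 != 0 ->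
  (exists m, A m != 0) -> (exists m, B m != 0) -> ~ common_factor_at A B p ->
  exists t1 t2 (D A' B' : {poly {poly R}}), [/\ A = poly_laurent t1 (D * A'), B = poly_laurent t2 (D * B'),
    D`_0 != 0 /\ A'`_0 != 0, D != 0 /\ B' != 0 & ev D p != 0 /\ coprime2 A' B'].
Proof.
move=> p1 p2 /poly_laurent_exists[t1 [q1 [A1 q10]]] /poly_laurent_exists[t2 [q2 [B2 q20]]] ncf.
have nz (q : {poly {poly R}}) : q`_0 != 0 -> q != 0.
  by apply: contraNneq => ->; rewrite coef0.
have [D [A' [B' [q1E q2E cop]]]] := maximal_divisor (nz _ q10) (nz _ q20).
exists t1, t2, D, A', B'; rewrite -q1E -q2E; split=> //.
- by apply/andP; move: q10; rewrite q1E coefM big_ord_recl big_ord0 addr0 subn0 mulf_eq0 negb_or.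
- by apply/andP; rewrite -negb_or -mulf_eq0 -q2E; exact: nz.
split=> //; apply/eqP => Dp; apply: ncf; rewrite A1 B2 q1E q2E.
apply: common_factor_poly => //.
by move: (nz _ q10); rewrite q1E mulf_eq0 negb_or => /andP[].
Qed.

Section Bound.
Variables (A B : laurent R) (p : R * R) (t1 t2 : int * int) (D A' B' : {poly {poly R}}).
Hypotheses (p1 : p.1 != 0) (p2 : p.2 != 0).
Hypotheses (AE : A = poly_laurent t1 (D * A')) (BE : B = poly_laurent t2 (D * B')).
Hypotheses (D00 : D`_0 != 0) (A00 : A'`_0 != 0) (D0 : D != 0) (B0 : B' != 0).
Hypotheses (Dp : ev D p != 0) (cop : coprime2 A' B').

Let A0 : A' != 0.
Proof. by apply: contraNneq A00 => ->; rewrite coef0. Qed.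

(** [e1] has degree 0 in x, as D is not divisible by x, so F stays prime to the power of x in G.
    [e2] has the top degree in x, so that G has the degree of D B', which bounds the abscissas of
    Newt B. *)
Let N := (size D).-1.
Let w1 := (size D`_0).-1.
Let w2 := (size (lead_coef D)).-1.
Let e1 : nat * nat := (0%N, w1).
Let e2 : nat * nat := (N, w2).
Let D1 : D`_e1.1`_e1.2 != 0.
Proof. by rewrite /= -/(lead_coef _) lead_coef_eq0. Qed.
Let D2 : D`_e2.1`_e2.2 != 0.
Proof. by rewrite /= -/(lead_coef D) -/(lead_coef (lead_coef D)) !lead_coef_eq0. Qed.
Let F := monomial R e1 * A'.
Let G := monomial R e2 * B'.

Let coef_monomialM e (q : {poly {poly R}}) i j : (monomial R e * q)`_i`_j =
  if (e.1 <= i)%N && (e.2 <= j)%N then q`_(i - e.1)`_(j - e.2) else 0.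
Proof.
rewrite /monomial -mulrA coefXnM; case: ltnP => h /=; first by rewrite coef0.
by rewrite -rmorphXn coefCM coefXnM; case: ltnP.
Qed.

Let Newt_supp (C : laurent R) t e q : C = poly_laurent t (D * q) -> q != 0 -> D`_e.1`_e.2 != 0 ->
  forall i j, (monomial R e * q)`_i`_j != 0 -> Newt C (i%:R - t.1%:~R, j%:R - t.2%:~R).
Proof.
move=> CE q0 De i j; rewrite coef_monomialM; case: ifP => [/andP[h1 h2] qij|]; last by rewrite eqxx.
have := @ostrowski R R D q (Newt C) (t.1%:~R, t.2%:~R) D0 q0 (@Newt_compact C) (@hull_convex _ _).
rewrite -{1}(subnKC h1) -{1}(subnKC h2); apply => // k l.
rewrite -(poly_laurent_coef t) -CE => /Newt_mem /=.
by rewrite !intrB.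
Qed.

Let Newt_ge0 (C : laurent R) t q : C = poly_laurent t q -> forall z, Newt C z -> - t.1%:~R <= z.1 /\ - t.2%:~R <= z.2.
Proof.
move=> CE z Cz; have pos m : C m != 0 -> 0 <= m.1 + t.1 /\ 0 <= m.2 + t.2.
  by rewrite CE poly_laurentE; case: ifP => [/andP[]|]; rewrite ?eqxx.
split.
- have := @Newt_bound C (-1) 0 t.1%:~R _ z Cz; rewrite mul0r addr0 mulN1r lerNl; apply => m /pos[h _].
  by rewrite mul0r addr0 mulN1r lerNl -subr_ge0 opprK -intrD ler0z.
- have := @Newt_bound C 0 (-1) t.2%:~R _ z Cz; rewrite mul0r add0r mulN1r lerNl; apply => m /pos[_ h].
  by rewrite mul0r add0r mulN1r lerNl -subr_ge0 opprK -intrD ler0z.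
Qed.

Let G0 : G != 0. Proof. by rewrite mulf_neq0 // monomial_eq0. Qed.
Let F0 : F != 0. Proof. by rewrite mulf_neq0 // monomial_eq0. Qed.

Let size_G : (size G).-1 = (size (D * B')).-1.
Proof.
have m2 : monomial R e2 = 'X^N * ('X ^+ w2)%:P by rewrite /monomial rmorphXn.
have D' : (0 < size D)%N by rewrite size_poly_gt0.
have B'' : (0 < size B')%N by rewrite size_poly_gt0.
rewrite /G m2 -mulrA ['X^N * _]mulrC size_mulXn ?mulf_neq0 ?polyC_eq0 ?expf_neq0 ?polyX_eq0 //.
rewrite size_Cmul ?expf_neq0 ?polyX_eq0 // size_mul // /N.
by case: (size D) D' => // a _; case: (size B') B'' => // b _; rewrite /= !addnS.
Qed.

Let Newt_degree z : Newt B z -> z.1 + t2.1%:~R <= (size G).-1%:R.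
Proof.
move=> Bz; rewrite -lerBrDr; have := @Newt_bound B 1 0 ((size G).-1%:R - t2.1%:~R) _ z Bz.
rewrite mul1r mul0r addr0; apply => m; rewrite BE poly_laurentE.
case: ifP => [/andP[h1 h2]|]; last by rewrite eqxx.
move=> /coef2_neq0[lt _]; rewrite mul1r mul0r addr0 lerBrDr -intrD -(gez0_abs h1).
by rewrite size_G -[(absz _)%:Z%:~R]/((absz (m.1 + t2.1))%:R : R) ler_nat -ltnS prednK // (leq_trans _ lt).
Qed.

(** D and all monomials are invertible at p, so F and G differ from the Laurent polynomials by
    units. *)
Lemma multiplicity_reduced :
  multiplicity (laurent_eval A) (laurent_eval B) p = multiplicity (ev F) (ev G) p.
Proof.
have evm e z : ev (monomial R e) z = z.1 ^+ e.1 * z.2 ^+ e.2 by rewrite /monomial !evE.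
have key (C : laurent R) t e q : C = poly_laurent t (D * q) -> exists U : R * R -> R,
    [/\ rational_near p U, U p != 0 & \forall z \near p, laurent_eval C z = U z * ev (monomial R e * q) z].
  move=> CE; have me : ev (monomial R e) p != 0 by rewrite evm mulf_neq0 ?expf_neq0.
  exists ((fun z => z.1 ^ (- t.1) * z.2 ^ (- t.2)) * ev D * (fun z => (ev (monomial R e) z)^-1)); split.
  - apply: rationalM; last by apply: rationalV => //; exact: ev_rational.
    by apply: rationalM; [exact: torus_rational|exact: ev_rational].
  - by rewrite /GRing.mul /= /mul_fun !mulf_neq0 ?invr_eq0 // expfz_neq0.
  apply: filterS2 (near_torus p1 p2) (near_ev_neq0 me) => z [z1 z2] mz.
  transitivity (z.1 ^ (- t.1) * z.2 ^ (- t.2) * ev D z * (ev (monomial R e) z)^-1 *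
    (ev (monomial R e) z * ev q z)); last by rewrite -evM.
  by rewrite CE poly_laurent_eval // evM -[RHS]mulrA (mulKf mz) mulrA.
have [U [rU U0 UE]] := key A t1 e1 A' AE; have [V [rV V0 VE]] := key B t2 e2 B' BE.
apply: (@multiplicity_units _ p _ _ _ _ U V (fun z => (U z)^-1) (fun z => (V z)^-1)).
- by split=> //; exact: rationalV.
- by split; try exact: ev_rational; exact: laurent_rational.
near=> z; have Uz : U z != 0 by near: z; exact: rational_neq0.
have Vz : V z != 0 by near: z; exact: rational_neq0.
have UEz : laurent_eval A z = U z * ev F z by near: z.
have VEz : laurent_eval B z = V z * ev G z by near: z.
by split=> //; rewrite ?UEz ?VEz mulKf.
Unshelve. all: by end_near. Qed.

Notation K := R[i].
Notation T := (expansion (p.1%:C%C : R[i]) p.2%:C%C).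

Let complexify_monomial e : complexify (monomial R e) = monomial K e.
Proof.
apply/polyP => i; apply/polyP => j; rewrite complexify_coef !coef_monomial.
exact: rmorph_nat.
Qed.

Let T_monomial e : exists h, h * T (complexify (monomial R e)) = 1.
Proof.
apply: expansion_unit; rewrite expansion00 complexify_monomial /monomial !hornerE /=.
by rewrite mulf_neq0 ?expf_neq0 // real_complex_neq0.
Qed.

Lemma complexifyM (q r : {poly {poly R}}) : complexify (q * r) = complexify q * complexify r.
Proof. exact: rmorphM. Qed.

Lemma complexifyD (q r : {poly {poly R}}) : complexify (q + r) = complexify q + complexify r.
Proof. exact: rmorphD. Qed.

Lemma complexify_const (r : {poly R}) : complexify r%:P = (map_poly (real_complex R) r)%:P.
Proof. by rewrite /complexify map_polyC. Qed.

Let complexify_neq0 (q : {poly {poly R}}) : q != 0 -> complexify q != 0.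
Proof.
move=> /exists_coef2[i [j qij]]; apply: contraTneq (real_complex_neq0 qij) => q0.
by rewrite -complexify_coef q0 !coef0 eqxx.
Qed.

Let complexify_restriction (q : {poly {poly R}}) : map_poly (horner_eval p.2) q != 0 ->
  map_poly (horner_eval p.2%:C%C) (complexify q) != 0.
Proof.
apply: contraNneq => h; apply/eqP/polyP => i; rewrite coef0 coef_map /= /horner_eval.
have := congr1 (fun u : {poly K} => u`_i) h; rewrite coef_map coef0 /= /horner_eval /complexify coef_map /=.
by rewrite (horner_map (real_complex R)) => -[].
Qed.

(** Coprimality is used over the reals only. Its consequences, a relation with r in R[y] and a
    nonzero restriction to the line y = p.2, persist over the complex numbers. *)
Lemma reduced_axes : (exists2 r : {poly K}, r != 0 & exists U V, r%:P = U * complexify F + V * complexify G) /\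
  exists k k', in_ideal (T (complexify F)) (T (complexify G)) (s_ K ^+ k) /\
    in_ideal (T (complexify F)) (T (complexify G)) (t_ K ^+ k').
Proof.
have [r r0 [U [V E]]] := coprime_terms w1 w2 N A0 B0 A00 cop.
pose rC := map_poly (real_complex R) r.
have rC0 : rC != 0 by rewrite map_poly_eq0.
have EC : rC%:P = complexify U * complexify F + complexify V * complexify G.
  by rewrite -!complexifyM -complexifyD -complexify_const E.
split; first by exists rC => //; exists (complexify U), (complexify V).
have [h1 h1E] := T_monomial e1; have [h2 h2E] := T_monomial e2.
have FE : T (complexify F) = T (complexify (monomial R e1)) * T (complexify A').
  by rewrite -expansionM -complexifyM.
have GE : T (complexify G) = T (complexify (monomial R e2)) * T (complexify B').
  by rewrite -expansionM -complexifyM.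
have FA : T (complexify A') = h1 * T (complexify F) by rewrite FE mulrA h1E mul1r.
have GB : T (complexify B') = h2 * T (complexify G) by rewrite GE mulrA h2E mul1r.
have [||k [k' [Ik Ik']]] := @expansion_axes K p.1%:C%C p.2%:C%C (complexify A') (complexify B') rC _ rC0.
- have [h|h] := coprime_restriction p.2 cop; [left|right]; exact: complexify_restriction.
- exists (T (complexify U) * T (complexify (monomial R e1))), (T (complexify V) * T (complexify (monomial R e2))).
  rewrite EC expansionD (expansionM _ _ (complexify U) (complexify F)) (expansionM _ _ (complexify V) (complexify G)).
  by rewrite FE GE; congr (_ + _); exact: mulrA.
have sub : in_ideal (T (complexify A')) (T (complexify B')) `<=` in_ideal (T (complexify F)) (T (complexify G)).
  apply: in_ideal_sub; rewrite ?FA ?GB; apply: in_idealM; [exact: in_ideal_l|exact: in_ideal_r].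
by exists k, k'; split; exact: sub.
Qed.

Lemma multiplicity_mixed_volume :
  (multiplicity (laurent_eval A) (laurent_eval B) p <= MV (Newt A) (Newt B))%E.
Proof.
have [comb [k [k' [Is It]]]] := reduced_axes.
rewrite multiplicity_reduced /multiplicity !taylorC_ev; apply: ge_ereal_sup => _ [n [b ind] <-].
(* The independent series are replaced by polynomials congruent to them modulo the ideal;
   independence is unaffected. *)
have /choice[q hq] : forall l, exists q, in_ideal (T (complexify F)) (T (complexify G)) ((b l : powser (powser K)) - T q).
  by move=> l; exact: expansion_truncate Is It.
pose d := \max_l (size (q l) + sizeY (q l)).
have hb : ((n%:R)%:E + area (Newt A) + area (Newt B) <= area (minkowski_sum (Newt A) (Newt B)))%E.
  apply: (@area_bound R K p.1%:C%C p.2%:C%C _ _ (complexify F) (complexify G) (Newt A) (Newt B) t1 t2 _ _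
    (@Newt_compact A) (@Newt_compact B) (@hull_convex _ _) (@hull_convex _ _) _ _ _ _ _ comb k k' Is It n q d).
  - exact: real_complex_neq0.
  - exact: real_complex_neq0.
  - exact: complexify_neq0.
  - exact: complexify_neq0.
  - move=> i j; rewrite complexify_coef => h; apply: (Newt_supp AE A0 D1).
    by apply: contraNneq h => ->; rewrite rmorph0.
  - move=> i j; rewrite complexify_coef => h; apply: (Newt_supp BE B0 D2).
    by apply: contraNneq h => ->; rewrite rmorph0.
  - exact: Newt_ge0 AE.
  - exact: Newt_ge0 BE.
  - move=> z /Newt_degree; rewrite /complexify size_map_inj_poly ?map_poly0 //.
    exact: map_poly_inj.
  - move=> c cI; apply: ind; rewrite fps2_idealE linear_combE.
    have -> : \sum_l const2 (c l) * (b l : powser (powser K)) =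
        \sum_l const2 (c l) * T (q l) + \sum_l const2 (c l) * ((b l : powser (powser K)) - T (q l)).
      rewrite -big_split /=; apply: eq_bigr => l _.
      by rewrite -[RHS]mulrDr addrC subrK.
    apply: in_idealD => //; apply: in_ideal_sum => l _; exact: in_idealM.
  - move=> l i j /coef2_neq0[h1 h2].
    have hd : (size (q l) + sizeY (q l) <= d)%N := @leq_bigmax _ (fun l => size (q l) + sizeY (q l))%N l.
    by split; apply: leq_trans hd; [exact: leq_trans (ltnW h1) (leq_addr _ _)|exact: leq_trans (ltnW h2) (leq_addl _ _)].
(* Newton polygons are compact, so their areas are finite and the subtractions in the extended reals
   can be moved across the inequality. *)
rewrite /MV.
have fA := compact_area_fin (@Newt_compact A).
have fB := compact_area_fin (@Newt_compact B).
move: hb fA fB; move: (area (Newt A)) (area (Newt B)) (area _) => a b' c hb fA fB.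
by rewrite leeBrDr // leeBrDr // addeAC.
Qed.

End Bound.

End NewtonPolygon.

(** * Zero sets near the equilibrium *)

Section Zeros.
Variable R : realType.
Notation P2 := {poly {poly R}}.
Implicit Types (A B H Q : laurent R) (h : P2) (p z : R * R).

Lemma isolated_root (r : {poly R}) a : r != 0 ->
  exists2 r1 : {poly R}, r1.[a] != 0 & forall x, r.[x] = 0 -> r1.[x] != 0 -> x = a.
Proof.
move=> r0; have [k [r1 ra rE]] := multiplicity_XsubC r a; rewrite r0 /= in ra.
exists r1 => // x; rewrite rE hornerM horner_exp hornerXsubC => /eqP.
rewrite mulf_eq0 => /orP[/eqP ->|]; first by rewrite eqxx.
by rewrite expf_eq0 subr_eq0 => /andP[_ /eqP].
Qed.

Lemma ev_restriction h z : (map_poly (horner_eval z.2) h).[z.1] = ev h z.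
Proof.
have E : z.1 = horner_eval z.2 z.1%:P by rewrite /horner_eval hornerC.
by rewrite {1}E (horner_map (horner_eval z.2)).
Qed.

(** Elimination of x gives a nonzero r in R[y] vanishing at all nearby common zeros, which forces y
    = p.2. On that line A' or B' is a nonzero polynomial in x, with isolated roots. *)
Lemma isolated_common_zero A B p : p.1 != 0 -> p.2 != 0 ->
  (exists m, A m != 0) -> (exists m, B m != 0) -> ~ common_factor_at A B p ->
  \forall z \near p, laurent_eval A z = 0 -> laurent_eval B z = 0 -> z = p.
Proof.
move=> p1 p2 An Bn ncf.
have [t1 [t2 [D [A' [B' [AE BE [_ A00] [_ B0] [Dp cop]]]]]]] := common_factorization p1 p2 An Bn ncf.
have A0 : A' != 0 by apply: contraNneq A00 => ->; rewrite coef0.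
have [|r r0 [U [V rE]]] := coprime_combination A0 B0.
  by move=> E A2 B2 EA EB; exact: (cop E A2 B2 EA EB).1.
have [r1 r1p r1E] := isolated_root p.2 r0.
have : exists2 q : {poly R}, q.[p.1] != 0 & forall x, ev A' (x, p.2) = 0 -> ev B' (x, p.2) = 0 -> q.[x] != 0 -> x = p.1.
  have [q0|q0] := coprime_restriction p.2 cop; have [q qp qE] := isolated_root p.1 q0; exists q => // x Ax Bx.
    by apply: qE; rewrite -[x]/((x, p.2).1) -[p.2]/((x, p.2).2) ev_restriction.
  by apply: qE; rewrite -[x]/((x, p.2).1) -[p.2]/((x, p.2).2) ev_restriction.
move=> [q qp qE].
have evy (c : {poly R}) z : ev c%:P z = c.[z.2] by rewrite /ev hornerC.
have evx (c : {poly R}) z : ev (map_poly polyC c) z = c.[z.1] by rewrite /ev (horner_map (@polyC R)) hornerC.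
have n1 : ev r1%:P p != 0 by rewrite evy.
have n2 : ev (map_poly polyC q) p != 0 by rewrite evx.
have key (C : laurent R) t (E : P2) z : C = poly_laurent t (D * E) -> z.1 != 0 -> z.2 != 0 -> ev D z != 0 ->
    laurent_eval C z = 0 -> ev E z = 0.
  move=> -> z1 z2 Dz; rewrite poly_laurent_eval // evM => /eqP.
  by rewrite !mulf_eq0 (negbTE Dz) !expfz_eq0 (negbTE z1) (negbTE z2) !andbF => /eqP.
near=> z => Az Bz.
have [z1 z2] : z.1 != 0 /\ z.2 != 0 by near: z; exact: near_torus.
have Dz : ev D z != 0 by near: z; exact: near_ev_neq0.
have A'z := key _ _ _ _ AE z1 z2 Dz Az; have B'z := key _ _ _ _ BE z1 z2 Dz Bz.
have e2 : z.2 = p.2.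
  apply: r1E; first by rewrite -evy rE evD !evM A'z B'z !mulr0 addr0.
  by rewrite -evy; near: z; exact: near_ev_neq0.
have e1 : z.1 = p.1.
  apply: qE; rewrite -?e2 -?surjective_pairing //.
  by rewrite -evx; near: z; exact: near_ev_neq0.
by rewrite [z]surjective_pairing e1 e2 -surjective_pairing.
Unshelve. all: by end_near. Qed.

Lemma simple_root_sign (q : {poly R}) a (e : R) : q.[a] = 0 -> q^`().[a] != 0 -> 0 < e ->
  exists2 d, 0 < d < e & q.[a + d] * q.[a - d] < 0.
Proof.
move=> /eqP/factor_theorem[g qE] qa e0.
have ga : g.[a] != 0.
  by move: qa; rewrite qE derivM derivXsubC mulr1 hornerD hornerM hornerXsubC subrr mulr0 add0r.
have : \forall x \near a, 0 < g.[x] * g.[a].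
  have cg : (fun x => g.[x] * g.[a]) x @[x --> a] --> g.[a] * g.[a].
    by apply: cvgM; [exact: continuous_horner|exact: cvg_cst].
  by apply: (cvgr_gt _ cg); rewrite -expr2 exprn_even_gt0.
move=> /nbhs_ballP[d /= d0 dg]; pose m := Num.min d e / 2.
have m0 : 0 < m by rewrite divr_gt0 // lt_min d0 e0.
have [md me] : m < d /\ m < e by rewrite /m; case: (ltP d e) => h; split; lra.
exists m; first by rewrite m0.
have g1 : 0 < g.[a + m] * g.[a] by apply: dg; rewrite /ball /= opprD addrA subrr add0r normrN gtr0_norm.
have g2 : 0 < g.[a - m] * g.[a] by apply: dg; rewrite /ball /= opprB addrCA subrr addr0 gtr0_norm.
have gg : 0 < g.[a + m] * g.[a - m].
  have : 0 < g.[a] ^+ 2 by rewrite exprn_even_gt0.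
  by move: (mulr_gt0 g1 g2) => h1 h2; rewrite -(pmulr_lgt0 _ h2); move: h1; congr (0 < _); ring.
rewrite qE !hornerM !hornerXsubC [a + m - a]addrAC subrr add0r [a - m - a]addrAC subrr add0r.
have -> : g.[a + m] * m * (g.[a - m] * - m) = - (g.[a + m] * g.[a - m] * m ^+ 2) by ring.
by rewrite oppr_lt0 mulr_gt0 // exprn_gt0.
Qed.

(** Stands in for the implicit function theorem: the sign change of q between a - d and a + d
    persists on nearby horizontal lines, and each of them carries a zero, distinct from (a, b) by
    its ordinate. *)
Lemma simple_zero_not_isolated h (a b e : R) (q := map_poly (horner_eval b) h) :
  q.[a] = 0 -> q^`().[a] != 0 -> 0 < e ->
  exists x y, [/\ `|a - x| < e, `|b - y| < e, y != b & ev h (x, y) = 0].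
Proof.
move=> qa qa' e0; have [d /andP[d0 de] sgn] := simple_root_sign qa qa' e0.
pose f y := ev h (a + d, y) * ev h (a - d, y).
have fb : f b < 0 by rewrite /f -!ev_restriction.
have : \forall y \near b, f y < 0.
  have c (x : R) : continuous (fun y => ev h (x, y)).
    move=> y; apply: (@continuous_comp _ _ _ (fun y => (x, y)) (ev h)); last exact: ev_continuous.
    by apply: (@continuous_pair _ _ _ (fun=> x) id); [exact: cvg_cst|exact: cvg_id].
  have cf : f y @[y --> b] --> f b by apply: cvgM; exact: c.
  exact: (cvgr_lt _ cf).
move=> /nbhs_ballP[m /= m0 mf]; pose y := b + Num.min m e / 2.
have k0 : 0 < Num.min m e / 2 by rewrite divr_gt0 // lt_min m0 e0.
have [km ke] : Num.min m e / 2 < m /\ Num.min m e / 2 < e by case: (ltP m e) => h'; split; lra.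
have yb : `|b - y| = Num.min m e / 2 by rewrite /y opprD addrA subrr add0r normrN gtr0_norm.
have fy : f y < 0 by apply: mf; rewrite /ball /= yb.
pose r := map_poly (horner_eval y) h.
have rE x : r.[x] = ev h (x, y) by rewrite -ev_restriction.
have ivt (s : {poly R}) : s.[a - d] <= 0 <= s.[a + d] -> exists2 x, a - d <= x <= a + d & s.[x] = 0.
  move=> hs; have [|x xi /eqP sx] := poly_ivt _ hs; first lra.
  by exists x => //; move: xi; rewrite in_itv.
have [x xi rx] : exists2 x, a - d <= x <= a + d & r.[x] = 0.
  have [h1|h1] := leP (r.[a - d]) 0.
    apply: ivt; rewrite h1 /=; move: fy; rewrite /f -!rE => fy.
    rewrite leNgt; apply/negP => h2.
    by have := mulr_le0 (ltW h2) h1; rewrite leNgt fy.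
  have [|x xi] := ivt (- r); last by rewrite hornerN => /eqP; rewrite oppr_eq0 => /eqP rx; exists x.
  rewrite !hornerN oppr_le0 oppr_ge0 (ltW h1) /=; move: fy; rewrite /f -!rE => fy.
  by rewrite leNgt; apply/negP => h2; have := mulr_gt0 h2 h1; rewrite ltNge (ltW fy).
exists x, y; split.
- by move: xi de; rewrite ltr_norml; lra.
- by rewrite yb.
- by rewrite /y -subr_eq0 addrAC subrr add0r gt_eqF.
- by rewrite -rE.
Qed.

Lemma critical_or_not_isolated h p : ev h p = 0 -> (exists j, ev (dpoly j h) p != 0) ->
  forall U, nbhs p U -> exists z, [/\ U z, z != p & ev h z = 0].
Proof.
move=> hp [j hj] U /nbhs_ballP[e /= e0 eU]; case: p hp hj eU => a b hp hj eU.
have sw x y : ev (swapXY h) (x, y) = ev h (y, x) by rewrite /ev /= horner2_swapXY.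
move: hj; rewrite /dpoly; case: (j == 0) => hj.
  have [||//|x [y [xa yb yn hxy]]] := @simple_zero_not_isolated h a b e.
  - by rewrite (ev_restriction h (a, b)).
  - by rewrite deriv_map (ev_restriction h^`() (a, b)).
  exists (x, y); split=> //; first by apply: eU; split.
  by apply: contra yn => /eqP[_ ->].
have [||//|x [y [xa yb yn hxy]]] := @simple_zero_not_isolated (swapXY h) b a e.
- by rewrite (ev_restriction (swapXY h) (b, a)) sw.
- rewrite deriv_map (ev_restriction (swapXY h)^`() (b, a)).
  suff -> : (swapXY h)^`() = swapXY (dY h) by rewrite /ev /= horner2_swapXY.
  apply/polyP => k; apply/polyP => l.
  by rewrite coef_deriv coefMn !coef_swapXY /dY coef_map coef_deriv.
exists (y, x); split; last by rewrite -sw.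
- by apply: eU; split.
- by apply: contra yn => /eqP[-> _].
Qed.

End Zeros.

(** * Jordan bases of nilpotent matrices of order two *)

Section NilpotentMatrix.
Variable R : realType.
Implicit Types (J : 'M[R]_2).

Let i1 : lift ord0 ord0 = (1 : 'I_2). Proof. exact/val_inj. Qed.
Let sum2 (f : 'I_2 -> R) : \sum_i f i = f 0 + f 1.
Proof. by rewrite !big_ord_recl big_ord0 addr0 i1. Qed.
Let ord2 (k : 'I_2) : k = 0 \/ k = 1.
Proof. by case: k => -[|[|//]] hk; [left|right]; apply/val_inj. Qed.

Let vec (x y : R) : 'cV[R]_2 := \col_(i < 2) if i == 0 then x else y.

Let vecE (q : 'cV[R]_2) : q = vec (q 0 0) (q 1 0).
Proof. by apply/matrixP => i j; rewrite mxE ord1; have [->|->] := ord2 i. Qed.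
Let vec_mul J x y : J *m vec x y = vec (J 0 0 * x + J 0 1 * y) (J 1 0 * x + J 1 1 * y).
Proof. by apply/matrixP => i j; rewrite !mxE sum2 !mxE; have [->|->] := ord2 i. Qed.
Let vec_trmul J x y : J^T *m vec x y = vec (J 0 0 * x + J 1 0 * y) (J 0 1 * x + J 1 1 * y).
Proof. by rewrite vec_mul !mxE. Qed.
Let dotp_vec x y x' y' : dotp (vec x y) (vec x' y') = x * x' + y * y'.
Proof. by rewrite /dotp sum2 !mxE. Qed.
Let vec_inj x y x' y' : vec x y = vec x' y' -> x = x' /\ y = y'.
Proof.
by move=> /matrixP E; split; [have := E 0 0|have := E 1 0]; rewrite !mxE.
Qed.
Let vec0 : 0 = vec 0 0. Proof. by apply/matrixP => i j; rewrite !mxE if_same. Qed.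
Let vecZ c x y : c *: vec x y = vec (c * x) (c * y).
Proof. by apply/matrixP => i j; rewrite !mxE; case: ifP. Qed.

Let matrix2P (M N : 'M[R]_2) :
  M 0 0 = N 0 0 -> M 0 1 = N 0 1 -> M 1 0 = N 1 0 -> M 1 1 = N 1 1 -> M = N.
Proof.
by move=> *; apply/matrixP => i j; have [->|->] := ord2 i; have [->|->] := ord2 j.
Qed.

(* By Cayley-Hamilton, a nilpotent matrix has determinant and trace zero. *)
Lemma nilpotent_mx2 J : nilpotent_mx J -> J 1 1 = - J 0 0 /\ J 0 0 ^+ 2 + J 0 1 * J 1 0 = 0.
Proof.
move=> [n Jn].
have [a aE] : exists a, a = J 0 0 by eexists.
have [b bE] : exists b, b = J 0 1 by eexists.
have [c cE] : exists c, c = J 1 0 by eexists.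
have [d dE] : exists d, d = J 1 1 by eexists.
rewrite -aE -bE -cE -dE.
have ch : J * ((a + d)%:M - J) = (a * d - b * c)%:M.
  by apply: matrix2P; rewrite !mxE sum2 !mxE -?aE -?bE -?cE -?dE /= ?mulr1n ?mulr0n; ring.
have det0 : a * d - b * c = 0.
  have : (J * ((a + d)%:M - J)) ^+ n = 0.
    rewrite exprMn_comm ?Jn ?mul0r //.
    by rewrite /GRing.comm mulrBr mulrBl; congr (_ - _); rewrite -!mulmxE scalar_mxC.
  rewrite ch -(rmorphXn (@scalar_mx R 2)) => /matrixP/(_ 0 0); rewrite !mxE eqxx mulr1n => /eqP.
  by rewrite expf_eq0 => /andP[_ /eqP].
have sq : J * J = (a + d) *: J.
  have : J * (a + d)%:M - J * J = 0 by rewrite -mulrBr ch det0 raddf0.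
  by move=> /eqP; rewrite subr_eq0 => /eqP <-; rewrite -mulmxE mul_mx_scalar.
have pw m : J ^+ m.+1 = (a + d) ^+ m *: J.
  elim: m => [|m IH]; first by rewrite expr1 expr0 scale1r.
  by rewrite exprS IH -scalerAr sq scalerA exprSr.
have tr0 : a + d = 0.
  have := pw n; rewrite exprS Jn mulr0 => /esym/eqP; rewrite scaler_eq0 expf_eq0 => /orP[/andP[_ /eqP]//|/eqP J0].
  by rewrite aE dE J0 !mxE addr0.
split; first by move: tr0; lra.
have -> : a ^+ 2 + b * c = a * (a + d) - (a * d - b * c) by ring.
by rewrite tr0 det0 mulr0 subr0.
Qed.

Lemma nilpotent_jordan_basis J : nilpotent_mx J -> J != 0 -> exists q0 q1 p0 p1 : 'cV[R]_2,
    [/\ q0 != 0, (forall q : 'cV[R]_2, J *m q = 0 <-> exists c, q = c *: q0),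
        J *m q1 = q0, J^T *m p1 = 0 & J^T *m p0 = p1] /\
    [/\ dotp q0 p0 = 1, dotp q1 p1 = 1, dotp q0 p1 = 0 & dotp q1 p0 = 0].
Proof.
move=> /nilpotent_mx2[dE sq] J0.
(* q1 is a coordinate vector outside the kernel, the second one if J 1 0 = 0 and the first one
   otherwise; q0 is its image and (p0, p1) the dual basis. *)
have [c0|c0] := eqVneq (J 1 0) 0.
  have a0 : J 0 0 = 0.
    by move/eqP: sq; rewrite c0 mulr0 addr0 sqrf_eq0 => /eqP.
  have b0 : J 0 1 != 0.
    apply: contraNneq J0 => b0; apply/eqP/matrix2P; rewrite ?mxE // dE a0 oppr0 //.
  exists (vec (J 0 1) 0), (vec 0 1), (vec (J 0 1)^-1 0), (vec 0 1).
  rewrite !dotp_vec !vec_trmul !vec_mul dE c0 a0; split; split; rewrite ?vec0.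
  - by apply: contraNneq b0 => /vec_inj[-> _].
  - move=> q; rewrite [q]vecE vec_mul dE c0 a0; split.
      move=> /vec_inj[/eqP]; rewrite mul0r add0r mulf_eq0 (negbTE b0) /= => /eqP y0 _.
      by exists (q 0 0 / J 0 1); rewrite vecZ divfK // y0 mulr0.
    by move=> [t]; rewrite vecZ mulr0 => /vec_inj[-> ->]; congr vec; ring.
  - by congr vec; ring.
  - by congr vec; ring.
  - by congr vec; rewrite ?mulfV //; ring.
  - by rewrite mulfV // mulr0 addr0.
  - by ring.
  - by ring.
  - by ring.
move: dE sq c0; have [a aE] : exists a, a = J 0 0 by eexists.
have [b bE] : exists b, b = J 0 1 by eexists.
have [c cE] : exists c, c = J 1 0 by eexists.
rewrite -aE -bE -cE => dE sq c0.
have ab : b = - a ^+ 2 / c.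
  by apply: (mulIf c0); rewrite divfK //; move: sq; lra.
exists (vec a c), (vec 1 0), (vec 0 c^-1), (vec 1 (- a / c)).
rewrite !dotp_vec !vec_trmul !vec_mul dE -aE -bE -cE ab; split; split; rewrite ?vec0.
- by apply: contraNneq c0 => /vec_inj[_ ->].
- move=> q; rewrite [q]vecE vec_mul dE -aE -bE -cE ab; split.
    move=> /vec_inj[_ h]; exists (q 1 0 / c); rewrite vecZ divfK //; congr vec.
    move: h; move: (q 0 0) (q 1 0) => x y h; apply: (mulfI c0).
    have -> : c * (y / c * a) = a * y by field.
    by move: h; lra.
  move=> [t]; rewrite vecZ => /vec_inj[-> ->]; congr vec; by field.
- by congr vec; ring.
- by congr vec; field.
- by congr vec; field.
- by field.
- by ring.
- by field.
- by ring.
Qed.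

End NilpotentMatrix.

(** * Common factors and the equilibria of the field *)

Section CommonFactor.
Variable R : realType.
Implicit Types (A B H Q : laurent R) (p z : R * R).

Lemma common_factor_sym A B p : common_factor_at A B p -> common_factor_at B A p.
Proof. by move=> [H [HA HB Hn Hp]]; exists H. Qed.

(** Every Laurent polynomial divides 0: if A = 0, then B itself is a common factor vanishing at p,
    or x - p.1 when B = 0 too. *)
Lemma no_common_factor_neq0 A B p : p.1 != 0 -> p.2 != 0 -> laurent_eval B p = 0 ->
  ~ common_factor_at A B p -> exists m, A m != 0.
Proof.
move=> p1 p2 Bp ncf; apply: contrapT => nA; apply: ncf.
have zero (C : laurent R) t (D : {poly {poly R}}) : ~ (exists m, C m != 0) -> C = poly_laurent t (D * 0).
  move=> nC; apply: laurent_eqP => m; rewrite mulr0 poly_laurentE !coef0 if_same.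
  by apply/eqP; apply/negPn/negP => Cm; apply: nC; exists m.
have [[m Bm]|nB] := pselect (exists m, B m != 0).
  have [t [q [BE q0]]] : exists t q, B = poly_laurent t q /\ q`_0 != 0.
    by apply: poly_laurent_exists; exists m.
  rewrite (zero A (0, 0) q nA) BE -[X in poly_laurent t X]mulr1; apply: common_factor_poly => //.
    by apply: contraNneq q0 => ->; rewrite coef0.
  move: Bp; rewrite BE poly_laurent_eval // => /eqP.
  by rewrite !mulf_eq0 !expfz_eq0 (negbTE p1) (negbTE p2) !andbF => /eqP.
rewrite (zero A (0, 0) ('X - p.1%:P%:P) nA) (zero B (0, 0) ('X - p.1%:P%:P) nB).
apply: common_factor_poly => //; first by rewrite polyXsubC_eq0.
by rewrite !evE subrr.
Qed.

Lemma laurent_factor_eval H Q A z : (forall m, A m = \sum_(k <- finsupp H) H k * Q (m - k)) ->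
  z.1 != 0 -> z.2 != 0 -> laurent_eval A z = laurent_eval H z * laurent_eval Q z.
Proof.
move=> AE z1 z2; pose mon (m : int * int) := z.1 ^ m.1 * z.2 ^ m.2.
have monD k l : mon (k + l) = mon k * mon l by rewrite /mon /= !expfzDr //; ring.
have ev_mon (C : laurent R) : laurent_eval C z = \sum_(m <- finsupp C) C m * mon m.
  by apply: eq_bigr => m _; rewrite /mon mulrA.
pose sums k := [fset (k + l)%R | l in finsupp Q]%fset.
pose S := (finsupp A `|` \bigcup_(k <- finsupp H) sums k)%fset.
have -> : laurent_eval A z = \sum_(m <- S) A m * mon m.
  rewrite ev_mon; apply: big_fset_incl; first exact: fsubsetUl.
  by move=> m _; rewrite mem_finsupp negbK => /eqP ->; rewrite mul0r.
under eq_bigr do rewrite AE mulr_suml.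
rewrite exchange_big /= !ev_mon mulr_suml big_seq [RHS]big_seq; apply: eq_bigr => k kH.
transitivity (\sum_(m <- sums k) H k * Q (m - k) * mon m).
  apply/esym/big_fset_incl.
    apply/fsubsetP => m mk; apply/fsetUP; right.
    by apply/bigfcupP; exists k => //; rewrite kH.
  move=> m _; apply: contraNeq => nz; apply/imfsetP; exists (m - k) => /=; last by rewrite addrC subrK.
  rewrite mem_finsupp; apply: contraNneq nz => ->.
  by rewrite mulr0 mul0r.
rewrite big_imfset /=; last by move=> l l' _ _ /addrI.
rewrite mulr_sumr; apply: eq_bigr => l _.
by rewrite monD [k + l]addrC addrK; ring.
Qed.

Variables (A B g1 g2 : laurent R) (p : R * R).
Hypotheses (p1 : p.1 != 0) (p2 : p.2 != 0).
Hypothesis hg : laurent_eval g1 p * laurent_eval g2 p != 0.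
Let X := laurent_field A B g1 g2.
Hypothesis Xp : X p = 0.
Hypothesis X1 : DX X p != 0.

Let g10 : laurent_eval g1 p != 0. Proof. by move: hg; rewrite mulf_eq0 negb_or => /andP[]. Qed.
Let g20 : laurent_eval g2 p != 0. Proof. by move: hg; rewrite mulf_eq0 negb_or => /andP[]. Qed.

Lemma common_factor_not_isolated : common_factor_at A B p -> ~ isolated_equilibrium X p.
Proof.
move=> [H [[Q1 E1] [Q2 E2] [m _ Hm] Hp]] [_ iso].
have [t [h [HE _]]] : exists t q, H = poly_laurent t q /\ q`_0 != 0.
  by apply: poly_laurent_exists; exists m.
have hp : ev h p = 0.
  move: Hp; rewrite HE poly_laurent_eval // => /eqP.
  by rewrite !mulf_eq0 !expfz_eq0 (negbTE p1) (negbTE p2) !andbF => /eqP.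
pose tor (z : R * R) : R := z.1 ^ (- t.1) * z.2 ^ (- t.2).
pose W (i : 'I_2) (z : R * R) : R := (if i == 0 then z.1 else z.2) * tor z *
  (laurent_eval (if i == 0 then Q1 else Q2) z / laurent_eval (if i == 0 then g1 else g2) z).
have rW i : rational_near p (W i).
  apply: (@rationalM _ _ (fun z => (if i == 0 then z.1 else z.2) * tor z)
    (fun z => laurent_eval (if i == 0 then Q1 else Q2) z / laurent_eval (if i == 0 then g1 else g2) z)).
    apply: (@rationalM _ _ (fun z => if i == 0 then z.1 else z.2)); last exact: torus_rational.
    by case: (i == 0); [exact: fst_rational|exact: snd_rational].
  apply: (@rationalM _ _ (laurent_eval (if i == 0 then Q1 else Q2))); first exact: laurent_rational.
  by apply: rationalV; [case: (i == 0)|exact: laurent_rational].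
have XE i : \forall z \near p, vf_comp X i z = (ev h * W i) z.
  apply: filterS (near_torus p1 p2) => z [z1 z2].
  rewrite /GRing.mul /= /mul_fun /vf_comp /X /laurent_field /W.
  case: (i == 0) => /=; rewrite ?(laurent_factor_eval E1 z1 z2) ?(laurent_factor_eval E2 z1 z2) HE poly_laurent_eval // -/(tor z).
    by move: (ev h z) (laurent_eval Q1 z) (laurent_eval g1 z)^-1 (tor z) => *; ring.
  by move: (ev h z) (laurent_eval Q2 z) (laurent_eval g2 z)^-1 (tor z) => *; ring.
have [j hj] : exists j, ev (dpoly j h) p != 0.
  apply: contrapT => nj; move/eqP: X1; apply; apply/matrixP => i j; rewrite !mxE.
  rewrite (nbhs_singleton (near_derive j (XE i))).
  rewrite (nbhs_singleton (rational_deriveM j (ev_rational p h) (rW i))).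
  have [_ dh] := dpoly_is_derive j h p.
  have dh0 : 'D_(dir R j) (ev h) p = 0.
    by rewrite dh; apply/eqP; apply/negPn/negP => nz; apply: nj; exists j.
  change ('D_(dir R j) (ev h) p * W i p + ev h p * 'D_(dir R j) (W i) p = 0).
  by rewrite dh0 hp !mul0r addr0.
have X0 : \forall z \near p, ev h z = 0 -> X z = 0.
  apply: filterS2 (XE 0) (XE 1) => z h0 h1 hz.
  rewrite [X z]surjective_pairing -[(X z).1]/(vf_comp X 0 z) -[(X z).2]/(vf_comp X 1 z) h0 h1.
  by rewrite /GRing.mul /= /mul_fun hz !mul0r.
have [z [[z0 zp] zn hz]] := critical_or_not_isolated hp (ex_intro _ j hj) (filterI X0 iso).
by move/eqP: zn; apply; apply: zp; exact: z0.
Qed.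

Let rX := @field_rational R A B g1 g2 p p1 p2 hg.

(** The square of the product of the two denominators is a common denominator that is positive at p,
    so that clearing it preserves the direction of time. *)
Lemma field_quotient : exists N1 N2 q : {poly {poly R}},
  (\forall z \near p, X z = (ev N1 z / ev q z, ev N2 z / ev q z)) /\ 0 < ev q p.
Proof.
have [N1 [D1 [d1 E1]]] := rX 0; have [N2 [D2 [d2 E2]]] := rX 1.
exists (N1 * D1 * D2 ^+ 2), (N2 * D2 * D1 ^+ 2), ((D1 * D2) ^+ 2); split; last first.
  by rewrite evXn evM exprn_even_gt0 //= mulf_neq0.
near=> z.
have Dz1 : ev D1 z != 0 by near: z; exact: near_ev_neq0.
have Dz2 : ev D2 z != 0 by near: z; exact: near_ev_neq0.
have h1 : vf_comp X 0 z = ev N1 z / ev D1 z by near: z.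
have h2 : vf_comp X 1 z = ev N2 z / ev D2 z by near: z.
rewrite [X z]surjective_pairing -[(X z).1]/(vf_comp X 0 z) -[(X z).2]/(vf_comp X 1 z) h1 h2 !evE.
move: Dz1 Dz2; move: (ev N1 z) (ev N2 z) (ev D1 z) (ev D2 z) => a b c d c0 d0.
by congr (_, _); field; rewrite ?c0 ?d0.
Unshelve. all: by end_near. Qed.

Lemma nilpotent_bt_coefficient : nilpotent_mx (DX X p) -> exists a, bt_coefficient X p a.
Proof.
move=> /nilpotent_jordan_basis/(_ X1)[q0 [q1 [pp0 [pp1 [h1 h2]]]]].
by exists (2^-1 * dotp pp1 (D2X X p q0 q0)), q0, q1, pp0, pp1.
Qed.

End CommonFactor.

Theorem theoremC (R : realType) (A B g1 g2 : laurent R) (p : R * R)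
    (X := laurent_field A B g1 g2)
    (hp1 : p.1 != 0) (hp2 : p.2 != 0)
    (hg : laurent_eval g1 p * laurent_eval g2 p != 0)
    (hX : X p = 0)
    (hnil : nilpotent_mx (DX X p)) (hnz : DX X p != 0) :
  (common_factor_at A B p ->
     ~ isolated_equilibrium X p /\
     (forall a, bt_coefficient X p a -> a = 0)) /\
  (~ common_factor_at A B p ->
     [/\ isolated_equilibrium X p,
         forall f g, takens_form X p f g ->
           fps_ord f = multiplicity (vf_comp X 0) (vf_comp X 1) p,
         multiplicity (vf_comp X 0) (vf_comp X 1) p =
           multiplicity (laurent_eval A) (laurent_eval B) p &
         (multiplicity (laurent_eval A) (laurent_eval B) p
            <= MV (Newt A) (Newt B))%E] /\
     ((MV (Newt A) (Newt B) <= 2%:E)%E ->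
        [/\ forall a, bt_coefficient X p a -> a != 0,
            topologically_cusp X p, ~ saddle_type X p,
            ~ focus_type X p & ~ elliptic_type X p])).
Proof.
have g10 : laurent_eval g1 p != 0 by move: hg; rewrite mulf_eq0 negb_or => /andP[].
have g20 : laurent_eval g2 p != 0 by move: hg; rewrite mulf_eq0 negb_or => /andP[].
have [Ap Bp] : laurent_eval A p = 0 /\ laurent_eval B p = 0.
  have z (x y w : R) : x != 0 -> w != 0 -> x * (y / w) = 0 -> y = 0.
    by move=> x0 w0 /eqP; rewrite !mulf_eq0 invr_eq0 (negbTE x0) (negbTE w0) orbF => /eqP.
  by split; [apply: (z _ _ _ hp1 g10); exact: (congr1 fst hX)|apply: (z _ _ _ hp2 g20); exact: (congr1 snd hX)].
have rX : forall i, rational_near p (vf_comp X i) by move=> i; exact: field_rational.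
have [N1 [N2 [q [Xq q0]]]] : exists N1 N2 q : {poly {poly R}},
    (\forall z \near p, X z = (ev N1 z / ev q z, ev N2 z / ev q z)) /\ 0 < ev q p.
  exact: field_quotient.
split=> [cf|ncf].
  have nI : ~ isolated_equilibrium X p by exact: common_factor_not_isolated.
  split; first exact: nI.
  move=> a ha; apply/eqP; apply: contrapT => /negP a0; apply: nI.
  exact: (bt_isolated rX Xq q0 hX ha a0).
have mu : multiplicity (vf_comp X 0%R) (vf_comp X 1%R) p = multiplicity (laurent_eval A) (laurent_eval B) p.
  exact: field_multiplicity.
have An := no_common_factor_neq0 hp1 hp2 Bp ncf.
have Bn := no_common_factor_neq0 hp1 hp2 Ap (contra_not (@common_factor_sym _ _ _ _) ncf).
have bound : (multiplicity (laurent_eval A) (laurent_eval B) p <= MV (Newt A) (Newt B))%E.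
  have [t1 [t2 [D [A' [B' [AE BE [D0 A0] [D0' B0] [Dp cop]]]]]]] := common_factorization hp1 hp2 An Bn ncf.
  exact: (multiplicity_mixed_volume hp1 hp2 AE BE).
have iso : isolated_equilibrium X p.
  split; first exact: hX.
  apply: filterS3 (isolated_common_zero hp1 hp2 An Bn ncf)
    (filterI (near_torus hp1 hp2) (rational_neq0 (laurent_rational g1 hp1 hp2) g10))
    (rational_neq0 (laurent_rational g2 hp1 hp2) g20) => z zE [[z1 z2] g1z] g2z Xz.
  have zero (x y w : R) : x != 0 -> w != 0 -> x * (y / w) = 0 -> y = 0.
    by move=> x0 w0 /eqP; rewrite !mulf_eq0 invr_eq0 (negbTE x0) (negbTE w0) orbF => /eqP.
  apply: zE; first by apply: (zero _ _ _ z1 g1z); exact: (congr1 fst Xz).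
  by apply: (zero _ _ _ z2 g2z); exact: (congr1 snd Xz).
split; first by split; [exact: iso|move=> f g; exact: takens_multiplicity|exact: mu|exact: bound].
move=> MV2; have a0 a : bt_coefficient X p a -> a != 0.
  move=> ha; apply/eqP => a0; rewrite a0 in ha.
  have := le_trans (bt_multiplicity rX hX ha) (eq_ind_r (fun m => (m <= 2%:E)%E) (le_trans bound MV2) mu).
  by rewrite lee_fin ler_nat.
have [a ha] : exists a, bt_coefficient X p a by exact: nilpotent_bt_coefficient.
have [cusp nsaddle nfocus nelliptic] := bt_cusp rX Xq q0 hX ha (a0 a ha).
split; [exact: a0|exact: cusp|exact: nsaddle|exact: nfocus|exact: nelliptic].
Qed.
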